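(* Let $W_n$ be the Hamming weight $\#\{h\in\mathcal S: a(h)\neq 0\}$ of a multi-base representation $a$ of $n$ chosen uniformly at random among all $P(n)$ representations. Then \[ \mathbb E[W_n]=\frac{\kappa(d-1)}{d\log d}(\log n)^m+O\big((\log n)^{m-1}\log\log n\big),\qquad \operatorname{Var}[W_n]=\frac{\kappa(d-1)}{d^2\log d}(\log n)^m+O\big((\log n)^{m-1}\log\log n\big), \] and $(W_n-\mathbb E[W_n])/\sqrt{\operatorname{Var}[W_n]}$ converges in distribution to a standard Gaussian random variable as $n\to\infty$.
   Context: Fix integers $d\geq 2$ and $m\geq 2$, and integers $1<p_1<p_2<\dots<p_m$ with $\gcd(p_i,p_j)=1$ for $i\neq j$. Let $\mathcal S=\{p_1^{\alpha_1}p_2^{\alpha_2}\cdots p_m^{\alpha_m}:\alpha_1,\dots,\alpha_m\in\mathbb Z_{\ge 0}\}$. A multi-base representation of a positive integer $n$ (with bases $p_1,\dots,p_m$ and digit set $\{0,1,\dots,d-1\}$) is a function $a:\mathcal S\to\{0,1,\dots,d-1\}$ with finite support such that $\sum_{h\in\mathcal S}a(h)\,h=n$. Let $P(n)$ be the (finite) number of multi-base representations of $n$. Set $\kappa=\frac{\log d}{m!}\prod_{j=1}^m\frac{1}{\log p_j}$. *)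

(* Defs.v *)
From Stdlib Require Import Reals.
From mathcomp Require Import all_boot.

(* Membership in S = { prod_{i<m} p_i^{alpha_i} }.  Exponents are bounded by h
   (harmless: p_i >= 2 forces alpha_i <= log_2 h < h+1), which makes the
   predicate boolean. *)
Definition inS (m : nat) (p : nat -> nat) (h : nat) : bool :=
  [exists alpha : {ffun 'I_m -> 'I_h.+1},
     h == \prod_(i < m) p (nat_of_ord i) ^ (nat_of_ord (alpha i))].

(* A multi-base representation of n: since every h in S is >= 1 and the
   digit sum equals n, its support lies in {1..n}; it is thus encoded as a
   finite function on 'I_(n.+1) (= positions 0..n) with digits in 'I_d,
   vanishing outside S, with sum_h h * a(h) = n. *)
Definition is_rep (d m : nat) (p : nat -> nat) (n : nat)
    (a : {ffun 'I_n.+1 -> 'I_d}) : bool :=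
  [forall h : 'I_n.+1, (nat_of_ord (a h) != 0) ==> inS m p (nat_of_ord h)]
  && (\sum_(h < n.+1) (nat_of_ord h) * nat_of_ord (a h) == n).

Definition reps (d m : nat) (p : nat -> nat) (n : nat) : seq {ffun 'I_n.+1 -> 'I_d} :=
  [seq a <- enum {ffun 'I_n.+1 -> 'I_d} | @is_rep d m p n a].

Definition Pcount (d m : nat) (p : nat -> nat) (n : nat) : nat := size (reps d m p n).

Definition weight (d n : nat) (a : {ffun 'I_n.+1 -> 'I_d}) : nat :=
  #|[pred h : 'I_n.+1 | nat_of_ord (a h) != 0]|.

Local Open Scope R_scope.

Definition Rleb (x y : R) : bool := if Rle_dec x y then true else false.

Definition EW (d m : nat) (p : nat -> nat) (n : nat) : R :=
  foldr Rplus 0 (map (fun a => INR (@weight d n a)) (reps d m p n)) / INR (Pcount d m p n).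

Definition VarW (d m : nat) (p : nat -> nat) (n : nat) : R :=
  foldr Rplus 0 (map (fun a => (INR (@weight d n a) - EW d m p n) ^ 2) (reps d m p n))
  / INR (Pcount d m p n).

Definition ProbLe (d m : nat) (p : nat -> nat) (n : nat) (x : R) : R :=
  INR (count (fun a => Rleb ((INR (@weight d n a) - EW d m p n) / sqrt (VarW d m p n)) x)
             (reps d m p n)) / INR (Pcount d m p n).

Definition kappa (d m : nat) (p : nat -> nat) : R :=
  ln (INR d) / INR (Factorial.fact m) * foldr Rmult 1 (map (fun j => / ln (INR (p j))) (iota 0 m)).

Definition gauss_density (t : R) : R := / sqrt (2 * PI) * exp (- (t ^ 2) / 2).

Definition std_normal_cdf_is (x l : R) : Prop :=
  forall eps, 0 < eps -> exists A0, forall A, A0 <= A ->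
    forall pr : Riemann_integrable gauss_density (- A) x,
      Rabs (RiemannInt pr - l) < eps.

(* Main.v *)
(** Tilt the digits: let the digit of [h] in S have law proportional to exp(- r h j), with [r]
    such that the sum of the [h * a(h)] has mean [n]. Conditioned on this sum being [n], the
    product law is uniform on the representations of [n], so uniform expectations are quotients
    of sums over the frequencies [2 pi k / M], with [M] exceeding all sums that can occur.

    Write [lam = (ln n)^((m-1)/2)]; about [lam^2] elements of S lie within a constant factor
    below [1/r]. Hence for [|theta| <= r] the product of characteristic functions is at most
    [C / (1 + (lam theta / r)^2)^2]. For [|theta| > r] only the elements [p_0^(Da) p_1^(Db)] are
    used: if no point of some row [b] is far from the integers, then [theta / (2 pi)] is within
    [O(r)] of a fraction whose denominator is a power of the second base, and every point of an
    earlier row is far from the integers; averaging over few rows then makes the sum over all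
    these frequencies smaller than [M r^(1+g)].

    A function of a digit that is centred under its tilted law has a transform of size
    [O(theta h)], which costs a factor [1/lam] per digit. This bounds the correlations of the
    digits and gives the mean and the variance, because most tilted laws are nearly uniform.

    For the limit law, discard the elements of S above [1 / (r (ln n)^(m+1))] and the
    [p_0^(Da) p_1^(Db)]. Fixing the remaining digits does not affect the bound for
    [|theta| > r], so conditionally on the sum these digits are still asymptotically independent
    and uniform, and the weight they carry is asymptotically binomial. The discarded digits
    contribute a variance of at most [O((ln n)^m / D^2) + o((ln n)^m)], and [D] is arbitrary. *)

From HB Require Import structures.
From Stdlib Require Import Reals Lra Lia ZArith Znumtheory.
From mathcomp Require Import all_boot.
From Coquelicot Require Import Coquelicot.
Require Import Defs.
Set Implicit Arguments.
Unset Strict Implicit.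
Unset Printing Implicit Defensive.
Delimit Scope R_scope with re.
Open Scope R_scope.

(** The quantity to beat is the probability that the tilted sum equals [n], of order [1 / L] with
    [L = lam / r]. Hence the product, averaged over the frequencies beyond [r], must fall below [r]
    by a power of [r], since this error is also summed over pairs of elements of S. Two bounds are
    available there and neither suffices. The pointwise one has an exponent proportional to
    [ln (1 / r)] with a small constant, so it yields a small power of [r]. The averaged one includes
    the frequencies near 0 and cannot go below order [r]. Half of the exponent is therefore spent on
    each, and the two powers of [r] add up to more than 1.

    The averaged bound dictates that [M] be a power of [P], the [D]-th power of the first base:
    multiplication by [P] then maps the grid of frequencies onto a coarser one with fibres of [P]
    points, and multiplication by powers of the second base permutes the grid.

    For [|theta| <= r] a Gaussian decay is weakened to [1 / (1 + t^2)^2]: one factor makes the sum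
    over the grid converge, the other absorbs up to two powers of [theta], one for each centred
    digit. *)

HB.instance Definition _ := Monoid.isComLaw.Build R 0 Rplus
  (fun x y z => esym (Rplus_assoc x y z)) Rplus_comm Rplus_0_l.
HB.instance Definition _ := Monoid.isComLaw.Build R 1 Rmult
  (fun x y z => esym (Rmult_assoc x y z)) Rmult_comm Rmult_1_l.
HB.instance Definition _ := Monoid.isMulLaw.Build R 0 Rmult Rmult_0_l Rmult_0_r.
HB.instance Definition _ := Monoid.isAddLaw.Build R Rmult Rplus
  Rmult_plus_distr_r Rmult_plus_distr_l.

HB.instance Definition _ := Monoid.isComLaw.Build C (RtoC 0) Cplus
  Cplus_assoc Cplus_comm Cplus_0_l.
HB.instance Definition _ := Monoid.isComLaw.Build C (RtoC 1) Cmult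
  Cmult_assoc Cmult_comm Cmult_1_l.
HB.instance Definition _ := Monoid.isMulLaw.Build C (RtoC 0) Cmult Cmult_0_l Cmult_0_r.
HB.instance Definition _ := Monoid.isAddLaw.Build C Cmult Cplus
  Cmult_plus_distr_r Cmult_plus_distr_l.

Notation "\rsum_ ( i <- r | P ) F" := (\big[Rplus/0]_(i <- r | P%B) F%re)
  (at level 41, F at level 41, i, r at level 50).
Notation "\rsum_ ( i <- r ) F" := (\big[Rplus/0]_(i <- r) F%re)
  (at level 41, F at level 41, i, r at level 50).
Notation "\rsum_ ( i < n | P ) F" := (\big[Rplus/0]_(i < n%N | P%B) F%re)
  (at level 41, F at level 41, i, n at level 50).
Notation "\rsum_ ( i < n ) F" := (\big[Rplus/0]_(i < n%N) F%re)
  (at level 41, F at level 41, i, n at level 50).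
Notation "\rsum_ ( i | P ) F" := (\big[Rplus/0]_(i | P%B) F%re)
  (at level 41, F at level 41, i at level 50).
Notation "\rsum_ i F" := (\big[Rplus/0]_i F%re)
  (at level 41, F at level 41, i at level 0, right associativity).
Notation "\rsum_ ( i : T ) F" := (\big[Rplus/0]_(i : T) F%re)
  (at level 41, F at level 41, i at level 50).
Notation "\rprod_ ( i <- r | P ) F" := (\big[Rmult/1]_(i <- r | P%B) F%re)
  (at level 36, F at level 36, i, r at level 50).
Notation "\rprod_ ( i < n ) F" := (\big[Rmult/1]_(i < n%N) F%re)
  (at level 36, F at level 36, i, n at level 50).
Notation "\rprod_ ( i | P ) F" := (\big[Rmult/1]_(i | P%B) F%re)
  (at level 36, F at level 36, i at level 50).
Notation "\rprod_ i F" := (\big[Rmult/1]_i F%re)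
  (at level 36, F at level 36, i at level 0, right associativity).
Notation "\csum_ ( i < n ) F" := (\big[Cplus/RtoC 0]_(i < n%N) F%C)
  (at level 41, F at level 41, i, n at level 50).
Notation "\rprod_ ( i : T | P ) F" := (\big[Rmult/1]_(i : T | P%B) F%re)
  (at level 36, F at level 36, i at level 50).
Notation "\cprod_ ( i : T | P ) F" := (\big[Cmult/RtoC 1]_(i : T | P%B) F%C)
  (at level 36, F at level 36, i at level 50).
Notation "\cprod_ i F" := (\big[Cmult/RtoC 1]_i F%C)
  (at level 36, F at level 36, i at level 0, right associativity).

(** * Inequalities for finite sums and products *)

Definition b2R (b : bool) : R := if b then 1 else 0.

Lemma b2R_ge0 b : 0 <= b2R b. Proof. case: b => /=; lra. Qed.
Lemma b2R_le1 b : b2R b <= 1. Proof. case: b => /=; lra. Qed.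

Section BigReal.
Variables (I : Type) (r : seq I) (P : pred I).
Implicit Types F G : I -> R.

Lemma rsum_le F G : (forall i, P i -> F i <= G i) ->
  \rsum_(i <- r | P i) F i <= \rsum_(i <- r | P i) G i.
Proof. by move=> H; elim/big_ind2: _ => // *; lra. Qed.

Lemma rsum_ge0 F : (forall i, P i -> 0 <= F i) -> 0 <= \rsum_(i <- r | P i) F i.
Proof. by move=> H; elim/big_ind: _ => // *; lra. Qed.

Lemma rsum_abs F : Rabs (\rsum_(i <- r | P i) F i) <= \rsum_(i <- r | P i) Rabs (F i).
Proof.
elim/big_ind2: _ => [|x1 x2 y1 y2 H1 H2|i _]; rewrite ?Rabs_R0; try lra.
by apply: Rle_trans (Rabs_triang _ _) _; lra.
Qed.

Lemma rsum_scal c F : \rsum_(i <- r | P i) (c * F i) = c * \rsum_(i <- r | P i) F i.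
Proof. by rewrite big_distrr. Qed.

Lemma rsum_scalr c F : \rsum_(i <- r | P i) (F i * c) = (\rsum_(i <- r | P i) F i) * c.
Proof. by rewrite big_distrl. Qed.

Lemma rsum_add F G : \rsum_(i <- r | P i) (F i + G i) =
  \rsum_(i <- r | P i) F i + \rsum_(i <- r | P i) G i.
Proof. by rewrite big_split. Qed.

Lemma rsum_sub F G : \rsum_(i <- r | P i) (F i - G i) =
  \rsum_(i <- r | P i) F i - \rsum_(i <- r | P i) G i.
Proof.
have E x y : x - y = x + -1 * y by ring.
under eq_bigr => i _ do rewrite E.
by rewrite rsum_add rsum_scal E.
Qed.

Lemma rsum_const c : \rsum_(i <- r | P i) c = c * INR (count P r).
Proof.
rewrite big_const_seq; elim: (count P r) => [|k IH]; first by rewrite /=; ring.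
by rewrite iterS IH S_INR; ring.
Qed.

Lemma rprod_ge0 F : (forall i, P i -> 0 <= F i) -> 0 <= \rprod_(i <- r | P i) F i.
Proof.
move=> H; elim/big_ind: _ => // [|x y]; first lra.
exact: Rmult_le_pos.
Qed.

Lemma rprod_gt0 F : (forall i, P i -> 0 < F i) -> 0 < \rprod_(i <- r | P i) F i.
Proof.
move=> H; elim/big_ind: _ => // [|x y]; first lra.
exact: Rmult_lt_0_compat.
Qed.

Lemma rprod_le F G : (forall i, P i -> 0 <= F i <= G i) ->
  \rprod_(i <- r | P i) F i <= \rprod_(i <- r | P i) G i.
Proof.
move=> H.
suff: 0 <= \rprod_(i <- r | P i) F i <= \rprod_(i <- r | P i) G i by case.
elim/big_ind2: _ => // [|x1 x2 y1 y2 [h1 h2] [h3 h4]]; first lra.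
by split; [exact: Rmult_le_pos|exact: Rmult_le_compat].
Qed.

Lemma rprod_le1 F : (forall i, P i -> 0 <= F i <= 1) -> \rprod_(i <- r | P i) F i <= 1.
Proof.
move=> H; apply: Rle_trans (_ : \rprod_(i <- r | P i) 1 <= _); first exact: rprod_le.
by rewrite big1 //; lra.
Qed.

Lemma rprod_exp F : \rprod_(i <- r | P i) exp (F i) = exp (\rsum_(i <- r | P i) F i).
Proof.
elim/big_rec2: _ => [|i x y _ ->]; first by rewrite exp_0.
by rewrite exp_plus.
Qed.

Lemma rprod_div F G : (forall i, P i -> G i <> 0) ->
  \rprod_(i <- r | P i) (F i / G i) =
  (\rprod_(i <- r | P i) F i) / (\rprod_(i <- r | P i) G i).
Proof.
move=> H.
suff: \rprod_(i <- r | P i) G i <> 0 /\ \rprod_(i <- r | P i) (F i / G i) =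
  (\rprod_(i <- r | P i) F i) / (\rprod_(i <- r | P i) G i) by case.
elim/big_rec3: _ => [|i x y z Pi [Hy ->]]; first by split; [lra|field].
have HG := H _ Pi.
split; last by field.
by move=> /Rmult_integral [].
Qed.

(** The Weierstrass product inequality, applied later to the quadratic Taylor factors of the
    characteristic functions. *)
Lemma rprod_ge_1sum F : (forall i, P i -> 0 <= F i <= 1) ->
  1 - \rsum_(i <- r | P i) F i <= \rprod_(i <- r | P i) (1 - F i).
Proof.
move=> H.
suff: 0 <= \rsum_(i <- r | P i) F i /\
  0 <= \rprod_(i <- r | P i) (1 - F i) <= 1 /\
  1 - \rsum_(i <- r | P i) F i <= \rprod_(i <- r | P i) (1 - F i) by tauto.
elim/big_rec2: _ => [|i x y Pi [H1 [[H2 H3] H4]]]; first lra.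
have := H _ Pi; nra.
Qed.

Lemma RtoC_rsum F : RtoC (\rsum_(i <- r | P i) F i) =
  \big[Cplus/RtoC 0]_(i <- r | P i) RtoC (F i).
Proof. by elim/big_rec2: _ => // i x y _ <-; rewrite RtoC_plus. Qed.

Lemma Re_csum (F : I -> C) : Re (\big[Cplus/RtoC 0]_(i <- r | P i) F i) =
  \rsum_(i <- r | P i) Re (F i).
Proof. by elim/big_rec2: _ => // i x y _ <-. Qed.

Lemma Cmod_csum (F : I -> C) :
  Cmod (\big[Cplus/RtoC 0]_(i <- r | P i) F i) <= \rsum_(i <- r | P i) Cmod (F i).
Proof.
elim/big_rec2: _ => [|i x y _ H]; first by rewrite Cmod_0; lra.
by apply: Rle_trans (Cmod_triangle _ _) _; lra.
Qed.

Lemma Cmod_cprod (F : I -> C) :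
  Cmod (\big[Cmult/RtoC 1]_(i <- r | P i) F i) = \rprod_(i <- r | P i) Cmod (F i).
Proof. by elim/big_rec2: _ => [|i x y _ <-]; rewrite ?Cmod_1 ?Cmod_mult. Qed.

(** Exchanging the factors one at a time costs only their difference, since all other factors have
    modulus at most 1. *)
Lemma Cmod_cprod_sub (F G : I -> C) :
  (forall i, P i -> Cmod (F i) <= 1) -> (forall i, P i -> Cmod (G i) <= 1) ->
  Cmod (\big[Cmult/RtoC 1]_(i <- r | P i) F i - \big[Cmult/RtoC 1]_(i <- r | P i) G i)
  <= \rsum_(i <- r | P i) Cmod (F i - G i).
Proof.
move=> HF HG.
suff: Cmod (\big[Cmult/RtoC 1]_(i <- r | P i) G i) <= 1 /\
  Cmod (\big[Cmult/RtoC 1]_(i <- r | P i) F i - \big[Cmult/RtoC 1]_(i <- r | P i) G i)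
  <= \rsum_(i <- r | P i) Cmod (F i - G i) by case.
elim/big_rec3: _ => [|i x z y Pi [H1 H2]].
  rewrite Cmod_1; split; first lra.
  have -> : (RtoC 1 - RtoC 1 = RtoC 0)%C by ring.
  by rewrite Cmod_0; lra.
split.
  rewrite Cmod_mult; have := HG _ Pi; have := Cmod_ge_0 (G i); have := Cmod_ge_0 y; nra.
have -> : (F i * z - G i * y = F i * (z - y) + (F i - G i) * y)%C by ring.
apply: Rle_trans (Cmod_triangle _ _) _; rewrite !Cmod_mult.
have := HF _ Pi; have := Cmod_ge_0 (F i - G i); have := Cmod_ge_0 (z - y)%C.
have := Cmod_ge_0 (F i); have := Cmod_ge_0 y; nra.
Qed.

End BigReal.

Lemma rsum_count (I : finType) (P : pred I) : \rsum_(i | P i) 1 = INR #|P|.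
Proof.
rewrite -big_filter rsum_const count_predT Rmult_1_l cardE /enum_mem.
by rewrite (_ : filter P _ = filter (mem P) (Finite.enum I)) //; rewrite unlock.
Qed.

Lemma rsum_sub_le (I : finType) (P Q : pred I) (F : I -> R) :
  (forall i, P i -> Q i) -> (forall i, Q i -> 0 <= F i) ->
  \rsum_(i | P i) F i <= \rsum_(i | Q i) F i.
Proof.
move=> H H0; rewrite big_mkcond [X in _ <= X]big_mkcond; apply: rsum_le => i _.
case: ifP => [/H ->|_]; first lra.
by case: ifP => [/H0|]; lra.
Qed.

Lemma rsum_telescope (g : nat -> R) K : \rsum_(a < K) (g a - g a.+1) = g 0%N - g K.
Proof. by elim: K => [|K IH]; rewrite ?big_ord0 ?big_ord_recr /= ?IH; ring. Qed.

Lemma rsum_term_le (I : finType) (P : pred I) (F : I -> R) j :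
  P j -> (forall i, P i -> 0 <= F i) -> F j <= \rsum_(i | P i) F i.
Proof.
move=> Pj H; rewrite (bigD1 j) //=.
have : 0 <= \rsum_(i | P i && (i != j)) F i by apply: rsum_ge0 => i /andP[/H].
lra.
Qed.

Lemma rsum_sq_split (I : finType) (P : pred I) (F : I -> R) :
  (\rsum_(i | P i) F i) ^ 2 =
  \rsum_(i | P i) (F i ^ 2 + \rsum_(j | P j && (j != i)) (F i * F j)).
Proof.
rewrite /= Rmult_1_r big_distrl /=; apply: eq_bigr => i Pi.
by rewrite big_distrr /= (bigD1 i) //=; congr (_ + _); ring.
Qed.

(** * The set S *)

Definition coprime_bases (m : nat) (p : nat -> nat) : Prop :=
  (forall i, (i < m)%N -> (1 < p i)%N) /\
  (forall i j, (i < m)%N -> (j < m)%N -> i <> j -> coprime (p i) (p j)).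

Lemma coprime_bases_pred k p : coprime_bases k.+1 p -> coprime_bases k p.
Proof.
case=> H1 H2; split=> [i ik|i j ik jk]; first by apply: H1; apply: ltnW.
by apply: H2; apply: ltnW.
Qed.

(** Frees the exponents from the bound built into [inS]: [p i ^ al i] divides [h], which keeps
    [al i] below [h]. *)
Lemma inSP m p h : (forall i, (i < m)%N -> (1 < p i)%N) ->
  reflect (exists alpha : nat -> nat, h = \prod_(i < m) p i ^ alpha i)%N (inS m p h).
Proof.
move=> Hp; apply: (iffP existsP) => [[al /eqP Hal]|[al Hal]].
  exists (fun i => if insub i is Some j then nat_of_ord (al j) else 0%N).
  by rewrite [LHS]Hal; apply: eq_bigr => i _; rewrite valK.
have Hb (i : 'I_m) : (al i <= h)%N.
  have Hdv : (p i ^ al i %| h)%N by rewrite Hal (bigD1 i) //= dvdn_mulr.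
  have hpos : (0 < h)%N.
    by rewrite Hal prodn_gt0 // => j; rewrite expn_gt0 ltnW // Hp.
  apply: leq_trans (dvdn_leq hpos Hdv); apply: ltnW.
  by apply: ltn_expl; apply: Hp.
exists [ffun i : 'I_m => inord (al i)]; apply/eqP.
rewrite [LHS]Hal; apply: eq_bigr => i _; rewrite ffunE inordK //.
by rewrite ltnS Hb.
Qed.

Lemma inS_gt0 m p h : (forall i, (i < m)%N -> (1 < p i)%N) -> inS m p h -> (0 < h)%N.
Proof.
move=> Hp /(inSP h Hp) [al ->]; apply: prodn_gt0 => i.
by rewrite expn_gt0 ltnW // Hp.
Qed.

Lemma inS0 p h : inS 0 p h = (h == 1%N).
Proof.
have Hp : forall i, (i < 0)%N -> (1 < p i)%N by [].
apply/(inSP h Hp)/eqP => [[al ->]|->]; first by rewrite big_ord0.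
by exists (fun=> 0%N); rewrite big_ord0.
Qed.

Lemma inS_rec k p h : (forall i, (i < k.+1)%N -> (1 < p i)%N) ->
  reflect (exists a h', h = p k ^ a * h' /\ inS k p h')%N (inS k.+1 p h).
Proof.
move=> Hp.
have Hp' : forall i, (i < k)%N -> (1 < p i)%N by move=> i ik; apply: Hp; apply: ltnW.
apply: (iffP (inSP h Hp)) => [[al Hal]|[a [h' [-> /(inSP h' Hp') [al ->]]]]].
  exists (al k), (\prod_(i < k) p i ^ al i)%N; split.
    by rewrite Hal big_ord_recr mulnC.
  by apply/(inSP _ Hp'); exists al.
exists (fun i => if (i < k)%N then al i else a).
rewrite big_ord_recr /= ltnn mulnC; congr (_ * _)%N.
by apply: eq_bigr => i _; rewrite ltn_ord.
Qed.

Lemma coprime_inS k p h : coprime_bases k.+1 p -> inS k p h -> coprime (p k) h.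
Proof.
move=> H; have [H1 H2] := H; have [H1' _] := coprime_bases_pred H.
move=> /(inSP h H1') [al ->].
elim/big_ind: _ => [|x y Hx Hy|i _]; rewrite ?coprimen1 ?coprimeMr ?Hx ?Hy //.
apply/coprimeXr/H2 => //; first by rewrite ltnS ltnW.
by apply/eqP; rewrite neq_ltn ltn_ord orbT.
Qed.

Lemma inS_rec_uniq q a b h h' : (1 < q)%N -> coprime q h -> coprime q h' ->
  (q ^ a * h = q ^ b * h')%N -> a = b /\ h = h'.
Proof.
move=> q1; wlog: a b h h' / (a <= b)%N => [W c1 c2 E|ab c1 c2 E].
  case/orP: (leq_total a b) => ab; first exact: W.
  by have [] := W _ _ _ _ ab c2 c1 (esym E).
have q0 : (0 < q)%N by apply: ltnW.
move: E; rewrite -(subnKC ab) expnD -mulnA => /eqP.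
rewrite eqn_pmul2l ?expn_gt0 ?q0 // => /eqP E.
case: (b - a)%N E => [|c] E; first by rewrite addn0; split=> //; rewrite E mul1n.
have : (q %| h)%N by rewrite E expnS -mulnA dvdn_mulr.
move: c1; rewrite /coprime => /eqP c1 /gcdn_idPl c3.
by rewrite c3 in c1; rewrite c1 in q1.
Qed.

(** Uniqueness of the exponent of the last base turns a sum over [S] into an iterated one. As [f]
    vanishes from [K] on, all ranges can be cut at the same [K]. *)
Lemma sum_inS_rec k p K (f : nat -> R) : coprime_bases k.+1 p ->
  (forall h, (K <= h)%N -> f h = 0) ->
  \rsum_(h < K | inS k.+1 p h) f h =
  \rsum_(a < K) \rsum_(h < K | inS k p h) f (p k ^ a * h)%N.
Proof.
move=> Hb Hf; have [Hp _] := Hb; have [Hp' _] := coprime_bases_pred Hb.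
have E1 (a h' : 'I_K) : f (p k ^ a * h')%N =
    \rsum_(h < K | (h == p k ^ a * h' :> nat)%N) f h.
  case: (ltnP (p k ^ a * h')%N K) => [lt|ge].
    rewrite (big_pred1 (Ordinal lt)) //.
  by rewrite Hf // big_pred0 // => h; apply/negbTE; rewrite neq_ltn (leq_trans (ltn_ord h) ge).
have E2 (a : 'I_K) : \rsum_(h' < K | inS k p h')
    \rsum_(h < K | (h == p k ^ a * h' :> nat)%N) f h =
  \rsum_(h < K) \rsum_(h' < K | inS k p h' && (h == p k ^ a * h' :> nat)%N) f h.
  rewrite (exchange_big_dep predT) //=.
transitivity (\rsum_(a < K) \rsum_(h < K)
    \rsum_(h' < K | inS k p h' && (h == p k ^ a * h' :> nat)%N) f h); last first.
  by apply: eq_bigr => a _; rewrite -E2; apply: eq_bigr => h' _; rewrite E1.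
rewrite exchange_big /= big_mkcond /=; apply: eq_bigr => h _.
rewrite pair_big_dep /=.
case: ifP => [/(inS_rec h Hp) [a [h' [Eh Sh']]]|Hn].
  have h'0 := inS_gt0 Hp' Sh'.
  have q0 : (0 < p k)%N by apply: ltnW; apply: Hp.
  have aK : (a < K)%N.
    apply: leq_ltn_trans (ltn_ord h); rewrite Eh.
    apply: leq_trans (leq_pmulr _ h'0); apply: ltnW; apply: ltn_expl.
    exact: Hp.
  have hK : (h' < K)%N.
    by apply: leq_ltn_trans (ltn_ord h); rewrite Eh leq_pmull // expn_gt0 q0.
  rewrite (big_pred1 (Ordinal aK, Ordinal hK)) // => -[b h''] /=.
  apply/andP/eqP => [[Sh'' /eqP Eh'']|[-> ->]] /=; last by rewrite Eh.
  have [||||E3 E4] // := @inS_rec_uniq (p k) b a h'' h'; first exact: Hp.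
  - exact: coprime_inS.
  - exact: coprime_inS.
  - by rewrite -Eh.
  by congr (_, _); apply: val_inj.
rewrite big_pred0 // => -[a h'] /=; apply/negP => /andP [Sh' /eqP Eh].
suff : inS k.+1 p h by rewrite Hn.
by apply/(inS_rec h Hp); exists a, h'.
Qed.

(** * Counting the elements of S *)

Lemma RlebP x y : reflect (x <= y) (Rleb x y).
Proof. by rewrite /Rleb; case: Rle_dec => H; constructor. Qed.

(** With [pow_diff_le], the mean value inequality for powers. It compares a sum of [k]-th powers
    along an arithmetic progression with a telescoping sum of powers of order [k + 1]. *)
Lemma pow_diff_ge k a b : 0 <= a <= b ->
  INR k.+1 * (b - a) * a ^ k <= b ^ k.+1 - a ^ k.+1.
Proof.
move=> [a0 ab]; elim: k => [|k IH]; first by rewrite /=; lra.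
have Ha : 0 <= a ^ k.+1 by apply: pow_le.
have Hb : a ^ k.+1 <= b ^ k.+1 by apply: pow_incr.
rewrite S_INR -[b ^ k.+2]/(b * b ^ k.+1) -[a ^ k.+2]/(a * a ^ k.+1).
have : a * (INR k.+1 * (b - a) * a ^ k) <= a * (b ^ k.+1 - a ^ k.+1).
  exact: Rmult_le_compat_l.
rewrite -[a ^ k.+1]/(a * a ^ k) in Ha Hb *; nra.
Qed.

Lemma pow_diff_le k a b : 0 <= a <= b ->
  b ^ k.+1 - a ^ k.+1 <= INR k.+1 * (b - a) * b ^ k.
Proof.
move=> [a0 ab]; elim: k => [|k IH]; first by rewrite /=; lra.
have Ha : 0 <= a ^ k.+1 by apply: pow_le.
have Hb : a ^ k.+1 <= b ^ k.+1 by apply: pow_incr.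
rewrite S_INR -[b ^ k.+2]/(b * b ^ k.+1) -[a ^ k.+2]/(a * a ^ k.+1).
have : b * (b ^ k.+1 - a ^ k.+1) <= b * (INR k.+1 * (b - a) * b ^ k).
  by apply: Rmult_le_compat_l => //; lra.
rewrite -[b ^ k.+1]/(b * b ^ k) in Ha Hb *; nra.
Qed.

Lemma INR_expn q a : INR (q ^ a)%N = INR q ^ a.
Proof. by elim: a => [|a IH]; rewrite ?expn0 // expnS mult_INR IH. Qed.

Lemma INR_mul a b : INR (a * b)%N = INR a * INR b.
Proof. exact: mult_INR. Qed.

Lemma INR_add a b : INR (a + b)%N = INR a + INR b.
Proof. exact: plus_INR. Qed.

Lemma INR_leq a b : (a <= b)%N -> INR a <= INR b.
Proof. by move=> /leP; apply: le_INR. Qed.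

Lemma INR_ltn a b : (a < b)%N -> INR a < INR b.
Proof. by move=> /ltP; apply: lt_INR. Qed.

Lemma leq_INR a b : INR a <= INR b -> (a <= b)%N.
Proof. by move=> H; apply/leP; apply: RIneq.INR_le. Qed.

Lemma INR_ge2 q : (1 < q)%N -> 2 <= INR q.
Proof. by move=> /INR_leq; rewrite /=; lra. Qed.

Lemma ln_gt0 x : 1 < x -> 0 < ln x.
Proof. by move=> H; rewrite -ln_1; apply: ln_increasing; lra. Qed.

Lemma ln_pow_div x q a : 0 < x -> 0 < q -> ln (x / q ^ a) = ln x - INR a * ln q.
Proof.
move=> x0 q0; rewrite ln_div ?ln_pow //; exact: pow_lt.
Qed.

Lemma lt_pow2 K q : 2 <= q -> INR K < q ^ K.
Proof.
move=> q2; elim: K => [|K IH]; first by rewrite /=; lra.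
have := pow_le q K; rewrite S_INR /=; have : 1 <= q ^ K by apply: pow_R1_Rle; lra.
nra.
Qed.

(** Counts elements of [S] up to the real number [x]. [K] is only a summation range, taken above [x]
    where the value matters. *)
Definition cnt (k : nat) (p : nat -> nat) (K : nat) (x : R) : R :=
  \rsum_(h < K | inS k p h) b2R (Rleb (INR h) x).

Lemma cnt_lt1 k p K x : (forall i, (i < k)%N -> (1 < p i)%N) -> x < 1 -> cnt k p K x = 0.
Proof.
move=> Hp x1; apply: big1 => i /(inS_gt0 Hp) /INR_leq /= h.
by case: RlebP => //; lra.
Qed.

Lemma cnt_rec k p K x : coprime_bases k.+1 p -> x < INR K ->
  cnt k.+1 p K x = \rsum_(a < K) cnt k p K (x / INR (p k) ^ a).
Proof.
move=> Hb xK; have [Hp _] := Hb.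
rewrite /cnt (sum_inS_rec (f := fun h => b2R (Rleb (INR h) x)) Hb); last first.
  by move=> h /INR_leq h1; case: RlebP => //; lra.
apply: eq_bigr => a _; apply: eq_bigr => h _; congr b2R.
have q2 := INR_ge2 (Hp k (ltnSn k)).
have qa : 0 < INR (p k) ^ a by apply: pow_lt; lra.
rewrite INR_mul INR_expn.
apply/RlebP/RlebP => H.
  by apply/(Rle_div_r _ _ _ qa); lra.
by move/(Rle_div_r _ _ _ qa): H; lra.
Qed.

(* [cnt_(k+1)(N) - cnt_(k+1)(N/p_k)] telescopes. *)
Lemma cnt_window k p K x : coprime_bases k.+1 p -> 0 <= x < INR K ->
  cnt k.+1 p K x - cnt k.+1 p K (x / INR (p k)) = cnt k p K x.
Proof.
move=> Hb [x0 xK]; have [Hp _] := Hb; have [Hp' _] := coprime_bases_pred Hb.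
have q2 := INR_ge2 (Hp k (ltnSn k)).
have xq : x / INR (p k) <= x.
  by apply/(Rle_div_l _ _ _); [lra|nra].
rewrite !cnt_rec //; last lra.
rewrite -rsum_sub.
pose g a := cnt k p K (x / INR (p k) ^ a).
rewrite (eq_bigr (fun a : 'I_K => g a - g a.+1)); last first.
  move=> a _; rewrite /g; congr (_ - cnt _ _ _ _); rewrite /= /Rdiv Rinv_mult; ring.
rewrite rsum_telescope {1}/g /= Rdiv_1_r /g (@cnt_lt1 _ _ _ (_ / _ ^ K)) ?Rminus_0_r //.
have H := lt_pow2 K q2.
by apply/(Rlt_div_l _ _ _); [apply: pow_lt; lra|lra].
Qed.

Definition lnprod (p : nat -> nat) k := \rprod_(j < k) ln (INR (p j)).
Definition lnsum (p : nat -> nat) k := \rsum_(j < k) ln (INR (p j)).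

Lemma lnprod_gt0 k p : (forall i, (i < k)%N -> (1 < p i)%N) -> 0 < lnprod p k.
Proof.
by move=> Hp; apply: rprod_gt0 => i _; apply: ln_gt0; have := INR_ge2 (Hp _ (ltn_ord i)); lra.
Qed.

Lemma lnsum_ge0 k p : (forall i, (i < k)%N -> (1 < p i)%N) -> 0 <= lnsum p k.
Proof.
move=> Hp; apply: rsum_ge0 => i _; apply: Rlt_le; apply: ln_gt0.
by have := INR_ge2 (Hp _ (ltn_ord i)); lra.
Qed.

Lemma INR_fact_gt0 k : 0 < INR (Factorial.fact k).
Proof. by apply: lt_0_INR; apply: Factorial.lt_O_fact. Qed.

(* Number of lattice points in a simplex, sandwiched between the volumes of the
   simplex and of a slightly larger one. *)
Lemma cnt_bounds k p K x : coprime_bases k p -> 1 <= x < INR K ->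
  ln x ^ k / (INR (Factorial.fact k) * lnprod p k) <= cnt k p K x
  <= (ln x + lnsum p k) ^ k / (INR (Factorial.fact k) * lnprod p k).
Proof.
elim: k x => [|k IH] x Hb [x1 xK].
  rewrite /lnprod big_ord0 /= Rmult_1_r Rdiv_1_r.
  suff -> : cnt 0 p K x = 1 by lra.
  have K1 : (1 < K)%N.
    by rewrite ltnNge; apply/negP => /INR_leq /=; lra.
  rewrite /cnt (big_pred1 (Ordinal K1)).
    by case: RlebP => //=; lra.
  by move=> h; rewrite inS0.
have [Hp _] := Hb; have Hb' := coprime_bases_pred Hb; have [Hp' _] := Hb'.
have q2 := INR_ge2 (Hp k (ltnSn k)); set q := INR (p k) in q2.
set l := ln q; have l0 : 0 < l by apply: ln_gt0; lra.
have Hc0 := lnprod_gt0 Hp'; have Hf := INR_fact_gt0 k.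
set c := INR (Factorial.fact k) * lnprod p k.
have c0 : 0 < c by apply: Rmult_lt_0_compat.
have k0 : 0 < INR k.+1 by apply: lt_0_INR; lia.
have Ec : INR (Factorial.fact k.+1) * lnprod p k.+1 = c * (INR k.+1 * l).
  by rewrite S_INR /lnprod big_ord_recr /= -/(lnprod p k) /c plus_INR mult_INR -/q -/l; ring.
have s0 := lnsum_ge0 Hp'.
have Es : lnsum p k.+1 = lnsum p k + l by rewrite /lnsum big_ord_recr.
have ln0 : 0 <= ln x by rewrite -ln_1; apply: Rcomplements.ln_le; lra.
rewrite cnt_rec // -/q Ec Es.
have Hln a : ln (x / q ^ a) = ln x - INR a * l by rewrite ln_pow_div //; lra.
have qa a : 0 < q ^ a by apply: pow_lt; lra.
have HK : ln x - INR K * l < 0.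
  rewrite -Hln -ln_1; apply: ln_increasing.
    by apply: Rdiv_lt_0_compat; [lra|].
  by apply/(Rlt_div_l _ _ _ (qa K)); have := lt_pow2 K q2; lra.
have Hcase a : (1 <= x / q ^ a < INR K /\ 0 <= ln x - INR a * l) \/
   (cnt k p K (x / q ^ a) = 0 /\ ln x - INR a * l < 0).
  have h0 : 0 < x / q ^ a by apply: Rdiv_lt_0_compat; [lra|].
  case: (Rlt_le_dec (x / q ^ a) 1) => h; [right|left]; rewrite -Hln.
    by rewrite cnt_lt1 //; split=> //; rewrite -ln_1; apply: ln_increasing.
  split; last by rewrite -ln_1; apply: Rcomplements.ln_le; lra.
  split=> //; apply: Rle_lt_trans xK; apply/(Rle_div_l _ _ _ (qa a)).
  by have : 1 <= q ^ a by [apply: pow_R1_Rle; lra]; nra.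
have Hd : 0 < c * (INR k.+1 * l) by apply: Rmult_lt_0_compat => //; apply: Rmult_lt_0_compat.
split.
  (* A potential whose decrements are at most the summands, by [pow_diff_le]. The cut at 0 preserves
     this for the indices with [x / q^a < 1], where the count is 0. *)
  pose g a := (Rmax 0 (ln x - INR a * l)) ^ k.+1 / (c * (INR k.+1 * l)).
  apply: Rle_trans (_ : \rsum_(a < K) (g a - g a.+1) <= _); last first.
    apply: rsum_le => a _; rewrite /g (S_INR a).
    case: (Hcase a) => [[h1 h2]|[-> h2]]; last first.
      by rewrite !Rmax_left; try lra; nra.
    have [h3 _] := IH _ Hb' h1; apply: Rle_trans h3; rewrite -/c Hln.
    rewrite (Rmax_right _ _ h2); set t := ln x - _ in h2 *.
    have -> : ln x - (INR a + 1) * l = t - l by rewrite /t; ring.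
    have h4 : 0 <= Rmax 0 (t - l) <= t.
      by split; [apply: Rmax_l|apply: Rmax_lub; lra].
    have h5 := pow_diff_le k h4.
    have h6 : t - Rmax 0 (t - l) <= l by have := Rmax_r 0 (t - l); lra.
    have h7 : 0 <= t ^ k by apply: pow_le.
    rewrite -RIneq.Rdiv_minus_distr; apply/(Rle_div_l _ _ _ Hd).
    have -> : t ^ k / c * (c * (INR k.+1 * l)) = INR k.+1 * l * t ^ k by field; lra.
    apply: Rle_trans h5 _; apply: Rmult_le_compat_r => //.
    by apply: Rmult_le_compat_l; lra.
  rewrite rsum_telescope /g /= Rmult_0_l Rminus_0_r (Rmax_right _ _ ln0) Rmax_left; last lra.
  by rewrite Rmult_0_l /Rdiv Rmult_0_l; lra.
(* Raising the potential by one step [l] reverses the inequality: its decrement over [[t, t + l]] is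
   at least [l] times the derivative at the left end. *)
pose g a := (Rmax 0 (ln x + lnsum p k + l - INR a * l)) ^ k.+1 / (c * (INR k.+1 * l)).
apply: Rle_trans (_ : \rsum_(a < K) (g a - g a.+1) <= _).
  apply: rsum_le => a _; rewrite /g (S_INR a).
  have E : ln x + lnsum p k + l - (INR a + 1) * l = ln x + lnsum p k - INR a * l by ring.
  rewrite E; set t := ln x + _ - INR a * l.
  have -> : ln x + lnsum p k + l - INR a * l = t + l by rewrite /t; ring.
  rewrite -RIneq.Rdiv_minus_distr.
  case: (Hcase a) => [[h1 h2]|[-> h2]]; last first.
    apply: Rdiv_le_0_compat => //.
    suff : Rmax 0 t ^ k.+1 <= Rmax 0 (t + l) ^ k.+1 by lra.
    apply: pow_incr; split; first exact: Rmax_l.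
    by apply: Rle_max_compat_l; lra.
  have [_ h3] := IH _ Hb' h1; apply: Rle_trans h3 _; rewrite -/c Hln.
  have t0 : 0 <= t by rewrite /t; lra.
  rewrite !Rmax_right; try lra.
  have -> : ln x - INR a * l + lnsum p k = t by rewrite /t; ring.
  apply/(Rle_div_r _ _ _ Hd).
  have -> : t ^ k / c * (c * (INR k.+1 * l)) = INR k.+1 * (t + l - t) * t ^ k by field; lra.
  by apply: pow_diff_ge; lra.
rewrite rsum_telescope /g -[INR 0]/0 Rmult_0_l Rminus_0_r Rmax_right; last lra.
rewrite -Rplus_assoc.
have : 0 <= Rmax 0 (ln x + lnsum p k + l - INR K * l) ^ k.+1 / (c * (INR k.+1 * l)).
  by apply: Rdiv_le_0_compat => //; apply: pow_le; apply: Rmax_l.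
lra.
Qed.

(** A common majorant, up to a constant, of [t^j * exp (- t)] for [j = 1, 2, 3]. A rational function
    is chosen because its sums along geometric progressions are bounded by a telescoping sum. *)
Definition hump (t : R) : R := t / (1 + t) ^ 2.

Lemma hump_ge0 t : 0 <= t -> 0 <= hump t.
Proof. by move=> t0; apply: Rdiv_le_0_compat => //; apply: pow_lt; lra. Qed.

Lemma hump_le1 t : 0 <= t -> hump t <= 1.
Proof. by move=> t0; apply/Rle_div_l; [apply: pow_lt; lra|nra]. Qed.

(** When [t] is multiplied by [q >= 2], the bounded function [t / (1 + t)] grows by an amount
    comparable to [hump t]; sums over powers of [q] are thus bounded whatever their length and
    starting point. *)
Lemma hump_telescope q t : 2 <= q -> 0 <= t ->
  hump t <= 2 * (q * t / (1 + q * t) - t / (1 + t)).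
Proof.
move=> q2 t0; rewrite /hump.
have h1 : 0 < 1 + q * t by nra.
have -> : 2 * (q * t / (1 + q * t) - t / (1 + t)) =
  (2 * (q - 1) * (1 + t) / (1 + q * t)) * (t / (1 + t) ^ 2) by field; lra.
have h2 : 0 <= t / (1 + t) ^ 2 by apply: hump_ge0.
suff h3 : 1 <= 2 * (q - 1) * (1 + t) / (1 + q * t) by nra.
by apply/Rle_div_r; nra.
Qed.

Lemma hump_geom_sum q t K : 2 <= q -> 0 <= t -> \rsum_(a < K) hump (q ^ a * t) <= 2.
Proof.
move=> q2 t0.
pose g a := - (2 * (q ^ a * t / (1 + q ^ a * t))).
have qa a : 0 <= q ^ a * t by apply: Rmult_le_pos => //; apply: pow_le; lra.
apply: Rle_trans (_ : \rsum_(a < K) (g a - g a.+1) <= _).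
  apply: rsum_le => a _; apply: Rle_trans (hump_telescope q2 (qa a)) _.
  by rewrite /g /= Rmult_assoc; lra.
rewrite rsum_telescope /g.
have H x : 0 <= x -> 0 <= x / (1 + x) <= 1.
  move=> x0; split; first by apply: Rdiv_le_0_compat; lra.
  by apply/Rle_div_l; lra.
have := H _ (qa 0%N); have := H _ (qa K); lra.
Qed.

(** The powers of the last base form a geometric progression and cost only a factor 2, so one base
    disappears from the count. The sum is of order [(ln n)^k], while [S] has about [(ln n)^(k+1)]
    elements up to [n]. *)
Lemma sum_hump_le k p r n : coprime_bases k.+1 p -> 0 < r ->
  \rsum_(h < n.+1 | inS k.+1 p h) hump (r * INR h) <= 2 * cnt k p n.+1 (INR n).
Proof.
move=> Hb r0; have [Hp _] := Hb.
have q2 := INR_ge2 (Hp k (ltnSn k)).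
pose f h := if (h <= n)%N then hump (r * INR h) else 0.
rewrite (eq_bigr (fun h : 'I_n.+1 => f h)); last first.
  by move=> h _; rewrite /f -ltnS ltn_ord.
rewrite sum_inS_rec //; last by move=> h hn; rewrite /f leqNgt hn.
rewrite exchange_big /= /cnt -rsum_scal; apply: rsum_le => h _.
have -> : b2R (Rleb (INR h) (INR n)) = 1.
  by case: RlebP => //; case; apply: INR_leq; rewrite -ltnS ltn_ord.
have t0 : 0 <= r * INR h by apply: Rmult_le_pos; [lra|apply: pos_INR].
rewrite Rmult_1_r; apply: Rle_trans (hump_geom_sum n.+1 q2 t0).
apply: rsum_le => a _; rewrite /f.
have E : r * INR (p k ^ a * h) = INR (p k) ^ a * (r * INR h).
  by rewrite INR_mul INR_expn; ring.
rewrite E; case: ifP => _; first lra.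
by apply: hump_ge0; apply: Rmult_le_pos => //; apply: pow_le; lra.
Qed.

(** From [exp t >= (1 + t / 5)^5 >= (1 + t)^5 / 5^5], hence the constant [3125 = 5^5]. The exponent
    5 is the 3 of the highest moment used plus the 2 in the denominator of [hump]. *)
Lemma pow_exp_le_hump k t : (1 <= k <= 3)%N -> 0 <= t -> t ^ k * exp (- t) <= 3125 * hump t.
Proof.
move=> hk t0.
have h1 : (1 + t / 5) ^ 5 <= exp t.
  have -> : exp t = exp (t / 5) ^ 5.
    by rewrite -!Rpower_pow ?/Rpower ?ln_exp; [congr exp; rewrite /=; field|apply: exp_pos].
  by apply: pow_incr; have := exp_ineq1_le (t / 5); lra.
have h2 : (1 + t) ^ 5 <= 3125 * (1 + t / 5) ^ 5.
  have -> : 3125 * (1 + t / 5) ^ 5 = (5 + t) ^ 5 by field.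
  by apply: pow_incr; lra.
rewrite exp_Ropp; apply/Rle_div_l; first exact: exp_pos.
have h3 : 0 < (1 + t) ^ 2 by apply: pow_lt; lra.
have h4 : t ^ k <= t * (1 + t) ^ 3.
  have h5 : t ^ k.-1 <= (1 + t) ^ 3.
    apply: Rle_trans (_ : (1 + t) ^ k.-1 <= _); first by apply: pow_incr; lra.
    apply: Rle_pow; first lra.
    by case: k hk => [|[|[|[|k]]]] //= _; lia.
  by case: k hk h5 => [|k] //= _ h5; apply: Rmult_le_compat_l.
apply: Rle_trans h4 _.
have -> : 3125 * hump t * exp t = (t / (1 + t) ^ 2) * (3125 * exp t) by rewrite /hump; ring.
have -> : t * (1 + t) ^ 3 = (t / (1 + t) ^ 2) * (1 + t) ^ 5 by field; lra.
by apply: Rmult_le_compat_l; [apply: hump_ge0|lra].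
Qed.

(** * Characteristic functions of digit laws *)

Definition expi (x : R) : C := (cos x, sin x).

Lemma expi0 : expi 0 = RtoC 1.
Proof. by rewrite /expi cos_0 sin_0. Qed.

Lemma expi_add x y : expi (x + y) = (expi x * expi y)%C.
Proof. by rewrite /expi cos_plus sin_plus /Cmult /=; congr (_, _); ring. Qed.

Lemma Cmod_expi x : Cmod (expi x) = 1.
Proof.
rewrite /Cmod /expi /= !Rmult_1_r.
by have := sin2_cos2 x; rewrite /Rsqr => H; rewrite Rplus_comm H sqrt_1.
Qed.

Lemma ge0_of_derive (f f' : R -> R) : (forall x, is_derive f x (f' x)) -> f 0 = 0 ->
  (forall x, 0 <= x -> 0 <= f' x) -> forall x, 0 <= x -> 0 <= f x.
Proof.
move=> H f0 Hf x x0.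
have [||c [[]]] := MVT_gen f 0 x f'.
- by move=> y _; apply: H.
- move=> y _; apply: derivable_continuous_pt; exists (f' y).
  by apply/is_derive_Reals; apply: H.
rewrite Rmin_left // Rmax_right // f0 => c0 cx E.
have := Hf _ c0; nra.
Qed.

Lemma one_sub_cos_le x : 1 - cos x <= x ^ 2 / 2.
Proof.
suff H y : 0 <= y -> 0 <= y ^ 2 / 2 - (1 - cos y).
  case: (Rle_dec 0 x) => [/H|h]; first lra.
  by rewrite -cos_neg; have := H (- x); rewrite /=; lra.
apply: (@ge0_of_derive (fun y => y ^ 2 / 2 - (1 - cos y)) (fun x => x - sin x)) => [z||z z0].
- by auto_derive => //; field.
- by rewrite cos_0; field.
have := SIN_bound z; case: (Req_dec z 0) => [->|zn]; first by rewrite sin_0; lra.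
by have := sin_lt_x z; lra.
Qed.

Lemma sin_le y : 0 <= y -> 0 <= y - sin y.
Proof.
move=> y0; case: (Req_dec y 0) => [->|zn]; first by rewrite sin_0; lra.
by have := sin_lt_x y; lra.
Qed.

Lemma cos_le_cubic y : 0 <= y -> 0 <= y ^ 3 / 6 - (cos y - 1 + y ^ 2 / 2).
Proof.
have D2 x : 0 <= x -> 0 <= x - (1 - cos x).
  apply: (@ge0_of_derive (fun y => y - (1 - cos y)) (fun x => 1 - sin x)) => [z||z z0].
  - by auto_derive => //; ring.
  - by rewrite cos_0; ring.
  by have := SIN_bound z; lra.
have D3 x : 0 <= x -> 0 <= x ^ 2 / 2 - (x - sin x).
  apply: (@ge0_of_derive (fun y => y ^ 2 / 2 - (y - sin y)) (fun x => x - (1 - cos x))) => [z||z z0].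
  - by auto_derive => //; field.
  - by rewrite sin_0; field.
  exact: D2.
apply: (@ge0_of_derive (fun y => y ^ 3 / 6 - (cos y - 1 + y ^ 2 / 2)) (fun x => x ^ 2 / 2 - (x - sin x))) => [z||z z0].
- by auto_derive => //; field.
- by rewrite cos_0; field.
exact: D3.
Qed.

Lemma one_sub_cos_ge y : Rabs y <= 1 -> y ^ 2 / 4 <= 1 - cos y.
Proof.
suff H x : 0 <= x <= 1 -> x ^ 2 / 4 <= 1 - cos x.
  move=> h; have := H (Rabs y); rewrite pow2_abs.
  have -> : cos (Rabs y) = cos y by rewrite /Rabs; case: Rcase_abs; rewrite ?cos_neg.
  by apply; split=> //; apply: Rabs_pos.
by move=> [x0 x1]; have := cos_le_cubic x0; have : 0 <= x ^ 2 by [apply: pow2_ge_0]; rewrite /=; nra.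
Qed.

Lemma expi_sub1_le x : Cmod (expi x - 1) <= Rabs x.
Proof.
rewrite /Cmod /expi /=; rewrite -sqrt_Rsqr_abs; apply: sqrt_le_1_alt.
have := sin2_cos2 x; have := one_sub_cos_le x; rewrite /Rsqr /=; nra.
Qed.

Lemma expi_taylor2 x : Cmod (expi x - 1 - Ci * x + x ^ 2 / 2) <= Rabs x ^ 3.
Proof.
have -> : (expi x - 1 - Ci * x + x ^ 2 / 2)%C = (cos x - 1 + x ^ 2 / 2, sin x - x).
  by rewrite /expi /Ci; apply: injective_projections; rewrite /=; field.
apply: Rle_trans (Cmod_2Rmax _) _ => /=.
suff H : Rmax (Rabs (cos x - 1 + x ^ 2 / 2)) (Rabs (sin x - x)) <= Rabs x ^ 3 / 2.
  have h2 : sqrt 2 <= 2.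
    by rewrite -{2}(sqrt_square 2); [apply: sqrt_le_1_alt; lra|lra].
  have h0 := sqrt_pos 2.
  have h3 : 0 <= Rmax (Rabs (cos x - 1 + x ^ 2 / 2)) (Rabs (sin x - x)).
    by apply: Rle_trans (Rmax_l _ _); apply: Rabs_pos.
  rewrite /= in H h3 *; nra.
have D5 y : 0 <= y -> 0 <= y ^ 3 / 6 - (y - sin y).
  apply: (@ge0_of_derive (fun y => y ^ 3 / 6 - (y - sin y)) (fun x => x ^ 2 / 2 - (1 - cos x))) => [z||z z0].
  - by auto_derive => //; field.
  - by rewrite sin_0; field.
  by have := one_sub_cos_le z; lra.
have K y : 0 <= y -> Rmax (Rabs (cos y - 1 + y ^ 2 / 2)) (Rabs (sin y - y)) <= Rabs y ^ 3 / 2.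
  move=> y0; rewrite (Rabs_pos_eq y) //; apply: Rmax_lub; apply: Rabs_le.
    by have := cos_le_cubic y0; have := one_sub_cos_le y; have : 0 <= y ^ 3 by [apply: pow_le]; lra.
  by have := D5 _ y0; have := sin_le y0; have : 0 <= y ^ 3 by [apply: pow_le]; lra.
case: (Rle_dec 0 x) => [/K //|h].
have := K (- x); rewrite cos_neg sin_neg Rabs_Ropp.
have -> : (- x) ^ 2 = x ^ 2 by ring.
have -> : - sin x - - x = - (sin x - x) by ring.
by rewrite Rabs_Ropp; apply; lra.
Qed.

Definition ldist (d : nat) (w : nat -> R) : Prop :=
  (forall j, 0 <= w j) /\ \rsum_(j < d) w j = 1.
Definition Ew (d : nat) (w f : nat -> R) : R := \rsum_(j < d) (w j * f j).
Definition muw (d : nat) (w : nat -> R) : R := Ew d w INR.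
Definition momw (d : nat) (w : nat -> R) (k : nat) : R :=
  Ew d w (fun j => Rabs (INR j - muw d w) ^ k).
(** The transform [E[b(X) exp (i s (X - mu))]] of a digit [X] with weights [w] and mean [mu]. Over
    all positions the centrings multiply to [exp (- i theta n)] once the sum has mean [n]. *)
Definition charw (d : nat) (w b : nat -> R) (s : R) : C :=
  (\csum_(j < d) (RtoC (w j * b j) * expi (s * (INR j - muw d w))%re)%C).

Section DigitLaw.
Variables (d : nat) (w : nat -> R).
Hypothesis Hw : ldist d w.
Let mu := muw d w.

Lemma Ew_le f g : (forall j, (j < d)%N -> f j <= g j) -> Ew d w f <= Ew d w g.
Proof.
move=> H; apply: rsum_le => j _; apply: Rmult_le_compat_l; first by case: Hw.
exact: H.
Qed.

Lemma Ew_ge0 f : (forall j, (j < d)%N -> 0 <= f j) -> 0 <= Ew d w f.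
Proof. by move=> H; apply: rsum_ge0 => j _; apply: Rmult_le_pos; [case: Hw|apply: H]. Qed.

Lemma Ew_const c : Ew d w (fun=> c) = c.
Proof. by rewrite /Ew rsum_scalr; case: Hw => _ ->; ring. Qed.

Lemma Ew_add f g : Ew d w (fun j => f j + g j) = Ew d w f + Ew d w g.
Proof. by rewrite /Ew -rsum_add; apply: eq_bigr => j _; ring. Qed.

Lemma Ew_scal c f : Ew d w (fun j => c * f j) = c * Ew d w f.
Proof. by rewrite /Ew -rsum_scal; apply: eq_bigr => j _; ring. Qed.

Lemma Ew_centered : Ew d w (fun j => INR j - mu) = 0.
Proof.
have -> : 0 = Ew d w INR + -1 * Ew d w (fun=> mu) by rewrite Ew_const /mu /muw; ring.
rewrite -Ew_scal -Ew_add; apply: eq_bigr => j _; ring.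
Qed.

Lemma muw_bounds : 0 <= mu <= INR d.
Proof.
split; first by apply: Ew_ge0 => j _; apply: pos_INR.
rewrite -(Ew_const (INR d)); apply: Ew_le => j jd; apply: INR_leq; exact: ltnW.
Qed.

Lemma momw_ge0 k : 0 <= momw d w k.
Proof. by apply: Ew_ge0 => j _; apply: pow_le; apply: Rabs_pos. Qed.

Lemma mom1_le : momw d w 1 <= 2 * mu.
Proof.
have -> : 2 * mu = Ew d w (fun j => INR j + mu).
  by rewrite Ew_add Ew_const -/(muw d w) -/mu; ring.
apply: Ew_le => j _; rewrite pow_1; have [m0 _] := muw_bounds.
have j0 := pos_INR j; apply: Rabs_le; rewrite -/mu; lra.
Qed.

Lemma mom_step k : momw d w k.+1 <= INR d * momw d w k.
Proof.
rewrite -Ew_scal; apply: Ew_le => j /ltnW /INR_leq jd /=.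
apply: Rmult_le_compat_r; first by apply: pow_le; apply: Rabs_pos.
by have [m0 m1] := muw_bounds; have := pos_INR j; rewrite -/mu => j0; apply: Rabs_le; lra.
Qed.

Lemma charw_le_Ew b s : Cmod (charw d w b s) <= Ew d w (fun j => Rabs (b j)).
Proof.
apply: Rle_trans (Cmod_csum _ _ _) _; apply: rsum_le => j _.
rewrite Cmod_mult Cmod_expi Cmod_R Rabs_mult Rmult_1_r (Rabs_pos_eq (w j)); first lra.
by case: Hw.
Qed.

Lemma charw_le1 b s : (forall j, Rabs (b j) <= 1) -> Cmod (charw d w b s) <= 1.
Proof.
move=> H; apply: Rle_trans (charw_le_Ew _ _) _.
by rewrite -[X in _ <= X](Ew_const 1); apply: Ew_le.
Qed.

(** As [E[b] = 0], the exponential may be diminished by 1, which leaves [O(s)]: this is the gain of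
    one power of [theta] per centred digit. *)
Lemma charw_centered_le b s : (forall j, Rabs (b j) <= 1) -> Ew d w b = 0 ->
  Cmod (charw d w b s) <= Rabs s * momw d w 1.
Proof.
move=> Hb1 Hb0.
have -> : charw d w b s =
    (\csum_(j < d) (RtoC (w j * b j) * (expi (s * (INR j - mu))%re - RtoC 1))%C).
  transitivity (charw d w b s - RtoC (Ew d w b))%C; first by rewrite Hb0; ring.
  rewrite /charw /Ew RtoC_rsum.
  have E (x y : C) : (x - y = x + (- RtoC 1) * y)%C by ring.
  rewrite E (big_distrr (times := Cmult)) -big_split; apply: eq_bigr => j _; rewrite -/mu; simpl; ring.
apply: Rle_trans (Cmod_csum _ _ _) _; rewrite -Ew_scal; apply: rsum_le => j _.
have w0 : 0 <= w j by case: Hw.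
rewrite Cmod_mult Cmod_R Rabs_mult (Rabs_pos_eq (w j)) //.
have h1 := expi_sub1_le (s * (INR j - mu)); rewrite Rabs_mult in h1.
rewrite pow_1 -/mu Rmult_assoc; apply: Rmult_le_compat_l => //.
have := Hb1 j; have := Cmod_ge_0 (expi (s * (INR j - mu)) - 1); have := Rabs_pos (b j).
nra.
Qed.

(** The linear Taylor term vanishes by the centring at [mu]. *)
Lemma charw_taylor2 s :
  Cmod (charw d w (fun=> 1%re) s - RtoC (1 - s ^ 2 / 2 * momw d w 2)%re) <= Rabs s ^ 3 * momw d w 3.
Proof.
have -> : (charw d w (fun=> 1%re) s - RtoC (1 - s ^ 2 / 2 * momw d w 2)%re =
  \csum_(j < d) (RtoC (w j) * (expi (s * (INR j - mu))%re - 1 -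
     Ci * (s * (INR j - mu))%re + RtoC (s * (INR j - mu)) ^ 2 / 2))%C)%C.
  transitivity (charw d w (fun=> 1%re) s - RtoC (1 - s ^ 2 / 2 * momw d w 2)%re -
     RtoC (Ew d w (fun j => INR j - mu)%re) * (Ci * RtoC s))%C; first by rewrite Ew_centered; ring.
  have -> : 1 - s ^ 2 / 2 * momw d w 2 = Ew d w (fun=> 1) + - (s ^ 2 / 2) * momw d w 2.
    by rewrite Ew_const; ring.
  rewrite /charw /momw -Ew_scal -Ew_add /Ew !RtoC_rsum.
  have E (x y z t : C) : (x - y - z * t = x + ((- RtoC 1) * y + (- t) * z))%C by ring.
  rewrite E !(big_distrr (times := Cmult)) -!big_split; apply: eq_bigr => j _.
  rewrite -/mu !pow2_abs; case: (expi _) => z1 z2.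
  by apply: injective_projections; rewrite /=; field.
apply: Rle_trans (Cmod_csum _ _ _) _; rewrite -Ew_scal; apply: rsum_le => j _.
have w0 : 0 <= w j by case: Hw.
rewrite Cmod_mult Cmod_R (Rabs_pos_eq (w j)) //; apply: Rmult_le_compat_l => //.
by apply: Rle_trans (expi_taylor2 _) _; rewrite Rabs_mult Rpow_mult_distr; apply: Rle_refl.
Qed.

End DigitLaw.

(* Keeping only the digits 0 and 1 already bounds the characteristic function away from 1. *)
Lemma charw_le_exp e w s : ldist e.+2 w ->
  Cmod (charw e.+2 w (fun=> 1) s) <= exp (- (w 0%N * w 1%N * (1 - cos s))).
Proof.
move=> Hw; have [w_ge0 Hsum] := Hw.
set mu := muw e.+2 w.
apply: Rle_trans (_ : 1 - w 0%N * w 1%N * (1 - cos s) <= _); last first.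
  by have := exp_ineq1_le (- (w 0%N * w 1%N * (1 - cos s))); lra.
rewrite !big_ord_recl lift0 /= in Hsum.
rewrite /charw !big_ord_recl lift0 -/mu.
set T := \big[_/_]_(_ < _) _; set W := \big[_/_]_(_ < _) _ in Hsum.
have HT : Cmod T <= W.
  apply: Rle_trans (Cmod_csum _ _ _) _; apply: rsum_le => j _.
  rewrite Cmod_mult Cmod_expi Cmod_R !Rmult_1_r Rabs_pos_eq; first exact: Rle_refl.
  exact: w_ge0.
rewrite -![nat_of_ord ord0]/0%N -[INR 0]/0 -[INR 1]/1 Cplus_assoc; apply: Rle_trans (Cmod_triangle _ _) _.
rewrite !Rmult_1_r in HT *.
set a := w 0%N in Hsum *; set b := w 1%N in Hsum *.
have a0 : 0 <= a by apply: w_ge0.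
have b0 : 0 <= b by apply: w_ge0.
have W0 : 0 <= W by apply: rsum_ge0 => j _; apply: w_ge0.
suff : Cmod (RtoC a * expi (s * (0 - mu)) + RtoC b * expi (s * (1 - mu))) <=
   a + b - a * b * (1 - cos s).
  by rewrite /= in Hsum *; lra.
have -> : s * (1 - mu) = s * (0 - mu) + s by ring.
rewrite expi_add.
have -> : (RtoC a * expi (s * (0 - mu)) + RtoC b * (expi (s * (0 - mu)) * expi s) =
  expi (s * (0 - mu)) * (RtoC a + RtoC b * expi s))%C by ring.
rewrite Cmod_mult Cmod_expi Rmult_1_l.
have c1 := COS_bound s.
have h0 : a * b <= 1 by nra.
have hx : 0 <= a + b - a * b * (1 - cos s).
  have : a * b * (1 - cos s) <= a * b * 2 by apply: Rmult_le_compat_l; nra.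
  nra.
rewrite -(sqrt_square _ hx) /Cmod; apply: sqrt_le_1_alt; rewrite /=.
have := sin2_cos2 s; rewrite /Rsqr => h1.
have -> : (a + (b * cos s - 0 * sin s)) * ((a + (b * cos s - 0 * sin s)) * 1) +
  (0 + (b * sin s + 0 * cos s)) * ((0 + (b * sin s + 0 * cos s)) * 1) =
  a * a + 2 * (a * b * cos s) + b * b * (sin s * sin s + cos s * cos s) by ring.
rewrite h1; set v := a * b in h0 hx *; have v0 : 0 <= v by apply: Rmult_le_pos.
(* As [a + b <= 1], [2 v (1 - cos s)] is at least [2 (a + b) v (1 - cos s)], which settles the
   comparison of the squares. *)
have : v * (1 - cos s) * (1 - a - b) >= 0.
  by apply: Rle_ge; apply: Rmult_le_pos; [apply: Rmult_le_pos; lra|lra].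
have -> : (a + b - v * (1 - cos s)) * (a + b - v * (1 - cos s)) =
  (a + b) * (a + b) - 2 * (a + b) * (v * (1 - cos s)) + (v * (1 - cos s)) ^ 2 by ring.
have := pow2_ge_0 (v * (1 - cos s)).
rewrite (_ : (a + b) * (a + b) = a * a + 2 * v + b * b); last by rewrite /v; ring.
nra.
Qed.

(** * Digit laws tilted by exp(- t j) *)

Definition Zt (d : nat) (t : R) : R := \rsum_(j < d) exp (- (t * INR j)).
Definition tilt (d : nat) (t : R) (j : nat) : R := exp (- (t * INR j)) / Zt d t.
Definition nz (j : nat) : R := b2R (j != 0%N).

Lemma exp_le x y : x <= y -> exp x <= exp y.
Proof. by case=> [h|->]; [apply: Rlt_le; apply: exp_increasing|lra]. Qed.

Section Tilt.
Variables (e : nat) (t : R).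
Hypothesis t0 : 0 <= t.
Let d := e.+2.

Lemma INR_d_ge2 : 2 <= INR d.
Proof. by rewrite /d !S_INR; have := pos_INR e; lra. Qed.

Lemma exp_le1 x : x <= 0 -> exp x <= 1.
Proof. by move=> h; rewrite -exp_0; apply: exp_le. Qed.

Lemma rsum_ord_const n c : \rsum_(j < n) c = c * INR n.
Proof. by rewrite rsum_const count_predT /index_enum -enumT size_enum_ord. Qed.

Lemma Zt_bounds : 1 <= Zt d t <= INR d.
Proof.
split.
  rewrite /Zt big_ord_recl /= Rmult_0_r Ropp_0 exp_0.
  suff : 0 <= \rsum_(i < e.+1) exp (- (t * INR (lift ord0 i))) by rewrite /=; lra.
  by apply: rsum_ge0 => i _; apply: Rlt_le; apply: exp_pos.
rewrite -[INR d]Rmult_1_l -rsum_ord_const; apply: rsum_le => j _.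
by apply: exp_le1; have := pos_INR j; nra.
Qed.

Lemma tilt_gt0 j : 0 < tilt d t j.
Proof. by apply: Rdiv_lt_0_compat; [exact: exp_pos|have [] := Zt_bounds; lra]. Qed.

Lemma tilt_ldist : ldist d (tilt d t).
Proof.
split=> [j|]; first by apply: Rlt_le; apply: tilt_gt0.
rewrite rsum_scalr -/(Zt d t); have [] := Zt_bounds => h _.
by field; lra.
Qed.

Lemma tilt_le j : tilt d t j <= exp (- (t * INR j)).
Proof.
have [h _] := Zt_bounds; apply/Rle_div_l; first lra.
by have := exp_pos (- (t * INR j)); nra.
Qed.

(** Serves [charw_le_exp]: for [t <= 1] the bound is at least [exp (- 1) / d^2], the constant of all
    later product bounds. *)
Lemma tilt01_ge : exp (- t) / INR d ^ 2 <= tilt d t 0 * tilt d t 1.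
Proof.
have [h1 h2] := Zt_bounds; rewrite /tilt -[INR 0]/0 -[INR 1]/1 Rmult_0_r Ropp_0 exp_0 Rmult_1_r.
have -> : INR d ^ 2 = INR d * INR d by ring.
have -> : 1 / Zt d t * (exp (- t) / Zt d t) = exp (- t) / (Zt d t * Zt d t) by field; lra.
apply: Rmult_le_compat_l; first by apply: Rlt_le; apply: exp_pos.
by apply: Rinv_le_contravar; [nra|apply: Rmult_le_compat; lra].
Qed.

Lemma Ew_tilt_le f B : f 0%N = 0 -> 0 <= B -> (forall j, (j < d)%N -> f j <= B) ->
  Ew d (tilt d t) f <= B * INR d * exp (- t).
Proof.
move=> f0 B0 fB.
have -> : B * INR d * exp (- t) = \rsum_(j < d) (B * exp (- t)) by rewrite rsum_ord_const; ring.
apply: rsum_le => j _; have e0 := exp_pos (- t).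
case: (posnP j) => [->|j0]; first by rewrite f0 Rmult_0_r; nra.
have h1 : tilt d t j <= exp (- t).
  apply: Rle_trans (tilt_le _) _; apply: exp_le.
  have /INR_leq := j0; rewrite /= => h; nra.
have h2 := fB _ (ltn_ord j); have h3 := tilt_gt0 j.
apply: Rle_trans (_ : tilt d t j * B <= _); first by apply: Rmult_le_compat_l; lra.
by rewrite Rmult_comm; apply: Rmult_le_compat_l.
Qed.

Lemma muw_tilt_le : muw d (tilt d t) <= INR d ^ 2 * exp (- t).
Proof.
have -> : INR d ^ 2 * exp (- t) = INR d * INR d * exp (- t) by ring.
apply: Ew_tilt_le => //; first by apply: pos_INR.
by move=> j /ltnW /INR_leq.
Qed.

Lemma momw_tilt_le k : (1 <= k <= 3)%N ->
  momw d (tilt d t) k <= 2 * INR d ^ 4 * exp (- t).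
Proof.
have d2 := INR_d_ge2; have H := tilt_ldist.
have h1 := mom1_le H; have m1 := muw_tilt_le.
have s2 := mom_step H 1; have s3 := mom_step H 2.
have e0 := exp_pos (- t).
set D := INR d in d2 m1 s2 s3 *.
have hd : 0 <= D ^ 2 * exp (- t) by apply: Rmult_le_pos; [apply: pow_le|]; lra.
have b1 : momw d (tilt d t) 1 <= 2 * D ^ 2 * exp (- t) by lra.
have b2 : momw d (tilt d t) 2 <= 2 * D ^ 3 * exp (- t).
  apply: Rle_trans s2 _; have -> : 2 * D ^ 3 * exp (- t) = D * (2 * D ^ 2 * exp (- t)) by ring.
  by apply: Rmult_le_compat_l; lra.
have b3 : momw d (tilt d t) 3 <= 2 * D ^ 4 * exp (- t).
  apply: Rle_trans s3 _; have -> : 2 * D ^ 4 * exp (- t) = D * (2 * D ^ 3 * exp (- t)) by ring.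
  by apply: Rmult_le_compat_l; lra.
have up x : 0 <= x -> x <= D * x by move=> x0; nra.
have p3 : D ^ 2 <= D ^ 3 by apply: up; apply: pow_le; lra.
have p4 : D ^ 3 <= D ^ 4 by apply: up; apply: pow_le; lra.
by case: k => [|[|[|[|k]]]] //; try lia; move=> _; nra.
Qed.

(** For large [t] the digit is 0 up to probability [O(exp (- t))], and so are its central moments;
    hence [6250 = 2 * 3125]. *)
Lemma momw_hump k : (1 <= k <= 3)%N ->
  t ^ k * momw d (tilt d t) k <= 6250 * INR d ^ 4 * hump t.
Proof.
move=> hk; have h1 := pow_exp_le_hump hk t0; have h2 := momw_tilt_le hk.
have tk : 0 <= t ^ k by apply: pow_le.
have d4 : 0 <= INR d ^ 4 by apply: pow_le; apply: pos_INR.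
apply: Rle_trans (_ : t ^ k * (2 * INR d ^ 4 * exp (- t)) <= _).
  exact: Rmult_le_compat_l.
nra.
Qed.

Lemma Ew_nz : Ew d (tilt d t) nz = 1 - / Zt d t.
Proof.
have [h1 h2] := Zt_bounds; have [_ H] := tilt_ldist.
have -> : 1 - / Zt d t = \rsum_(j < d) tilt d t j - tilt d t 0.
  by rewrite H /tilt /= Rmult_0_r Ropp_0 exp_0; field; lra.
rewrite /Ew big_ord_recl [X in _ = X - _]big_ord_recl /= /nz /= Rmult_0_r.
have -> (a b c : R) : a = b + c - b <-> a = c by split; lra.
by rewrite Rplus_0_l; apply: eq_bigr => j _; rewrite Rmult_1_r.
Qed.

Lemma Ew_nz_bounds : 0 <= Ew d (tilt d t) nz <= 1.
Proof.
rewrite Ew_nz; have [h1 h2] := Zt_bounds.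
have : / Zt d t <= 1 by rewrite -Rinv_1; apply: Rinv_le_contravar; lra.
by have : 0 < / Zt d t by [apply: Rinv_0_lt_compat; lra]; lra.
Qed.

Lemma Zt_ge : INR d * exp (- (t * INR d)) <= Zt d t.
Proof.
rewrite Rmult_comm -rsum_ord_const; apply: rsum_le => j _; apply: exp_le.
by have := INR_leq (ltnW (ltn_ord j)); nra.
Qed.

Lemma Ew_nz_near : Rabs (Ew d (tilt d t) nz - (1 - / INR d)) <= INR d ^ 2 * t.
Proof.
rewrite Ew_nz; have [h1 h2] := Zt_bounds; have h3 := Zt_ge; have d2 := INR_d_ge2.
have -> : 1 - / Zt d t - (1 - / INR d) = - ((INR d - Zt d t) / (Zt d t * INR d)) by field; lra.
rewrite Rabs_Ropp Rabs_pos_eq; last by apply: Rdiv_le_0_compat; nra.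
have h4 : INR d - Zt d t <= INR d ^ 2 * t.
  by have := exp_ineq1_le (- (t * INR d)); nra.
apply/Rle_div_l; first nra.
have h5 : 1 <= Zt d t * INR d by nra.
have h6 : 0 <= INR d ^ 2 * t by nra.
nra.
Qed.

Lemma tilt_near j : (j < d)%N ->
  exp (- (t * INR d)) / INR d <= tilt d t j <= exp (t * INR d) / INR d.
Proof.
move=> /ltnW /INR_leq jd; have [h1 h2] := Zt_bounds; have h3 := Zt_ge; have d2 := INR_d_ge2.
have h4 : t * INR j <= t * INR d by apply: Rmult_le_compat_l.
have h5 : 0 <= t * INR j by apply: Rmult_le_pos => //; apply: pos_INR.
split; rewrite /tilt.
  apply: Rmult_le_compat; try by apply: Rlt_le; apply: exp_pos.
  - by apply: Rlt_le; apply: Rinv_0_lt_compat; lra.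
  - by apply: exp_le; lra.
  by apply: Rinv_le_contravar; lra.
apply/Rle_div_l; first lra.
have e1 : exp (- (t * INR j)) <= 1 by apply: exp_le1; lra.
apply: Rle_trans e1 _.
have E : exp (t * INR d) / INR d * (INR d * exp (- (t * INR d))) = 1.
  by rewrite exp_Ropp; field; have := exp_pos (t * INR d); lra.
rewrite -{1}E; apply: Rmult_le_compat_l => //.
by apply: Rdiv_le_0_compat; [apply: Rlt_le; apply: exp_pos|lra].
Qed.

End Tilt.

(** * Discrete Fourier inversion *)

Lemma expi_2PI_INR k : expi (2 * PI * INR k) = RtoC 1.
Proof.
have := cos_period 0 k; have := sin_period 0 k.
rewrite cos_0 sin_0 !Rplus_0_l /expi => h1 h2.
have -> : 2 * PI * INR k = 2 * INR k * PI by ring.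
by rewrite h1 h2.
Qed.

Lemma expi_opp_2PI_INR k : expi (- (2 * PI * INR k)) = RtoC 1.
Proof.
have := expi_2PI_INR k; rewrite /expi cos_neg sin_neg => -[-> ->].
by rewrite Ropp_0.
Qed.

Lemma expi_mulr_INR x k : expi (INR k * x) = (expi x ^ k)%C.
Proof.
elim: k => [|k IH]; first by rewrite Rmult_0_l expi0.
have -> : INR k.+1 * x = x + INR k * x by rewrite S_INR; ring.
by rewrite expi_add IH.
Qed.

Lemma csum_geom (z : C) M : ((z - 1) * (\csum_(k < M) (z ^ k)%C) = z ^ M - 1)%C.
Proof.
elim: M => [|M IH]; first by rewrite big_ord0 /=; ring.
by rewrite big_ord_recr /= Cmult_plus_distr_l IH; ring.
Qed.

Lemma expi_neq1 x : 0 < Rabs x < 2 * PI -> expi x <> RtoC 1.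
Proof.
move=> [x0 x1] [hc _].
have hs : 0 < sin (Rabs x / 2) by apply: sin_gt_0; lra.
have hc' : cos (Rabs x) = 1 by rewrite /Rabs; case: Rcase_abs => _; rewrite ?cos_neg.
have E : Rabs x = 2 * (Rabs x / 2) by field.
by move: hc'; rewrite {1}E cos_2a_sin; nra.
Qed.

Lemma RtoC_INR_sum M : RtoC (INR M) = (\csum_(k < M) RtoC 1)%C.
Proof.
elim: M => [|M IH]; first by rewrite big_ord0.
by rewrite big_ord_recr -IH S_INR RtoC_plus.
Qed.

(** The representative of [2 PI k / M] in [[- PI, PI]], so that its absolute value is the distance
    to 0 on the circle. *)
Definition freq (M k : nat) : R :=
  if (2 * k <= M)%N then 2 * PI * (INR k / INR M) else 2 * PI * (INR k / INR M - 1).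

Lemma expi_freq M k a b : (0 < M)%N ->
  expi (freq M k * (INR a - INR b)) = expi (INR k * (2 * PI * (INR a - INR b) / INR M)).
Proof.
move=> /INR_ltn /= M0; rewrite /freq; case: ifP => _.
  by congr expi; field; lra.
have -> : 2 * PI * (INR k / INR M - 1) * (INR a - INR b) =
  INR k * (2 * PI * (INR a - INR b) / INR M) + (- (2 * PI * INR a) + 2 * PI * INR b).
  by field; lra.
by rewrite !expi_add expi_opp_2PI_INR expi_2PI_INR; ring.
Qed.

Lemma csum_freq M a b : (0 < M)%N -> (a < M)%N -> (b < M)%N ->
  ((\csum_(k < M) expi (freq M k * (INR a - INR b))%re) = RtoC (INR M * b2R (a == b)))%C.
Proof.
move=> M0 aM bM; have hM := INR_ltn M0; rewrite /= in hM.
have P0 := PI_RGT_0.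
under eq_bigr => k _ do rewrite expi_freq // expi_mulr_INR.
case: eqP => [->|ab].
  rewrite Rmult_1_r RtoC_INR_sum; apply: eq_bigr => k _.
  have -> : 2 * PI * (INR b - INR b) / INR M = 0 by field; lra.
  by rewrite expi0 Cpow_1_l.
set x := 2 * PI * (INR a - INR b) / INR M; rewrite Rmult_0_r.
have hx : 0 < Rabs x < 2 * PI.
  have h1 : INR a - INR b <> 0 by move=> h; apply: ab; apply: INR_eq; lra.
  have h2 : Rabs (INR a - INR b) < INR M.
    have := INR_ltn aM; have := INR_ltn bM; have := pos_INR a; have := pos_INR b => ? ? ? ?.
    by apply: Rabs_def1; lra.
  have h3 := Rabs_pos_lt _ h1.
  have -> : Rabs x = 2 * PI * (Rabs (INR a - INR b) / INR M).
    have -> : x = (2 * PI / INR M) * (INR a - INR b) by rewrite /x; field; lra.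
    rewrite Rabs_mult (Rabs_pos_eq (2 * PI / INR M)); first by field; lra.
    by apply: Rlt_le; apply: Rdiv_lt_0_compat; lra.
  have h4 : 0 < Rabs (INR a - INR b) / INR M < 1.
    by split; [apply: Rdiv_lt_0_compat|apply/Rlt_div_l; lra].
  nra.
have h1 := expi_neq1 hx.
have h2 : (expi x - 1 <> 0)%C.
  move=> h; apply: h1; have -> : expi x = (expi x - 1 + 1)%C by ring.
  by rewrite h; ring.
have h3 : (expi x ^ M = 1)%C.
  rewrite -expi_mulr_INR /x.
  have -> : INR M * (2 * PI * (INR a - INR b) / INR M) = 2 * PI * INR a + - (2 * PI * INR b).
    by field; lra.
  by rewrite expi_add expi_2PI_INR expi_opp_2PI_INR; ring.
have := csum_geom (expi x) M; rewrite h3.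
have -> : (RtoC 1 - RtoC 1 = 0)%C by ring.
set S := \big[_/_]_(_ < _) _ => hS.
have -> : S = (/ (expi x - 1) * ((expi x - 1) * S))%C by field.
by rewrite hS Cmult_0_r.
Qed.

Section Fourier.
Variables (I : finType) (d n M : nat) (W : I -> nat -> R) (h : I -> nat).
Implicit Types f : I -> nat -> R.

Definition wsum (a : {ffun I -> 'I_d}) : nat := (\sum_i h i * a i)%N.

(** Under the product law [W], the expectation of the product of the [f i (a i)] restricted to the
    event that the sum is [n]. *)
Definition massw f : R :=
  \rsum_(a : {ffun I -> 'I_d}) (b2R (wsum a == n) * \rprod_i (W i (a i) * f i (a i))).

Lemma big_distr_ffunC (F : I -> 'I_d -> C) :
  (\cprod_i (\csum_(j < d) F i j))%C =
  (\big[Cplus/RtoC 0]_(a : {ffun I -> 'I_d}) \cprod_i F i (a i))%C.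
Proof. exact: (bigA_distr_bigA (times := Cmult)). Qed.

Lemma big_distr_ffunR (F : I -> 'I_d -> R) :
  \rprod_i (\rsum_(j < d) F i j) = \rsum_(a : {ffun I -> 'I_d}) \rprod_i F i (a i).
Proof. exact: (bigA_distr_bigA (times := Rmult)). Qed.

Lemma INR_sum (J : Type) (r : seq J) (P : pred J) (F : J -> nat) :
  INR (\sum_(i <- r | P i) F i)%N = \rsum_(i <- r | P i) INR (F i).
Proof. by elim/big_rec2: _ => // i x y _ <-; rewrite plus_INR. Qed.

Lemma expi_sum (J : Type) (r : seq J) (F : J -> R) :
  expi (\rsum_(i <- r) F i) = (\big[Cmult/RtoC 1]_(i <- r) expi (F i))%C.
Proof. by elim/big_rec2: _ => [|i x y _ <-]; rewrite ?expi0 ?expi_add. Qed.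

Lemma RtoC_rprod (J : Type) (r : seq J) (F : J -> R) :
  RtoC (\rprod_(i <- r | true) F i) = (\big[Cmult/RtoC 1]_(i <- r) RtoC (F i))%C.
Proof. by elim/big_rec2: _ => [|i x y _ <-] //; rewrite RtoC_mult. Qed.

(** No phase [exp (- i theta n)] is left over, as the means subtracted in the factors add up to [n].
    Sums below [M] are equal as soon as they agree modulo [M]. *)
Lemma fourier_massw f : (0 < M)%N -> (n < M)%N -> (forall a, wsum a < M)%N ->
  \rsum_i (INR (h i) * muw d (W i)) = INR n ->
  RtoC (INR M * massw f) =
  (\csum_(k < M) \cprod_i charw d (W i) (f i) (freq M k * INR (h i))%re)%C.
Proof.
move=> M0 nM aM Hmu.
have E (k : 'I_M) : (\cprod_i charw d (W i) (f i) (freq M k * INR (h i))%re)%C =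
  (\big[Cplus/RtoC 0]_(a : {ffun I -> 'I_d})
     (RtoC (\rprod_i (W i (a i) * f i (a i))) * expi (freq M k * (INR (wsum a) - INR n))%re))%C.
  rewrite big_distr_ffunC; apply: eq_bigr => a _; rewrite big_split /= RtoC_rprod.
  congr (_ * _)%C; rewrite -expi_sum -Hmu INR_sum -rsum_sub -rsum_scal; congr expi.
  by apply: eq_bigr => i _; rewrite INR_mul; ring.
under eq_bigr => k _ do rewrite E.
rewrite exchange_big /= /massw -rsum_scal RtoC_rsum; apply: eq_bigr => a _.
rewrite -(big_distrr (times := Cmult)) /= (csum_freq (b := n) M0 (aM a) nM).
by rewrite -RtoC_mult; congr RtoC; ring.
Qed.

End Fourier.

(** * Minor arcs *)

Lemma cos_2PI_IZR x z : cos (2 * PI * (x + IZR z)) = cos (2 * PI * x).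
Proof.
have H y k : cos (2 * PI * (y + INR k)) = cos (2 * PI * y).
  by rewrite -(cos_period (2 * PI * y) k); congr cos; ring.
case: (Z_le_gt_dec 0 z) => hz.
  by rewrite -(Z2Nat.id z hz) -INR_IZR_INZ H.
rewrite -(H (x + IZR z) (Z.to_nat (- z))) INR_IZR_INZ Z2Nat.id; last lia.
by rewrite opp_IZR; congr cos; ring.
Qed.

Lemma near_integer_of_cos delta y : 0 < delta < / 2 ->
  1 - cos (2 * PI * y) < 1 - cos (2 * PI * delta) -> exists z : Z, Rabs (y - IZR z) < delta.
Proof.
move=> [d0 d1] H; have P0 := PI_RGT_0.
have [z Hz] : exists z, - / 2 <= y - IZR z <= / 2.
  have [h1 h2] := archimed (y - / 2); exists (up (y - / 2)); lra.
exists z; apply: Rnot_le_lt => hge.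
have E : cos (2 * PI * y) = cos (2 * PI * Rabs (y - IZR z)).
  have {1}-> : y = (y - IZR z) + IZR z by ring.
  rewrite cos_2PI_IZR /Rabs; case: Rcase_abs => _; last by congr cos; ring.
  by rewrite -cos_neg; congr cos; ring.
have h2 : Rabs (y - IZR z) <= / 2 by apply: Rabs_le; lra.
have : cos (2 * PI * Rabs (y - IZR z)) <= cos (2 * PI * delta).
  by apply: cos_decr_1; nra.
lra.
Qed.

Lemma cos_2PI_gap delta : 0 < delta < / 2 -> 0 < 1 - cos (2 * PI * delta).
Proof.
move=> [d0 d1]; have P0 := PI_RGT_0.
by have := @cos_decreasing_1 0 (2 * PI * delta); rewrite cos_0; nra.
Qed.

Lemma IZR_abs_lt1 z : Rabs (IZR z) < 1 -> z = 0%Z.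
Proof.
by rewrite -abs_IZR => /lt_IZR h; lia.
Qed.

(** Only whole factors [Q] are removed. [Q] may be composite, so [z'] can still share a divisor with
    it; it is the failure of [Q | z'] that is contradicted later. *)
Lemma Z_factor_out (Q : Z) b z : ~ (Z.pow Q (Z.of_nat b) | z)%Z ->
  exists v z', (v < b)%N /\ z = (Z.pow Q (Z.of_nat v) * z')%Z /\ ~ (Q | z')%Z.
Proof.
elim: b => [|b IH] H; first by case: H; exists z; rewrite [Z.of_nat 0]/= Z.pow_0_r Z.mul_1_r.
case: (Zdivide_dec (Z.pow Q (Z.of_nat b)) z) => [[w Hw]|/IH [v [z' [vb Hz]]]].
  exists b, w; split=> //; split; first by rewrite Hw; ring.
  move=> [u Hu]; apply: H; exists u; rewrite Hw Hu Nat2Z.inj_succ Z.pow_succ_r; last lia.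
  ring.
by exists v, z'; split=> //; apply: ltnW; rewrite ltnS.
Qed.

Section SupBound.
Variables (P Q : nat).
Hypotheses (P1 : (1 < P)%N) (Q1 : (1 < Q)%N) (PQ : coprime P Q).
(** Small enough that [delta + P * delta] and [Q * delta + P * Q * delta] are below 1: the integers
    compared in the next proofs then coincide. The 7 also exceeds [2 PI], which matches the
    threshold [/ (7 * N)] for [theta / (2 PI)]. *)
Let delta := / (7 * INR P * INR Q).
Let c0 := 1 - cos (2 * PI * delta).

Let p2 : 2 <= INR P := INR_ge2 P1.
Let q2 : 2 <= INR Q := INR_ge2 Q1.

Lemma delta_bounds : 0 < delta /\ INR P * delta * 7 * INR Q = 1 /\ delta < / 2.
Proof.
split; first by apply: Rinv_0_lt_compat; nra.
split; first by rewrite /delta; field; nra.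
by apply: Rinv_lt_contravar; nra.
Qed.

Lemma c0_gt0 : 0 < c0.
Proof. by apply: cos_2PI_gap; have [h1 [_ h2]] := delta_bounds. Qed.

(** The approximation improves along the row. If [y] is within [delta / P^a] of [z] and [P^(a+1) y]
    is within [delta] of [z'], then the integer [P^(a+1) z - z'] is smaller than 1 in absolute
    value, hence 0, and the error gains a factor [P]. *)
Lemma bad_row x N b a :
  (forall a', (a' <= a)%N -> INR P ^ a' * INR Q ^ b <= N ->
    1 - cos (2 * PI * (INR P ^ a' * INR Q ^ b * x)) < c0) ->
  INR P ^ a * INR Q ^ b <= N ->
  exists z, Rabs (INR Q ^ b * x - IZR z) < delta / INR P ^ a.
Proof.
have [d0 [d1 d2]] := delta_bounds.
have qb : 0 < INR Q ^ b by apply: pow_lt; lra.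
elim: a => [|a IH] H ha.
  have := H 0%N isT ha; rewrite /= !Rmult_1_l => /near_integer_of_cos [//|z hz].
  by exists z; rewrite Rdiv_1_r.
have pa : 0 < INR P ^ a by apply: pow_lt; lra.
have [z hz] : exists z, Rabs (INR Q ^ b * x - IZR z) < delta / INR P ^ a.
  apply: IH => [a' h1 h2|]; first by apply: H => //; apply: leqW.
  apply: Rle_trans ha; apply: Rmult_le_compat_r; first lra.
  by rewrite /=; nra.
have [//|z' hz'] := near_integer_of_cos _ (H a.+1 (leqnn _) ha).
exists z; set y := INR Q ^ b * x in hz *.
have E : INR P ^ a.+1 * INR Q ^ b * x = INR P ^ a.+1 * y by rewrite /y; ring.
rewrite E in hz'.
have EP : INR P ^ a.+1 = IZR (Z.of_nat (P ^ a.+1)%N) by rewrite -INR_IZR_INZ INR_expn.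
have pa1 : 0 < INR P ^ a.+1 by apply: pow_lt; lra.
have h1 : INR P ^ a.+1 * Rabs (y - IZR z) < INR P * delta.
  have -> : INR P * delta = INR P ^ a.+1 * (delta / INR P ^ a) by rewrite /=; field; lra.
  exact: Rmult_lt_compat_l.
have h2 : Rabs (INR P ^ a.+1 * y - INR P ^ a.+1 * IZR z) < INR P * delta.
  by rewrite -Rmult_minus_distr_l Rabs_mult (Rabs_pos_eq (_ ^ _)); lra.
have ez : (Z.of_nat (P ^ a.+1) * z - z' = 0)%Z.
  apply: IZR_abs_lt1; rewrite minus_IZR mult_IZR -EP.
  have -> : INR P ^ a.+1 * IZR z - IZR z' = (INR P ^ a.+1 * y - IZR z') -
    (INR P ^ a.+1 * y - INR P ^ a.+1 * IZR z) by ring.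
  apply: Rle_lt_trans (Rabs_triang _ _) _; rewrite Rabs_Ropp.
  have : INR P * delta * (7 * INR Q) = 1 by lra.
  have : 0 < INR P * delta by nra.
  nra.
have ez' : IZR z' = INR P ^ a.+1 * IZR z.
  by rewrite EP -mult_IZR; congr IZR; lia.
rewrite ez' -Rmult_minus_distr_l Rabs_mult (Rabs_pos_eq (_ ^ _)) in hz'; last lra.
by apply/Rlt_div_r => //; lra.
Qed.

Lemma exists_pow_window q N : 2 <= q -> 1 <= N -> exists a, q ^ a <= N < q ^ a.+1.
Proof.
move=> hq hN.
have [K hK] : exists K, N < q ^ K.
  have [h1 _] := archimed N; exists (Z.to_nat (up N)).
  have := lt_pow2 (Z.to_nat (up N)) hq; rewrite INR_IZR_INZ Z2Nat.id; first lra.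
  by apply: le_IZR; lra.
elim: K hK => [|K IH] h; first by rewrite /= in h; lra.
case: (Rle_dec (q ^ K) N) => h'; first by exists K; lra.
by apply: IH; lra.
Qed.

(* If row [b] has no good point then [x] is within [O(1/N)] of some [z'/Q^(b'+1)]
   with [Q] not dividing [z'], which makes every point of row [b'] good. *)
Lemma good_row_or_column x N L : INR P ^ L * INR Q ^ L <= N ->
  Rabs x <= / 2 -> / (7 * N) < Rabs x ->
  (forall b, (b < L)%N -> exists a, INR P ^ a * INR Q ^ b <= N /\
    c0 <= 1 - cos (2 * PI * (INR P ^ a * INR Q ^ b * x))) \/
  (exists2 b, (b < L)%N & forall a, (a < L)%N ->
     c0 <= 1 - cos (2 * PI * (INR P ^ a * INR Q ^ b * x))).
Proof.
move=> hL hx1 hx2; have [d0 [d1 d2]] := delta_bounds.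
have pL k : (k <= L)%N -> 1 <= INR P ^ k <= INR P ^ L.
  move=> kL; split; first by apply: pow_R1_Rle; lra.
  by apply: Rle_pow; [lra|apply/leP].
have qL k : (k <= L)%N -> 1 <= INR Q ^ k <= INR Q ^ L.
  move=> kL; split; first by apply: pow_R1_Rle; lra.
  by apply: Rle_pow; [lra|apply/leP].
have N1 : 1 <= N by have := pL _ (leqnn L); have := qL _ (leqnn L); nra.
case: (Classical_Prop.classic (forall b, (b < L)%N -> exists a, INR P ^ a * INR Q ^ b <= N /\
    c0 <= 1 - cos (2 * PI * (INR P ^ a * INR Q ^ b * x)))) => [|/Classical_Pred_Type.not_all_ex_not [b]];
  first by left.
move=> Hn; have [bL Hb] := Classical_Prop.imply_to_and _ _ Hn; right.
have qb := qL _ (ltnW bL); have pl := pL _ (leqnn L).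
(* [P^a Q^b] is the last point of the row up to [N], so the accuracy [delta / P^a] is at most
   [P * delta * Q^b / N]. *)
have [a [ha1 ha2]] : exists a, INR P ^ a <= N / INR Q ^ b < INR P ^ a.+1.
  by apply: exists_pow_window => //; apply/Rle_div_r; nra.
have pa : 0 < INR P ^ a by apply: pow_lt; lra.
have ha : INR P ^ a * INR Q ^ b <= N by apply/Rle_div_r => //; lra.
have [z hz] : exists z, Rabs (INR Q ^ b * x - IZR z) < delta / INR P ^ a.
  apply: (bad_row (N := N)) => // a' _ h; apply: Rnot_le_lt => hc.
  by apply: Hb; exists a'.
have hz1 : Rabs (INR Q ^ b * x - IZR z) < INR P * delta * INR Q ^ b / N.
  apply: Rlt_le_trans hz _; apply/Rle_div_l => //.
  have -> : INR P * delta * INR Q ^ b / N * INR P ^ a =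
     delta * (INR P ^ a.+1 * INR Q ^ b / N) by rewrite /=; field; lra.
  have : 1 <= INR P ^ a.+1 * INR Q ^ b / N.
    apply/Rle_div_r; first lra.
    by move/(Rlt_div_l _ _ _ (_ : INR Q ^ b > 0)): ha2 => h; have := h ltac:(lra); lra.
  by nra.
have EQ k : INR Q ^ k = IZR (Z.pow (Z.of_nat Q) (Z.of_nat k)).
  by rewrite INR_IZR_INZ pow_IZR.
have hPd : 0 < INR P * delta by nra.
have hPd1 : INR P * delta * 7 * 2 <= 1 by nra.
(* If [Q^b] divides [z], then [x] is close to the integer [w], which is 0 as [|x| <= 1/2]; this
   contradicts the lower bound on [|x|]. Otherwise [v < b] whole factors [Q] are split off [z]. *)
case: (Zdivide_dec (Z.pow (Z.of_nat Q) (Z.of_nat b)) z) => [[w Hw]|/Z_factor_out [v [z' [vb [Hz Hz']]]]].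
  rewrite Hw mult_IZR -EQ in hz1.
  have hx : Rabs (x - IZR w) < INR P * delta / N.
    have E : INR Q ^ b * x - IZR w * INR Q ^ b = INR Q ^ b * (x - IZR w) by ring.
    rewrite E Rabs_mult (Rabs_pos_eq (_ ^ _)) in hz1; last lra.
    apply: (Rmult_lt_reg_l (INR Q ^ b)); first lra.
    by apply: Rlt_le_trans hz1 _; apply: Req_le; field; lra.
  have h1 : INR P * delta / N <= INR P * delta by apply/Rle_div_l; nra.
  have w0 : w = 0%Z.
    apply: IZR_abs_lt1; have -> : IZR w = x - (x - IZR w) by ring.
    by apply: Rle_lt_trans (Rabs_triang _ _) _; rewrite Rabs_Ropp; lra.
  rewrite w0 Rminus_0_r in hx.
  have : INR P * delta / N <= / (7 * N).
    have -> : / (7 * N) = / 7 / N by field; lra.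
    by apply: Rmult_le_compat_r; [apply: Rlt_le; apply: Rinv_0_lt_compat|]; lra.
  by lra.
(* In this row exactly one factor [Q] is missing: [Q^(b'+1) x] is close to [z']. A point
   [P^a' Q^b' x] close to an integer [w] would force [P^a' z' = w Q], and [Q | z'] by
   coprimality. *)
exists (b - v).-1; first by apply: leq_ltn_trans bL; rewrite -subnS leq_subr.
set b' := (b - v).-1 => a' ha'; apply: Rnot_lt_le => /near_integer_of_cos [//|w hw].
have Eb : b = (v + b'.+1)%N by rewrite /b' prednK ?subn_gt0 // subnKC // ltnW.
have b'L : (b' <= L)%N by rewrite /b'; apply: leq_trans (ltnW bL); rewrite -subnS leq_subr.
have qb' := qL _ b'L; have pa' := pL _ (ltnW ha').
have qv : 0 < INR Q ^ v by apply: pow_lt; lra.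
set e := INR Q ^ b' * INR Q * x - IZR z'.
have he : Rabs e < INR P * delta * (INR Q ^ b' * INR Q) / N.
  have E : INR Q ^ b * x - IZR z = INR Q ^ v * e.
    by rewrite Hz mult_IZR -EQ Eb pow_add /e /=; ring.
  rewrite E Rabs_mult (Rabs_pos_eq (_ ^ _)) in hz1; last lra.
  apply: (Rmult_lt_reg_l (INR Q ^ v)) => //; apply: Rlt_le_trans hz1 _.
  by apply: Req_le; rewrite Eb pow_add /=; field; lra.
have EP : INR P ^ a' = IZR (Z.of_nat (P ^ a')%N) by rewrite -INR_IZR_INZ INR_expn.
have ez : (Z.of_nat (P ^ a') * z' - w * Z.of_nat Q = 0)%Z.
  apply: IZR_abs_lt1; rewrite minus_IZR !mult_IZR -EP -INR_IZR_INZ.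
  have -> : INR P ^ a' * IZR z' - IZR w * INR Q =
    INR Q * (INR P ^ a' * INR Q ^ b' * x - IZR w) - INR P ^ a' * e by rewrite /e; ring.
  apply: Rle_lt_trans (Rabs_triang _ _) _.
  rewrite Rabs_Ropp !Rabs_mult (Rabs_pos_eq (INR Q)) ?(Rabs_pos_eq (_ ^ _)); try lra.
  have h1 : INR Q * Rabs (INR P ^ a' * INR Q ^ b' * x - IZR w) <= INR Q * delta.
    by apply: Rmult_le_compat_l; lra.
  have h2 : INR P ^ a' * Rabs e <= INR P ^ a' * (INR P * delta * (INR Q ^ b' * INR Q) / N).
    by apply: Rmult_le_compat_l; lra.
  have h3 : INR P ^ a' * (INR P * delta * (INR Q ^ b' * INR Q) / N) <= INR P * delta * INR Q.
    have -> : INR P ^ a' * (INR P * delta * (INR Q ^ b' * INR Q) / N) =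
      (INR P * delta * INR Q) * (INR P ^ a' * INR Q ^ b' / N) by field; lra.
    have h4 : INR P ^ a' * INR Q ^ b' / N <= 1.
      apply/Rle_div_l; first lra.
      rewrite Rmult_1_l; apply: Rle_trans hL; apply: Rmult_le_compat; lra.
    by have : 0 <= INR P * delta * INR Q by [nra]; nra.
  by nra.
apply: Hz'.
have hd : (Z.of_nat Q | Z.of_nat (P ^ a') * z')%Z by exists w; lia.
apply: Gauss hd _; apply/Zgcd_1_rel_prime.
have : gcdn Q (P ^ a') = 1%N by apply/eqP; rewrite -/(coprime _ _) coprime_sym coprimeXl.
move=> hg; have hgd := Z.gcd_divide_l (Z.of_nat Q) (Z.of_nat (P ^ a')).
have hgd' := Z.gcd_divide_r (Z.of_nat Q) (Z.of_nat (P ^ a')).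
set g := Z.gcd _ _ in hgd hgd' *; have g0 : (0 <= g)%Z by apply: Z.gcd_nonneg.
have cv (u : nat) : (g | Z.of_nat u)%Z -> (0 < u)%N -> (Z.to_nat g %| u)%N.
  move=> [y hy] u0; apply/dvdnP; exists (Z.to_nat y).
  have y0 : (0 <= y)%Z.
    by move/ltP: u0 => u0; nia.
  by rewrite -(Nat2Z.id u) hy Z2Nat.inj_mul.
have : (Z.to_nat g %| gcdn Q (P ^ a'))%N.
  by rewrite dvdn_gcd !cv // ?expn_gt0 ltnW.
by rewrite hg dvdn1 => /eqP; lia.
Qed.

End SupBound.

Lemma exp_beats_pow q g B : 0 < g -> exists L0, forall L, L0 <= L -> B * L ^ q <= exp (g * L).
Proof.
move=> g0; have q0 : 0 < INR q.+1 by apply: lt_0_INR; lia.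
set s := g / INR q.+1; have s0 : 0 < s by apply: Rdiv_lt_0_compat.
have sq0 : 0 < s ^ q.+1 by apply: pow_lt.
exists (Rmax 0 (B / s ^ q.+1)) => L hL.
have L0 : 0 <= L by apply: Rle_trans hL; apply: Rmax_l.
have hB : B <= L * s ^ q.+1.
  by apply/Rle_div_l => //; apply: Rle_trans hL; apply: Rmax_r.
have -> : exp (g * L) = exp (s * L) ^ q.+1.
  rewrite -Rpower_pow; last exact: exp_pos.
  by rewrite /Rpower ln_exp; congr exp; rewrite /s; field; lra.
apply: Rle_trans (_ : (s * L) ^ q.+1 <= _); last first.
  apply: pow_incr; split; first by apply: Rmult_le_pos; lra.
  by have := exp_ineq1_le (s * L); lra.
rewrite Rpow_mult_distr -[L ^ q.+1]/(L * L ^ q).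
have : 0 <= L ^ q by apply: pow_le.
nra.
Qed.

(** * Averages of exponentials over the grid of frequencies *)

Lemma rsum_ord_widen m n (F : nat -> R) : (m <= n)%N -> (forall i, 0 <= F i) ->
  \rsum_(i < m) F i <= \rsum_(i < n) F i.
Proof. by move=> mn F0; rewrite (big_ord_widen _ F mn); apply: rsum_sub_le. Qed.

(** Groups the indices below [P * m] into the fibres of reduction modulo [m]. *)
Lemma rsum_ord_mul P m (F : nat -> R) :
  \rsum_(k < P * m) F k = \rsum_(k < m) \rsum_(j < P) F (k + j * m)%N.
Proof.
elim: P F => [|P IH] F.
  by rewrite mul0n big_ord0 big1 // => k _; rewrite big_ord0.
rewrite mulSn big_split_ord /= (IH (fun k => F (m + k)%N)) -rsum_add.
apply: eq_bigr => k _; rewrite big_ord_recl -[nat_of_ord ord0]/0%N mul0n addn0; congr (_ + _).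
by apply: eq_bigr => j _; rewrite lift0 mulSn; congr F; rewrite addnCA.
Qed.

(** Jensen's inequality for [exp], from its tangent at the mean of the [n * y b]. *)
Lemma exp_jensen n (y : nat -> R) : (0 < n)%N ->
  exp (\rsum_(b < n) y b) <= / INR n * \rsum_(b < n) exp (INR n * y b).
Proof.
move=> n0; have hn : 0 < INR n by apply: (INR_ltn n0).
set s := \rsum_(b < n) y b.
apply: (Rmult_le_reg_l (INR n)) => //.
rewrite -Rmult_assoc Rinv_r ?Rmult_1_l; last lra.
apply: Rle_trans (_ : \rsum_(b < n) (exp s * (1 + (INR n * y b - s))) <= _); last first.
  apply: rsum_le => b _; have e0 := exp_pos s.
  have -> : exp (INR n * y b) = exp s * exp (INR n * y b - s).
    by rewrite -exp_plus; congr exp; ring.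
  by apply: Rmult_le_compat_l; [lra|exact: exp_ineq1_le].
rewrite rsum_scal rsum_add rsum_sub rsum_scal !rsum_ord_const -/s.
by apply: Req_le; ring.
Qed.

Section Transfer.
Variables (P : nat) (C0 : R).
Hypotheses (P1 : (1 < P)%N) (C00 : 0 <= C0).
Let eta := 1 - cos (2 * PI * / (2 * INR P)).

Lemma cos_2PI_INR x k : cos (2 * PI * (x + INR k)) = cos (2 * PI * x).
Proof. by rewrite INR_IZR_INZ cos_2PI_IZR. Qed.

(** The [P] points are spaced by [1 / P] modulo 1, so at most one is within [1 / (2 P)] of an
    integer; each of the others has [1 - cos >= eta]. *)
Lemma sum_fiber_le x :
  \rsum_(j < P) exp (- (C0 * (1 - cos (2 * PI * (x + INR j / INR P))))) <=
  1 + INR P * exp (- (C0 * eta)).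
Proof.
have p2 := INR_ge2 P1.
have hd : 0 < / (2 * INR P) < / 2.
  by split; [apply: Rinv_0_lt_compat|apply: Rinv_lt_contravar]; lra.
pose bad (j : 'I_P) := ~~ Rleb eta (1 - cos (2 * PI * (x + INR j / INR P))).
apply: Rle_trans (_ : \rsum_(j < P) (b2R (bad j) + exp (- (C0 * eta))) <= _).
  apply: rsum_le => j _; rewrite /bad; case: RlebP => h /=.
    rewrite Rplus_0_l; apply: exp_le; nra.
  have h1 := COS_bound (2 * PI * (x + INR j / INR P)).
  have h2 := exp_pos (- (C0 * eta)).
  suff : exp (- (C0 * (1 - cos (2 * PI * (x + INR j / INR P))))) <= 1 by lra.
  by apply: exp_le1; nra.
rewrite rsum_add rsum_ord_const (Rmult_comm (exp _)); apply: Rplus_le_compat_r.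
have uniq_bad (i j : 'I_P) : bad i -> bad j -> i = j.
  rewrite /bad => /RlebP /Rnot_le_lt hi /RlebP /Rnot_le_lt hj.
  have [z hz] := near_integer_of_cos hd hi; have [w hw] := near_integer_of_cos hd hj.
  have E : (Z.of_nat i - Z.of_nat j - (z - w) * Z.of_nat P = 0)%Z.
    apply: IZR_abs_lt1; rewrite !minus_IZR mult_IZR minus_IZR -!INR_IZR_INZ.
    have -> : INR i - INR j - (IZR z - IZR w) * INR P =
      INR P * ((x + INR i / INR P - IZR z) - (x + INR j / INR P - IZR w)) by field; lra.
    rewrite Rabs_mult (Rabs_pos_eq (INR P)); last lra.
    have h : Rabs ((x + INR i / INR P - IZR z) - (x + INR j / INR P - IZR w)) < / INR P.
      apply: Rle_lt_trans (Rabs_triang _ _) _; rewrite Rabs_Ropp.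
      have -> : / INR P = / (2 * INR P) + / (2 * INR P) by field; lra.
      lra.
    apply: Rlt_le_trans (_ : INR P * / INR P <= _); last by apply: Req_le; field; lra.
    by apply: Rmult_lt_compat_l; lra.
  apply: val_inj => /=; move: (ltn_ord i) (ltn_ord j).
  have : (z - w = 0 \/ z - w >= 1 \/ z - w <= -1)%Z by lia.
  by case=> [h|[h|h]] /ltP h1 /ltP h2; move: E; rewrite ?h; nia.
case: (pickP bad) => [j hj|h0]; last by rewrite big1 ?Rle_0_1 //; [lra|move=> j _; rewrite h0].
rewrite (bigD1 j) //= hj /= big1 => [|i ij]; first lra.
by case hi: (bad i) => //; rewrite (uniq_bad i j) ?eqxx in ij.
Qed.

(** Multiplication by [P] maps the grid of step [P^(-J)] onto the grid of step [P^(1-J)] with fibres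
    of [P] points. The term [a = 0] sees the point of the fibre, the later terms only its image, so
    each of the [A] scales contributes [1 + P exp (- C0 eta)] in place of the trivial factor [P]. *)
Lemma sum_transfer_le A J : (A <= J)%N ->
  \rsum_(k < P ^ J) exp (- (C0 * \rsum_(a < A) (1 - cos (2 * PI * (INR P ^ a * (INR k / INR (P ^ J)%N)))))) <=
  (1 + INR P * exp (- (C0 * eta))) ^ A * INR P ^ (J - A)%N.
Proof.
have p2 := INR_ge2 P1.
elim: A J => [|A IH] [|J] //= AJ.
- rewrite big_ord_recl big_ord0 big_ord0 Rmult_0_r Ropp_0 exp_0; lra.
- under eq_bigr => k _ do rewrite big_ord0 Rmult_0_r Ropp_0 exp_0.
  by rewrite rsum_ord_const INR_expn /=; lra.
have pJ : 0 < INR P ^ J by apply: pow_lt; lra.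
rewrite expnS (rsum_ord_mul P (P ^ J) (fun k => exp (- (C0 * \rsum_(a < A.+1)
  (1 - cos (2 * PI * (INR P ^ a * (INR k / INR (P * P ^ J)%N)))))))).
apply: Rle_trans (_ : \rsum_(k < P ^ J) ((1 + INR P * exp (- (C0 * eta))) *
  exp (- (C0 * \rsum_(a < A) (1 - cos (2 * PI * (INR P ^ a * (INR k / INR (P ^ J)%N))))))) <= _).
  apply: rsum_le => k _.
  set T := \rsum_(a < A) _.
  apply: Rle_trans (_ : (\rsum_(j < P) exp (- (C0 *
    (1 - cos (2 * PI * (INR k / INR (P * P ^ J)%N + INR j / INR P)))))) * exp (- (C0 * T)) <= _).
    rewrite -rsum_scalr; apply: Req_le; apply: eq_bigr => j _; rewrite -exp_plus; congr exp.
    rewrite big_ord_recl -[nat_of_ord ord0]/0%N [INR P ^ 0]/= Rmult_1_l.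
    have -> : INR (k + j * P ^ J)%N / INR (P * P ^ J)%N = INR k / INR (P * P ^ J)%N + INR j / INR P.
      by rewrite !INR_add !INR_mul INR_expn; field; lra.
    rewrite (_ : \big[_/_]_(_ < A) _ = T); first ring.
    apply: eq_bigr => a _; rewrite lift0; congr (1 - _).
    rewrite -[RHS](cos_2PI_INR _ (j * P ^ a)%N); congr cos.
    by rewrite !INR_mul !INR_expn /=; field; lra.
  apply: Rmult_le_compat_r; first by apply: Rlt_le; apply: exp_pos.
  exact: sum_fiber_le.
rewrite rsum_scal subSS Rmult_assoc; apply: Rmult_le_compat_l; last exact: IH.
by have := exp_pos (- (C0 * eta)); nra.
Qed.

End Transfer.

(** A factor prime to [M] permutes the residues modulo [M]. *)
Lemma sum_mul_unit_periodic M u (f : R -> R) : (0 < M)%N -> coprime M u ->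
  (forall x k, f (x + INR k) = f x) ->
  \rsum_(k < M) f (INR u * (INR k / INR M)) = \rsum_(k < M) f (INR k / INR M).
Proof.
move=> M0 cMu fP; have hM := INR_ltn M0; rewrite [INR 0]/= in hM.
pose s (k : 'I_M) : 'I_M := Ordinal (ltn_pmod (u * k) M0).
have s_inj : injective s.
  move=> i j /(congr1 val) /= /eqP; wlog ij : i j / (i <= j)%N => [Wl h|].
    case/orP: (leq_total i j) => ij; first exact: Wl.
    by apply/esym; apply: Wl => //; rewrite eq_sym.
  rewrite eq_sym eqn_mod_dvd ?leq_mul // -mulnBr Gauss_dvdr // => hd.
  apply: val_inj => /=; apply/eqP; rewrite eqn_leq ij /= -subn_eq0.
  case: (posnP (j - i)%N) => [//|h]; have := dvdn_leq h hd.
  by rewrite leqNgt (leq_ltn_trans (leq_subr _ _)).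
rewrite [RHS](reindex_inj s_inj) /=; apply: eq_bigr => k _.
rewrite -[RHS](fP _ ((u * k) %/ M)%N) /=; congr f.
have E : INR (u * k) = INR ((u * k) %/ M * M + (u * k) %% M)%N by rewrite -divn_eq.
rewrite INR_add !INR_mul in E.
have -> : INR u * (INR k / INR M) = (INR u * INR k) / INR M by field; lra.
by rewrite E; field; lra.
Qed.

(** * Pointwise and averaged bounds for the energy *)

Definition energy (p : nat -> nat) (K : nat) (N th : R) : R :=
  \rsum_(h < K | inS 2 p h) (b2R (Rleb (INR h) N) * (1 - cos (th * INR h))).

Lemma energy_double p K N th : coprime_bases 2 p -> N < INR K ->
  energy p K N th = \rsum_(b < K) \rsum_(a < K)
    (b2R (Rleb (INR (p 0%N) ^ a * INR (p 1%N) ^ b) N) *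
     (1 - cos (th * (INR (p 0%N) ^ a * INR (p 1%N) ^ b)))).
Proof.
move=> Hp NK; have [Hp1 _] := Hp; have Hp' := coprime_bases_pred Hp.
pose f h := b2R (Rleb (INR h) N) * (1 - cos (th * INR h)).
have f0 h : (K <= h)%N -> f h = 0.
  by move=> /INR_leq h1; rewrite /f; case: RlebP => h2 /=; lra.
rewrite /energy (sum_inS_rec (f := f)) //; apply: eq_bigr => b _.
rewrite (sum_inS_rec (f := fun h => f (p 1%N ^ b * h)%N)) //; last first.
  move=> h Kh; apply: f0; apply: leq_trans Kh _.
  by rewrite leq_pmull // expn_gt0 ltnW // Hp1.
apply: eq_bigr => a _.
case: (leqP K 1) => K1.
  have E : \rsum_(h < K | inS 0 p h) f (p 1%N ^ b * (p 0%N ^ a * h))%N = 0.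
    apply: big1 => h; rewrite inS0 => /eqP h1; have := ltn_ord h.
    by rewrite h1 ltnNge K1.
  rewrite E; case: RlebP => h; last by rewrite /=; ring.
  have h1 : 1 <= INR (p 0%N) ^ a by apply: pow_R1_Rle; have := INR_ge2 (Hp1 0%N isT); lra.
  have h2 : 1 <= INR (p 1%N) ^ b by apply: pow_R1_Rle; have := INR_ge2 (Hp1 1%N isT); lra.
  have h3 := INR_leq K1; rewrite [INR 1]/= in h3.
  have : 1 <= INR (p 0%N) ^ a * INR (p 1%N) ^ b by nra.
  lra.
rewrite (big_pred1 (Ordinal K1)) /=; last by move=> h; rewrite inS0.
by rewrite /f muln1 INR_mul !INR_expn (Rmult_comm (INR (p 1%N) ^ b)).
Qed.

Lemma freq_cos M k h : cos (freq M k * INR h) = cos (2 * PI * (INR h * (INR k / INR M))).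
Proof.
rewrite /freq; case: ifP => _; first by congr cos; ring.
have -> : INR h * (INR k / INR M) = INR h * (INR k / INR M - 1) + INR h by ring.
by rewrite cos_2PI_INR; congr cos; ring.
Qed.

Lemma freq_half M k : (k < M)%N -> Rabs (freq M k / (2 * PI)) <= / 2.
Proof.
move=> kM; have P0 := PI_RGT_0.
have M0 : 0 < INR M by apply: (INR_ltn (leq_ltn_trans (leq0n _) kM)).
have k0 := pos_INR k; have h1 := INR_ltn kM.
have h2 : INR k / INR M <= 1 by apply/Rle_div_l; lra.
have h3 : 0 <= INR k / INR M by apply: Rdiv_le_0_compat.
rewrite /freq; case: ifP => h.
  have -> : 2 * PI * (INR k / INR M) / (2 * PI) = INR k / INR M by field; lra.
  apply: Rabs_le; split; first lra.
  apply/Rle_div_l; first lra.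
  by move/INR_leq: h; rewrite INR_mul [INR 2]/=; lra.
have -> : 2 * PI * (INR k / INR M - 1) / (2 * PI) = INR k / INR M - 1 by field; lra.
apply: Rabs_le; split; last lra.
suff : / 2 <= INR k / INR M by lra.
apply/Rle_div_r; first lra.
move/negbT: h; rewrite -ltnNge => /INR_ltn; rewrite INR_mul [INR 2]/=; lra.
Qed.

Section EnergyBounds.
Variables (p : nat -> nat).
Hypothesis Hp : coprime_bases 2 p.
Let P := p 0%N. Let Q := p 1%N.
Let c0 := 1 - cos (2 * PI * / (7 * INR P * INR Q)).

Let P1 : (1 < P)%N. Proof. by case: Hp => H _; apply: H. Qed.
Let Q1 : (1 < Q)%N. Proof. by case: Hp => H _; apply: H. Qed.
Let cPQ : coprime P Q. Proof. by case: Hp => _ H; apply: H. Qed.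

Lemma pow_lt_nat a K N : 1 <= N -> N < INR K -> INR P ^ a <= N -> (a < K)%N.
Proof.
move=> _ NK h; rewrite ltnNge; apply/negP => Ka.
have p2 := INR_ge2 P1; have := lt_pow2 K p2.
have : INR P ^ K <= INR P ^ a by apply: Rle_pow; [lra|apply/leP].
lra.
Qed.

(** Either each of the first [L] rows holds a point worth [c0], or a single row holds [L] of them.
    Here [L] can be of order [ln N]. *)
Lemma energy_ge K N M k L : N < INR K -> (k < M)%N -> / N < Rabs (freq M k) ->
  INR P ^ L * INR Q ^ L <= N -> c0 * INR L <= energy p K N (freq M k).
Proof.
move=> NK kM hf hL.
have P0 := PI_RGT_0; have PI4 := PI_4; have p2 := INR_ge2 P1; have q2 := INR_ge2 Q1.
have c00 : 0 < c0 by apply: c0_gt0.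
have N1 : 1 <= N.
  have h1 : 1 <= INR P ^ L by apply: pow_R1_Rle; lra.
  have h2 : 1 <= INR Q ^ L by apply: pow_R1_Rle; lra.
  by nra.
set x := freq M k / (2 * PI).
have Ex y : freq M k * y = 2 * PI * (y * x) by rewrite /x; field; lra.
have hx : Rabs x <= / 2 by apply: freq_half.
(* Gives [2 PI < 7], the 7 in the threshold of [good_row_or_column]. *)
have PI3 : PI < 3.5.
  by have := PI_ineq 1; rewrite /sum_f_R0 /tg_alt /PI_tg /=; lra.
have hx' : / (7 * N) < Rabs x.
  have -> : Rabs x = Rabs (freq M k) / (2 * PI).
    by rewrite /x Rabs_div ?(Rabs_pos_eq (2 * PI)); lra.
  apply/Rlt_div_r; first lra.
  apply: Rlt_trans hf; rewrite Rinv_mult.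
  by have : 0 < / N by [apply: Rinv_0_lt_compat; lra]; nra.
rewrite energy_double // -/P -/Q.
pose F b a := b2R (Rleb (INR P ^ a * INR Q ^ b) N) *
     (1 - cos (freq M k * (INR P ^ a * INR Q ^ b))).
have F0 b a : 0 <= F b a.
  by apply: Rmult_le_pos; [exact: b2R_ge0|have := COS_bound (freq M k * (INR P ^ a * INR Q ^ b)); lra].
have G0 b : 0 <= \rsum_(a < K) F b a by apply: rsum_ge0.
have LK : (L <= K)%N.
  apply: ltnW; apply: (pow_lt_nat N1 NK).
  by have : 1 <= INR Q ^ L by [apply: pow_R1_Rle; lra]; have := pow_le (INR P) L; nra.
apply: Rle_trans (_ : \rsum_(b < K) \rsum_(a < K) F b a <= _); last exact: Rle_refl.
case: (good_row_or_column P1 Q1 cPQ hL hx hx') => [H|[b bL H]].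
  apply: Rle_trans (rsum_ord_widen (F := fun b => \rsum_(a < K) F b a) LK G0).
  rewrite -rsum_ord_const; apply: rsum_le => b _.
  have [a [h1 h2]] := H b (ltn_ord b).
  have aK : (a < K)%N.
    apply: (pow_lt_nat N1 NK).
    by have : 1 <= INR Q ^ b by [apply: pow_R1_Rle; lra]; have := pow_le (INR P) a; nra.
  apply: Rle_trans (@rsum_term_le _ predT (fun a : 'I_K => F b a) (Ordinal aK) isT _) => //.
  rewrite -/c0 in h2; rewrite /F Ex; case: RlebP => [_|[]] //=; by rewrite Rmult_1_l.
have bK : (b < K)%N by apply: leq_trans LK.
apply: Rle_trans (@rsum_term_le _ predT (fun b : 'I_K => \rsum_(a < K) F b a) (Ordinal bK) isT _) => //=.
apply: Rle_trans (rsum_ord_widen LK (F0 b)).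
rewrite -rsum_ord_const; apply: rsum_le => a _.
have h := H a (ltn_ord a); rewrite -/c0 in h.
rewrite /F Ex; case: RlebP => /= h1; first by rewrite Rmult_1_l.
case: h1; apply: Rle_trans hL; apply: Rmult_le_compat; try (apply: pow_le; lra).
  by apply: Rle_pow; [lra|apply/leP; apply: ltnW].
by apply: Rle_pow; [lra|apply/leP; apply: ltnW].
Qed.

(** Jensen's inequality trades the product over [R0] rows for the average of their [R0]-th powers.
    All rows have the same sum over the grid, because [Q^b] is prime to its size, and the transfer
    bound then applies to one row with [c * R0] in place of [c]. A growing [R0] brings the factor of
    each scale close to 1. *)
Lemma sum_exp_energy_le c K N J R0 A : 0 < c -> N < INR K -> (0 < R0)%N -> (A <= J)%N ->
  INR P ^ A * INR Q ^ R0 <= N ->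
  \rsum_(k < P ^ J) exp (- (c * energy p K N (freq (P ^ J) k))) <=
  (1 + INR P * exp (- (c * INR R0 * (1 - cos (2 * PI * / (2 * INR P)))))) ^ A * INR P ^ (J - A)%N.
Proof.
move=> cpos NK R00 AJ hN.
have p2 := INR_ge2 P1; have q2 := INR_ge2 Q1.
have pa1 a : 1 <= INR P ^ a by apply: pow_R1_Rle; lra.
have qb1 b : 1 <= INR Q ^ b by apply: pow_R1_Rle; lra.
have N1 : 1 <= N by have := pa1 A; have := qb1 R0; nra.
have AK : (A <= K)%N.
  apply: ltnW; apply: (pow_lt_nat N1 NK); have := pa1 A; have := qb1 R0; nra.
have RK : (R0 <= K)%N.
  rewrite leqNgt; apply/negP => KR; have := lt_pow2 K q2.
  have : INR Q ^ K <= INR Q ^ R0 by apply: Rle_pow; [lra|apply/leP; apply: ltnW].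
  by have := pa1 A; have := qb1 R0; nra.
set M := (P ^ J)%N.
have M0 : (0 < M)%N by rewrite expn_gt0 ltnW.
pose G y := \rsum_(a < A) (1 - cos (2 * PI * (INR P ^ a * y))).
have HE k : \rsum_(b < R0) G (INR Q ^ b * (INR k / INR M)) <= energy p K N (freq M k).
  rewrite energy_double // -/P -/Q.
  pose F b a := b2R (Rleb (INR P ^ a * INR Q ^ b) N) *
     (1 - cos (freq M k * (INR P ^ a * INR Q ^ b))).
  have F0 b a : 0 <= F b a.
    by apply: Rmult_le_pos; [exact: b2R_ge0|have := COS_bound (freq M k * (INR P ^ a * INR Q ^ b)); lra].
  have G0 b : 0 <= \rsum_(a < K) F b a by apply: rsum_ge0.
  apply: Rle_trans (rsum_ord_widen (F := fun b => \rsum_(a < K) F b a) RK G0).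
  apply: rsum_le => b _; apply: Rle_trans (rsum_ord_widen AK (F0 b)).
  apply: Req_le; apply: eq_bigr => a _; rewrite /F.
  case: RlebP => [_|[]] /=.
    rewrite Rmult_1_l; congr (1 - _).
    have -> : INR P ^ a * INR Q ^ b = INR (P ^ a * Q ^ b)%N by rewrite INR_mul !INR_expn.
    by rewrite freq_cos INR_mul !INR_expn; congr cos; ring.
  apply: Rle_trans hN; apply: Rmult_le_compat; try (apply: pow_le; lra).
    by apply: Rle_pow; [lra|apply/leP; apply: ltnW].
  by apply: Rle_pow; [lra|apply/leP; apply: ltnW].
apply: Rle_trans (_ : \rsum_(k < M) (/ INR R0 * \rsum_(b < R0)
   exp (- (c * INR R0 * G (INR Q ^ b * (INR k / INR M))))) <= _).
  apply: rsum_le => k _.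
  have -> : \rsum_(b < R0) exp (- (c * INR R0 * G (INR Q ^ b * (INR k / INR M)))) =
    \rsum_(b < R0) exp (INR R0 * (- c * G (INR Q ^ b * (INR k / INR M)))).
    by apply: eq_bigr => b _; congr exp; ring.
  apply: Rle_trans (exp_jensen (fun b => - c * G (INR Q ^ b * (INR k / INR M))) R00).
  rewrite rsum_scal; apply: exp_le.
  rewrite Ropp_mult_distr_l_reverse; apply: Ropp_le_contravar.
  by apply: Rmult_le_compat_l (HE k); lra.
have Gper y k : G (y + INR k) = G y.
  apply: eq_bigr => a _; congr (1 - _); rewrite -[RHS](cos_2PI_INR _ (P ^ a * k)%N).
  by congr cos; rewrite INR_mul INR_expn; ring.
rewrite rsum_scal exchange_big /=.
have hR : 0 < INR R0 by apply: (INR_ltn R00).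
have E b : \rsum_(k < M) exp (- (c * INR R0 * G (INR Q ^ b * (INR k / INR M)))) =
   \rsum_(k < M) exp (- (c * INR R0 * G (INR k / INR M))).
  rewrite -INR_expn (sum_mul_unit_periodic (M := M) (u := (Q ^ b)%N)
     (f := fun y => exp (- (c * INR R0 * G y)))) //.
    by apply: coprimeXl; apply: coprimeXr.
  by move=> x k; rewrite Gper.
under eq_bigr => b _ do rewrite E.
rewrite rsum_ord_const Rmult_comm Rmult_assoc Rinv_r ?Rmult_1_r; last lra.
by apply: (sum_transfer_le P1 _ AJ); nra.
Qed.

End EnergyBounds.

Lemma nat_ceil x : 0 <= x -> exists k : nat, x <= INR k <= x + 1.
Proof.
move=> x0; have [h1 h2] := archimed x; exists (Z.to_nat (up x)).
rewrite INR_IZR_INZ Z2Nat.id; first lra.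
by apply: le_IZR; lra.
Qed.

Lemma pow_exp_ln q k : 0 < q -> q ^ k = exp (INR k * ln q).
Proof. by move=> q0; rewrite -Rpower_pow. Qed.

(** Up to constants, the pointwise half gives [N^(- g1)] and the averaged half [N^(- 1 + g1 / 4)];
    the remaining margin [g1 / 4] over [g = g1 / 2] absorbs the constants. *)
Lemma minor_arcs p c : coprime_bases 2 p -> 0 < c ->
  exists g N0, 0 < g /\ 1 <= N0 /\ forall N J K, N0 <= N -> N < INR K ->
    INR (p 0%N) * N <= INR (p 0%N) ^ J ->
  \rsum_(k < p 0%N ^ J) (b2R (~~ Rleb (Rabs (freq (p 0%N ^ J) k)) (/ N)) *
      exp (- (c * energy p K N (freq (p 0%N ^ J) k)))) <=
  INR (p 0%N) ^ J * exp (- ((1 + g) * ln N)).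
Proof.
move=> Hp cpos; have [Hp1 Hp2] := Hp.
have P1 : (1 < p 0%N)%N by apply: Hp1.
have Q1 : (1 < p 1%N)%N by apply: Hp1.
have p2 := INR_ge2 P1; have q2 := INR_ge2 Q1.
set P := p 0%N in P1 p2 *; set Q := p 1%N in Q1 q2.
set c0 := 1 - cos (2 * PI * / (7 * INR P * INR Q)).
have c00 : 0 < c0 by apply: c0_gt0.
set eta := 1 - cos (2 * PI * / (2 * INR P)).
have eta0 : 0 < eta.
  by apply: cos_2PI_gap; split; [apply: Rinv_0_lt_compat|apply: Rinv_lt_contravar]; lra.
set c1 := c / 2; have c10 : 0 < c1 by rewrite /c1; lra.
have lP : 0 < ln (INR P) by apply: ln_gt0; lra.
have lQ : 0 < ln (INR Q) by apply: ln_gt0; lra.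
set l := ln (INR P * INR Q); have l0 : 0 < l by apply: ln_gt0; nra.
(* The exponent gained from [c1 * c0 * L], where [L >= ln N / l - 1]. *)
set g1 := Rmin 1 (c1 * c0 / l).
have g10 : 0 < g1.
  by apply: Rmin_glb_lt; [lra|apply: Rdiv_lt_0_compat => //; apply: Rmult_lt_0_compat].
have g11 : g1 <= 1 by apply: Rmin_l.
have g12 : g1 <= c1 * c0 / l by apply: Rmin_r.
(* About [e1 * ln N] rows are averaged; this shortens the usable part of each row by
   [Q^R0 <= Q * N^(g1 / 4)]. *)
set e1 := g1 / (4 * ln (INR Q)); have e10 : 0 < e1 by apply: Rdiv_lt_0_compat; lra.
set ka := c1 * eta * e1; have ka0 : 0 < ka by apply: Rmult_lt_0_compat => //; apply: Rmult_lt_0_compat.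
(* Beyond [L1] the corrections [P * exp (- ka * ln N)] of the [A <= 2 ln N] scales add up to at most
   1, so the scales together cost at most [exp 1]. *)
have [L1 HL1] := exp_beats_pow 1 (2 * INR P) ka0.
have g4 : 0 < g1 / 4 by lra.
have [L2 HL2] := exp_beats_pow 0 (exp (c1 * c0 + 1) * INR P * INR Q) g4.
set L3 := Rmax (Rmax L1 L2) (Rmax 1 (4 * ln (INR Q))).
exists (g1 / 2), (exp L3); split; first lra.
have L3_1 : 1 <= L3 by apply: Rle_trans (Rmax_r _ _); apply: Rmax_l.
split; first by have := exp_ineq1_le L3; lra.
move=> N J K hN NK hJ.
have N0 : 0 < N by have := exp_pos L3; lra.
set La := ln N.
have hLa : L3 <= La by rewrite -(ln_exp L3); apply: Rcomplements.ln_le => //; exact: exp_pos.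
have EN : exp La = N by apply: exp_ln.
have hL1 : L1 <= La by apply: Rle_trans hLa; apply: Rle_trans (Rmax_l _ _); apply: Rmax_l.
have hL2 : L2 <= La by apply: Rle_trans hLa; apply: Rle_trans (Rmax_l _ _); apply: Rmax_r.
have hL4 : 4 * ln (INR Q) <= La by apply: Rle_trans hLa; apply: Rle_trans (Rmax_r _ _); apply: Rmax_r.
have hLa1 : 1 <= La by lra.
have N1 : 1 <= N by rewrite -EN; have := exp_ineq1_le La; lra.
have lnmono x y : 0 < x -> x <= y -> ln x <= ln y by move=> *; apply: Rcomplements.ln_le.
have [L [hLl hLr]] : exists L, (INR P * INR Q) ^ L <= N < (INR P * INR Q) ^ L.+1.
  by apply: exists_pow_window => //; nra.
have pq0 : 0 < INR P * INR Q by nra.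
have hL : La / l - 1 <= INR L.
  have : La <= INR L.+1 * l.
    rewrite /La -(ln_exp (INR L.+1 * l)) -pow_exp_ln //; apply: lnmono; lra.
  rewrite S_INR => h; suff : La / l <= INR L + 1 by lra.
  by apply/Rle_div_l; lra.
rewrite Rpow_mult_distr in hLl.
have [R0 [hR1 hR2]] := nat_ceil (Rlt_le _ _ (Rmult_lt_0_compat _ _ e10 (Rlt_le_trans _ _ _ Rlt_0_1 hLa1))).
have R00 : (0 < R0)%N.
  rewrite lt0n; apply/eqP => h; rewrite h [INR 0]/= in hR1.
  have := Rmult_lt_0_compat _ _ e10 (Rlt_le_trans _ _ _ Rlt_0_1 hLa1); lra.
have qR0 : 0 < INR Q ^ R0 by apply: pow_lt; lra.
have qR : INR Q ^ R0 <= INR Q * exp (g1 / 4 * La).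
  rewrite pow_exp_ln; last lra.
  rewrite -{2}(exp_ln (INR Q)); last lra.
  rewrite -exp_plus; apply: exp_le.
  have -> : ln (INR Q) + g1 / 4 * La = (e1 * La + 1) * ln (INR Q) by rewrite /e1; field; lra.
  by apply: Rmult_le_compat_r; lra.
have qRN : INR Q ^ R0 <= N.
  apply: Rle_trans qR _; rewrite -EN -{1}(exp_ln (INR Q)); last lra.
  rewrite -exp_plus; apply: exp_le; nra.
have [A [hA1 hA2]] : exists a, INR P ^ a <= N / INR Q ^ R0 < INR P ^ a.+1.
  by apply: exists_pow_window => //; apply/Rle_div_r; lra.
have pa : 0 < INR P ^ A by apply: pow_lt; lra.
have hA3 : INR P ^ A * INR Q ^ R0 <= N by apply/Rle_div_r => //; lra.
have qR1 : 1 <= INR Q ^ R0 by apply: pow_R1_Rle; lra.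
have hA4 : INR P ^ A <= N by nra.
have AJ : (A <= J)%N.
  rewrite leqNgt; apply/negP => h.
  have : INR P ^ J <= INR P ^ A by apply: Rle_pow; [lra|apply/leP; apply: ltnW].
  nra.
have hA5 : INR A <= 2 * La.
  have h1 : INR A * ln (INR P) <= La.
    by rewrite -(ln_exp (INR A * _)) -pow_exp_ln; [apply: lnmono|lra].
  have h2 : ln 2 <= ln (INR P) by apply: lnmono; lra.
  have h3 := ln_lt_2; have := pos_INR A; nra.
have H2 := sum_exp_energy_le Hp c10 NK R00 AJ hA3.
rewrite -/P -/eta in H2.
have H1 k : (k < P ^ J)%N -> / N < Rabs (freq (P ^ J) k) ->
    c0 * INR L <= energy p K N (freq (P ^ J) k).
  by move=> h1 h2; apply: energy_ge.
apply: Rle_trans (_ : exp (- (c1 * (c0 * INR L))) *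
   (\rsum_(k < P ^ J) exp (- (c1 * energy p K N (freq (P ^ J) k)))) <= _).
  rewrite -rsum_scal; apply: rsum_le => k _.
  case: RlebP => /= h.
    rewrite Rmult_0_l; apply: Rmult_le_pos; apply: Rlt_le; exact: exp_pos.
  rewrite Rmult_1_l -exp_plus; apply: exp_le.
  have := H1 k (ltn_ord k) (Rnot_le_lt _ _ h); rewrite /c1.
  set E := energy _ _ _ _ => hE.
  by have := Rmult_le_compat_l (c / 2) _ _ (Rlt_le _ _ c10) hE; lra.
have hfac : (1 + INR P * exp (- (c1 * INR R0 * eta))) ^ A <= exp 1.
  set ep := INR P * exp _.
  have ep0 : 0 <= ep by apply: Rmult_le_pos; [lra|apply: Rlt_le; exact: exp_pos].
  apply: Rle_trans (_ : exp ep ^ A <= _).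
    by apply: pow_incr; have := exp_ineq1_le ep; lra.
  rewrite -Rpower_pow; last exact: exp_pos.
  rewrite /Rpower ln_exp; apply: exp_le.
  have h1 : ep <= INR P * exp (- (ka * La)).
    apply: Rmult_le_compat_l; first lra.
    apply: exp_le; apply: Ropp_le_contravar.
    have -> : ka * La = (c1 * eta) * (e1 * La) by rewrite /ka; ring.
    have -> : c1 * INR R0 * eta = (c1 * eta) * INR R0 by ring.
    by apply: Rmult_le_compat_l => //; apply: Rlt_le; apply: Rmult_lt_0_compat.
  have h2 := HL1 _ hL1; rewrite pow_1 in h2.
  have h3 : exp (- (ka * La)) * exp (ka * La) = 1 by rewrite -exp_plus Rplus_opp_l exp_0.
  have h4 := exp_pos (- (ka * La)); have h5 := pos_INR A.
  apply: Rle_trans (_ : (2 * La) * (INR P * exp (- (ka * La))) <= _).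
    by apply: Rmult_le_compat.
  by rewrite -h3; nra.
have hPJ : INR P ^ (J - A)%N <= INR P ^ J * (INR P * (INR Q * exp (g1 / 4 * La)) / N).
  have EJ : INR P ^ J = INR P ^ A * INR P ^ (J - A)%N by rewrite -pow_add; congr (_ ^ _); rewrite -[LHS](subnKC AJ).
  have h0 : 0 < INR P ^ (J - A)%N by apply: pow_lt; lra.
  have h1 : 1 <= INR P ^ A * (INR P * INR Q ^ R0 / N).
    have h2 : N < INR P ^ A.+1 * INR Q ^ R0 by apply/Rlt_div_l.
    have -> : INR P ^ A * (INR P * INR Q ^ R0 / N) = INR P ^ A.+1 * INR Q ^ R0 / N.
      by rewrite /=; field; lra.
    by apply/Rle_div_r; lra.
  have h3 : INR P * INR Q ^ R0 / N <= INR P * (INR Q * exp (g1 / 4 * La)) / N.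
    apply: Rmult_le_compat_r; first by apply: Rlt_le; apply: Rinv_0_lt_compat.
    by apply: Rmult_le_compat_l; lra.
  rewrite EJ; set y := INR P * INR Q ^ R0 / N in h1 h3; set z := _ / N in h3 *.
  have : 1 <= INR P ^ A * z.
    by apply: Rle_trans h1 _; apply: Rmult_le_compat_l; lra.
  nra.
apply: Rle_trans (_ : exp (- (c1 * (c0 * INR L))) * (exp 1 * (INR P ^ J * (INR P * (INR Q * exp (g1 / 4 * La)) / N))) <= _).
  apply: Rmult_le_compat_l; first by apply: Rlt_le; apply: exp_pos.
  apply: Rle_trans H2 _; apply: Rmult_le_compat => //.
    apply: pow_le; have := exp_pos (- (c1 * INR R0 * eta)); nra.
  by apply: pow_le; lra.
have h1 : exp (- (c1 * (c0 * INR L))) <= exp (c1 * c0) * exp (- (g1 * La)).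
  rewrite -exp_plus; apply: exp_le.
  have h2 : c1 * c0 * (La / l - 1) <= c1 * c0 * INR L.
    by apply: Rmult_le_compat_l => //; apply: Rlt_le; apply: Rmult_lt_0_compat.
  have h3 : g1 * La <= c1 * c0 / l * La by apply: Rmult_le_compat_r; lra.
  have -> : - (c1 * (c0 * INR L)) = - (c1 * c0 * INR L) by ring.
  have : c1 * c0 * (La / l - 1) = c1 * c0 / l * La - c1 * c0 by field; lra.
  lra.
have pJ : 0 < INR P ^ J by apply: pow_lt; lra.
have h2 := HL2 _ hL2; rewrite Rmult_1_r exp_plus in h2.
set X := exp (g1 / 4 * La) in h2 *.
have X0 : 0 < X by apply: exp_pos.
have EX : exp (- (g1 * La)) = / (X * X * X * X).
  by rewrite -!exp_plus -exp_Ropp; congr exp; field.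
have ER : exp (- ((1 + g1 / 2) * La)) = / N * / (X * X).
  rewrite -EN -exp_plus -!exp_Ropp -exp_plus; congr exp; field.
rewrite ER.
rewrite EX in h1.
apply: Rle_trans (_ : (exp (c1 * c0) * / (X * X * X * X)) * (exp 1 * (INR P ^ J * (INR P * (INR Q * X) / N))) <= _).
  apply: Rmult_le_compat_r h1; apply: Rmult_le_pos; first by apply: Rlt_le; apply: exp_pos.
  apply: Rmult_le_pos; first lra.
  apply: Rdiv_le_0_compat => //; apply: Rmult_le_pos; first lra.
  by apply: Rmult_le_pos; lra.
have -> : exp (c1 * c0) * / (X * X * X * X) * (exp 1 * (INR P ^ J * (INR P * (INR Q * X) / N))) =
  (INR P ^ J * (/ N * / (X * X))) * ((exp (c1 * c0) * exp 1 * INR P * INR Q) / X).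
  by field; split; lra.
rewrite -[X in _ <= X]Rmult_1_r; apply: Rmult_le_compat_l.
  apply: Rmult_le_pos; first lra.
  apply: Rmult_le_pos; apply: Rlt_le; apply: Rinv_0_lt_compat => //.
  exact: Rmult_lt_0_compat.
by apply/Rle_div_l => //; lra.
Qed.

(** * Major arcs *)

Lemma inv_sq_le_atan s j : 0 < s -> 0 <= j ->
  s / (1 + (s * (j + 1)) ^ 2) <= atan (s * (j + 1)) - atan (s * j).
Proof.
move=> s0 j0.
have [||c [[c1 c2] ->]] := MVT_gen atan (s * j) (s * (j + 1)) (fun x => / (1 + x ^ 2)).
- move=> x _; apply/is_derive_Reals; have := derivable_pt_lim_atan x.
  by rewrite /Rsqr /= Rmult_1_r.
- by move=> x _; apply: derivable_continuous_pt; apply: derivable_pt_atan.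
rewrite Rmin_left in c1; last nra.
rewrite Rmax_right in c2; last nra.
have -> : s * (j + 1) - s * j = s by ring.
rewrite /Rdiv [X in X <= _]Rmult_comm; apply: Rmult_le_compat_r; first lra.
apply: Rinv_le_contravar; first nra.
have h : 0 <= c by nra.
by apply: Rplus_le_compat_l; apply: pow_incr; lra.
Qed.

Lemma sum_inv_sq_le s K : 0 < s ->
  \rsum_(j < K) / (1 + (s * INR j.+1) ^ 2) <= PI / (2 * s).
Proof.
move=> s0; pose g j := - (/ s * atan (s * INR j)).
apply: Rle_trans (_ : \rsum_(j < K) (g j - g j.+1) <= _).
  apply: rsum_le => j _; rewrite /g S_INR.
  have h := inv_sq_le_atan s0 (pos_INR j).
  have -> : / (1 + (s * (INR j + 1)) ^ 2) = / s * (s / (1 + (s * (INR j + 1)) ^ 2)).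
    by field; split; [|lra]; have := pow2_ge_0 (s * (INR j + 1)); lra.
  have : 0 < / s by apply: Rinv_0_lt_compat.
  nra.
rewrite rsum_telescope /g [INR 0]/= Rmult_0_r atan_0.
have := atan_bound (s * INR K) => -[_ h].
have -> : PI / (2 * s) = / s * (PI / 2) by field; lra.
have : 0 < / s by apply: Rinv_0_lt_compat.
nra.
Qed.

(** Comparison with the integral of [1 / (1 + x^2)] through [atan]; the summand 1 is the frequency
    0. *)
Lemma sum_grid_le M L : (0 < M)%N -> 0 < L ->
  \rsum_(k < M) / (1 + (L * freq M k) ^ 2) <= 1 + INR M / (2 * L).
Proof.
move=> M0 L0; have hM := INR_ltn M0; rewrite [INR 0]/= in hM.
have P0 := PI_RGT_0.
set s := 2 * PI * L / INR M; have s0 : 0 < s by apply: Rdiv_lt_0_compat; nra.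
have f0 x : 0 < / (1 + x ^ 2) <= 1.
  have := pow2_ge_0 x => h; split; first by apply: Rinv_0_lt_compat; lra.
  by rewrite -Rinv_1; apply: Rinv_le_contravar; lra.
(* Each term is bounded by both branches of [freq] at once, which avoids cutting the sum at
   [M / 2]. *)
apply: Rle_trans (_ : \rsum_(k < M) (/ (1 + (s * INR k) ^ 2) + / (1 + (s * INR (M - k)%N) ^ 2)) <= _).
  apply: rsum_le => k _; rewrite /freq; case: ifP => _.
    have -> : L * (2 * PI * (INR k / INR M)) = s * INR k by rewrite /s; field; lra.
    by have := f0 (s * INR (M - k)%N); lra.
  have -> : (L * (2 * PI * (INR k / INR M - 1))) ^ 2 = (s * INR (M - k)%N) ^ 2.
    rewrite minus_INR; last by apply/leP; apply: ltnW.
    by rewrite /s; field; lra.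
  by have := f0 (s * INR k); lra.
rewrite rsum_add.
have E2 : \rsum_(k < M) / (1 + (s * INR (M - k)%N) ^ 2) = \rsum_(j < M) / (1 + (s * INR j.+1) ^ 2).
  rewrite (reindex_inj rev_ord_inj) /=; apply: eq_bigr => k _.
  by rewrite subKn.
have E1 : \rsum_(k < M) / (1 + (s * INR k) ^ 2) <= 1 + \rsum_(j < M) / (1 + (s * INR j.+1) ^ 2).
  case: (M) => [|M']; first by rewrite !big_ord0; lra.
  rewrite big_ord_recl -[nat_of_ord ord0]/0%N [INR 0]/= Rmult_0_r.
  rewrite pow_i; last lia.
  rewrite Rplus_0_r Rinv_1; apply: Rplus_le_compat_l.
  apply: (@rsum_ord_widen M' M'.+1 (fun j => / (1 + (s * INR j.+1) ^ 2))) => // j.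
  by have := f0 (s * INR j.+1); lra.
have E3 := @sum_inv_sq_le s M s0.
have E4 : PI / (2 * s) = INR M / (4 * L) by rewrite /s; field; lra.
have E5 : INR M / (2 * L) = INR M / (4 * L) + INR M / (4 * L) by field; lra.
rewrite E2 E5 -E4; apply: Rle_trans (Rplus_le_compat_r _ _ _ E1) _.
by rewrite Rplus_assoc; apply: Rplus_le_compat_l; apply: Rplus_le_compat.
Qed.

Lemma count_grid_ge M x : (0 < M)%N -> 0 <= x < PI ->
  INR M * x / (2 * PI) <= \rsum_(k < M) b2R (Rleb (Rabs (freq M k)) x).
Proof.
move=> M0 [x0 x1]; have hM := INR_ltn M0; rewrite [INR 0]/= in hM.
have P0 := PI_RGT_0.
set y := INR M * x / (2 * PI).
have y0 : 0 <= y by apply: Rdiv_le_0_compat; nra.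
have yM : y < INR M / 2.
  apply/Rlt_div_l; first lra.
  have -> : INR M / 2 * (2 * PI) = INR M * PI by field.
  by apply: Rmult_lt_compat_l.
have [K [hK1 hK2]] : exists K : nat, y < INR K <= y + 1.
  have [h1 h2] := archimed y; exists (Z.to_nat (up y)).
  by rewrite INR_IZR_INZ Z2Nat.id; [lra|apply: le_IZR; lra].
have hle k : (k < K)%N -> INR k <= y.
  by move=> /INR_leq; rewrite S_INR; lra.
have KM : (K <= M)%N.
  case: (posnP K) => [->//|K0].
  have h := hle K.-1; rewrite -(prednK K0).
  have : INR K.-1 < INR M by have := h ltac:(by rewrite prednK); lra.
  by move=> h'; rewrite ltnNge; apply/negP => /INR_leq; lra.
apply: Rle_trans (_ : \rsum_(k < K) b2R (Rleb (Rabs (freq M k)) x) <= _); last first.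
  by apply: (rsum_ord_widen (F := fun k => b2R (Rleb (Rabs (freq M k)) x)) KM) => k; apply: b2R_ge0.
apply: Rle_trans (_ : \rsum_(k < K) 1 <= _); first by rewrite rsum_ord_const; lra.
apply: rsum_le => k _; have hk := hle k (ltn_ord k).
case: RlebP => [|[]] /=; first lra.
rewrite /freq ifT; last first.
  by apply: leq_INR; rewrite INR_mul [INR 2]/=; lra.
rewrite Rabs_pos_eq; last first.
  by apply: Rmult_le_pos; [lra|apply: Rdiv_le_0_compat => //; apply: pos_INR].
have -> : x = 2 * PI * (y / INR M) by rewrite /y; field; lra.
apply: Rmult_le_compat_l; first lra.
by apply: Rmult_le_compat_r => //; apply: Rlt_le; apply: Rinv_0_lt_compat.
Qed.

(** * Products of characteristic functions over S *)

(** Outside [S] a point mass at 0, so that all positions up to [n] are treated alike and the support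
    condition is part of the product law. *)
Definition law (d m : nat) (p : nat -> nat) (r : R) (h : nat) : nat -> R :=
  if inS m p h then tilt d (r * INR h) else fun j => b2R (j == 0%N).

Definition pexp (p : nat -> nat) (D : nat) : nat -> nat := fun i => (p i ^ D)%N.

Lemma pexp_bases p D m : (0 < D)%N -> (2 <= m)%N -> coprime_bases m p -> coprime_bases 2 (pexp p D).
Proof.
move=> D0 m2 [H1 H2]; split=> [i i2|i j i2 j2 ij].
  have h := H1 i (leq_trans i2 m2); rewrite /pexp; apply: leq_trans h _.
  by rewrite -{1}(expn1 (p i)) leq_pexp2l // ltnW // H1 // (leq_trans i2).
by apply: coprimeXl; apply: coprimeXr; apply: H2 => //; apply: leq_trans m2.
Qed.

Lemma inS_pexp p D m h : (2 <= m)%N -> (forall i, (i < m)%N -> (1 < p i)%N) -> (0 < D)%N ->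
  inS 2 (pexp p D) h -> inS m p h.
Proof.
move=> m2 Hp D0 H.
have Hp2 i : (i < 2)%N -> (1 < pexp p D i)%N.
  move=> i2; have h1 := Hp i (leq_trans i2 m2); apply: leq_trans h1 _.
  by rewrite -{1}(expn1 (p i)) leq_pexp2l // ltnW // Hp // (leq_trans i2).
have [al ->] := inSP h Hp2 H.
apply/(inSP _ Hp); exists (fun i => if (i < 2)%N then (D * al i)%N else 0%N).
rewrite (big_ord_widen m (fun i => pexp p D i ^ al i)%N) // big_mkcond /=.
by apply: eq_bigr => i _; case: ifP => // _; rewrite /pexp -expnM.
Qed.

Section ProductBounds.
Variables (e k : nat) (p : nat -> nat) (D n : nat) (r : R).
Hypotheses (k0 : (0 < k)%N) (Hp : coprime_bases k.+1 p) (D0 : (0 < D)%N) (r0 : 0 < r).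
Let d := e.+2.
Let m := k.+1.
Let N := / r.
Let q := INR (p k).
Let cd := exp (- (1)) / INR d ^ 2.

Let rh_ge0 (h : nat) : 0 <= r * INR h.
Proof. by apply: Rmult_le_pos; [lra|apply: pos_INR]. Qed.

Let q2 : 2 <= q. Proof. by apply: INR_ge2; case: Hp => H _; apply: H. Qed.

Lemma law_ldist h : ldist d (law d m p r h).
Proof.
rewrite /law; case: ifP => _; first exact: tilt_ldist.
split=> [j|]; first exact: b2R_ge0.
by rewrite big_ord_recl /= big1 //; ring.
Qed.

Definition phi (h : nat) (th : R) : C := charw d (law d m p r h) (fun=> 1) (th * INR h).

Lemma Cmod_phi_le1 h th : Cmod (phi h th) <= 1.
Proof. by apply: charw_le1; [exact: law_ldist|move=> j; rewrite Rabs_R1; lra]. Qed.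

Lemma cd_gt0 : 0 < cd.
Proof.
apply: Rdiv_lt_0_compat; first exact: exp_pos.
by apply: pow_lt; have := INR_d_ge2 e; rewrite -/d; lra.
Qed.

Lemma Cmod_phi_exp h th : inS m p h -> INR h <= N ->
  Cmod (phi h th) <= exp (- (cd * (1 - cos (th * INR h)))).
Proof.
move=> Sh hN; apply: Rle_trans (charw_le_exp _ (law_ldist h)) _.
rewrite /law Sh; apply: exp_le; apply: Ropp_le_contravar.
apply: Rmult_le_compat_r; first by have := COS_bound (th * INR h); lra.
apply: Rle_trans (tilt01_ge e (rh_ge0 h)).
apply: Rmult_le_compat_r.
  apply: Rlt_le; apply: Rinv_0_lt_compat; apply: pow_lt.
  by have := INR_d_ge2 e; rewrite -/d; lra.
apply: exp_le; apply: Ropp_le_contravar.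
have -> : 1 = r * N by rewrite /N; field; lra.
by apply: Rmult_le_compat_l; lra.
Qed.

Lemma prod_phi_le (X Y : pred 'I_n.+1) th :
  (forall h, Y h -> [/\ X h, inS m p h & INR h <= N]) ->
  \rprod_(h | X h) Cmod (phi h th) <= exp (- (cd * \rsum_(h | Y h) (1 - cos (th * INR h)))).
Proof.
move=> HY.
have -> : exp (- (cd * \rsum_(h | Y h) (1 - cos (th * INR h)))) =
    \rprod_(h | X h) (if Y h then exp (- (cd * (1 - cos (th * INR h)))) else 1).
  rewrite -big_mkcondr -rsum_scal.
  have -> : \rprod_(h | X h && Y h) exp (- (cd * (1 - cos (th * INR h)))) =
    \rprod_(h | Y h) exp (- (cd * (1 - cos (th * INR h)))).
    apply: eq_bigl => h; case Yh: (Y h); last by rewrite andbF.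
    by have [-> _ _] := HY h Yh.
  rewrite rprod_exp; congr exp.
  have E x : - x = -1 * x by ring.
  by rewrite E -rsum_scal; apply: eq_bigr => h _; ring.
apply: rprod_le => h Xh; split; first exact: Cmod_ge_0.
case: ifP => [/HY [_ Sh hN]|_]; [exact: Cmod_phi_exp|exact: Cmod_phi_le1].
Qed.

Lemma sum_window : N < INR n.+1 ->
  \rsum_(h < n.+1 | inS m p h) b2R (Rleb (INR h) N && ~~ Rleb (INR h) (N / q)) =
  cnt k p n.+1 N.
Proof.
move=> Nn; have N0 : 0 < N by apply: Rinv_0_lt_compat.
rewrite -(cnt_window Hp); last by lra.
rewrite /cnt -rsum_sub; apply: eq_bigr => h _.
have hq : N / q <= N by apply/Rle_div_l; nra.
by case: RlebP => h1; case: RlebP => h2 /=; try ring; rewrite -/q in h2; lra.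
Qed.

(* Families whose removal from the product over S damages neither the minor arc bound nor the
   major arc one. *)
Definition few (T : pred 'I_n.+1) : Prop :=
  \rsum_(h | T h) b2R [&& inS m p h, Rleb (INR h) N &
     inS 2 (pexp p D) h || ~~ Rleb (INR h) (N / q)] <= 2.

(** Removing [T] loses at most two terms of the energy, each at most 2: hence [exp (4 * cd)]. *)
Lemma prod_phi_minor (T : pred 'I_n.+1) th : few T ->
  \rprod_(h | ~~ T h) Cmod (phi h th) <=
  exp (4 * cd) * exp (- (cd * energy (pexp p D) n.+1 N th)).
Proof.
move=> fT; rewrite -exp_plus.
have [Hp1 _] := Hp; have m2 : (2 <= m)%N by rewrite /m ltnS.
pose Y (h : 'I_n.+1) := [&& ~~ T h, inS 2 (pexp p D) h & Rleb (INR h) N].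
apply: Rle_trans (@prod_phi_le _ Y th _) _.
  by move=> h /and3P [h1 h2 /RlebP h3]; split=> //; apply: inS_pexp h2.
apply: exp_le.
suff : energy (pexp p D) n.+1 N th - 4 <= \rsum_(h | Y h) (1 - cos (th * INR h)).
  by have := cd_gt0; nra.
have hc h := COS_bound (th * INR h).
have E : energy (pexp p D) n.+1 N th = \rsum_(h | Y h) (1 - cos (th * INR h)) +
   \rsum_(h | T h && (inS 2 (pexp p D) h && Rleb (INR h) N)) (1 - cos (th * INR h)).
  rewrite /energy.
  have -> : \rsum_(h < n.+1 | inS 2 (pexp p D) h) (b2R (Rleb (INR h) N) * (1 - cos (th * INR h))) =
    \rsum_(h < n.+1 | inS 2 (pexp p D) h && Rleb (INR h) N) (1 - cos (th * INR h)).
    by rewrite big_mkcondr; apply: eq_bigr => h _; case: ifP => _ /=; ring.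
  rewrite (bigID (fun h => ~~ T h)) /=; congr (_ + _); apply: eq_bigl => h.
    by rewrite /Y andbC.
  by rewrite negbK andbC.
rewrite E.
suff : \rsum_(h | T h && (inS 2 (pexp p D) h && Rleb (INR h) N)) (1 - cos (th * INR h)) <= 2 * 2 by lra.
apply: Rle_trans (Rmult_le_compat_l 2 _ _ _ fT); last lra.
rewrite big_mkcondr -rsum_scal; apply: rsum_le => h Th.
case: ifP => [/andP [h1 h2]|_].
  by rewrite (inS_pexp _ _ _ h1) // h1 h2 /=; have := hc h; lra.
by have := b2R_ge0 ([&& inS m p h, Rleb (INR h) N & inS 2 (pexp p D) h || ~~ Rleb (INR h) (N / q)]); lra.
Qed.

(** By [sum_window] at least [c4 * lam^2 + 2] elements lie in [(N / q, N]]. At most two are lost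
    with [T], and each of the others contributes at least [(theta N / q)^2 / 4]. The resulting
    Gaussian decay is weakened through [exp (2 u) >= (1 + u)^2]. *)
Lemma prod_phi_major (T : pred 'I_n.+1) th c4 lam : few T -> N < INR n.+1 ->
  0 < c4 -> 0 <= lam -> c4 * lam ^ 2 + 2 <= cnt k p n.+1 N -> Rabs th <= r ->
  \rprod_(h | ~~ T h) Cmod (phi h th) <=
  / (Rmin 1 (cd * c4 / (8 * q ^ 2))) ^ 2 * / (1 + (lam * N * th) ^ 2) ^ 2.
Proof.
move=> fT Nn c40 lam0 hcnt hth.
have N0 : 0 < N by apply: Rinv_0_lt_compat.
pose Y (h : 'I_n.+1) := [&& ~~ T h, inS m p h, Rleb (INR h) N & ~~ Rleb (INR h) (N / q)].
apply: Rle_trans (@prod_phi_le _ Y th _) _.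
  by move=> h /and4P [h1 h2 /RlebP h3 _]; split.
have hY : c4 * lam ^ 2 <= \rsum_(h | Y h) 1.
  have : cnt k p n.+1 N = \rsum_(h | Y h) 1 + \rsum_(h | T h && (inS m p h && (Rleb (INR h) N && ~~ Rleb (INR h) (N / q)))) 1.
    rewrite -sum_window //.
    have -> : \rsum_(h < n.+1 | inS m p h) b2R (Rleb (INR h) N && ~~ Rleb (INR h) (N / q)) =
      \rsum_(h < n.+1 | inS m p h && (Rleb (INR h) N && ~~ Rleb (INR h) (N / q))) 1.
      by rewrite big_mkcondr; apply: eq_bigr => h _; case: ifP.
    rewrite (bigID (fun h => ~~ T h)) /=; congr (_ + _); apply: eq_bigl => h.
      by rewrite /Y andbC.
    by rewrite negbK andbC.
  suff : \rsum_(h | T h && (inS m p h && (Rleb (INR h) N && ~~ Rleb (INR h) (N / q)))) 1 <= 2 by lra.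
  apply: Rle_trans fT; rewrite big_mkcondr; apply: rsum_le => h Th.
  by case: (inS m p h) => //=; case: (Rleb _ N) => //=; case: (Rleb _ (N / q)) => //=; rewrite ?orbT /=; try lra; apply: b2R_ge0.
have hcos : (th * (N / q)) ^ 2 / 4 * (c4 * lam ^ 2) <= \rsum_(h | Y h) (1 - cos (th * INR h)).
  apply: (Rle_trans _ ((th * (N / q)) ^ 2 / 4 * (\rsum_(h | Y h) 1))).
    apply: Rmult_le_compat_l => //; have := pow2_ge_0 (th * (N / q)); lra.
  rewrite -rsum_scal; apply: rsum_le => h /and4P [_ _ /RlebP h1 /RlebP /Rnot_le_lt h2].
  have hh : 0 <= INR h by apply: pos_INR.
  have h3 : Rabs (th * INR h) <= 1.
    rewrite Rabs_mult (Rabs_pos_eq (INR h)) //.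
    have -> : 1 = r * N by rewrite /N; field; lra.
    by apply: Rmult_le_compat => //; apply: Rabs_pos.
  apply: Rle_trans (one_sub_cos_ge h3); rewrite Rmult_1_r.
  apply: Rmult_le_compat_r; first lra.
  rewrite (Rpow_mult_distr th (N / q)) (Rpow_mult_distr th (INR h)); apply: Rmult_le_compat_l; first exact: pow2_ge_0.
  apply: pow_incr; split; last lra.
  by apply: Rdiv_le_0_compat; lra.
have cd0 := cd_gt0.
set c5 := cd * c4 / (8 * q ^ 2).
have c50 : 0 < c5.
  apply: Rdiv_lt_0_compat; first exact: Rmult_lt_0_compat.
  by apply: Rmult_lt_0_compat; [lra|apply: pow_lt; lra].
set t := (lam * N * th) ^ 2; have t0 : 0 <= t by apply: pow2_ge_0.
apply: Rle_trans (_ : exp (- (2 * c5 * t)) <= _).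
  apply: exp_le; apply: Ropp_le_contravar.
  have -> : 2 * c5 * t = cd * ((th * (N / q)) ^ 2 / 4 * (c4 * lam ^ 2)).
    by rewrite /c5 /t; field; lra.
  by apply: Rmult_le_compat_l; lra.
set mi := Rmin 1 c5; have mi0 : 0 < mi by apply: Rmin_glb_lt; lra.
have mi1 : mi <= 1 by apply: Rmin_l.
have mi2 : mi <= c5 by apply: Rmin_r.
rewrite -Rinv_mult exp_Ropp; apply: Rinv_le_contravar.
  by apply: Rmult_lt_0_compat; apply: pow_lt; lra.
have -> : exp (2 * c5 * t) = exp (c5 * t) ^ 2.
  by rewrite -Rpower_pow ?/Rpower ?ln_exp; [congr exp; rewrite /=; ring|exact: exp_pos].
rewrite -Rpow_mult_distr; apply: pow_incr; split; first by nra.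
by have := exp_ineq1_le (c5 * t); nra.
Qed.

End ProductBounds.

(** * Fourier sums at the saddle point *)

Lemma Re_sub_R (z : C) x : Re (z - RtoC x) = Re z - x.
Proof. by case: z. Qed.

Section Regime.
Variables (e k : nat) (p : nat -> nat) (D : nat) (c4 Cu : R).
Hypotheses (k0 : (0 < k)%N) (Hp : coprime_bases k.+1 p) (D0 : (0 < D)%N) (c40 : 0 < c4).
Let d := e.+2.
Let m := k.+1.
Let q := INR (p k).
(** A lower bound for the product of the weights of the digits 0 and 1 at a position [h <= 1 / r].
    [Cmom], [Cmaj] and [Cmin] are the constants of [momw_hump], [prod_phi_major] and
    [prod_phi_minor]. *)
Definition cdig : R := exp (- (1)) / INR d ^ 2.
Definition Cmom : R := 6250 * INR d ^ 4.
Definition Cmaj : R := / (Rmin 1 (cdig * c4 / (8 * q ^ 2))) ^ 2.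
Definition Cmin : R := exp (4 * cdig).

Lemma Cmom_ge1 : 1 <= Cmom.
Proof.
have h : 1 <= INR d ^ 4 by apply: pow_R1_Rle; have := INR_d_ge2 e; rewrite -/d; lra.
by rewrite /Cmom; lra.
Qed.

Lemma Cmaj_ge0 : 0 <= Cmaj.
Proof.
apply: Rlt_le; apply: Rinv_0_lt_compat; apply: pow_lt; apply: Rmin_glb_lt; first lra.
have hq : 2 <= q by apply: INR_ge2; case: Hp => H _; apply: H.
apply: Rdiv_lt_0_compat; first by apply: Rmult_lt_0_compat; [exact: cd_gt0|].
by apply: Rmult_lt_0_compat; [lra|apply: pow_lt; lra].
Qed.

Lemma Cmin_ge0 : 0 <= Cmin.
Proof. by apply: Rlt_le; apply: exp_pos. Qed.

Variables (n J : nat) (r lam eps : R).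
Let N := / r.
Let M := (pexp p D 0 ^ J)%N.
Let L := lam * N.
Let W (h : 'I_n.+1) : nat -> R := law d m p r h.
Let hv (h : 'I_n.+1) : nat := h.
Hypotheses (r0 : 0 < r) (Hlam : 1 <= lam).
Hypothesis Hmean : \rsum_(h < n.+1) (INR h * muw d (law d m p r h)) = INR n.
Hypothesis HNn : N < INR n.+1.
Hypothesis Hcnt : c4 * lam ^ 2 + 2 <= cnt k p n.+1 N.
Hypothesis Hu : \rsum_(h < n.+1 | inS m p h) hump (r * INR h) <= Cu * lam ^ 2.
Hypothesis Hmin : \rsum_(k < M) (b2R (~~ Rleb (Rabs (freq M k)) (/ N)) *
      exp (- (cdig * energy (pexp p D) n.+1 N (freq M k)))) <= INR M * eps.
Hypotheses (HM1 : (n < M)%N) (HM2 : forall a : {ffun 'I_n.+1 -> 'I_d}, (wsum hv a < M)%N)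
  (HM3 : 2 * L <= INR M).

(** Measures how far the digit at [h] moves the sum on the scale [1 / r]; its total over the
    positions is [O(lam^2)]. *)
Definition uhump (h : nat) : R := if inS m p h then hump (r * INR h) else 0.

Lemma r_INR_ge0 h : 0 <= r * INR h.
Proof. by apply: Rmult_le_pos; [lra|apply: pos_INR]. Qed.

Lemma uhump_bounds h : 0 <= uhump h <= 1.
Proof.
rewrite /uhump; case: ifP => _; last lra.
by split; [exact: hump_ge0 (r_INR_ge0 h)|exact: hump_le1 (r_INR_ge0 h)].
Qed.

Lemma N_gt0 : 0 < N. Proof. exact: Rinv_0_lt_compat. Qed.

Lemma L_gt0 : 0 < L. Proof. by apply: Rmult_lt_0_compat N_gt0; lra. Qed.

Lemma momw_law_le h j : (1 <= j <= 3)%N ->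
  INR h ^ j * momw d (law d m p r h) j <= Cmom * N ^ j * uhump h.
Proof.
move=> hj; have N0 := N_gt0.
rewrite /uhump /law; case: ifP => Sh; last first.
  rewrite Rmult_0_r; have mu0 : muw d (fun j => b2R (j == 0%N)) = 0.
    rewrite /muw /Ew big_ord_recl -[nat_of_ord ord0]/0%N [INR 0]/= Rmult_0_r Rplus_0_l.
    by apply: big1 => i _; rewrite /=; ring.
  have -> : momw d (fun j => b2R (j == 0%N)) j = 0.
    rewrite /momw mu0 /Ew big_ord_recl -[nat_of_ord ord0]/0%N [INR 0]/= Rminus_0_r Rabs_R0.
    rewrite pow_i; last by apply/ltP; case/andP: hj.
    rewrite Rmult_0_r Rplus_0_l.
    by apply: big1 => i _; rewrite /=; ring.
  by rewrite Rmult_0_r; lra.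
have h1 := momw_hump e (r_INR_ge0 h) hj.
have Nj : 0 < N ^ j by apply: pow_lt.
have E : INR h ^ j = N ^ j * (r * INR h) ^ j.
  by rewrite Rpow_mult_distr -Rmult_assoc -Rpow_mult_distr (_ : N * r = 1) ?pow1 ?Rmult_1_l // /N; field; lra.
rewrite E Rmult_assoc.
have -> : Cmom * N ^ j * hump (r * INR h) = N ^ j * (Cmom * hump (r * INR h)) by ring.
by apply: Rmult_le_compat_l; [lra|exact: h1].
Qed.

Lemma sum_uhump_le : \rsum_(h < n.+1) uhump h <= Cu * lam ^ 2.
Proof. by apply: Rle_trans Hu; rewrite /uhump -big_mkcond; apply: Rle_refl. Qed.

Lemma few_pred2 (i j : 'I_n.+1) : few k p D r (pred2 i j).
Proof.
apply: Rle_trans (_ : \rsum_(h | pred2 i j h) 1 <= _).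
  by apply: rsum_le => h _; apply: b2R_le1.
rewrite rsum_count.
by rewrite card2; case: (i != j); rewrite /=; lra.
Qed.

Lemma M_gt0 : (0 < M)%N. Proof. exact: leq_ltn_trans (leq0n _) HM1. Qed.

Lemma massw_fourier f :
  RtoC (INR M * massw d n W hv f) =
  (\csum_(j < M) \cprod_(i : 'I_n.+1 | true) charw d (W i) (f i) (freq M j * INR (hv i))%re)%C.
Proof. exact: (fourier_massw (W := W) (h := hv) f M_gt0 HM1 HM2 Hmean). Qed.

(** The frame shared by all estimates. [A] is what remains of the factors in [T]. For [|theta| <= r]
    each of its [j] powers of [theta] costs [1 / L], one of the two decaying factors being spent on
    it; beyond, only the trivial bound [B'] is used. *)
Lemma fourier_sum_le x (A : R -> C) (T : pred 'I_n.+1) B B' j : few k p D r T -> (j <= 2)%N ->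
  RtoC (INR M * x) =
    (\csum_(i < M) (A (freq M i) * \big[Cmult/RtoC 1]_(h : 'I_n.+1 | ~~ T h) phi e k p r h (freq M i)))%C ->
  (forall th, Cmod (A th) <= B * Rabs th ^ j) -> (forall th, Cmod (A th) <= B') ->
  Rabs x <= B * Cmaj / (L ^ j * L) + B' * Cmin * eps.
Proof.
move=> fT j2 Hx HB HB'; have L0 := L_gt0; have N0 := N_gt0.
have hM : 0 < INR M by apply: (INR_ltn M_gt0).
have Cm := Cmaj_ge0; have Ci := Cmin_ge0.
have B0 : 0 <= B.
  have := HB 1; have := Cmod_ge_0 (A 1); rewrite Rabs_R1 pow1; lra.
have B'0 : 0 <= B' by have := HB' 1; have := Cmod_ge_0 (A 1); lra.
have Lj : 0 < L ^ j by apply: pow_lt.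
suff H : INR M * Rabs x <= B * Cmaj / L ^ j * (INR M / L) + B' * Cmin * (INR M * eps).
  apply: (Rmult_le_reg_l (INR M)) => //; apply: Rle_trans H _; apply: Req_le; field; lra.
have -> : INR M * Rabs x = Cmod (RtoC (INR M * x)).
  by rewrite Cmod_R Rabs_mult (Rabs_pos_eq (INR M)); lra.
rewrite Hx; apply: Rle_trans (Cmod_csum _ _ _) _.
apply: Rle_trans (_ : \rsum_(i < M) (B * Cmaj / L ^ j * / (1 + (L * freq M i) ^ 2) +
   B' * Cmin * (b2R (~~ Rleb (Rabs (freq M i)) (/ N)) *
      exp (- (cdig * energy (pexp p D) n.+1 N (freq M i))))) <= _); last first.
  rewrite rsum_add !rsum_scal; apply: Rplus_le_compat.
    apply: Rmult_le_compat_l.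
      by apply: Rdiv_le_0_compat => //; apply: Rmult_le_pos.
    apply: Rle_trans (sum_grid_le M_gt0 L0) _.
    have : 1 <= INR M / (2 * L) by apply/Rle_div_r; lra.
    have -> : INR M / L = INR M / (2 * L) + INR M / (2 * L) by field; lra.
    lra.
  by apply: Rmult_le_compat_l => //; apply: Rmult_le_pos.
apply: rsum_le => i _; set th := freq M i.
rewrite Cmod_mult Cmod_cprod.
set PT := Cmod (A th); set PX := \rprod_(h | ~~ T h) _.
have PT0 : 0 <= PT by apply: Cmod_ge_0.
have PX0 : 0 <= PX by apply: rprod_ge0 => h _; apply: Cmod_ge_0.
have f0 z : 0 < / (1 + z ^ 2) <= 1.
  have := pow2_ge_0 z => h; split; first by apply: Rinv_0_lt_compat; lra.
  by rewrite -Rinv_1; apply: Rinv_le_contravar; lra.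
have h0 : 0 <= B * Cmaj / L ^ j by apply: Rdiv_le_0_compat => //; apply: Rmult_le_pos.
case: RlebP => hth; rewrite [b2R _]/=.
  rewrite Rmult_0_l Rmult_0_r Rplus_0_r.
  have h1 : PX <= Cmaj * / (1 + (L * th) ^ 2) ^ 2.
    apply: (prod_phi_major e Hp r0 fT HNn c40 _ Hcnt); first lra.
    by move: hth; rewrite /N Rinv_inv.
  apply: Rle_trans (_ : (B * Rabs th ^ j) * (Cmaj * / (1 + (L * th) ^ 2) ^ 2) <= _).
    by apply: Rmult_le_compat => //; apply: HB.
  have h2 : (L * Rabs th) ^ j <= 1 + (L * th) ^ 2.
    have -> : (L * th) ^ 2 = (L * Rabs th) ^ 2.
      by rewrite !Rpow_mult_distr pow2_abs.
    set y := L * Rabs th; have y0 : 0 <= y by apply: Rmult_le_pos; [lra|exact: Rabs_pos].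
    by case: (j) j2 => [|[|[|j']]] //= _; nra.
  have h3 := f0 (L * th); set t := 1 + (L * th) ^ 2 in h1 h2 h3 *.
  have t0 : 0 < t by rewrite /t; have := pow2_ge_0 (L * th); lra.
  have -> : B * Rabs th ^ j * (Cmaj * / t ^ 2) =
     (B * Cmaj / L ^ j * / t) * ((L * Rabs th) ^ j / t) by rewrite Rpow_mult_distr; field; lra.
  rewrite -[X in _ <= X]Rmult_1_r; apply: Rmult_le_compat_l.
    by apply: Rmult_le_pos; lra.
  by apply/Rle_div_l; lra.
rewrite Rmult_1_l.
have h1 := prod_phi_minor e k0 Hp D0 r0 th fT.
apply: Rle_trans (_ : B' * (Cmin * exp (- (cdig * energy (pexp p D) n.+1 N th))) <= _).
  by apply: Rmult_le_compat => //; apply: HB'.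
have h2 : 0 <= B * Cmaj / L ^ j * / (1 + (L * th) ^ 2).
  by apply: Rmult_le_pos => //; have := f0 (L * th); lra.
lra.
Qed.

Lemma massw_le f (T : pred 'I_n.+1) B B' j : few k p D r T -> (j <= 2)%N ->
  (forall i, ~~ T i -> f i = (fun=> 1)) ->
  (forall th, \rprod_(i | T i) Cmod (charw d (W i) (f i) (th * INR i)) <= B * Rabs th ^ j) ->
  (forall th, \rprod_(i | T i) Cmod (charw d (W i) (f i) (th * INR i)) <= B') ->
  Rabs (massw d n W hv f) <= B * Cmaj / (L ^ j * L) + B' * Cmin * eps.
Proof.
move=> fT j2 Hf HB HB'.
apply: (fourier_sum_le (A := fun th => \big[Cmult/RtoC 1]_(i : 'I_n.+1 | T i)
   charw d (W i) (f i) (th * INR i)) fT j2).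
- rewrite massw_fourier; apply: eq_bigr => i _; rewrite (bigID T); congr (_ * _)%C.
  by apply: eq_bigr => h hT; rewrite Hf.
- by move=> th; rewrite Cmod_cprod.
- by move=> th; rewrite Cmod_cprod.
Qed.

(** Only the order of magnitude of the mass at [n] is needed. Frequencies up to [c1 / L] have real
    part near or above [1/2]; up to [K / L] the real part is almost nonnegative; further out the
    modulus is small. The subtracted terms are the Taylor error, the tail beyond [K / L], and the
    frequencies beyond [r]. *)
Lemma massw1_ge K c1 : 1 <= K -> K ^ 2 * Cmom <= 2 * lam ^ 2 ->
  0 < c1 -> c1 ^ 2 * (Cmom * Cu) <= 1 -> c1 <= K -> c1 / L < PI ->
  c1 / (2 * PI * 2) - (1 + K ^ 2) * (Cmom * Cu * K ^ 3 / lam) - Cmaj / (1 + K ^ 2) - Cmin * eps * L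
  <= L * massw d n W hv (fun _ _ => 1).
Proof.
move=> K1 HK c10 Hc1 c1K c1L; have L0 := L_gt0; have N0 := N_gt0; have PI0 := PI_RGT_0.
have hM : 0 < INR M by apply: (INR_ltn M_gt0).
have Cm := Cmaj_ge0; have Ci := Cmin_ge0; have Co := Cmom_ge1.
have lam2 : 0 < lam ^ 2 by apply: pow_lt; lra.
have Cu0 : 0 <= Cu.
  have : 0 <= Cu * lam ^ 2.
    apply: Rle_trans Hu; apply: rsum_ge0 => h _; exact: hump_ge0 (r_INR_ge0 h).
  by move=> h; apply: (Rmult_le_reg_r (lam ^ 2)) => //; lra.
pose Phi th := (\cprod_(i : 'I_n.+1 | true) phi e k p r i th)%C.
have EM : INR M * massw d n W hv (fun _ _ => 1) = \rsum_(j < M) Re (Phi (freq M j)).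
  by rewrite -Re_csum -massw_fourier.
(* The product is compared with that of the real numbers [1 - x h], which lie in [[0, 1]]: it is at
   least [1/2] for [|th| <= c1 / L] and nonnegative in any case. *)
have core th : Rabs th <= K / L ->
  (if Rle_dec (Rabs th) (c1 / L) then / 2 else 0) - Cmom * Cu * K ^ 3 / lam <= Re (Phi th).
  move=> hth.
  pose x (h : 'I_n.+1) := (th * INR h) ^ 2 / 2 * momw d (W h) 2.
  have a0 : 0 <= Rabs th by apply: Rabs_pos.
  have hLt : L * Rabs th <= K by rewrite Rmult_comm; apply/Rle_div_r.
  have xu h : 0 <= x h <= (N * Rabs th) ^ 2 / 2 * Cmom * uhump h.
    split.
      apply: Rmult_le_pos; last exact: (momw_ge0 (law_ldist _ _ _ r0 _)).
      by have := pow2_ge_0 (th * INR h); lra.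
    have := @momw_law_le h 2 isT; rewrite /x /W => h1.
    have -> : (th * INR h) ^ 2 / 2 * momw d (law d m p r h) 2 =
      (Rabs th ^ 2 / 2) * (INR h ^ 2 * momw d (law d m p r h) 2) by rewrite pow2_abs; field.
    have -> : (N * Rabs th) ^ 2 / 2 * Cmom * uhump h = (Rabs th ^ 2 / 2) * (Cmom * N ^ 2 * uhump h).
      by field.
    apply: Rmult_le_compat_l => //.
    by have := pow2_ge_0 (Rabs th); lra.
  have ENt : lam ^ 2 * (N * Rabs th) ^ 2 = (L * Rabs th) ^ 2 by rewrite /L; ring.
  have Ny : 0 <= (N * Rabs th) ^ 2 by apply: pow2_ge_0.
  have Lt0 : 0 <= L * Rabs th by apply: Rmult_le_pos; lra.
  have LtK : (L * Rabs th) ^ 2 <= K ^ 2 by apply: pow_incr.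
  have x1 h : 0 <= x h <= 1.
    have [h1 h2] := xu h; split=> //; apply: Rle_trans h2 _; have [u0 u1] := uhump_bounds h.
    have h3 : (N * Rabs th) ^ 2 / 2 * Cmom <= 1.
      apply: (Rmult_le_reg_l (lam ^ 2)) => //; nra.
    have h4 : 0 <= (N * Rabs th) ^ 2 / 2 * Cmom by nra.
    nra.
  have Hsub : Cmod (Phi th - RtoC (\rprod_(i : 'I_n.+1 | true) (1 - x i))) <= Cmom * Cu * K ^ 3 / lam.
    rewrite RtoC_rprod.
    apply: Rle_trans (Cmod_cprod_sub _ _ _) _.
    - by move=> i _; apply: Cmod_phi_le1.
    - by move=> i _; rewrite Cmod_R; apply: Rabs_le; have := x1 i; lra.
    apply: Rle_trans (_ : \rsum_(i < n.+1) ((N * Rabs th) ^ 3 * Cmom * uhump i) <= _).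
      apply: rsum_le => i _.
      apply: Rle_trans (charw_taylor2 (law_ldist _ _ _ r0 _) _) _.
      have := @momw_law_le i 3 isT => h1.
      have -> : Rabs (th * INR i) ^ 3 * momw d (law d m p r i) 3 =
        Rabs th ^ 3 * (INR i ^ 3 * momw d (law d m p r i) 3).
        by rewrite Rabs_mult (Rabs_pos_eq (INR i)); [ring|apply: pos_INR].
      have -> : (N * Rabs th) ^ 3 * Cmom * uhump i = Rabs th ^ 3 * (Cmom * N ^ 3 * uhump i) by ring.
      by apply: Rmult_le_compat_l => //; apply: pow_le.
    rewrite rsum_scal.
    have h1 : 0 <= (N * Rabs th) ^ 3 * Cmom.
      by apply: Rmult_le_pos; [apply: pow_le; apply: Rmult_le_pos; lra|lra].
    apply: Rle_trans (Rmult_le_compat_l _ _ _ h1 sum_uhump_le) _.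
    have -> : (N * Rabs th) ^ 3 * Cmom * (Cu * lam ^ 2) = (L * Rabs th) ^ 3 * (Cmom * Cu / lam).
      by rewrite /L; field; lra.
    have -> : Cmom * Cu * K ^ 3 / lam = K ^ 3 * (Cmom * Cu / lam) by field; lra.
    apply: Rmult_le_compat_r.
      by apply: Rdiv_le_0_compat; [apply: Rmult_le_pos; lra|lra].
    by apply: pow_incr.
  have hRe : Rabs (Re (Phi th - RtoC (\rprod_(i : 'I_n.+1 | true) (1 - x i)))) <= Cmom * Cu * K ^ 3 / lam.
    by apply: Rle_trans (re_le_Cmod _) _.
  have -> : Re (Phi th) = Re (Phi th - RtoC (\rprod_(i : 'I_n.+1 | true) (1 - x i))) + \rprod_(i : 'I_n.+1 | true) (1 - x i).
    by rewrite Re_sub_R; ring.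
  suff h : (if Rle_dec (Rabs th) (c1 / L) then / 2 else 0) <= \rprod_(i : 'I_n.+1 | true) (1 - x i).
    by have := Rabs_le_between (Re (Phi th - RtoC (\rprod_(i : 'I_n.+1 | true) (1 - x i)))) (Cmom * Cu * K ^ 3 / lam) => -[/(_ hRe) h' _]; lra.
  case: Rle_dec => hc; last by apply: rprod_ge0 => i _; have := x1 i; lra.
  have hp := @rprod_ge_1sum _ (index_enum 'I_n.+1) (fun=> true) x (fun i _ => x1 i).
  apply: Rle_trans hp.
  suff h : \rsum_(i < n.+1) x i <= / 2.
    apply: (Rle_trans _ (1 - / 2)); first lra.
    by apply: Rplus_le_compat_l; apply: Ropp_le_contravar; exact: h.
  apply: Rle_trans (_ : \rsum_(i < n.+1) ((N * Rabs th) ^ 2 / 2 * Cmom * uhump i) <= _).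
    by apply: rsum_le => i _; have := xu i; lra.
  rewrite rsum_scal.
  have h1 : 0 <= (N * Rabs th) ^ 2 / 2 * Cmom by nra.
  apply: Rle_trans (Rmult_le_compat_l _ _ _ h1 sum_uhump_le) _.
  have -> : (N * Rabs th) ^ 2 / 2 * Cmom * (Cu * lam ^ 2) = (L * Rabs th) ^ 2 * (Cmom * Cu) / 2.
    by rewrite -ENt; field.
  have hLc : L * Rabs th <= c1 by rewrite Rmult_comm; apply/Rle_div_r.
  have h2 : (L * Rabs th) ^ 2 <= c1 ^ 2 by apply: pow_incr.
  have h3 : 0 <= Cmom * Cu by apply: Rmult_le_pos; lra.
  have : (L * Rabs th) ^ 2 * (Cmom * Cu) <= c1 ^ 2 * (Cmom * Cu) by apply: Rmult_le_compat_r.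
  lra.
have f0 x : 0 < / (1 + x ^ 2) <= 1.
  have := pow2_ge_0 x => h; split; first by apply: Rinv_0_lt_compat; lra.
  by rewrite -Rinv_1; apply: Rinv_le_contravar; lra.
have K2 : 0 < 1 + K ^ 2 by have := pow2_ge_0 K; lra.
set E3 := Cmom * Cu * K ^ 3 / lam in core *.
have E30 : 0 <= E3.
  apply: Rdiv_le_0_compat; last lra.
  by apply: Rmult_le_pos; [apply: Rmult_le_pos; lra|apply: pow_le; lra].
have fewF : few k p D r (fun _ : 'I_n.+1 => false) by rewrite /few big_pred0 //; lra.
(* A minorant at all frequencies, combined from functions whose grid sums are known. Below [K / L]
   the factor [1 + K^2] outweighs [1 + (L theta)^2]; beyond, one of the two decaying factors
   supplies [1 / (1 + K^2)]. *)
have pt j : (j < M)%N -> / 2 * b2R (Rleb (Rabs (freq M j)) (c1 / L)) +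
   (- ((1 + K ^ 2) * E3 + Cmaj / (1 + K ^ 2)) * / (1 + (L * freq M j) ^ 2) +
   - Cmin * (b2R (~~ Rleb (Rabs (freq M j)) (/ N)) *
      exp (- (cdig * energy (pexp p D) n.+1 N (freq M j)))))
   <= Re (Phi (freq M j)).
  move=> jM; set th := freq M j; have ft := f0 (L * th).
  set ex := exp _; have ex0 : 0 < ex by apply: exp_pos.
  have hmaj0 : 0 <= Cmaj / (1 + K ^ 2) by apply: Rdiv_le_0_compat.
  have b0 := b2R_ge0 (~~ Rleb (Rabs th) (/ N)).
  have bex : 0 <= Cmin * (b2R (~~ Rleb (Rabs th) (/ N)) * ex).
    by apply: Rmult_le_pos => //; apply: Rmult_le_pos; lra.
  have EPhi : Cmod (Phi th) = \rprod_(h : 'I_n.+1 | ~~ false) Cmod (phi e k p r h th).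
    by rewrite /Phi Cmod_cprod.
  have hPhi : - Cmod (Phi th) <= Re (Phi th).
    by have := re_le_Cmod (Phi th); have := Rabs_le_between (Re (Phi th)) (Cmod (Phi th)) => -[H _] /H; lra.
  have HLt : (L * th) ^ 2 = (L * Rabs th) ^ 2 by rewrite !Rpow_mult_distr pow2_abs.
  have Lt0 : 0 <= L * Rabs th by apply: Rmult_le_pos; [lra|exact: Rabs_pos].
  case: (Rle_dec (Rabs th) (K / L)) => hK.
    have := core th hK; have -> : (if Rle_dec (Rabs th) (c1 / L) then / 2 else 0) =
      / 2 * b2R (Rleb (Rabs th) (c1 / L)).
      by rewrite /Rleb; case: Rle_dec => _ /=; ring.
    have h1 : 1 <= (1 + K ^ 2) * / (1 + (L * th) ^ 2).
      rewrite HLt; have : (L * Rabs th) ^ 2 <= K ^ 2.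
        by apply: pow_incr; split=> //; rewrite Rmult_comm; apply/Rle_div_r.
      have := pow2_ge_0 (L * Rabs th) => h2 h3; apply/Rle_div_r; lra.
    have h2 : E3 <= E3 * ((1 + K ^ 2) * / (1 + (L * th) ^ 2)) by nra.
    have h3 : 0 <= Cmaj / (1 + K ^ 2) * / (1 + (L * th) ^ 2) by nra.
    lra.
  have hc : (Rleb (Rabs th) (c1 / L)) = false.
    apply/RlebP => h; apply: hK; apply: Rle_trans h _.
    by apply: Rmult_le_compat_r => //; apply: Rlt_le; apply: Rinv_0_lt_compat.
  rewrite hc [b2R false]/= Rmult_0_r Rplus_0_l.
  have h4 : 0 <= (1 + K ^ 2) * E3 * / (1 + (L * th) ^ 2).
    by apply: Rmult_le_pos; [apply: Rmult_le_pos|]; lra.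
  apply: Rle_trans hPhi; rewrite EPhi.
  case: RlebP => hth; rewrite [b2R _]/=.
    rewrite Rmult_0_l Rmult_0_r Rplus_0_r.
    have h1 : \rprod_(h : 'I_n.+1 | ~~ false) Cmod (phi e k p r h th) <= Cmaj * / (1 + (L * th) ^ 2) ^ 2.
      apply: (prod_phi_major e Hp r0 fewF HNn c40 _ Hcnt); first lra.
      by move: hth; rewrite /N Rinv_inv.
    have h2 : Cmaj * / (1 + (L * th) ^ 2) ^ 2 <= Cmaj / (1 + K ^ 2) * / (1 + (L * th) ^ 2).
      have h3 : K ^ 2 <= (L * th) ^ 2.
        rewrite HLt; apply: pow_incr; split; first lra.
        by rewrite Rmult_comm; apply/Rle_div_l => //; lra.
      have -> : / (1 + (L * th) ^ 2) ^ 2 = / (1 + (L * th) ^ 2) * / (1 + (L * th) ^ 2).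
        by rewrite -Rinv_mult; congr (/ _); ring.
      rewrite /Rdiv Rmult_assoc; apply: Rmult_le_compat_l => //.
      by apply: Rmult_le_compat_r; [lra|apply: Rinv_le_contravar; lra].
    lra.
  rewrite Rmult_1_l.
  have h1 := prod_phi_minor e k0 Hp D0 r0 th fewF.
  have h2 : \rprod_(h : 'I_n.+1 | ~~ false) Cmod (phi e k p r h th) <= Cmin * ex by exact: h1.
  have h3 : 0 <= Cmaj / (1 + K ^ 2) * / (1 + (L * th) ^ 2) by nra.
  lra.
have Hs : \rsum_(j < M) Re (Phi (freq M j)) >=
   / 2 * (INR M * (c1 / L) / (2 * PI)) - ((1 + K ^ 2) * E3 + Cmaj / (1 + K ^ 2)) * (INR M / L)
   - Cmin * (INR M * eps).
  apply: Rle_ge.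
  have hp := @rsum_le _ (index_enum 'I_M) (fun=> true) _ _ (fun (j : 'I_M) _ => pt j (ltn_ord j)).
  apply: Rle_trans hp.
  rewrite !rsum_add !rsum_scal.
  have g1 : INR M * (c1 / L) / (2 * PI) <= \rsum_(j < M) b2R (Rleb (Rabs (freq M j)) (c1 / L)).
    apply: count_grid_ge; first exact: M_gt0.
    by split=> //; apply: Rdiv_le_0_compat; lra.
  have g2 : \rsum_(j < M) / (1 + (L * freq M j) ^ 2) <= INR M / L.
    apply: Rle_trans (sum_grid_le M_gt0 L0) _.
    have : 1 <= INR M / (2 * L) by apply/Rle_div_r; lra.
    have -> : INR M / L = INR M / (2 * L) + INR M / (2 * L) by field; lra.
    lra.
  have g3 : 0 <= (1 + K ^ 2) * E3 + Cmaj / (1 + K ^ 2).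
    apply: Rplus_le_le_0_compat; first by apply: Rmult_le_pos; lra.
    by apply: Rdiv_le_0_compat.
  have g4 := Rmult_le_compat_l _ _ _ g3 g2.
  have g5 := Rmult_le_compat_l _ _ _ Ci Hmin.
  set S1 := \rsum_(j < M) b2R (Rleb (Rabs (freq M j)) (c1 / L)) in g1 *.
  set S2 := \rsum_(j < M) / (1 + (L * freq M j) ^ 2) in g2 g4 *.
  set S3 := \rsum_(j < M) (b2R (~~ Rleb (Rabs (freq M j)) (/ N)) * _) in g5 *.
  lra.
apply: (Rmult_le_reg_l (INR M)) => //.
have -> : INR M * (L * massw d n W hv (fun _ _ => 1)) = L * (INR M * massw d n W hv (fun _ _ => 1)) by ring.
rewrite EM; apply: Rle_trans (Rmult_le_compat_l _ _ _ (Rlt_le _ _ L0) (Rge_le _ _ Hs)).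
by apply: Req_le; field; lra.
Qed.

End Regime.

(** * Uniform expectation over representations *)

Section UniformExpectation.
Variables (e m : nat) (p : nat -> nat) (n : nat).
Let d := e.+2.
Hypothesis Hp : forall i, (i < m)%N -> (1 < p i)%N.
Implicit Types g : {ffun 'I_n.+1 -> 'I_d} -> R.

Definition RE g : R :=
  (\big[Rplus/0]_(a | @is_rep d m p n a) g a) / INR (Pcount d m p n).

Lemma foldr_rsum (T : Type) (s : seq T) (g : T -> R) :
  foldr Rplus 0 (map g s) = \rsum_(a <- s) g a.
Proof. by elim: s => [|x s IH]; rewrite ?big_nil //= big_cons IH. Qed.

Lemma rsum_reps g : \rsum_(a <- reps d m p n) g a = \big[Rplus/0]_(a | @is_rep d m p n a) g a.
Proof. by rewrite /reps big_filter big_enum_cond; apply: eq_bigl. Qed.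

Lemma Pcount_rsum : INR (Pcount d m p n) = \big[Rplus/0]_(a | @is_rep d m p n a) 1.
Proof. by rewrite -rsum_reps rsum_const count_predT Rmult_1_l. Qed.

Lemma EW_RE : EW d m p n = RE (fun a => INR (@weight d n a)).
Proof. by rewrite /EW foldr_rsum rsum_reps. Qed.

Lemma VarW_RE : VarW d m p n = RE (fun a => (INR (@weight d n a) - EW d m p n) ^ 2).
Proof. by rewrite /VarW foldr_rsum rsum_reps. Qed.

Lemma ProbLe_RE x : ProbLe d m p n x =
  RE (fun a => b2R (Rleb ((INR (@weight d n a) - EW d m p n) / sqrt (VarW d m p n)) x)).
Proof.
rewrite /ProbLe /RE -rsum_reps; congr (_ / _).
by elim: (reps d m p n) => [|a s IH]; rewrite ?big_nil // big_cons -IH /= INR_add; case: (Rleb _ x).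
Qed.

Hypothesis P0 : (0 < Pcount d m p n)%N.

Let P0' : 0 < INR (Pcount d m p n). Proof. exact: (INR_ltn P0). Qed.

Lemma eq_RE g g' : (forall a, @is_rep d m p n a -> g a = g' a) -> RE g = RE g'.
Proof. by move=> H; congr (_ / _); apply: eq_bigr. Qed.

Lemma RE_le g g' : (forall a, @is_rep d m p n a -> g a <= g' a) -> RE g <= RE g'.
Proof.
move=> H; apply: Rmult_le_compat_r; first by apply: Rlt_le; apply: Rinv_0_lt_compat.
exact: rsum_le.
Qed.

Lemma RE_add g g' : RE (fun a => g a + g' a) = RE g + RE g'.
Proof. by rewrite /RE rsum_add; field; lra. Qed.

Lemma RE_sub g g' : RE (fun a => g a - g' a) = RE g - RE g'.
Proof. by rewrite /RE rsum_sub; field; lra. Qed.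

Lemma RE_scal c g : RE (fun a => c * g a) = c * RE g.
Proof. by rewrite /RE rsum_scal; field; lra. Qed.

Lemma RE_const c : RE (fun=> c) = c.
Proof.
rewrite -[c in LHS]Rmult_1_r RE_scal /RE -Pcount_rsum; field; lra.
Qed.

Lemma RE_sum (J : Type) (s : seq J) (P : pred J) (G : J -> {ffun 'I_n.+1 -> 'I_d} -> R) :
  RE (fun a => \rsum_(i <- s | P i) G i a) = \rsum_(i <- s | P i) RE (G i).
Proof. by rewrite /RE exchange_big /= /Rdiv -rsum_scalr. Qed.

Lemma RE_var g c : RE (fun a => (g a - RE g) ^ 2) = RE (fun a => (g a - c) ^ 2) - (RE g - c) ^ 2.
Proof.
set mu := RE g.
rewrite (@eq_RE _ (fun a => (g a - c) ^ 2 + (2 * (c - mu) * g a + (mu ^ 2 - c ^ 2)))); last first.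
  by move=> a _; ring.
by rewrite RE_add RE_add RE_scal RE_const -/mu; ring.
Qed.

Lemma RE_chebyshev g t : 0 < t ->
  RE (fun a => b2R (~~ Rleb (Rabs (g a)) t)) <= RE (fun a => g a ^ 2) / t ^ 2.
Proof.
move=> t0; have t2 : 0 < t ^ 2 by apply: pow_lt.
rewrite /Rdiv Rmult_comm -RE_scal; apply: RE_le => a _.
have it : 0 < / t ^ 2 by apply: Rinv_0_lt_compat.
have g0 := pow2_ge_0 (g a).
case: RlebP => h; rewrite [b2R _]/=; first by apply: Rmult_le_pos; lra.
have h1 : t ^ 2 <= g a ^ 2 by rewrite -(pow2_abs (g a)); apply: pow_incr; lra.
apply: (Rmult_le_reg_l (t ^ 2)) => //.
by rewrite -Rmult_assoc Rinv_r; lra.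
Qed.

Variable r : R.
Hypothesis r0 : 0 < r.
Let W (h : 'I_n.+1) : nat -> R := law d m p r h.
Let hv (h : 'I_n.+1) : nat := h.

Definition wt (a : {ffun 'I_n.+1 -> 'I_d}) : R := b2R (wsum hv a == n) * \rprod_i W i (a i).

Lemma massw_wt f : massw d n W hv f = \big[Rplus/0]_a (wt a * \rprod_i f i (a i)).
Proof.
by apply: eq_bigr => a _; rewrite /wt big_split /=; ring.
Qed.

(** The weight that every representation of [n] has under the product law: the tilt depends on the
    digits only through the sum of the [h * a(h)]. *)
Definition repc : R := exp (- (r * INR n)) / \rprod_(h : 'I_n.+1 | inS m p h) Zt d (r * INR h).

Lemma rh_ge0 h : 0 <= r * INR h.
Proof. by apply: Rmult_le_pos; [lra|apply: pos_INR]. Qed.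

Lemma repc_gt0 : 0 < repc.
Proof.
apply: Rdiv_lt_0_compat; first exact: exp_pos.
by apply: rprod_gt0 => h _; have := Zt_bounds e (rh_ge0 h); rewrite -/d; lra.
Qed.

Lemma wt_rep a : wt a = b2R (@is_rep d m p n a) * repc.
Proof.
rewrite /wt /is_rep -/(wsum hv a); case: eqP => Hs; last by rewrite andbF /=; ring.
rewrite andbT Rmult_1_l; case: forallP => Hsup /=; last first.
  rewrite Rmult_0_l.
  have /forallPn [h] : ~~ [forall h : 'I_n.+1, (nat_of_ord (a h) != 0%N) ==> inS m p h].
    by apply/negP => /forallP.
  rewrite negb_imply => /andP [h1 h2].
  rewrite (bigD1 h) //= /W /law (negbTE h2) (negbTE h1) /=; ring.
rewrite Rmult_1_l /repc.
have -> : exp (- (r * INR n)) = \rprod_(h : 'I_n.+1 | inS m p h) exp (- (r * INR h * INR (a h))).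
  rewrite rprod_exp; congr exp; rewrite -[n in LHS]Hs /wsum INR_sum.
  have E x : - x = -1 * x by ring.
  rewrite E -!rsum_scal [RHS]big_mkcond; apply: eq_bigr => h _.
  case: ifP => Sh; first by rewrite INR_mul /hv /=; ring.
  have := Hsup h; rewrite Sh implybF negbK => /eqP ->.
  by rewrite muln0 /=; ring.
rewrite -rprod_div; last first.
  by move=> h _; have := Zt_bounds e (rh_ge0 h); rewrite -/d; lra.
rewrite [RHS]big_mkcond; apply: eq_bigr => h _; rewrite /W /law.
case: ifP => Sh //=.
by have := Hsup h; rewrite Sh implybF negbK => ->.
Qed.

Lemma massw1_Pcount : massw d n W hv (fun _ _ => 1) = repc * INR (Pcount d m p n).
Proof.
rewrite massw_wt Pcount_rsum -rsum_scal [RHS]big_mkcond; apply: eq_bigr => a _.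
by rewrite wt_rep big1 //; case: (is_rep _ _ _) => /=; ring.
Qed.

Lemma RE_prod (f : 'I_n.+1 -> nat -> R) :
  RE (fun a => \rprod_i f i (a i)) = massw d n W hv f / massw d n W hv (fun _ _ => 1).
Proof.
rewrite massw1_Pcount.
have -> : massw d n W hv f = repc * \big[Rplus/0]_(a | @is_rep d m p n a) \rprod_i f i (a i).
  rewrite massw_wt -rsum_scal [RHS]big_mkcond; apply: eq_bigr => a _.
  by rewrite wt_rep; case: (is_rep _ _ _) => /=; ring.
by rewrite /RE /=; field; have := repc_gt0; lra.
Qed.

Lemma weight_sum a : @is_rep d m p n a ->
  INR (@weight d n a) = \big[Rplus/0]_(h : 'I_n.+1 | inS m p h) nz (a h).
Proof.
move=> /andP [/forallP Hsup _]; rewrite /weight -rsum_count.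
rewrite [LHS]big_mkcond [RHS]big_mkcond; apply: eq_bigr => h _ /=.
have := Hsup h; rewrite /nz; case: (nat_of_ord (a h) != 0%N) => /=; first by move=> ->.
by move=> _; case: ifP.
Qed.

End UniformExpectation.

(** * Moments of digits of a random representation *)

Lemma charw_sub1_le d w s : ldist d w ->
  Cmod (charw d w (fun=> 1) s - 1) <= Rabs s * momw d w 1.
Proof.
move=> Hw.
have -> : (charw d w (fun=> 1%re) s - 1 =
    (\csum_(j < d) (RtoC (w j) * (expi (s * (INR j - muw d w))%re - RtoC 1))%C))%C.
  transitivity (charw d w (fun=> 1%re) s - RtoC (Ew d w (fun=> 1%re)))%C; first by rewrite Ew_const.
  rewrite /charw /Ew RtoC_rsum.
  have E (x y : C) : (x - y = x + (- RtoC 1) * y)%C by ring.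
  rewrite E (big_distrr (times := Cmult)) -big_split; apply: eq_bigr => j _; rewrite Rmult_1_r; simpl; ring.
apply: Rle_trans (Cmod_csum _ _ _) _; rewrite -Ew_scal; apply: rsum_le => j _.
have w0 : 0 <= w j by case: Hw.
rewrite Cmod_mult Cmod_R (Rabs_pos_eq (w j)) //; apply: Rmult_le_compat_l => //.
by apply: Rle_trans (expi_sub1_le _) _; rewrite Rabs_mult pow_1; apply: Rle_refl.
Qed.

(* The estimates at the saddle point [r] that all later bounds rely on: [lam ^ 2] is the order of
   [ln n ^ k], [lam * / r] that of the standard deviation of the sum, and [eps] the average over the
   frequencies of the minor arc bound. *)
Record regime (e k : nat) (p : nat -> nat) (D : nat) (c4 Cu cden : R)
   (n : nat) (r lam eps : R) : Prop := Regime {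
  rg_r : 0 < r;
  rg_lam : 1 <= lam;
  rg_eps : 0 <= eps;
  rg_mean : \rsum_(h < n.+1) (INR h * muw e.+2 (law e.+2 k.+1 p r h)) = INR n;
  rg_N : / r < INR n.+1;
  rg_cnt : c4 * lam ^ 2 + 2 <= cnt k p n.+1 (/ r);
  rg_hump : \rsum_(h < n.+1 | inS k.+1 p h) hump (r * INR h) <= Cu * lam ^ 2;
  rg_minor : exists J, [/\ \rsum_(i < pexp p D 0 ^ J)
      (b2R (~~ Rleb (Rabs (freq (pexp p D 0 ^ J) i)) (/ / r)) *
      exp (- (cdig e * energy (pexp p D) n.+1 (/ r) (freq (pexp p D 0 ^ J) i))))
        <= INR (pexp p D 0 ^ J) * eps,
      (n < pexp p D 0 ^ J)%N,
      forall a : {ffun 'I_n.+1 -> 'I_e.+2},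
        (wsum (fun h : 'I_n.+1 => nat_of_ord h) a < pexp p D 0 ^ J)%N &
      2 * (lam * / r) <= INR (pexp p D 0 ^ J)];
  rg_den : cden <= lam * / r *
     massw e.+2 n (fun h : 'I_n.+1 => law e.+2 k.+1 p r h) (fun h => nat_of_ord h) (fun _ _ => 1);
  rg_tiny : eps * (lam * / r) * (cnt k.+1 p n.+1 (INR n) + 1) ^ 2 <= 1
}.

Section Moments.
Variables (e k : nat) (p : nat -> nat) (D : nat) (c4 Cu cden : R).
Hypotheses (k0 : (0 < k)%N) (Hp : coprime_bases k.+1 p) (D0 : (0 < D)%N) (c40 : 0 < c4)
  (cden0 : 0 < cden).
Variables (n : nat) (r lam eps : R).
Hypothesis Hrg : regime e k p D c4 Cu cden n r lam eps.
Let d := e.+2.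
Let m := k.+1.
Let L := lam * / r.
Let W (h : 'I_n.+1) : nat -> R := law d m p r h.
Let hv (h : 'I_n.+1) : nat := h.
Let RE := @RE e m p n.
Let mw1 := massw d n W hv (fun _ _ => 1).

Definition qn (h : nat) : R := Ew d (law d m p r h) nz.
Definition Ca := Cmom e * Cmaj e k p c4 / cden.
Definition Cb := Cmom e ^ 2 * Cmaj e k p c4 / cden.
Definition Ce := Cmin e / cden.

Let r0 : 0 < r := rg_r Hrg.
Let lam1 : 1 <= lam := rg_lam Hrg.
Let N0 : 0 < / r. Proof. exact: Rinv_0_lt_compat. Qed.
Let L0 : 0 < L. Proof. by apply: Rmult_lt_0_compat N0; lra. Qed.
Let mw1_ge : cden / L <= mw1.
Proof. by apply/Rle_div_l => //; rewrite Rmult_comm; exact: (rg_den Hrg). Qed.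
Let mw10 : 0 < mw1.
Proof. by have := mw1_ge; have : 0 < cden / L by [apply: Rdiv_lt_0_compat]; lra. Qed.

Let Hpos i : (i < m)%N -> (1 < p i)%N. Proof. by case: Hp => H _; apply: H. Qed.

Lemma Pcount_gt0 : (0 < Pcount d m p n)%N.
Proof.
rewrite lt0n; apply/eqP => h.
have := massw1_Pcount e m p n r0; rewrite -/d -/W -/hv -/mw1 h [INR 0]/= Rmult_0_r.
by have := mw10; lra.
Qed.

Lemma Ca_ge0 : 0 <= Ca.
Proof.
apply: Rdiv_le_0_compat => //; apply: Rmult_le_pos; last exact: Cmaj_ge0.
by have := Cmom_ge1 e; lra.
Qed.

Lemma Cb_ge0 : 0 <= Cb.
Proof.
apply: Rdiv_le_0_compat => //; apply: Rmult_le_pos; last exact: Cmaj_ge0.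
exact: pow2_ge_0.
Qed.

Lemma Ce_ge0 : 0 <= Ce.
Proof. by apply: Rdiv_le_0_compat => //; exact: Cmin_ge0. Qed.

Lemma inv_mw1_le x : 0 <= x -> x / mw1 <= x * L / cden.
Proof.
move=> x0; have h : / mw1 <= L / cden.
  have -> : L / cden = / (cden / L) by field; lra.
  by apply: Rinv_le_contravar => //; apply: Rdiv_lt_0_compat.
by have := Rmult_le_compat_l _ _ _ x0 h; rewrite /Rdiv Rmult_assoc.
Qed.

(** Division by the mass at [n], at least [cden / L], cancels one [L] and leaves the relative gain
    [1 / L^j]. *)
Lemma cond_le f (T : pred 'I_n.+1) B j : few k p D r T -> (j <= 2)%N ->
  (forall i, ~~ T i -> f i = (fun=> 1)) ->
  (forall th, \rprod_(i | T i) Cmod (charw d (W i) (f i) (th * INR i)) <= B * Rabs th ^ j) ->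
  (forall th, \rprod_(i | T i) Cmod (charw d (W i) (f i) (th * INR i)) <= 1) ->
  Rabs (RE (fun a => \rprod_i f i (a i))) <= B * Cmaj e k p c4 / L ^ j / cden + Ce * (eps * L).
Proof.
move=> fT j2 Hf HB HB'.
have [J [Hmin HM1 HM2 HM3]] := rg_minor Hrg.
have H := massw_le k0 Hp D0 c40 r0 lam1 (rg_mean Hrg) (rg_N Hrg) (rg_cnt Hrg) Hmin HM1 HM2 HM3 fT j2 Hf HB HB'.
rewrite /RE (RE_prod Pcount_gt0 r0) -/d -/W -/hv -/mw1 Rabs_div ?(Rabs_pos_eq mw1); try lra.
have Lj : 0 < L ^ j by apply: pow_lt.
apply: Rle_trans (inv_mw1_le (Rabs_pos _)) _.
have -> : B * Cmaj e k p c4 / L ^ j / cden + Ce * (eps * L) =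
  (B * Cmaj e k p c4 / (L ^ j * L) + 1 * Cmin e * eps) * L / cden by rewrite /Ce; field; lra.
apply: Rmult_le_compat_r; first by apply: Rlt_le; apply: Rinv_0_lt_compat.
by apply: Rmult_le_compat_r; [lra|exact: H].
Qed.

Lemma mom1_law_le h : INR h * momw d (law d m p r h) 1 <= Cmom e * / r * uhump k p r h.
Proof. by have := momw_law_le e k p r0 h (j := 1) isT; rewrite !pow_1. Qed.

Lemma charw_law_centered h b th : (forall j, Rabs (b j) <= 1) -> Ew d (law d m p r h) b = 0 ->
  Cmod (charw d (law d m p r h) b (th * INR h)) <= Cmom e * / r * uhump k p r h * Rabs th.
Proof.
move=> b1 b0; apply: Rle_trans (charw_centered_le (law_ldist e k p r0 h) _ b1 b0) _.
rewrite Rabs_mult (Rabs_pos_eq (INR h)); last exact: pos_INR.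
rewrite Rmult_assoc Rmult_comm; apply: Rmult_le_compat_r; first exact: Rabs_pos.
exact: mom1_law_le.
Qed.

(** The transform is [O(theta / r)], and [1 / r] against the cost [L = lam / r] of one power of
    [theta] leaves [1 / lam]. *)
Lemma RE_centered1 (h : 'I_n.+1) b : (forall j, Rabs (b j) <= 1) -> Ew d (W h) b = 0 ->
  Rabs (RE (fun a => b (a h))) <= Ca * uhump k p r h / lam + Ce * (eps * L).
Proof.
move=> b1 b0.
pose f (i : 'I_n.+1) : nat -> R := if i == h then b else fun=> 1.
have -> : RE (fun a => b (a h)) = RE (fun a => \rprod_i f i (a i)).
  congr (_ / _); apply: eq_bigr => a _.
  by rewrite (bigD1 h) //= /f eqxx big1 ?Rmult_1_r // => i /negbTE ->.
have Eprod th : \rprod_(i | pred2 h h i) Cmod (charw d (W i) (f i) (th * INR i)) =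
   Cmod (charw d (W h) b (th * INR h)).
  by rewrite (big_pred1 h) /f ?eqxx // => i /=; rewrite orbb.
have H := @cond_le f (pred2 h h) (Cmom e * / r * uhump k p r h) 1 (few_pred2 k p D r h h) isT.
have -> : Ca * uhump k p r h / lam = Cmom e * / r * uhump k p r h * Cmaj e k p c4 / L ^ 1 / cden.
  by rewrite /Ca /L pow_1; field; lra.
apply: H.
- by move=> i; rewrite /= orbb /f => /negbTE ->.
- by move=> th; rewrite Eprod pow_1; apply: charw_law_centered.
- by move=> th; rewrite Eprod; apply: charw_le1 b1; apply: law_ldist.
Qed.

Lemma RE_centered2 (h h' : 'I_n.+1) b b' : h' != h ->
  (forall j, Rabs (b j) <= 1) -> Ew d (W h) b = 0 ->
  (forall j, Rabs (b' j) <= 1) -> Ew d (W h') b' = 0 ->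
  Rabs (RE (fun a => b (a h) * b' (a h'))) <=
  Cb * (uhump k p r h * uhump k p r h') / lam ^ 2 + Ce * (eps * L).
Proof.
move=> hh b1 b0 b'1 b'0.
pose f (i : 'I_n.+1) : nat -> R := if i == h then b else if i == h' then b' else fun=> 1.
have -> : RE (fun a => b (a h) * b' (a h')) = RE (fun a => \rprod_i f i (a i)).
  congr (_ / _); apply: eq_bigr => a _.
  rewrite (bigD1 h) //= (bigD1 h') //= /f !eqxx (negbTE hh) big1 ?Rmult_1_r // => i.
  by move=> /andP [/negbTE -> /negbTE ->].
have Eprod th : \rprod_(i | pred2 h h' i) Cmod (charw d (W i) (f i) (th * INR i)) =
   Cmod (charw d (W h) b (th * INR h)) * Cmod (charw d (W h') b' (th * INR h')).
  rewrite (bigD1 h) /= ?eqxx // (big_pred1 h') /f ?eqxx ?(negbTE hh) // => i /=.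
  by case: eqP => [->|_] //=; rewrite ?andbF ?andbT // eq_sym (negbTE hh).
have H := @cond_le f (pred2 h h') ((Cmom e * / r * uhump k p r h) * (Cmom e * / r * uhump k p r h'))
   2 (few_pred2 k p D r h h') isT.
have -> : Cb * (uhump k p r h * uhump k p r h') / lam ^ 2 =
  (Cmom e * / r * uhump k p r h) * (Cmom e * / r * uhump k p r h') * Cmaj e k p c4 / L ^ 2 / cden.
  by rewrite /Cb /L; field; lra.
apply: H.
- by move=> i; rewrite /= negb_or /f => /andP [/negbTE -> /negbTE ->].
- move=> th; rewrite Eprod.
  have h1 := charw_law_centered th b1 b0; have h2 := charw_law_centered th b'1 b'0.
  apply: (Rle_trans _ ((Cmom e * / r * uhump k p r h * Rabs th) * (Cmom e * / r * uhump k p r h' * Rabs th))).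
    by apply: Rmult_le_compat => //; exact: Cmod_ge_0.
  by apply: Req_le; ring.
- move=> th; rewrite Eprod.
  have h1 : Cmod (charw d (W h) b (th * INR h)) <= 1 := charw_le1 (law_ldist e k p r0 h) (th * INR h) b1.
  have h2 : Cmod (charw d (W h') b' (th * INR h')) <= 1 := charw_le1 (law_ldist e k p r0 h') (th * INR h') b'1.
  have := Cmod_ge_0 (charw d (W h) b (th * INR h)); have := Cmod_ge_0 (charw d (W h') b' (th * INR h')).
  nra.
Qed.

Let bc (h : nat) (j : nat) : R := nz j - qn h.

Lemma qn_bounds h : 0 <= qn h <= 1.
Proof.
have Hw := law_ldist e k p r0 h.
split; first by apply: (Ew_ge0 Hw) => j _; apply: b2R_ge0.
by rewrite -[X in _ <= X](Ew_const Hw 1); apply: (Ew_le Hw) => j _; apply: b2R_le1.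
Qed.

Lemma bc_le1 h j : Rabs (bc h j) <= 1.
Proof.
have := qn_bounds h; have := b2R_ge0 (j != 0%N); have := b2R_le1 (j != 0%N).
by rewrite /bc /nz => *; apply: Rabs_le; lra.
Qed.

Lemma bc_centered h : Ew d (law d m p r h) (bc h) = 0.
Proof.
have Hw := law_ldist e k p r0 h.
have -> : 0 = qn h + -1 * Ew d (law d m p r h) (fun=> qn h) by rewrite (Ew_const Hw); ring.
by rewrite -Ew_scal /qn -Ew_add; apply: eq_bigr => j _; rewrite /bc /qn; ring.
Qed.

Let b2 (h : nat) (j : nat) : R := bc h j ^ 2 - qn h * (1 - qn h).

Lemma b2_le1 h j : Rabs (b2 h j) <= 1.
Proof.
have := qn_bounds h; rewrite /b2 /bc /nz; case: (j != 0%N) => /= *; apply: Rabs_le; split; nra.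
Qed.

(** For a variable [X] with values 0 and 1, [(X - q)^2 - q (1 - q) = (1 - 2 q) (X - q)]. *)
Lemma b2_centered h : Ew d (law d m p r h) (b2 h) = 0.
Proof.
have Hw := law_ldist e k p r0 h.
have -> : 0 = (1 - 2 * qn h) * Ew d (law d m p r h) (bc h) + 0 by rewrite bc_centered; ring.
rewrite -Ew_scal -(Ew_const Hw 0) -Ew_add; apply: eq_bigr => j _; congr (_ * _).
by rewrite /b2 /bc /nz; case: (nat_of_ord j != 0%N) => /=; ring.
Qed.

Let nS := cnt m p n.+1 (INR n).

Lemma sum_inS_count : \big[Rplus/0]_(h : 'I_n.+1 | inS m p h) 1 = nS.
Proof.
apply: eq_bigr => h _; case: RlebP => // -[].
by apply: INR_leq; rewrite -ltnS.
Qed.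

Section SubFamily.
Variable T : pred 'I_n.+1.
Hypothesis TS : forall h, T h -> inS m p h.

Lemma sum_T_uhump : 0 <= \big[Rplus/0]_(h | T h) uhump k p r h <= Cu * lam ^ 2.
Proof.
have u0 h := proj1 (uhump_bounds k p r0 h).
split; first by apply: rsum_ge0.
by apply: Rle_trans (sum_uhump_le (rg_hump Hrg)); apply: rsum_sub_le.
Qed.

Lemma sum_T_1 : 0 <= \big[Rplus/0]_(h | T h) 1 <= nS.
Proof.
split; first by apply: rsum_ge0 => *; lra.
by rewrite -sum_inS_count; apply: rsum_sub_le => // *; lra.
Qed.

Let epsL0 : 0 <= eps * L.
Proof. by apply: Rmult_le_pos; [exact: (rg_eps Hrg)|lra]. Qed.

Let tiny : eps * L * (nS + 1) ^ 2 <= 1. Proof. exact: (rg_tiny Hrg). Qed.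

(** Each bias is [O(uhump / lam)] and the humps add up to [O(lam^2)]. Subfamilies are allowed
    because the limit law needs the digits outside a block as well. *)
Lemma mean_T : Rabs (RE (fun a => \big[Rplus/0]_(h | T h) bc h (a h))) <= (Ca * Cu + Ce) * lam.
Proof.
rewrite /RE RE_sum; apply: Rle_trans (rsum_abs _ _ _) _.
apply: (Rle_trans _ (\big[Rplus/0]_(h | T h) (Ca / lam * uhump k p r h + Ce * (eps * L) * 1))).
  apply: rsum_le => h _.
  have := @RE_centered1 h _ (bc_le1 h) (bc_centered h).
  by rewrite -/RE => H; apply: Rle_trans H _; apply: Req_le; field; lra.
rewrite rsum_add !rsum_scal.
have [t1 t2] := sum_T_uhump; have [s1 s2] := sum_T_1; have a0 := Ca_ge0; have e0 := Ce_ge0.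
have h1 : Ca / lam * \big[Rplus/0]_(h | T h) uhump k p r h <= Ca / lam * (Cu * lam ^ 2).
  by apply: Rmult_le_compat_l => //; apply: Rdiv_le_0_compat; lra.
have E1 : Ca / lam * (Cu * lam ^ 2) = Ca * Cu * lam by field; lra.
set s := \big[Rplus/0]_(h | T h) 1 in s1 s2 *.
have h2 : eps * L * s <= 1.
  apply: Rle_trans tiny; apply: Rmult_le_compat_l => //; nra.
have h3 : Ce * (eps * L) * s <= Ce * lam.
  by rewrite Rmult_assoc; apply: Rmult_le_compat_l => //; lra.
lra.
Qed.

(** The diagonal yields the independent variance plus the centred functions [b2]; off the diagonal
    the humps give [(Cu * lam^2)^2 / lam^2]. The error from the frequencies beyond [r] enters once
    per pair, which is why [rg_tiny] contains the square of the count. *)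
Lemma second_moment_T :
  Rabs (RE (fun a => (\big[Rplus/0]_(h | T h) bc h (a h)) ^ 2) -
        \big[Rplus/0]_(h | T h) (qn h * (1 - qn h))) <= (Ca * Cu + Cb * Cu ^ 2 + Ce) * lam ^ 2.
Proof.
have -> : RE (fun a => (\big[Rplus/0]_(h | T h) bc h (a h)) ^ 2) =
  \big[Rplus/0]_(h | T h) (RE (fun a => bc h (a h) ^ 2) +
     \big[Rplus/0]_(h' | T h' && (h' != h)) RE (fun a => bc h (a h) * bc h' (a h'))).
  transitivity (RE (fun a => \big[Rplus/0]_(h | T h) (bc h (a h) ^ 2 +
     \big[Rplus/0]_(h' | T h' && (h' != h)) (bc h (a h) * bc h' (a h'))))).
    by congr (_ / _); apply: eq_bigr => a _; rewrite rsum_sq_split.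
  by rewrite /RE RE_sum; apply: eq_bigr => h _; rewrite (RE_add Pcount_gt0) RE_sum.
rewrite -rsum_sub; apply: Rle_trans (rsum_abs _ _ _) _.
have [t1 t2] := sum_T_uhump; have [s1 s2] := sum_T_1; have a0 := Ca_ge0; have e0 := Ce_ge0.
have b0 := Cb_ge0.
set st := \big[Rplus/0]_(h | T h) uhump k p r h in t1 t2.
set s := \big[Rplus/0]_(h | T h) 1 in s1 s2.
have u0 h := proj1 (uhump_bounds k p r0 h).
have lam2 : 0 < lam ^ 2 by apply: pow_lt; lra.
apply: (Rle_trans _ (\big[Rplus/0]_(h | T h) ((Ca / lam + Cb / lam ^ 2 * st) * uhump k p r h
    + Ce * (eps * L) * (1 + s) * 1))).
  apply: rsum_le => h Th.
  have E : RE (fun a => bc h (a h) ^ 2) - qn h * (1 - qn h) = RE (fun a => b2 h (a h)).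
    rewrite -[X in _ - X](@RE_const e m p n Pcount_gt0) /RE -(RE_sub Pcount_gt0).
    by congr (_ / _).
  have -> : RE (fun a => bc h (a h) ^ 2) +
     \big[Rplus/0]_(h' | T h' && (h' != h)) RE (fun a => bc h (a h) * bc h' (a h')) - qn h * (1 - qn h)
   = RE (fun a => b2 h (a h)) +
     \big[Rplus/0]_(h' | T h' && (h' != h)) RE (fun a => bc h (a h) * bc h' (a h')).
    by rewrite -E; ring.
  apply: Rle_trans (Rabs_triang _ _) _.
  have H1 := @RE_centered1 h _ (b2_le1 h) (b2_centered h).
  have H2 : Rabs (\big[Rplus/0]_(h' | T h' && (h' != h)) RE (fun a => bc h (a h) * bc h' (a h'))) <=
     \big[Rplus/0]_(h' | T h') (Cb / lam ^ 2 * uhump k p r h * uhump k p r h' + Ce * (eps * L) * 1).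
    apply: Rle_trans (rsum_abs _ _ _) _.
    apply: (Rle_trans _ (\big[Rplus/0]_(h' | T h' && (h' != h))
       (Cb / lam ^ 2 * uhump k p r h * uhump k p r h' + Ce * (eps * L) * 1))).
      apply: rsum_le => h' /andP [_ hh].
      have := RE_centered2 hh (bc_le1 h) (bc_centered h) (bc_le1 h') (bc_centered h').
      by move=> H; apply: Rle_trans H _; apply: Req_le; field; lra.
    apply: rsum_sub_le => [h' /andP [] //|h' _].
    apply: Rplus_le_le_0_compat.
      apply: Rmult_le_pos => //; apply: Rmult_le_pos => //.
      by apply: Rdiv_le_0_compat.
    by rewrite Rmult_1_r; apply: Rmult_le_pos.
  rewrite rsum_add !rsum_scal -/st -/s in H2.
  apply: Rle_trans (Rplus_le_compat _ _ _ _ H1 H2) _.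
  by apply: Req_le; field; lra.
rewrite rsum_add !rsum_scal -/st -/s.
have h1 : (Ca / lam + Cb / lam ^ 2 * st) * st <= (Ca / lam + Cb / lam ^ 2 * (Cu * lam ^ 2)) * (Cu * lam ^ 2).
  have g1 : 0 <= Ca / lam by apply: Rdiv_le_0_compat; lra.
  have g2 : 0 <= Cb / lam ^ 2 by apply: Rdiv_le_0_compat.
  apply: Rmult_le_compat => //.
    by apply: Rplus_le_le_0_compat => //; apply: Rmult_le_pos.
  by apply: Rplus_le_compat_l; apply: Rmult_le_compat_l.
have E1 : (Ca / lam + Cb / lam ^ 2 * (Cu * lam ^ 2)) * (Cu * lam ^ 2) = Ca * Cu * lam + Cb * Cu ^ 2 * lam ^ 2.
  by field; lra.
have Cu0 : 0 <= Cu by nra.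
have h0 : Ca * Cu * lam <= Ca * Cu * lam ^ 2.
  by apply: Rmult_le_compat_l; [exact: Rmult_le_pos|nra].
have h2 : eps * L * (1 + s) * s <= 1.
  apply: Rle_trans tiny; rewrite Rmult_assoc; apply: Rmult_le_compat_l => //; nra.
have h3 : Ce * (eps * L) * (1 + s) * s <= Ce * lam ^ 2.
  have -> : Ce * (eps * L) * (1 + s) * s = Ce * (eps * L * (1 + s) * s) by ring.
  by apply: Rmult_le_compat_l => //; nra.
lra.
Qed.

End SubFamily.

Section Block.
Variable G : pred 'I_n.+1.
Hypothesis fG : few k p D r G.

(** Fixing the digits on [G] leaves the product outside [G] untouched, and the two transforms on [G]
    differ by [O(theta)] times the sum of its elements. The error carries the tilted probability of
    the pattern as a factor, so it can be summed over exponentially many patterns. *)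
Lemma block_le (al : {ffun 'I_n.+1 -> 'I_d}) :
  Rabs (RE (fun a => b2R [forall h, G h ==> (a h == al h)]) - \rprod_(h | G h) W h (al h)) <=
  (\rprod_(h | G h) W h (al h)) *
  ((\big[Rplus/0]_(h | G h) (2 * INR d * INR h)) * Cmaj e k p c4 / L / cden + 2 * Ce * (eps * L)).
Proof.
have [J [Hmin HM1 HM2 HM3]] := rg_minor Hrg.
set PA := \rprod_(h | G h) _.
have w0 (h : 'I_n.+1) j : 0 <= W h j by have [H _] := law_ldist e k p r0 h; apply: H.
have PA0 : 0 <= PA by apply: rprod_ge0.
pose f (i : 'I_n.+1) (j : nat) : R := if G i then b2R (j == al i :> nat) else 1.
have -> : RE (fun a => b2R [forall h, G h ==> (a h == al h)]) = RE (fun a => \rprod_i f i (a i)).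
  congr (_ / _); apply: eq_bigr => a _.
  case: forallP => [H|H].
    by rewrite big1 // => i _; rewrite /f; have := H i; case: (G i) => //= /eqP ->; rewrite eqxx.
  have /forallPn [h] : ~~ [forall h, G h ==> (a h == al h)] by apply/negP => /forallP.
  rewrite negb_imply => /andP [h1 h2].
  rewrite (bigD1 h) //= /f h1 (_ : (nat_of_ord (a h) == al h) = false) /=; first by ring.
  by apply/negbTE; apply: contra h2 => /eqP /val_inj ->.
rewrite /RE (RE_prod Pcount_gt0 r0) -/d -/W -/hv -/mw1.
have -> : massw d n W hv f / mw1 - PA = (massw d n W hv f - PA * mw1) / mw1 by field; lra.
rewrite Rabs_div ?(Rabs_pos_eq mw1); try lra.
apply: Rle_trans (inv_mw1_le (Rabs_pos _)) _.
set Y := \big[Rplus/0]_(h | G h) _.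
(* The transform on [G] of the indicator of the pattern minus [PA] times that of the constant 1. It
   vanishes at [th = 0], whence the one power of [th]. *)
pose A th := (RtoC PA * (\big[Cmult/RtoC 1]_(i | G i) expi (th * INR i * (INR (al i) - muw d (W i)))
   - \big[Cmult/RtoC 1]_(i | G i) phi e k p r i th))%C.
have H : Rabs (massw d n W hv f - PA * mw1) <=
    (PA * Y) * Cmaj e k p c4 / (L ^ 1 * L) + (2 * PA) * Cmin e * eps.
  apply: (fourier_sum_le k0 Hp D0 c40 r0 lam1 (rg_N Hrg) (rg_cnt Hrg) Hmin HM1 HM3 (A := A) (j := 1%N) fG isT).
  - set M := INR (pexp p D 0 ^ J)%N.
    have E1 : RtoC (M * massw d n W hv f) = _ := massw_fourier (rg_mean Hrg) HM1 HM2 f.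
    have E2 : RtoC (M * mw1) = _ := massw_fourier (rg_mean Hrg) HM1 HM2 (fun _ _ => 1).
    have -> : M * (massw d n W hv f - PA * mw1) = M * massw d n W hv f - PA * (M * mw1) by ring.
    rewrite RtoC_minus (RtoC_mult PA) E1 E2.
    have E (x y : C) : (x - RtoC PA * y = x + (- RtoC PA) * y)%C by ring.
    rewrite E (big_distrr (times := Cmult)) -big_split; apply: eq_bigr => i _.
    set th := freq _ _.
    set X2 := \big[Cmult/RtoC 1]_(h : 'I_n.+1 | ~~ G h) phi e k p r h th.
    pose X1 := \big[Cmult/RtoC 1]_(i : 'I_n.+1 | G i) expi (th * INR i * (INR (al i) - muw d (W i))).
    pose X3 := \big[Cmult/RtoC 1]_(i : 'I_n.+1 | G i) phi e k p r i th.
    have K2 : \big[Cmult/RtoC 1]_(i : 'I_n.+1) charw d (W i) (fun=> 1) (th * INR i) = (X3 * X2)%C.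
      by rewrite (bigID G).
    have K1 : \big[Cmult/RtoC 1]_(i : 'I_n.+1) charw d (W i) (f i) (th * INR i) =
        (RtoC PA * X1 * X2)%C.
      rewrite (bigID G); congr (_ * _)%C; last first.
        apply: eq_bigr => h /= /negbTE Gh; rewrite /phi; apply: eq_bigr => j _.
        by rewrite /f Gh.
      have -> : RtoC PA = \big[Cmult/RtoC 1]_(h : 'I_n.+1 | true && G h) RtoC (W h (al h)).
        by rewrite /PA; elim/big_rec2: _ => // h x y _ <-; rewrite RtoC_mult.
      rewrite -big_split; apply: eq_bigr => h /= Gh; rewrite /charw.
      rewrite (bigD1 (al h)) //= big1 ?Cplus_0_r; last first.
        move=> j jal; rewrite /f Gh (_ : (nat_of_ord j == al h) = false) /=; first by rewrite Rmult_0_r; ring.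
        by apply/negbTE; apply: contra jal => /eqP /val_inj ->.
      by rewrite /f Gh eqxx /= Rmult_1_r.
    transitivity (RtoC PA * X1 * X2 + - RtoC PA * (X3 * X2))%C; first by rewrite -K1 -K2.
    by rewrite /A -/X1 -/X3; ring.
  - move=> th; rewrite /A Cmod_mult Cmod_R (Rabs_pos_eq PA) // pow_1 Rmult_assoc.
    apply: Rmult_le_compat_l => //.
    apply: Rle_trans (Cmod_cprod_sub _ _ _) _.
    - by move=> i _; rewrite Cmod_expi; lra.
    - by move=> i _; apply: Cmod_phi_le1.
    rewrite /Y -rsum_scalr; apply: rsum_le => i _.
    have Hw := law_ldist e k p r0 i.
    have i0 := pos_INR i.
    have [m0 m1] : 0 <= muw d (W i) <= INR d := muw_bounds Hw.
    have al0 := pos_INR (al i); have al1 : INR (al i) <= INR d := INR_leq (ltnW (ltn_ord (al i))).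
    have g1 : Cmod (expi (th * INR i * (INR (al i) - muw d (W i))) - 1) <= Rabs th * INR i * INR d.
      apply: Rle_trans (expi_sub1_le _) _; rewrite !Rabs_mult (Rabs_pos_eq (INR i)) //.
      apply: Rmult_le_compat_l; first by apply: Rmult_le_pos => //; exact: Rabs_pos.
      by apply: Rabs_le; lra.
    have g2 : Cmod (phi e k p r i th - 1) <= Rabs th * INR i * INR d.
      apply: Rle_trans (charw_sub1_le _ Hw) _; rewrite !Rabs_mult (Rabs_pos_eq (INR i)) //.
      apply: Rmult_le_compat_l; first by apply: Rmult_le_pos => //; exact: Rabs_pos.
      have := mom_step Hw 0; have -> : momw d (law d m p r i) 0 = 1 by rewrite /momw /= (Ew_const Hw).
      by rewrite Rmult_1_r.
    have -> : (expi (th * INR i * (INR (al i) - muw d (W i))) - phi e k p r i th)%C =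
      ((expi (th * INR i * (INR (al i) - muw d (W i)))%re - 1) + - (phi e k p r i th - 1))%C by ring.
    by apply: Rle_trans (Cmod_triangle _ _) _; rewrite Cmod_opp; lra.
  move=> th; rewrite /A Cmod_mult Cmod_R (Rabs_pos_eq PA) // Rmult_comm.
  apply: Rmult_le_compat_r => //; apply: Rle_trans (Cmod_triangle _ _) _.
  rewrite Cmod_opp !Cmod_cprod.
  have g1 : \rprod_(i | G i) Cmod (expi (th * INR i * (INR (al i) - muw d (W i)))) <= 1.
    by apply: rprod_le1 => i _; rewrite Cmod_expi; lra.
  have g2 : \rprod_(i | G i) Cmod (phi e k p r i th) <= 1.
    by apply: rprod_le1 => i _; split; [exact: Cmod_ge_0|exact: Cmod_phi_le1].
  lra.
have -> : PA * (Y * Cmaj e k p c4 / L / cden + 2 * Ce * (eps * L)) =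
  ((PA * Y) * Cmaj e k p c4 / (L ^ 1 * L) + (2 * PA) * Cmin e * eps) * L / cden.
  by rewrite /Ce pow_1; field; lra.
apply: Rmult_le_compat_r; first by apply: Rlt_le; apply: Rinv_0_lt_compat.
by apply: Rmult_le_compat_r; lra.
Qed.

End Block.
End Moments.

(** * Existence of the saddle point *)

Definition evR (P : R -> Prop) : Prop := exists L0, forall L, L0 <= L -> P L.

Lemma evR_and (P Q : R -> Prop) : evR P -> evR Q -> evR (fun L => P L /\ Q L).
Proof.
move=> [a Ha] [b Hb]; exists (Rmax a b) => L hL; split.
  by apply: Ha; apply: Rle_trans hL; apply: Rmax_l.
by apply: Hb; apply: Rle_trans hL; apply: Rmax_r.
Qed.

Lemma evR_ge c : evR (fun L => c <= L).
Proof. by exists c. Qed.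

Lemma evR_pow_ge k c : (0 < k)%N -> evR (fun L => c <= L ^ k).
Proof.
move=> k0; exists (Rmax 1 c) => L hL.
have h1 : 1 <= L by apply: Rle_trans hL; apply: Rmax_l.
have h2 : c <= L by apply: Rle_trans hL; apply: Rmax_r.
apply: Rle_trans h2 _; rewrite -{1}(pow_1 L); apply: Rle_pow => //.
exact/leP.
Qed.

Lemma evR_nat (P : R -> Prop) : evR P -> exists n0, forall n, (n0 <= n)%N -> P (ln (INR n)).
Proof.
move=> [L0 H]; have [n0 [h1 _]] := nat_ceil (Rlt_le _ _ (exp_pos L0)).
exists n0 => n /INR_leq hn; apply: H; rewrite -(ln_exp L0); apply: Rcomplements.ln_le.
  exact: exp_pos.
lra.
Qed.

Section Counting.
Variables (k : nat) (p : nat -> nat).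
Hypothesis Hp : coprime_bases k p.
Let den := INR (Factorial.fact k) * lnprod p k.

Lemma cnt_den_gt0 : 0 < den.
Proof. by apply: Rmult_lt_0_compat; [exact: INR_fact_gt0|apply: lnprod_gt0; case: Hp]. Qed.

Lemma cnt_le_pow K x l : 1 <= x < INR K -> ln x <= l -> 1 <= l ->
  cnt k p K x <= (1 + lnsum p k) ^ k / den * l ^ k.
Proof.
move=> hx xl l1; have [_ h] := cnt_bounds Hp hx; apply: Rle_trans h _.
have d0 := cnt_den_gt0; rewrite -/den.
have s0 : 0 <= lnsum p k by apply: lnsum_ge0; case: Hp.
have -> : (1 + lnsum p k) ^ k / den * l ^ k = ((1 + lnsum p k) * l) ^ k / den.
  by rewrite Rpow_mult_distr; field; lra.
apply: Rmult_le_compat_r; first by apply: Rlt_le; apply: Rinv_0_lt_compat.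
apply: pow_incr; split; last nra.
by have : 0 <= ln x by [rewrite -ln_1; apply: Rcomplements.ln_le; lra]; lra.
Qed.

Lemma cnt_ge_pow K x l : 1 <= x < INR K -> 0 <= l <= ln x -> l ^ k / den <= cnt k p K x.
Proof.
move=> hx hl; have [h _] := cnt_bounds Hp hx; apply: Rle_trans h.
apply: Rmult_le_compat_r; first by apply: Rlt_le; apply: Rinv_0_lt_compat; exact: cnt_den_gt0.
exact: pow_incr.
Qed.

End Counting.

Lemma continuity_rsum (I : Type) (s : seq I) (P : pred I) (F : I -> R -> R) x :
  (forall i, continuity_pt (F i) x) ->
  continuity_pt (fun y => \rsum_(i <- s | P i) F i y) x.
Proof.
move=> HF; elim: s => [|i s IH].
  apply: (continuity_pt_ext (fun=> 0)); first by move=> y; rewrite big_nil.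
  by apply: continuity_pt_const.
case Pi: (P i).
  apply: (continuity_pt_ext (F i + (fun y => \rsum_(i <- s | P i) F i y))%F).
    by move=> y; rewrite big_cons Pi.
  exact: continuity_pt_plus.
apply: (continuity_pt_ext (fun y => \rsum_(i <- s | P i) F i y)) => // y.
by rewrite big_cons Pi.
Qed.

Lemma continuity_exp_lin c x : continuity_pt (fun r => exp (- (r * c))) x.
Proof.
apply: derivable_continuous_pt; apply: ex_derive_Reals_0; auto_derive => //.
Qed.

Section Saddle.
Variables (e k : nat) (p : nat -> nat).
Hypothesis Hp : coprime_bases k.+1 p.
Let d := e.+2.
Let m := k.+1.
Let q := INR (p k).
Let Hpos i : (i < m)%N -> (1 < p i)%N. Proof. by case: Hp => H _; apply: H. Qed.

Definition meanf n r := \rsum_(h < n.+1) (INR h * muw d (law d m p r h)).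

Lemma meanf_continuity n : continuity (meanf n).
Proof.
move=> x; apply: continuity_rsum => h.
apply: continuity_pt_mult; first by apply: continuity_pt_const.
rewrite /law; case: (inS m p h); last by apply: continuity_pt_const.
rewrite /muw /Ew /tilt; apply: continuity_rsum => j.
apply: continuity_pt_mult; last by apply: continuity_pt_const.
have ce (i : nat) : continuity_pt (fun r => exp (- (r * INR h * INR i))) x.
  apply: (continuity_pt_ext (fun r => exp (- (r * (INR h * INR i))))).
    by move=> y; rewrite Rmult_assoc.
  exact: continuity_exp_lin.
apply: continuity_pt_div; [exact: ce| |].
  by apply: continuity_rsum => i; exact: ce.
rewrite /Zt big_ord_recl; apply: Rgt_not_eq.
apply: Rplus_lt_le_0_compat; first exact: exp_pos.
by apply: rsum_ge0 => i _; apply: Rlt_le; exact: exp_pos.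
Qed.

(** At [r = 1 / n] every element of [(n / q, n]] contributes at least [n / (q d e)] through its
    digit 1 alone, and there are at least [q d e] of them. *)
Lemma meanf_low n : (0 < n)%N -> q * INR d * exp 1 <= cnt k p n.+1 (INR n) ->
  INR n <= meanf n (/ INR n).
Proof.
move=> n0 hc; have hn := INR_ltn n0; rewrite [INR 0]/= in hn.
have q2 : 2 <= q by apply: INR_ge2; apply: Hpos; rewrite ltnSn.
have d2 := INR_d_ge2 e; rewrite -/d in d2.
have e1 := exp_pos 1.
have r0 : 0 < / INR n by apply: Rinv_0_lt_compat.
have nn : INR n < INR n.+1 by apply: INR_ltn.
have Hw := @sum_window k p n (/ INR n) Hp r0; rewrite Rinv_inv -/m -/q in Hw.
apply: (Rle_trans _ (\big[Rplus/0]_(h : 'I_n.+1 | inS m p h)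
   (INR n / q / INR d / exp 1 * b2R (Rleb (INR h) (INR n) && ~~ Rleb (INR h) (INR n / q))))).
  rewrite rsum_scal Hw //; set c := INR n / q / INR d / exp 1.
  have {1}-> : INR n = c * (q * INR d * exp 1) by rewrite /c; field; lra.
  apply: Rmult_le_compat_l => //.
  by rewrite /c; repeat apply: Rdiv_le_0_compat; lra.
have Hl h : ldist d (law d m p (/ INR n) h) by apply: law_ldist.
rewrite /meanf big_mkcond; apply: rsum_le => h _.
have h0 := pos_INR h; have mu0 : 0 <= muw d (law d m p (/ INR n) h) by have [] := muw_bounds (Hl h).
have hmu : 0 <= INR h * muw d (law d m p (/ INR n) h) by apply: Rmult_le_pos.
case: ifP => // Sh; case: RlebP => h1; case: RlebP => h2; rewrite [b2R _]/= ?Rmult_0_r ?Rmult_1_r //.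
move/Rnot_le_lt: h2 => h2.
have t1 : / INR n * INR h <= 1 by rewrite Rmult_comm; apply/Rle_div_l; lra.
have t0 : 0 <= / INR n * INR h by apply: Rmult_le_pos; lra.
have hm : / (INR d * exp 1) <= muw d (law d m p (/ INR n) h).
  rewrite /law Sh /muw /Ew.
  have h3 : tilt d (/ INR n * INR h) 1 * INR 1 <= \rsum_(j < d) (tilt d (/ INR n * INR h) j * INR j).
    apply: (@rsum_term_le _ predT (fun j : 'I_d => tilt d (/ INR n * INR h) j * INR j) (Ordinal (isT : (1 < d)%N)) isT) => j _.
    by apply: Rmult_le_pos; [apply: Rlt_le; exact: tilt_gt0|exact: pos_INR].
  apply: Rle_trans h3; rewrite [INR 1]/= Rmult_1_r /tilt [INR 1]/= Rmult_1_r.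
  have [z1 z2] := Zt_bounds e t0; rewrite -/d in z1 z2.
  rewrite Rinv_mult Rmult_comm; apply: Rmult_le_compat.
  - by rewrite -exp_Ropp; apply: Rlt_le; exact: exp_pos.
  - by apply: Rlt_le; apply: Rinv_0_lt_compat; lra.
  - by rewrite -exp_Ropp; apply: exp_le; lra.
  by apply: Rinv_le_contravar; lra.
have -> : INR n / q / INR d / exp 1 = (INR n / q) * / (INR d * exp 1) by field; lra.
apply: Rmult_le_compat => //; try lra.
- by apply: Rdiv_le_0_compat; lra.
- by apply: Rlt_le; apply: Rinv_0_lt_compat; nra.
Qed.

(** As [x exp (- x) <= 1] with [x = r h], each element contributes at most [d^2 / r]. *)
Lemma meanf_high n r : 0 < r -> meanf n r <= INR d ^ 2 * cnt m p n.+1 (INR n) / r.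
Proof.
move=> r0.
have -> : INR d ^ 2 * cnt m p n.+1 (INR n) / r =
  \big[Rplus/0]_(h : 'I_n.+1 | inS m p h) (INR d ^ 2 / r).
  rewrite -[INR d ^ 2 / r]Rmult_1_r rsum_scal.
  have -> : \big[Rplus/0]_(h : 'I_n.+1 | inS m p h) 1 = cnt m p n.+1 (INR n).
    apply: eq_bigr => h _; case: RlebP => // -[].
    by apply: INR_leq; rewrite -ltnS.
  by field; lra.
have d2 : 0 <= INR d ^ 2 by apply: pow2_ge_0.
rewrite /meanf [X in _ <= X]big_mkcond; apply: rsum_le => h _; rewrite /law.
have t0 : 0 <= r * INR h by apply: Rmult_le_pos; [lra|exact: pos_INR].
case: ifP => Sh; last first.
  rewrite /muw /Ew big_ord_recl -[nat_of_ord ord0]/0%N [INR 0]/= Rmult_0_r Rplus_0_l big1 ?Rmult_0_r; first lra.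
  by move=> i _; rewrite lift0 [b2R _]/=; ring.
have H := muw_tilt_le e t0; rewrite -/d in H.
apply: (Rle_trans _ (INR h * (INR d ^ 2 * exp (- (r * INR h))))).
  by apply: Rmult_le_compat_l => //; exact: pos_INR.
have -> : INR h * (INR d ^ 2 * exp (- (r * INR h))) =
  INR d ^ 2 / r * ((r * INR h) * exp (- (r * INR h))) by field; lra.
rewrite -[X in _ <= X]Rmult_1_r; apply: Rmult_le_compat_l.
  exact: Rdiv_le_0_compat.
rewrite exp_Ropp; apply/Rle_div_l; first exact: exp_pos.
by have := exp_ineq1_le (r * INR h); lra.
Qed.

(** The intermediate value theorem. The bracket is kept in the conclusion: it places [1 / r] within
    a power of [ln n] of [n]. *)
Lemma saddle_exists n : (0 < n)%N -> q * INR d * exp 1 <= cnt k p n.+1 (INR n) ->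
  1 <= cnt m p n.+1 (INR n) ->
  exists r, [/\ / INR n <= r, r <= INR d ^ 2 * cnt m p n.+1 (INR n) / INR n & meanf n r = INR n].
Proof.
move=> n0 hc hS; have hn := INR_ltn n0; rewrite [INR 0]/= in hn.
set S := cnt m p n.+1 (INR n) in hS *.
have d2 := INR_d_ge2 e; rewrite -/d in d2.
set a := / INR n; set b := INR d ^ 2 * S / INR n.
have a0 : 0 < a by apply: Rinv_0_lt_compat.
have d4 : 1 <= INR d ^ 2 by nra.
have ab : a <= b.
  rewrite /a /b; have -> : / INR n = 1 / INR n by field; lra.
  by apply: Rmult_le_compat_r; [exact: Rlt_le|nra].
have b0 : 0 < b by lra.
have hb : meanf n b <= INR n.
  apply: Rle_trans (meanf_high n b0) _; rewrite -/S.
  by apply: Req_le; rewrite /b; field; split; [lra|split; nra].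
have ha : INR n <= meanf n a by apply: meanf_low.
have [r [[h1 h2] h3]] := IVT_gen (meanf n) a b (INR n) (meanf_continuity n)
  (conj (Rle_trans _ _ _ (Rmin_r _ _) hb) (Rle_trans _ _ _ ha (Rmax_l _ _))).
rewrite Rmin_left // in h1; rewrite Rmax_right // in h2.
by exists r.
Qed.

End Saddle.

Lemma sqrt_le_self x : 1 <= x -> 1 <= sqrt x <= x.
Proof.
move=> x1; split; first by rewrite -sqrt_1; apply: sqrt_le_1_alt.
rewrite -{2}(sqrt_square x); last lra.
by apply: sqrt_le_1_alt; nra.
Qed.

Lemma regime_eventually e k p D : (0 < k)%N -> coprime_bases k.+1 p -> (0 < D)%N ->
  exists c4 Cu cden, [/\ 0 < c4, 0 < cden & exists n0, forall n, (n0 <= n)%N ->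
    exists r eps, [/\ regime e k p D c4 Cu cden n r (sqrt (ln (INR n) ^ k)) eps,
      / INR n <= r & r <= INR e.+2 ^ 2 * cnt k.+1 p n.+1 (INR n) / INR n]].
Proof.
move=> k0 Hp D0; have Hp' := coprime_bases_pred Hp; have [Hpos _] := Hp; have [Hpos' _] := Hp'.
set d := e.+2; set m := k.+1; set q := INR (p k).
have q2 : 2 <= q by apply: INR_ge2; apply: Hpos.
have d2 := INR_d_ge2 e; rewrite -/d in d2.
set dk := INR (Factorial.fact k) * lnprod p k; have dk0 : 0 < dk by apply: cnt_den_gt0 Hp'.
set dm := INR (Factorial.fact m) * lnprod p m; have dm0 : 0 < dm by apply: cnt_den_gt0 Hp.
have sk0 := lnsum_ge0 Hpos'; have sm0 : 0 <= lnsum p m := lnsum_ge0 Hpos.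
set Ck := (1 + lnsum p k) ^ k / dk.
have Ck0 : 0 <= Ck by apply: Rdiv_le_0_compat => //; apply: pow_le; lra.
set Cm := (1 + lnsum p m) ^ m / dm.
have Cm0 : 0 < Cm by apply: Rdiv_lt_0_compat => //; apply: pow_lt; lra.
have t2k : 0 < 2 ^ k by apply: pow_lt; lra.
(* Half of what the count gives from [ln (1 / r) >= (ln n) / 2]; the other half covers the [+ 2]. *)
set c4 := / (2 * (2 ^ k * dk)).
have c40 : 0 < c4 by apply: Rinv_0_lt_compat; have := Rmult_lt_0_compat _ _ t2k dk0; lra.
set Cu := 2 * Ck; have Cu0 : 0 <= Cu by rewrite /Cu; lra.
have m2 : (2 <= m)%N by rewrite /m ltnS.
have HpD := pexp_bases D0 m2 Hp.
have cd0 := cd_gt0 e.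
have [g [N0 [g0 [N01 Hmin]]]] := minor_arcs HpD cd0.
have P1 : (1 < pexp p D 0)%N by case: HpD => H _; apply: H.
have p2 := INR_ge2 P1; set P := pexp p D 0 in Hmin P1 p2.
set CM := Cmom e; have CM1 : 1 <= CM := Cmom_ge1 e.
set CJ := Cmaj e k p c4; have CJ0 : 0 <= CJ := Cmaj_ge0 e Hp c40.
set CI := Cmin e; have CI0 : 0 <= CI := Cmin_ge0 e.
have PI0 := PI_RGT_0.
(* Makes [c1^2 * (CM * Cu) <= 1], as [massw1_ge] requires. *)
set c1 := / (1 + CM * Cu).
have CMCu : 0 <= CM * Cu by apply: Rmult_le_pos; lra.
have c10 : 0 < c1 by apply: Rinv_0_lt_compat; lra.
have c11 : c1 <= 1 by rewrite /c1 -Rinv_1; apply: Rinv_le_contravar; lra.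
have c1e : c1 * (1 + CM * Cu) = 1 by rewrite /c1; field; lra.
(* Chosen so that [t0 * (K - 1) = CJ], which makes the tail [CJ / (1 + K^2)] at most [t0]. *)
set K := 1 + 16 * PI * CJ / c1.
have K1 : 1 <= K.
  have : 0 <= 16 * PI * CJ / c1 by apply: Rdiv_le_0_compat => //; apply: Rmult_le_pos; lra.
  by rewrite /K; lra.
(* A quarter of the main term [c1 / (4 PI)]: each of the three errors takes one [t0], and one is
   left as [cden]. *)
set t0 := c1 / (16 * PI); have t00 : 0 < t0 by apply: Rdiv_lt_0_compat; lra.
exists c4, Cu, t0; split=> //.
set F := (1 + K ^ 2) * (CM * Cu * K ^ 3) / t0.
have F0 : 0 <= F.
  apply: Rdiv_le_0_compat => //; apply: Rmult_le_pos; first by have := pow2_ge_0 K; lra.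
  by apply: Rmult_le_pos => //; apply: pow_le; lra.
have half : 0 < / 2 by lra.
have g20 : 0 < g / 2 by lra.
have Hev : evR (fun l => (((1 <= l) /\ (q * INR d * exp 1 * dk <= l ^ k)) /\
   ((INR d ^ 2 * Cm * l ^ m <= exp (/ 2 * l)) /\ (2 / c4 <= l ^ k))) /\
   (((2 * N0 <= l) /\ (K ^ 2 * CM <= l ^ k)) /\
   ((F ^ 2 <= l ^ k) /\ (((Cm + 1) ^ 2 * l ^ (k + 2 * m)%N <= exp (g / 2 * l)) /\
   ((CI / t0 * l ^ k <= exp (g / 2 * l)) /\ (dm <= l ^ m)))))).
  apply: evR_and; [apply: evR_and; apply: evR_and|apply: evR_and; apply: evR_and;
     [| |exact: evR_pow_ge|apply: evR_and; [|apply: evR_and]]].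
  - exact: evR_ge.
  - exact: evR_pow_ge.
  - exact: exp_beats_pow.
  - exact: evR_pow_ge.
  - exact: evR_ge.
  - exact: evR_pow_ge.
  - exact: exp_beats_pow.
  - exact: exp_beats_pow.
  - exact: evR_pow_ge.
have [n0 Hn0] := evR_nat Hev.
exists (maxn n0 3) => n; rewrite geq_max => /andP [/Hn0 Hl n3].
set l := ln (INR n) in Hl *.
move: Hl => [[[l1 hb] [hc hd]] [[he hK] [hF [hg [hh hdm]]]]].
have n0' : (0 < n)%N by apply: leq_trans n3.
have n1 : 1 <= INR n by have := INR_leq n0'; rewrite /=.
have En : exp l = INR n by apply: exp_ln; lra.
have nn : INR n < INR n.+1 by apply: INR_ltn.
have hkn : l ^ k / dk <= cnt k p n.+1 (INR n).
  by apply: (cnt_ge_pow Hp') => //; split; [lra|exact: Rle_refl].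
have hcn : q * INR d * exp 1 <= cnt k p n.+1 (INR n).
  by apply: Rle_trans hkn; apply: (proj1 (Rle_div_r _ _ _ dk0)); exact: hb.
set S := cnt m p n.+1 (INR n).
have hS1 : 1 <= S.
  apply: (Rle_trans _ (l ^ m / dm)); first by apply/Rle_div_r; lra.
  by apply: (cnt_ge_pow Hp) => //; split; [lra|exact: Rle_refl].
have hS2 : S <= Cm * l ^ m by apply: (cnt_le_pow Hp) => //; exact: Rle_refl.
have [r [hr1 hr2 hr3]] := @saddle_exists e k p Hp n n0' hcn hS1.
rewrite -/S -/d in hr2.
have r0 : 0 < r by apply: Rlt_le_trans hr1; apply: Rinv_0_lt_compat; lra.
set N := / r; have Npos : 0 < N by apply: Rinv_0_lt_compat.
have Nn : N <= INR n.
  by rewrite -(Rinv_inv (INR n)); apply: Rinv_le_contravar => //; apply: Rinv_0_lt_compat; lra.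
have lm0 : 0 < l ^ m by apply: pow_lt; lra.
have lk0 : 0 < l ^ k by apply: pow_lt; lra.
(* [N >= sqrt n], because [r <= d^2 S / n] and [d^2 S] is at most [sqrt n] for large [n]. *)
have hN1 : exp (/ 2 * l) <= N.
  apply: (Rle_trans _ (INR n / (INR d ^ 2 * S))).
    apply/Rle_div_r; first by apply: Rmult_lt_0_compat; [apply: pow_lt|]; lra.
    have -> : INR n = exp (/ 2 * l) * exp (/ 2 * l) by rewrite -En -exp_plus; congr exp; field.
    apply: Rmult_le_compat_l; first by apply: Rlt_le; exact: exp_pos.
    apply: Rle_trans hc; rewrite Rmult_assoc; apply: Rmult_le_compat_l => //; exact: pow2_ge_0.
  have -> : INR n / (INR d ^ 2 * S) = / (INR d ^ 2 * S / INR n) by field; repeat split; lra.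
  by apply: Rinv_le_contravar.
have hlnN : l / 2 <= ln N.
  by rewrite -(ln_exp (l / 2)); apply: Rcomplements.ln_le; [exact: exp_pos|rewrite /Rdiv Rmult_comm].
have hN0 : N0 <= N by apply: Rle_trans hN1; have := exp_ineq1_le (/ 2 * l); lra.
have N1 : 1 <= N by lra.
(* [N^(- 1 - g)]; against [lam * N] it leaves [lam * N^(- g)], which beats every power of [ln n]. *)
set eps := exp (- ((1 + g) * ln N)); have eps0 : 0 < eps by apply: exp_pos.
set lam := sqrt (l ^ k).
have lk1 : 1 <= l ^ k by apply: pow_R1_Rle.
have [lam1 lam2] := sqrt_le_self lk1; rewrite -/lam in lam1 lam2.
have Elam : lam ^ 2 = l ^ k by rewrite /lam pow2_sqrt //; lra.
have hepsL : eps * (lam * N) <= lam * exp (- (g / 2 * l)).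
  have -> : eps * (lam * N) = lam * exp (- (g * ln N)).
    rewrite /eps -{2}(exp_ln N Npos).
    have -> : - ((1 + g) * ln N) = - (g * ln N) + - ln N by ring.
    by rewrite exp_plus [exp (- ln N)]exp_Ropp; field; have := exp_pos (ln N); lra.
  apply: Rmult_le_compat_l; first lra.
  by apply: exp_le; apply: Ropp_le_contravar; have := Rmult_le_compat_l g _ _ (Rlt_le _ _ g0) hlnN; lra.
have hepsL2 : eps * (lam * N) <= l ^ k * / exp (g / 2 * l).
  apply: Rle_trans hepsL _; rewrite exp_Ropp; apply: Rmult_le_compat_r => //.
  by apply: Rlt_le; apply: Rinv_0_lt_compat; exact: exp_pos.
have egl := exp_pos (g / 2 * l).
exists r, eps; split=> //.
(* [J] itself already reaches the sum of all sizes that [M = P^J > J] has to exceed. *)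
have [J [hJ _]] : exists J : nat, INR P * N + INR (n.+1 * (n * d))%N + INR n + 1 + 2 * (lam * N) <= INR J <=
   INR P * N + INR (n.+1 * (n * d))%N + INR n + 1 + 2 * (lam * N) + 1.
  apply: nat_ceil.
  have := pos_INR (n.+1 * (n * d))%N; have : 0 <= INR P * N by apply: Rmult_le_pos; lra.
  by have : 0 <= lam * N by [apply: Rmult_le_pos; lra]; lra.
have pJ := lt_pow2 J p2.
have b1 := pos_INR (n.+1 * (n * d))%N.
have b2 : 0 <= INR P * N by apply: Rmult_le_pos; lra.
have b3 : 0 <= lam * N by apply: Rmult_le_pos; lra.
have hJ1 : INR P * N <= INR P ^ J by lra.
have HNn : N < INR n.+1 by lra.
have EM : INR (P ^ J)%N = INR P ^ J by rewrite INR_expn.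
have HM1 : (n < P ^ J)%N by rewrite ltnNge; apply/negP => /INR_leq; rewrite EM; lra.
have HM2 (a : {ffun 'I_n.+1 -> 'I_d}) : (wsum (fun h : 'I_n.+1 => nat_of_ord h) a < P ^ J)%N.
  have h1 : (wsum (fun h : 'I_n.+1 => nat_of_ord h) a <= n.+1 * (n * d))%N.
    have -> : (n.+1 * (n * d) = \sum_(h < n.+1) n * d)%N by rewrite sum_nat_const card_ord.
    by apply: leq_sum => h _; apply: leq_mul; [rewrite -ltnS|apply: ltnW].
  by rewrite ltnNge; apply/negP => /INR_leq; rewrite EM; have := INR_leq h1; lra.
have HM3 : 2 * (lam * N) <= INR (P ^ J)%N by rewrite EM; lra.
have Hmn := Hmin N J n.+1 hN0 HNn hJ1.
rewrite -EM in Hmn.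
have Hcnt : c4 * lam ^ 2 + 2 <= cnt k p n.+1 N.
  apply: (Rle_trans _ ((l / 2) ^ k / dk)); last first.
    by apply: (cnt_ge_pow Hp'); [lra|split; [lra|exact: hlnN]].
  have -> : (l / 2) ^ k / dk = 2 * c4 * l ^ k.
    by rewrite /c4 /Rdiv Rpow_mult_distr pow_inv; field; lra.
  rewrite Elam; move/(Rle_div_l _ _ _ c40): hd; lra.
have Hhump : \rsum_(h < n.+1 | inS m p h) hump (r * INR h) <= Cu * lam ^ 2.
  apply: Rle_trans (sum_hump_le n Hp r0) _; rewrite Elam /Cu Rmult_assoc.
  apply: Rmult_le_compat_l; first lra.
  by apply: (cnt_le_pow Hp') => //; exact: Rle_refl.
have hden : t0 <= lam * N * massw d n (fun h : 'I_n.+1 => law d m p r h) (fun h => nat_of_ord h) (fun _ _ => 1).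
  have L1 : 1 <= lam * N by rewrite -[1]Rmult_1_l; apply: Rmult_le_compat; lra.
  have K2C : K ^ 2 * Cmom e <= 2 * lam ^ 2 by rewrite Elam -/CM; lra.
  have c1C : c1 ^ 2 * (Cmom e * Cu) <= 1.
    rewrite -/CM; have -> : c1 ^ 2 * (CM * Cu) = c1 * (c1 * (1 + CM * Cu) - c1) by ring.
    by rewrite c1e; have := pow2_ge_0 c1; lra.
  have c1K : c1 <= K by lra.
  have c1P : c1 / (lam * N) < PI.
    apply: (Rle_lt_trans _ 1); first by apply/Rle_div_l; lra.
    by have := PI2_1; lra.
  have H := massw1_ge k0 Hp D0 c40 r0 lam1 hr3 HNn Hcnt Hhump Hmn HM1 HM2 HM3 K1 K2C c10 c1C c1K c1P.
  apply: Rle_trans H; rewrite -/CM -/CJ -/CI -/N -/eps.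
  have E4 : c1 / (2 * PI * 2) = 4 * t0 by rewrite /t0; field; lra.
  have T1 : (1 + K ^ 2) * (CM * Cu * K ^ 3 / lam) <= t0.
    have hFl : F <= lam.
      by rewrite /lam -(sqrt_pow2 F F0); apply: sqrt_le_1_alt.
    have -> : (1 + K ^ 2) * (CM * Cu * K ^ 3 / lam) = F * t0 / lam by rewrite /F; field; lra.
    by apply/Rle_div_l; [lra|rewrite Rmult_comm; apply: Rmult_le_compat_l; lra].
  have T2 : CJ / (1 + K ^ 2) <= t0.
    apply/Rle_div_l; first by have := pow2_ge_0 K; lra.
    have h1 : t0 * (K - 1) = CJ by rewrite /t0 /K; field; lra.
    by rewrite -{1}h1; apply: Rmult_le_compat_l; have := pow2_ge_0 (K - 1); lra.
  have T3 : CI * eps * (lam * N) <= t0.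
    apply: (Rle_trans _ (CI * (l ^ k * / exp (g / 2 * l)))).
      by rewrite Rmult_assoc; apply: Rmult_le_compat_l.
    have -> : CI * (l ^ k * / exp (g / 2 * l)) = t0 * ((CI / t0 * l ^ k) / exp (g / 2 * l)) by field; lra.
    rewrite -[X in _ <= X]Rmult_1_r; apply: Rmult_le_compat_l; first lra.
    by apply/Rle_div_l; lra.
  lra.
have Htiny : eps * (lam * N) * (S + 1) ^ 2 <= 1.
  have hS3 : (S + 1) ^ 2 <= ((Cm + 1) * l ^ m) ^ 2.
    have : 1 <= l ^ m by apply: pow_R1_Rle.
    by move=> h; apply: pow_incr; lra.
  apply: (Rle_trans _ (l ^ k * / exp (g / 2 * l) * ((Cm + 1) * l ^ m) ^ 2)).
    apply: Rmult_le_compat => //; [by apply: Rmult_le_pos; lra|exact: pow2_ge_0].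
  have -> : l ^ k * / exp (g / 2 * l) * ((Cm + 1) * l ^ m) ^ 2 =
    ((Cm + 1) ^ 2 * l ^ (k + 2 * m)%N) / exp (g / 2 * l).
    have -> : l ^ (k + 2 * m)%N = l ^ k * (l ^ m * l ^ m) by rewrite mul2n -addnn !pow_add.
    by field; lra.
  by apply/Rle_div_l; lra.
apply: Regime => //; first lra.
by exists J; split.
Qed.

(** * Mean and variance *)

Section Asymptotics.
Variables (e k : nat) (p : nat -> nat).
Hypotheses (k0 : (0 < k)%N) (Hp : coprime_bases k.+1 p).
Let d := e.+2.
Let m := k.+1.
Let Hpos i : (i < m)%N -> (1 < p i)%N. Proof. by case: Hp => H _; apply: H. Qed.
Let den := INR (Factorial.fact m) * lnprod p m.
Let s := lnsum p m.
Let den0 : 0 < den. Proof. exact: cnt_den_gt0 Hp. Qed.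
Let s0 : 0 <= s. Proof. exact: lnsum_ge0. Qed.
Let d2 : 2 <= INR d. Proof. exact: INR_d_ge2. Qed.

Lemma pow_shift_diff a x l : 0 <= a <= x -> x <= l -> 1 <= l ->
  (x + s) ^ m - a ^ m <= INR m * (1 + s) ^ k * (l ^ k * (x + s - a)).
Proof.
move=> [a0 ax] xl l1.
have h : 0 <= a <= x + s by lra.
have := pow_diff_le k h; rewrite -/m => H; apply: Rle_trans H _.
have -> : INR m * (1 + s) ^ k * (l ^ k * (x + s - a)) = INR m * (x + s - a) * ((1 + s) * l) ^ k.
  by rewrite Rpow_mult_distr; ring.
apply: Rmult_le_compat_l; first by apply: Rmult_le_pos; [exact: pos_INR|lra].
by apply: pow_incr; nra.
Qed.

Lemma cnt_near n l : (0 < n)%N -> l = ln (INR n) -> 1 <= l ->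
  Rabs (cnt m p n.+1 (INR n) - l ^ m / den) <= INR m * (1 + s) ^ k * s / den * l ^ k.
Proof.
move=> n0 El l1.
have n1 : 1 <= INR n < INR n.+1.
  by split; [have := INR_leq n0; rewrite /=|apply: INR_ltn].
have := cnt_bounds Hp n1; rewrite -El -/m -/den -/s => -[h1 h2].
have h3 := @pow_shift_diff l l l (conj (Rle_trans _ _ _ Rle_0_1 l1) (Rle_refl l)) (Rle_refl l) l1.
have h4 : (l + s) ^ m / den - l ^ m / den <= INR m * (1 + s) ^ k * s / den * l ^ k.
  have -> : (l + s) ^ m / den - l ^ m / den = ((l + s) ^ m - l ^ m) / den by field; lra.
  apply/Rle_div_l => //; apply: Rle_trans h3 _; apply: Req_le; field; lra.
apply: Rabs_le; split; last lra.
have : 0 <= INR m * (1 + s) ^ k * s / den * l ^ k.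
  apply: Rmult_le_pos; last by apply: pow_le; lra.
  apply: Rdiv_le_0_compat => //; apply: Rmult_le_pos => //; apply: Rmult_le_pos; first exact: pos_INR.
  by apply: pow_le; lra.
lra.
Qed.

Lemma evR_ln c : evR (fun L => c * ln L <= L).
Proof.
have [L1 H] := exp_beats_pow 1 c Rlt_0_1; exists (exp L1) => L hL.
have L0 : 0 < L by have := exp_pos L1; lra.
rewrite -{2}(exp_ln _ L0) -[ln L in X in _ <= X]Rmult_1_l -{1}[ln L]pow_1; apply: H.
by rewrite -(ln_exp L1); apply: Rcomplements.ln_le => //; exact: exp_pos.
Qed.

(* At the saddle point [r <= d^2 |S_n| / n], so all but a [ln ln n / ln n] proportion of
   the elements of [S_n] lie below any [1 / (r (ln n)^j)]. *)
Lemma cnt_top_window j : exists C n0, forall n r, (n0 <= n)%N -> 0 < r -> / INR n <= r ->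
  r <= INR d ^ 2 * cnt m p n.+1 (INR n) / INR n ->
  1 <= / r / ln (INR n) ^ j <= INR n /\
  cnt m p n.+1 (INR n) - cnt m p n.+1 (/ r / ln (INR n) ^ j) <= C * (ln (INR n) ^ k * ln (ln (INR n))).
Proof.
set Cm := (1 + s) ^ m / den.
have Cm0 : 0 < Cm by apply: Rdiv_lt_0_compat => //; apply: pow_lt; lra.
set c0 := ln (INR d ^ 2 * Cm).
(* Collects the terms of [l + s - ln H], each at most a multiple of [ln l]. *)
set B := s + INR j + INR m + Rabs c0.
exists (INR m * (1 + s) ^ k * B / den).
have [n0 Hn0] := evR_nat (evR_and (evR_ge (exp 1)) (evR_ln B)).
exists (maxn n0 1) => n r; rewrite geq_max => /andP [/Hn0 [hl hBl] n1] r0 hr1 hr.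
set l := ln (INR n) in hl hBl *.
have l2 : 2 <= l by have := exp_ineq1_le 1; lra.
have ll1 : 1 <= ln l by rewrite -{1}(ln_exp 1); apply: Rcomplements.ln_le => //; exact: exp_pos.
have hn : 0 < INR n := INR_ltn n1.
have lj1 : 1 <= l ^ j by apply: pow_R1_Rle; lra.
set N := / r; have N0 : 0 < N by apply: Rinv_0_lt_compat.
set H := N / l ^ j; have H0 : 0 < H by apply: Rdiv_lt_0_compat; lra.
have n1' : 1 <= INR n < INR n.+1.
  by split; [have := INR_leq n1; rewrite /=|apply: INR_ltn].
set S := cnt m p n.+1 (INR n) in hr.
have hS : S <= Cm * l ^ m by apply: (cnt_le_pow Hp) => //; [exact: Rle_refl|lra].
have dd2 : 0 < INR d ^ 2 by nra.
have lm0 : 0 < l ^ m by apply: pow_lt; lra.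
have hlnN : l - ln N <= INR m * ln l + c0.
  have h1 : ln r <= ln (INR d ^ 2 * (Cm * l ^ m) / INR n).
    apply: Rcomplements.ln_le => //; apply: Rle_trans hr _.
    apply: Rmult_le_compat_r; first by apply: Rlt_le; apply: Rinv_0_lt_compat.
    by apply: Rmult_le_compat_l; lra.
  have -> : ln N = - ln r by rewrite /N ln_Rinv.
  have E : ln (INR d ^ 2 * (Cm * l ^ m) / INR n) = c0 + INR m * ln l - l.
    rewrite ln_div //; last by apply: Rmult_lt_0_compat => //; apply: Rmult_lt_0_compat.
    rewrite -Rmult_assoc ln_mult //; last by apply: Rmult_lt_0_compat.
    by rewrite ln_pow -/c0 -/l; [ring|lra].
  lra.
have EH : ln H = ln N - INR j * ln l by rewrite /H ln_pow_div //; lra.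
have Hn : H <= INR n.
  apply: (Rle_trans _ N).
    by apply: (proj2 (Rle_div_l N N _ (_ : l ^ j > 0))); [lra|rewrite -{1}[N]Rmult_1_r; apply: Rmult_le_compat_l; lra].
  by rewrite -(Rinv_inv (INR n)); apply: Rinv_le_contravar => //; exact: Rinv_0_lt_compat.
have hB : l + s - ln H <= B * ln l.
  have a1 := Rle_abs c0; have a2 := Rabs_pos c0; have a3 := pos_INR m; rewrite EH /B.
  have : s <= s * ln l by nra.
  have : Rabs c0 <= Rabs c0 * ln l by nra.
  lra.
have lnH0 : 0 <= ln H by lra.
have H1 : 1 <= H by rewrite -(exp_ln _ H0) -exp_0; apply: exp_le.
have lnHl : ln H <= l by apply: Rcomplements.ln_le.
split=> //.
have [_ h1] := cnt_bounds Hp n1'; have [h2 _] := cnt_bounds Hp (conj H1 (Rle_lt_trans _ _ _ Hn (proj2 n1'))).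
have h3 := @pow_shift_diff (ln H) l l (conj lnH0 lnHl) (Rle_refl l) ltac:(lra).
rewrite -/m -/den -/s in h1 h2; rewrite -/l in h1.
apply: (Rle_trans _ (((l + s) ^ m - ln H ^ m) / den)).
  have -> : ((l + s) ^ m - ln H ^ m) / den = (l + s) ^ m / den - ln H ^ m / den by field; lra.
  by lra.
apply/Rle_div_l => //; apply: Rle_trans h3 _.
have -> : INR m * (1 + s) ^ k * B / den * (l ^ k * ln l) * den =
  INR m * (1 + s) ^ k * (l ^ k * (B * ln l)) by field; lra.
apply: Rmult_le_compat_l.
  by apply: Rmult_le_pos; [exact: pos_INR|apply: pow_le; lra].
have lk0 : 0 < l ^ k by apply: pow_lt; lra.
by apply: Rmult_le_compat_l; lra.
Qed.

(** Up to [1 / r] the deviation is at most [d^2 r h], hence a multiple of [hump]. Beyond [1 / r] it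
    is at most 1, and the few elements there are counted by [cnt_top_window] with exponent 0. *)
Lemma sum_qn_near D c4 Cu cden : exists C n0, forall n r eps, (n0 <= n)%N ->
  regime e k p D c4 Cu cden n r (sqrt (ln (INR n) ^ k)) eps ->
  0 < c4 -> / INR n <= r -> r <= INR d ^ 2 * cnt m p n.+1 (INR n) / INR n ->
  \big[Rplus/0]_(h : 'I_n.+1 | inS m p h) Rabs (qn e k p r h - (1 - / INR d))
   <= C * (ln (INR n) ^ k * ln (ln (INR n))).
Proof.
have [C1 [n1 H1]] := cnt_top_window 0.
exists (4 * INR d ^ 2 * Rabs Cu + C1).
have [n0 Hn0] := evR_nat (evR_ge (exp 1)).
exists (maxn n0 n1) => n r eps; rewrite geq_max => /andP [/Hn0 hl nn1] Hrg c40 hr1 hr.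
have r0 := rg_r Hrg; have [_ hw] := H1 n r nn1 r0 hr1 hr.
rewrite /Rdiv Rinv_1 Rmult_1_r in hw.
set l := ln (INR n) in Hrg hl hw *.
have l2 : 2 <= l by have := exp_ineq1_le 1; lra.
have ll1 : 1 <= ln l by rewrite -{1}(ln_exp 1); apply: Rcomplements.ln_le => //; exact: exp_pos.
set N := / r in hw *; have N0 : 0 < N by apply: Rinv_0_lt_compat.
have lk0 : 0 < l ^ k by apply: pow_lt; lra.
have Elam : sqrt (l ^ k) ^ 2 = l ^ k by rewrite pow2_sqrt //; lra.
have dd2 : 0 < INR d ^ 2 by nra.
set q0 := 1 - / INR d.
apply: (Rle_trans _ (\big[Rplus/0]_(h : 'I_n.+1 | inS m p h)
   (4 * INR d ^ 2 * hump (r * INR h) + (b2R (Rleb (INR h) (INR n)) - b2R (Rleb (INR h) N))))).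
  apply: rsum_le => h Sh.
  have t0 : 0 <= r * INR h by apply: Rmult_le_pos; [lra|exact: pos_INR].
  have hu0 := hump_ge0 t0.
  have hhn : Rleb (INR h) (INR n) by apply/RlebP; apply: INR_leq; rewrite -ltnS.
  rewrite hhn /qn /law Sh -/d.
  have h1 := Ew_nz_bounds e t0; have h2 := Ew_nz_near e t0; rewrite -/d -/q0 in h1 h2.
  have q01 : 0 <= q0 <= 1.
    have : / INR d <= 1 by rewrite -Rinv_1; apply: Rinv_le_contravar; lra.
    by have : 0 < / INR d by [apply: Rinv_0_lt_compat; lra]; rewrite /q0; lra.
  have bt : b2R true = 1 by [].
  have bf : b2R false = 0 by [].
  case: RlebP => hN; rewrite ?bt ?bf.
    have t1 : r * INR h <= 1.
      have -> : 1 = r * N by rewrite /N; field; lra.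
      by apply: Rmult_le_compat_l; lra.
    have h3 : r * INR h <= 4 * hump (r * INR h).
      set t := r * INR h in t0 t1 *; rewrite /hump.
      have h4 : 0 < (1 + t) ^ 2 by apply: pow_lt; lra.
      have -> : 4 * (t / (1 + t) ^ 2) = (4 * t) / (1 + t) ^ 2 by field; lra.
      have h5 : (1 + t) ^ 2 <= 4 by nra.
      apply: (proj1 (Rle_div_r _ _ _ h4)); rewrite (Rmult_comm 4); exact: Rmult_le_compat_l.
    have := Rmult_le_compat_l _ _ _ (Rlt_le _ _ dd2) h3; lra.
  have h5 : 0 <= 4 * INR d ^ 2 * hump (r * INR h) by apply: Rmult_le_pos; lra.
  have h6 : Rabs (Ew d (tilt d (r * INR h)) nz - q0) <= 1 by apply: Rabs_le; lra.
  lra.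
rewrite rsum_add rsum_scal rsum_sub -/(cnt m p n.+1 (INR n)) -/(cnt m p n.+1 N).
have hh := rg_hump Hrg; rewrite Elam -/m in hh.
have h7 : 4 * INR d ^ 2 * (\big[Rplus/0]_(h : 'I_n.+1 | inS m p h) hump (r * INR h)) <=
   4 * INR d ^ 2 * Rabs Cu * (l ^ k * ln l).
  rewrite Rmult_assoc [X in _ <= X]Rmult_assoc Rmult_assoc; apply: Rmult_le_compat_l; first lra.
  apply: Rmult_le_compat_l; first lra.
  apply: Rle_trans hh _; have := Rle_abs Cu; have := Rabs_pos Cu => a1 a2.
  have : l ^ k <= l ^ k * ln l by nra.
  move=> a3; apply: (Rle_trans _ (Rabs Cu * l ^ k)); first by apply: Rmult_le_compat_r; lra.
  exact: Rmult_le_compat_l.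
have -> : (4 * INR d ^ 2 * Rabs Cu + C1) * (l ^ k * ln l) =
  4 * INR d ^ 2 * Rabs Cu * (l ^ k * ln l) + C1 * (l ^ k * ln l) by ring.
exact: Rplus_le_compat.
Qed.

End Asymptotics.

Lemma foldr_iota_inv_ln m p :
  (forall i, (i < m)%N -> (1 < p i)%N) ->
  foldr Rmult 1 (map (fun j => / ln (INR (p j))) (seq.iota 0%N m)) = / lnprod p m.
Proof.
move=> Hp.
have -> : foldr Rmult 1 (map (fun j => / ln (INR (p j))) (seq.iota 0%N m)) =
    \rprod_(j <- seq.iota 0%N m | true) / ln (INR (p j)).
  by elim: (seq.iota 0%N m) => [|j s IH]; rewrite ?big_nil //= IH big_cons.
rewrite (_ : seq.iota 0%N m = index_iota 0%N m); last by rewrite /index_iota subn0.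
rewrite big_mkord /lnprod.
have h0 (i : 'I_m) : ln (INR (p i)) <> 0.
  by have := ln_gt0 (x := INR (p i)); have := INR_ge2 (Hp _ (ltn_ord i)); move=> a b; have := b ltac:(lra); lra.
have L0 := lnprod_gt0 Hp.
have H : (\rprod_(i < m) / ln (INR (p i))) * lnprod p m = 1.
  by rewrite /lnprod -big_split big1 // => i _; apply: Rinv_l; exact: h0.
apply: (Rmult_eq_reg_r (lnprod p m)); last lra.
by rewrite Rinv_l; [exact: H|rewrite -/(lnprod p m); lra].
Qed.

Section MeanVariance.
Variables (e k : nat) (p : nat -> nat).
Hypotheses (k0 : (0 < k)%N) (Hp : coprime_bases k.+1 p).
Let d := e.+2.
Let m := k.+1.
Let q0 := 1 - / INR d.
Let S (n : nat) := cnt m p n.+1 (INR n).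

Lemma evR_lnln : evR (fun l => 2 <= l /\ 1 <= ln l).
Proof.
exists (exp 1) => l hl; split; first by have := exp_ineq1_le 1; lra.
by rewrite -{1}(ln_exp 1); apply: Rcomplements.ln_le => //; exact: exp_pos.
Qed.

(** The indicators of nonzero digits are compared with their tilted means [qn], and these with [q0].
    The correlations cost [O(l^k)]; the elements above [1 / r], where the tilt is not small, cost
    [l^k ln l] and produce the double logarithm. *)
Lemma mean_var_count : exists C n0, forall n, (n0 <= n)%N ->
  [/\ (0 < Pcount d m p n)%N,
   Rabs (EW d m p n - S n * q0) <= C * (ln (INR n) ^ k * ln (ln (INR n))) &
   Rabs (VarW d m p n - S n * (q0 * (1 - q0))) <= C * (ln (INR n) ^ k * ln (ln (INR n)))].
Proof.
have d2 := INR_d_ge2 e; rewrite -/d in d2.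
have [c4 [Cu [cden [c40 cden0 [n1 H1]]]]] := regime_eventually e k0 Hp (isT : (0 < 1)%N).
have [C2 [n2 H2]] := sum_qn_near e Hp 1 c4 Cu cden.
have [n3 H3] := evR_nat evR_lnln.
set ca := Ca e k p c4 cden * Cu + Ce e cden.
set cv := Ca e k p c4 cden * Cu + Cb e k p c4 cden * Cu ^ 2 + Ce e cden.
exists (Rabs ca + ca ^ 2 + Rabs cv + C2), (maxn n1 (maxn n2 n3)) => n.
rewrite !geq_max => /andP [h1 /andP [h2 h3]].
have [r [eps [Hrg hr1 hr2]]] := H1 n h1; have [hl1 hl2] := H3 n h3.
set l := ln (INR n) in Hrg hl1 hl2 *.
have P0 := Pcount_gt0 cden0 Hrg; rewrite -/d -/m in P0.
have HQ := H2 n r eps h2 Hrg c40 hr1 hr2; rewrite -/l -/m in HQ.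
have lk1 : 1 <= l ^ k by apply: pow_R1_Rle; lra.
set lam := sqrt (l ^ k) in Hrg.
have Elam : lam ^ 2 = l ^ k by rewrite pow2_sqrt //; lra.
have [lam1 lam2] := sqrt_le_self lk1; rewrite -/lam in lam1 lam2.
pose Tp (h : 'I_n.+1) := inS m p h.
have TS h : Tp h -> inS m p h by [].
have M1 := mean_T k0 Hp (isT : (0 < 1)%N) c40 cden0 Hrg TS.
have M2 := second_moment_T k0 Hp (isT : (0 < 1)%N) c40 cden0 Hrg TS.
rewrite -/ca -/cv Elam in M1 M2.
set q := qn e k p r in HQ M1 M2.
set Q := \big[Rplus/0]_(h : 'I_n.+1 | inS m p h) q h.
pose Z (a : {ffun 'I_n.+1 -> 'I_d}) := \big[Rplus/0]_(h : 'I_n.+1 | inS m p h) (nz (a h) - q h).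
have EZ a : @is_rep d m p n a -> INR (@weight d n a) - Q = Z a.
  by move=> Ha; rewrite (weight_sum Ha) /Z rsum_sub.
have EE : EW d m p n - Q = RE m p Z.
  rewrite EW_RE -(RE_const P0 Q) -(RE_sub P0); apply: eq_RE => a Ha.
  exact: EZ.
have EV : VarW d m p n = RE m p (fun a => Z a ^ 2) - (RE m p Z) ^ 2.
  rewrite VarW_RE EW_RE (RE_var P0 _ Q) -EW_RE EE; congr (_ - _).
  by apply: eq_RE => a Ha; rewrite EZ.
rewrite -/Z in M1; have M1' : Rabs (RE m p Z) <= ca * lam by exact: M1.
have M2' : Rabs (RE m p (fun a => Z a ^ 2) - \big[Rplus/0]_(h : 'I_n.+1 | inS m p h) (q h * (1 - q h))) <= cv * l ^ k by exact: M2.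
have hS : \big[Rplus/0]_(h : 'I_n.+1 | inS m p h) 1 = S n.
  by rewrite (sum_inS_count k p n).
have hQ : Rabs (Q - S n * q0) <= C2 * (l ^ k * ln l).
  apply: Rle_trans HQ.
  have -> : S n * q0 = \big[Rplus/0]_(h : 'I_n.+1 | inS m p h) q0.
    by rewrite -hS -rsum_scalr; apply: eq_bigr => h _; ring.
  by rewrite /Q -rsum_sub; apply: rsum_abs.
have q01 : 0 <= q0 <= 1.
  have : / INR d <= 1 by rewrite -Rinv_1; apply: Rinv_le_contravar; lra.
  by have : 0 < / INR d by [apply: Rinv_0_lt_compat; lra]; rewrite /q0; lra.
have hQ2 : Rabs (\big[Rplus/0]_(h : 'I_n.+1 | inS m p h) (q h * (1 - q h)) - S n * (q0 * (1 - q0)))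
    <= C2 * (l ^ k * ln l).
  apply: Rle_trans HQ.
  have -> : S n * (q0 * (1 - q0)) = \big[Rplus/0]_(h : 'I_n.+1 | inS m p h) (q0 * (1 - q0)).
    by rewrite -hS -rsum_scalr; apply: eq_bigr => h _; ring.
  rewrite -rsum_sub; apply: Rle_trans (rsum_abs _ _ _) _; apply: rsum_le => h _.
  have qb := qn_bounds Hrg h; rewrite -/q in qb.
  (* [x (1 - x)] is 1-Lipschitz on [[0, 1]], so the bound for the means serves for the variances. *)
  have -> : q h * (1 - q h) - q0 * (1 - q0) = (q h - q0) * (1 - q h - q0) by ring.
  rewrite Rabs_mult; have : Rabs (1 - q h - q0) <= 1 by apply: Rabs_le; lra.
  by have := Rabs_pos (q h - q0); rewrite -/q0; nra.
have ca0 := Rle_abs ca; have ca0' := Rabs_pos ca.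
have cv0 := Rle_abs cv; have cv0' := Rabs_pos cv.
have lkl : l ^ k <= l ^ k * ln l by nra.
have C20 : 0 <= C2 * (l ^ k * ln l) by apply: Rle_trans hQ; exact: Rabs_pos.
have X1 : ca * lam <= Rabs ca * (l ^ k * ln l).
  apply: (Rle_trans _ (Rabs ca * lam)); first by apply: Rmult_le_compat_r; lra.
  by apply: Rmult_le_compat_l; lra.
have X2 : cv * l ^ k <= Rabs cv * (l ^ k * ln l).
  apply: (Rle_trans _ (Rabs cv * l ^ k)); first by apply: Rmult_le_compat_r; lra.
  by apply: Rmult_le_compat_l; lra.
have X3 : (RE m p Z) ^ 2 <= ca ^ 2 * (l ^ k * ln l).
  apply: (Rle_trans _ (ca ^ 2 * l ^ k)); last by apply: Rmult_le_compat_l => //; exact: pow2_ge_0.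
  rewrite -Elam -Rpow_mult_distr -(pow2_abs (RE m p Z)); apply: pow_incr; split=> //.
  exact: Rabs_pos.
have X4 : 0 <= ca ^ 2 * (l ^ k * ln l) by apply: Rmult_le_pos; [exact: pow2_ge_0|lra].
have X5 : 0 <= Rabs cv * (l ^ k * ln l) by apply: Rmult_le_pos; lra.
have X6 : 0 <= Rabs ca * (l ^ k * ln l) by apply: Rmult_le_pos; lra.
split=> //.
  have -> : EW d m p n - S n * q0 = RE m p Z + (Q - S n * q0) by rewrite -EE; ring.
  by apply: Rle_trans (Rabs_triang _ _) _; lra.
set Q2 := \big[Rplus/0]_(h : 'I_n.+1 | inS m p h) _ in M2' hQ2.
have -> : VarW d m p n - S n * (q0 * (1 - q0)) =
  (RE m p (fun a => Z a ^ 2) - Q2) + (Q2 - S n * (q0 * (1 - q0))) + - (RE m p Z) ^ 2.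
  by rewrite EV; ring.
apply: Rle_trans (Rabs_triang _ _) _.
have := Rabs_triang (RE m p (fun a => Z a ^ 2) - Q2) (Q2 - S n * (q0 * (1 - q0))).
rewrite Rabs_Ropp (Rabs_pos_eq ((RE m p Z) ^ 2)); last exact: pow2_ge_0.
lra.
Qed.

Lemma mean_var_asymptotics :
  (exists C : R, exists N0 : nat, forall n : nat, (N0 <= n)%N ->
     Rabs (EW d m p n
           - kappa d m p * (INR d - 1) / (INR d * ln (INR d)) * ln (INR n) ^ m)
     <= C * ln (INR n) ^ k * ln (ln (INR n)))
  /\
  (exists C : R, exists N0 : nat, forall n : nat, (N0 <= n)%N ->
     Rabs (VarW d m p n
           - kappa d m p * (INR d - 1) / (INR d ^ 2 * ln (INR d)) * ln (INR n) ^ m)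
     <= C * ln (INR n) ^ k * ln (ln (INR n))).
Proof.
have d2 := INR_d_ge2 e; rewrite -/d in d2.
have [Hpos _] := Hp.
have ld : 0 < ln (INR d) by apply: ln_gt0; lra.
have [C1 [n1 H1]] := mean_var_count.
have [n3 H3] := evR_nat evR_lnln.
set den := INR (Factorial.fact m) * lnprod p m.
have den0 : 0 < den := cnt_den_gt0 Hp.
set C2 := INR m * (1 + lnsum p m) ^ k * lnsum p m / den.
have q01 : 0 <= q0 <= 1.
  have : / INR d <= 1 by rewrite -Rinv_1; apply: Rinv_le_contravar; lra.
  by have : 0 < / INR d by [apply: Rinv_0_lt_compat; lra]; rewrite /q0; lra.
have Ek : kappa d m p = ln (INR d) / den.
  by rewrite /kappa foldr_iota_inv_ln // /den; field; split; [have := lnprod_gt0 Hpos|have := INR_fact_gt0 m]; rewrite -/m; lra.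
have key n (v x : R) : (maxn n1 (maxn n3 1) <= n)%N -> 0 <= x <= 1 ->
  Rabs (v - S n * x) <= C1 * (ln (INR n) ^ k * ln (ln (INR n))) ->
  Rabs (v - ln (INR n) ^ m / den * x) <= (C1 + C2) * ln (INR n) ^ k * ln (ln (INR n)).
  rewrite !geq_max => /andP [h1 /andP [h3 h4]] [x0 x1] hv.
  have [hl1 hl2] := H3 n h3; set l := ln (INR n) in hl1 hl2 hv *.
  have hS := cnt_near Hp h4 (erefl l) ltac:(lra).
  rewrite -/m -/den -/C2 -/(S n) in hS.
  have lk1 : 1 <= l ^ k by apply: pow_R1_Rle; lra.
  have -> : v - l ^ m / den * x = (v - S n * x) + (S n - l ^ m / den) * x by ring.
  apply: Rle_trans (Rabs_triang _ _) _.
  rewrite Rabs_mult (Rabs_pos_eq x) //.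
  have h5 : Rabs (S n - l ^ m / den) * x <= C2 * (l ^ k * ln l).
    have := Rabs_pos (S n - l ^ m / den) => a0.
    have C20 : 0 <= C2 * l ^ k by lra.
    have : C2 * l ^ k <= C2 * (l ^ k * ln l) by nra.
    nra.
  have -> : (C1 + C2) * l ^ k * ln l = C1 * (l ^ k * ln l) + C2 * (l ^ k * ln l) by ring.
  lra.
split; exists (C1 + C2), (maxn n1 (maxn n3 1)) => n hn;
  have hn1 : (n1 <= n)%N by [move: hn; rewrite !geq_max => /andP []];
  have [_ hE hV] := H1 n hn1.
  have -> : kappa d m p * (INR d - 1) / (INR d * ln (INR d)) * ln (INR n) ^ m =
    ln (INR n) ^ m / den * q0 by rewrite Ek /q0; field; lra.
  exact: key.
have -> : kappa d m p * (INR d - 1) / (INR d ^ 2 * ln (INR d)) * ln (INR n) ^ m =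
    ln (INR n) ^ m / den * (q0 * (1 - q0)) by rewrite Ek /q0; field; lra.
by apply: key => //; nra.
Qed.

End MeanVariance.

(** * The Gaussian integral *)

Definition gs (t : R) : R := exp (- (t ^ 2) / 2).
Definition Phi0 (t : R) : R := RInt gs 0 t.

Lemma gs_pos t : 0 < gs t. Proof. exact: exp_pos. Qed.

Lemma gs_le1 t : gs t <= 1.
Proof.
rewrite -exp_0 /gs; case: (Req_dec t 0) => [->|t0].
  by rewrite /= Rmult_0_l Ropp_0 /Rdiv Rmult_0_l; lra.
apply: Rlt_le; apply: exp_increasing; have := pow2_gt_0 t t0; lra.
Qed.

Lemma continuous_gs t : continuous gs t.
Proof. by apply: ex_derive_continuous; rewrite /gs; auto_derive. Qed.

Lemma ex_RInt_gs a b : ex_RInt gs a b.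
Proof. by apply: ex_RInt_continuous => z _; exact: continuous_gs. Qed.

Lemma is_derive_Phi0 t : is_derive Phi0 t (gs t).
Proof.
apply: (is_derive_RInt gs Phi0 0 t); last exact: continuous_gs.
by apply: filter_forall => y; apply: RInt_correct; exact: ex_RInt_gs.
Qed.

Lemma Phi0_diff a b : a <= b -> 0 <= Phi0 b - Phi0 a <= b - a.
Proof.
move=> ab; have [||c [_ ->]] := MVT_gen Phi0 a b gs.
- by move=> x _; exact: is_derive_Phi0.
- move=> x _; apply: derivable_continuous_pt; exists (gs x).
  by apply/is_derive_Reals; exact: is_derive_Phi0.
by have := gs_pos c; have := gs_le1 c; nra.
Qed.

Lemma Phi0_0 : Phi0 0 = 0.
Proof. by rewrite /Phi0 RInt_point. Qed.

Lemma Phi0_opp t : Phi0 (- t) = - Phi0 t.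
Proof.
have H x : is_derive (fun y => Phi0 (- y) + Phi0 y) x 0.
  have -> : 0 = plus (scal (- 1) (gs (- x))) (gs x).
    rewrite /plus /scal /= /mult /= /gs.
    have -> : (- x) ^ 2 = x ^ 2 by ring.
    ring.
  apply: is_derive_plus; last exact: is_derive_Phi0.
  apply: (is_derive_comp Phi0 Ropp); first exact: is_derive_Phi0.
  by auto_derive.
have [||c [_ E]] := MVT_gen (fun y => Phi0 (- y) + Phi0 y) 0 t (fun=> 0).
- by move=> x _; exact: H.
- by move=> x _; apply: derivable_continuous_pt; exists 0; apply/is_derive_Reals; exact: H.
by rewrite Ropp_0 Phi0_0 in E; lra.
Qed.

(** The classical companion of the Gaussian integral: its derivative is [- gs t * Phi0 t], so
    [Phi0^2 + 2 Gaux] is constant, and at 0 it is an arctangent integral. *)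
Definition Gaux (t : R) : R := RInt (fun u => exp (- (t ^ 2 * (1 + u ^ 2)) / 2) / (1 + u ^ 2)) 0 1.

Lemma one_plus_sq_pos u : 0 < 1 + u ^ 2.
Proof. by have := pow2_ge_0 u; lra. Qed.

Lemma is_derive_Gaux_integrand t u :
  is_derive (fun z => exp (- (z ^ 2 * (1 + u ^ 2)) / 2) / (1 + u ^ 2)) t
    (- (t * exp (- (t ^ 2 * (1 + u ^ 2)) / 2))).
Proof.
have h := one_plus_sq_pos u; auto_derive; first by split => //; lra.
rewrite (_ : - (t * (t * 1) * (1 + u * (u * 1))) * / 2 = - (t ^ 2 * (1 + u ^ 2)) / 2); last by field.
by field; rewrite /= in h; lra.
Qed.

Lemma is_derive_Gaux t : is_derive Gaux t (- (gs t * Phi0 t)).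
Proof.
have E u v : Derive (fun z => exp (- (z ^ 2 * (1 + v ^ 2)) / 2) / (1 + v ^ 2)) u =
  - (u * exp (- (u ^ 2 * (1 + v ^ 2)) / 2)).
  by apply: is_derive_unique; exact: is_derive_Gaux_integrand.
have -> : - (gs t * Phi0 t) =
  RInt (fun u => Derive (fun z => exp (- (z ^ 2 * (1 + u ^ 2)) / 2) / (1 + u ^ 2)) t) 0 1.
  have -> : Phi0 t = RInt (fun u => t * gs (t * u + 0)) 0 1.
    rewrite (RInt_comp_lin gs t 0 0 1) ?Rmult_0_r ?Rmult_1_r ?Rplus_0_r //.
    exact: ex_RInt_gs.
  have ex1 : ex_RInt (fun u => t * gs (t * u + 0)) 0 1.
    apply: ex_RInt_continuous => z _; apply: ex_derive_continuous.
    by rewrite /gs; auto_derive.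
  have -> : - (gs t * RInt (fun u => t * gs (t * u + 0)) 0 1) =
     RInt (fun u => scal (- gs t) (t * gs (t * u + 0))) 0 1.
    rewrite (RInt_scal (fun u => t * gs (t * u + 0)) 0 1 (- gs t) ex1).
    exact: Ropp_mult_distr_l.
  apply: RInt_ext => u _; rewrite E /scal /= /mult /= /gs Rplus_0_r.
  have -> : - exp (- t ^ 2 / 2) * (t * exp (- (t * u) ^ 2 / 2)) =
    - (t * (exp (- t ^ 2 / 2) * exp (- (t * u) ^ 2 / 2))) by ring.
  rewrite -exp_plus; congr (- (t * exp _)); rewrite /=; field.
apply: is_derive_RInt_param.
- by apply: filter_forall => x u _; eexists; exact: is_derive_Gaux_integrand.
- move=> u _; apply: (continuity_2d_pt_ext (fun x y => - (x * exp (- (x ^ 2 * (1 + y ^ 2)) / 2)))).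
    by move=> x y; rewrite E.
  apply: continuity_2d_pt_opp; apply: continuity_2d_pt_mult; first exact: continuity_2d_pt_id1.
  apply: continuity_1d_2d_pt_comp.
    by apply: derivable_continuous_pt; exact: derivable_pt_exp.
  apply: (continuity_2d_pt_ext (fun x y => - (/ 2) * ((x * x) * (1 + y * y)))).
    by move=> x y /=; field.
  apply: continuity_2d_pt_mult; first exact: continuity_2d_pt_const.
  apply: continuity_2d_pt_mult.
    by apply: continuity_2d_pt_mult; exact: continuity_2d_pt_id1.
  apply: continuity_2d_pt_plus; first exact: continuity_2d_pt_const.
  by apply: continuity_2d_pt_mult; exact: continuity_2d_pt_id2.
apply: filter_forall => y; apply: ex_RInt_continuous => z _; apply: ex_derive_continuous.
by have h := one_plus_sq_pos z; auto_derive; rewrite /= in h; lra.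
Qed.

Lemma Gaux_0 : Gaux 0 = PI / 4.
Proof.
rewrite -atan_1 /Gaux.
have -> : atan 1 = atan 1 - atan 0 by rewrite atan_0; ring.
apply: is_RInt_unique; apply: (is_RInt_ext (fun u => / (1 + u ^ 2))).
  move=> u _; have h := one_plus_sq_pos u.
  have -> : - (0 ^ 2 * (1 + u ^ 2)) / 2 = 0 by rewrite /=; field.
  by rewrite exp_0 /Rdiv Rmult_1_l.
apply: (is_RInt_derive atan (fun u => / (1 + u ^ 2))).
  move=> x _; apply/is_derive_Reals; have := derivable_pt_lim_atan x.
  by rewrite /Rsqr /= Rmult_1_r.
move=> x _; apply: ex_derive_continuous; have h := one_plus_sq_pos x.
by auto_derive; rewrite /= in h; lra.
Qed.

Lemma Gaux_bounds t : 0 <= Gaux t <= gs t.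
Proof.
have ex : ex_RInt (fun u => exp (- (t ^ 2 * (1 + u ^ 2)) / 2) / (1 + u ^ 2)) 0 1.
  apply: ex_RInt_continuous => z _; apply: ex_derive_continuous.
  by have h := one_plus_sq_pos z; auto_derive; rewrite /= in h; lra.
split.
  apply: RInt_ge_0 => [|//|u _]; first lra.
  by apply: Rlt_le; apply: Rdiv_lt_0_compat; [exact: exp_pos|exact: one_plus_sq_pos].
have -> : gs t = RInt (fun=> gs t) 0 1.
  by rewrite RInt_const /scal /= /mult /=; ring.
apply: RInt_le => [|//||u _]; first lra.
  exact: ex_RInt_const.
have h := one_plus_sq_pos u; have h0 := pow2_ge_0 u; have h1 := pow2_ge_0 t.
apply/Rle_div_l => //.
have : exp (- (t ^ 2 * (1 + u ^ 2)) / 2) <= gs t.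
  have h2 : 0 <= t ^ 2 * u ^ 2 by apply: Rmult_le_pos.
  case: (Rle_lt_or_eq_dec _ _ h2) => [h3|h3].
    by apply: Rlt_le; apply: exp_increasing; lra.
  by apply: Req_le; rewrite /gs; congr exp; lra.
have := gs_pos t; nra.
Qed.

Lemma gauss_integral_identity t : Phi0 t ^ 2 + 2 * Gaux t = PI / 2.
Proof.
have H x : is_derive (fun y => Phi0 y ^ 2 + 2 * Gaux y) x 0.
  have d1 := is_derive_Phi0 x; have d2 := is_derive_Gaux x.
  have -> : 0 = 2 * Phi0 x * gs x + 2 * (- (gs x * Phi0 x)) by ring.
  apply: (is_derive_plus (fun y => Phi0 y ^ 2) (fun y => 2 * Gaux y)).
    have -> : 2 * Phi0 x * gs x = INR 2 * gs x * Phi0 x ^ 1 by rewrite /=; ring.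
    exact: is_derive_pow.
  by apply: (is_derive_scal Gaux).
have [||c [_ E]] := MVT_gen (fun y => Phi0 y ^ 2 + 2 * Gaux y) 0 t (fun=> 0).
- by move=> x _; exact: H.
- by move=> x _; apply: derivable_continuous_pt; exists 0; apply/is_derive_Reals; exact: H.
rewrite Phi0_0 Gaux_0 in E; rewrite /= in E *; lra.
Qed.

Lemma Phi0_cvg eps : 0 < eps -> exists A0, 1 <= A0 /\ forall A, A0 <= A ->
  Rabs (Phi0 A - sqrt (PI / 2)) <= eps.
Proof.
move=> e0; have P0 := PI_RGT_0; have P2 := PI2_1.
(* The distance to the limit is at most [2 * Gaux A <= 2 * gs A <= 2 / A]. *)
exists (Rmax 1 (2 / eps)); split; first exact: Rmax_l.
move=> A hA.
have A1 : 1 <= A by apply: Rle_trans hA; exact: Rmax_l.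
have A2 : 2 / eps <= A by apply: Rle_trans hA; exact: Rmax_r.
have hPhi : 0 <= Phi0 A by have := @Phi0_diff 0 A; rewrite Phi0_0; lra.
have hs : 1 <= sqrt (PI / 2) by rewrite -sqrt_1; apply: sqrt_le_1_alt; lra.
have hs2 : sqrt (PI / 2) ^ 2 = PI / 2 by rewrite pow2_sqrt //; lra.
have hid := gauss_integral_identity A; have [g0 g1] := Gaux_bounds A.
have hg : gs A <= / A.
  rewrite /gs; have -> : - A ^ 2 / 2 = - (A ^ 2 / 2) by field.
  rewrite exp_Ropp; apply: Rinv_le_contravar; first lra.
  have := exp_ineq1_le (A ^ 2 / 2); nra.
have h1 : sqrt (PI / 2) - Phi0 A <= 2 * / A.
  have : (sqrt (PI / 2) - Phi0 A) * (sqrt (PI / 2) + Phi0 A) = 2 * Gaux A.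
    by rewrite -Rsqr_plus_minus in hs2 * || nra.
  nra.
have h2 : 0 <= sqrt (PI / 2) - Phi0 A by nra.
have h3 : 2 * / A <= eps.
  apply: (Rmult_le_reg_r A); first lra.
  rewrite Rmult_assoc Rinv_l; last lra.
  move/(Rle_div_l _ _ _ e0): A2; lra.
by rewrite Rabs_left1; lra.
Qed.

(** The integral from [- A] is [Phi0 x + Phi0 A] up to normalisation, and the second term tends to
    [sqrt (PI / 2)]; this determines [l]. *)
Lemma std_normal_cdf_Phi0 x l : std_normal_cdf_is x l -> l = / 2 + Phi0 x / sqrt (2 * PI).
Proof.
move=> H; have P0 := PI_RGT_0.
have s0 : 0 < sqrt (2 * PI) by apply: sqrt_lt_R0; lra.
have E2 : sqrt (PI / 2) / sqrt (2 * PI) = / 2.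
  have -> : 2 * PI = 4 * (PI / 2) by field.
  rewrite sqrt_mult; try lra.
  have -> : sqrt 4 = 2 by have -> : 4 = 2 * 2 by [ring]; rewrite sqrt_square; lra.
  by field; apply: Rgt_not_eq; apply: sqrt_lt_R0; lra.
apply: cond_eq => eps e0.
have [A0 HA0] := H (eps / 2) ltac:(lra).
have [A1 [A11 HA1]] := Phi0_cvg (Rmult_lt_0_compat _ _ (Rdiv_lt_0_compat _ _ e0 Rlt_0_2) s0).
set A := Rmax A0 A1.
have exg : ex_RInt gauss_density (- A) x.
  apply: ex_RInt_continuous => z _; apply: ex_derive_continuous.
  by rewrite /gauss_density; auto_derive.
have pr := ex_RInt_Reals_0 _ _ _ exg.
have := HA0 A (Rmax_l _ _) pr; rewrite -RInt_Reals.
have -> : RInt gauss_density (- A) x = (Phi0 x + Phi0 A) / sqrt (2 * PI).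
  have -> : RInt gauss_density (- A) x = RInt (fun t => scal (/ sqrt (2 * PI)) (gs t)) (- A) x.
    by apply: RInt_ext => t _.
  rewrite RInt_scal; last exact: ex_RInt_gs.
  have -> : RInt gs (- A) x = Phi0 x + Phi0 A.
    have -> : Phi0 A = - Phi0 (- A) by rewrite Phi0_opp; ring.
    have h := RInt_Chasles gs (- A) 0 x (ex_RInt_gs _ _) (ex_RInt_gs _ _).
    rewrite -h /plus /= /Phi0 -(opp_RInt_swap gs 0 (- A)); last exact: ex_RInt_gs.
    by rewrite /opp /=; ring.
  by rewrite /scal /= /mult /= /Rdiv; ring.
have := HA1 A (Rmax_r _ _) => h1 h2.
have h3 : Rabs (Phi0 A / sqrt (2 * PI) - / 2) <= eps / 2.
  rewrite -E2 -RIneq.Rdiv_minus_distr Rabs_div ?(Rabs_pos_eq (sqrt (2 * PI))); try lra.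
  by apply/Rle_div_l; lra.
have E : l - (/ 2 + Phi0 x / sqrt (2 * PI)) =
  - ((Phi0 x + Phi0 A) / sqrt (2 * PI) - l) + (Phi0 A / sqrt (2 * PI) - / 2) by field; lra.
rewrite E; apply: Rle_lt_trans (Rabs_triang _ _) _; rewrite Rabs_Ropp; lra.
Qed.

(** * The de Moivre-Laplace theorem *)

Lemma exp_sub_sq_le u : - / 2 <= u <= / 2 -> exp (u - 2 * u ^ 2) <= 1 + u.
Proof.
move=> hu; have -> : u - 2 * u ^ 2 = - (- u + 2 * u ^ 2) by ring.
rewrite exp_Ropp -[X in _ <= X]Rinv_inv; apply: Rinv_le_contravar.
  by apply: Rinv_0_lt_compat; lra.
apply: Rle_trans (exp_ineq1_le _).
have -> : / (1 + u) = 1 / (1 + u) by rewrite /Rdiv Rmult_1_l.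
by apply/Rle_div_l; nra.
Qed.

Section Binomial.
Variable q : R.
Hypothesis q01 : 0 < q < 1.

Definition binp (N j : nat) : R := INR 'C(N, j) * q ^ j * (1 - q) ^ (N - j)%N.

Lemma binp_ge0 N j : 0 <= binp N j.
Proof.
apply: Rmult_le_pos; last by apply: pow_le; lra.
by apply: Rmult_le_pos; [exact: pos_INR|apply: pow_le; lra].
Qed.

Lemma binp_gt0 N j : (j <= N)%N -> 0 < binp N j.
Proof.
move=> jN; apply: Rmult_lt_0_compat; last by apply: pow_lt; lra.
apply: Rmult_lt_0_compat; last by apply: pow_lt; lra.
by apply: (@INR_ltn 0); rewrite bin_gt0.
Qed.

Lemma binp_small N j : (N < j)%N -> binp N j = 0.
Proof. by move=> h; rewrite /binp bin_small // Rmult_0_l Rmult_0_l. Qed.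

Lemma binpS N j : binp N.+1 j.+1 = (1 - q) * binp N j.+1 + q * binp N j.
Proof.
rewrite {1}/binp binS INR_add subSS.
case: (ltnP j N) => jN.
  rewrite /binp; have -> : (N - j = (N - j.+1).+1)%N by rewrite subnSK.
  by rewrite -![_ ^ _.+1]/(_ * _ ^ _); ring.
rewrite (@binp_small N j.+1) // bin_small // /binp [INR 0]/=.
by rewrite -[q ^ _.+1]/(q * q ^ _); ring.
Qed.

Lemma binp0 N : binp N.+1 0 = (1 - q) * binp N 0.
Proof. by rewrite /binp !bin0 !subn0 -[(1 - q) ^ _.+1]/((1 - q) * (1 - q) ^ _); ring. Qed.

(** Pascal's rule, read as conditioning on the last of [N + 1] trials. The moments below follow by
    induction on [N]. *)
Lemma sum_binpS N (f : nat -> R) :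
  \rsum_(j < N.+2) (binp N.+1 j * f j) =
  (1 - q) * (\rsum_(j < N.+1) (binp N j * f j)) + q * (\rsum_(j < N.+1) (binp N j * f j.+1)).
Proof.
rewrite big_ord_recl.
have -> : \rsum_(j < N.+1) (binp N.+1 (lift ord0 j) * f (lift ord0 j)) =
  (1 - q) * (\rsum_(j < N.+1) (binp N j.+1 * f j.+1)) + q * (\rsum_(j < N.+1) (binp N j * f j.+1)).
  rewrite -!rsum_scal -rsum_add; apply: eq_bigr => j _; rewrite lift0 binpS; ring.
rewrite -[nat_of_ord ord0]/0%N binp0.
suff <- : binp N 0 * f 0%N + \rsum_(j < N.+1) (binp N j.+1 * f j.+1) =
  \rsum_(j < N.+1) (binp N j * f j) by ring.
transitivity (\rsum_(j < N.+2) (binp N j * f j)).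
  by rewrite [RHS]big_ord_recl; congr (_ + _); apply: eq_bigr => j _; rewrite lift0.
by rewrite big_ord_recr /= binp_small // Rmult_0_l Rplus_0_r.
Qed.

Lemma sum_binp N : \rsum_(j < N.+1) (binp N j * 1) = 1.
Proof.
elim: N => [|N IH]; first by rewrite big_ord_recl big_ord0 /binp /=; ring.
by rewrite (sum_binpS N (fun=> 1)) IH; ring.
Qed.

Lemma sum_binp_lin N : \rsum_(j < N.+1) (binp N j * (INR j - INR N * q)) = 0.
Proof.
elim: N => [|N IH]; first by rewrite big_ord_recl big_ord0 /binp /=; ring.
rewrite (sum_binpS N (fun j => INR j - INR N.+1 * q)).
have -> : \rsum_(j < N.+1) (binp N j * (INR j - INR N.+1 * q)) =
  \rsum_(j < N.+1) (binp N j * (INR j - INR N * q)) - q * \rsum_(j < N.+1) (binp N j * 1).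
  rewrite -rsum_scal -rsum_sub; apply: eq_bigr => j _; rewrite S_INR; ring.
have -> : \rsum_(j < N.+1) (binp N j * (INR j.+1 - INR N.+1 * q)) =
  \rsum_(j < N.+1) (binp N j * (INR j - INR N * q)) + (1 - q) * \rsum_(j < N.+1) (binp N j * 1).
  rewrite -rsum_scal -rsum_add; apply: eq_bigr => j _; rewrite !S_INR; ring.
by rewrite IH sum_binp; ring.
Qed.

Lemma sum_binp_var N :
  \rsum_(j < N.+1) (binp N j * (INR j - INR N * q) ^ 2) = INR N * q * (1 - q).
Proof.
elim: N => [|N IH]; first by rewrite big_ord_recl big_ord0 /binp /=; ring.
rewrite (sum_binpS N (fun j => (INR j - INR N.+1 * q) ^ 2)).
have -> : \rsum_(j < N.+1) (binp N j * (INR j - INR N.+1 * q) ^ 2) =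
  \rsum_(j < N.+1) (binp N j * (INR j - INR N * q) ^ 2) +
  (- 2 * q * (\rsum_(j < N.+1) (binp N j * (INR j - INR N * q))) + q ^ 2 * \rsum_(j < N.+1) (binp N j * 1)).
  rewrite -!rsum_scal -!rsum_add; apply: eq_bigr => j _; rewrite S_INR; ring.
have -> : \rsum_(j < N.+1) (binp N j * (INR j.+1 - INR N.+1 * q) ^ 2) =
  \rsum_(j < N.+1) (binp N j * (INR j - INR N * q) ^ 2) +
  (2 * (1 - q) * (\rsum_(j < N.+1) (binp N j * (INR j - INR N * q))) + (1 - q) ^ 2 * \rsum_(j < N.+1) (binp N j * 1)).
  rewrite -!rsum_scal -!rsum_add; apply: eq_bigr => j _; rewrite !S_INR; ring.
by rewrite IH sum_binp sum_binp_lin S_INR; ring.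
Qed.

Lemma binp_ratio N j : (j < N)%N ->
  binp N j.+1 * (INR j.+1 * (1 - q)) = binp N j * ((INR N - INR j) * q).
Proof.
move=> jN; have := congr1 INR (mul_bin_left N j); rewrite !INR_mul minus_INR; last by apply/leP; apply: ltnW.
rewrite /binp; have -> : (N - j = (N - j.+1).+1)%N by rewrite subnSK.
rewrite -[q ^ j.+1]/(q * q ^ j) -[(1 - q) ^ _.+1]/((1 - q) * (1 - q) ^ _).
set a := q ^ j; set b := (1 - q) ^ _ => h.
have -> : INR 'C(N, j.+1) * (q * a) * b * (INR j.+1 * (1 - q)) =
  (INR j.+1 * INR 'C(N, j.+1)) * (q * a * b * (1 - q)) by ring.
by rewrite h; ring.
Qed.

Section Local.
Variables (N : nat) (X : R).
Let s := sqrt (INR N * q * (1 - q)).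
Hypotheses (X1 : 1 <= X) (hs : 4 * (X + 1) <= s).
Let y (j : nat) := (INR j - INR N * q) / s.
Let C0 := 1 + 2 * (X + 2) ^ 2.

Let s0 : 0 < s. Proof. by lra. Qed.

Let s2 : s ^ 2 = INR N * q * (1 - q).
Proof.
rewrite /s pow2_sqrt //; apply: Rmult_le_pos; last lra.
by apply: Rmult_le_pos; [exact: pos_INR|lra].
Qed.

Lemma gs_step t : gs t = gs (t + / s) * exp (t / s + / (2 * s ^ 2)).
Proof. by rewrite /gs -exp_plus; congr exp; field; lra. Qed.

Lemma yS j : y j.+1 = y j + / s.
Proof. by rewrite /y S_INR; field; lra. Qed.

(** Instead of Stirling's formula, the quotient of the binomial weight by the Gaussian density is
    followed from [j] to [j + 1]. In [C0], the 1 bounds what is left of the linear terms and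
    [2 (X + 2)^2] comes from [1 + u >= exp (u - 2 u^2)]. *)
Lemma local_ratio j : Rabs (y j) <= X + 1 ->
  (j < N)%N /\
  binp N j.+1 / gs (y j.+1) <= binp N j / gs (y j) * exp (C0 / s ^ 2) /\
  binp N j / gs (y j) <= binp N j.+1 / gs (y j.+1) * exp (C0 / s ^ 2).
Proof.
move=> hy.
have hy' : - (X + 1) <= y j <= X + 1 by apply/Rabs_le_between.
have is0 : 0 < / s by apply: Rinv_0_lt_compat.
have his : (X + 1) * / s <= / 4.
  by apply/(Rle_div_l (X + 1) (/ 4) s s0); lra.
have is2 : / s ^ 2 = / s * / s by field; lra.
set u1 := - (y j) * q * / s; set u2 := (1 - q) * (y j * / s + / s ^ 2).
have hyis : - ((X + 1) * / s) <= y j * / s <= (X + 1) * / s by nra.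
have is1 : / s <= / 4 by nra.
have hu1 : - / 2 <= u1 <= / 2.
  have -> : u1 = - (q * (y j * / s)) by rewrite /u1; ring.
  nra.
have hu2a : - ((X + 2) * / s) <= y j * / s + / s ^ 2 <= (X + 2) * / s by rewrite is2; nra.
have hu2b : - ((X + 2) * / s) <= u2 <= (X + 2) * / s by rewrite /u2; nra.
have hX2 : (X + 2) * / s <= / 2 by nra.
have hu2 : - / 2 <= u2 <= / 2 by lra.
have sq1 : u1 ^ 2 <= (X + 2) ^ 2 * / s ^ 2.
  have -> : (X + 2) ^ 2 * / s ^ 2 = ((X + 2) * / s) ^ 2 by field; lra.
  rewrite -(pow2_abs u1); apply: pow_incr; split; first exact: Rabs_pos.
  by apply: Rabs_le; rewrite /u1; nra.
have sq2 : u2 ^ 2 <= (X + 2) ^ 2 * / s ^ 2.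
  have -> : (X + 2) ^ 2 * / s ^ 2 = ((X + 2) * / s) ^ 2 by field; lra.
  by rewrite -(pow2_abs u2); apply: pow_incr; split; [exact: Rabs_pos|apply: Rabs_le].
have Ej : INR j = INR N * q + y j * s by rewrite /y; field; lra.
have E1 : (INR N - INR j) * q = s ^ 2 * (1 + u1).
  by rewrite Ej s2 /u1; have -> : INR N * q * (1 - q) * (1 + - y j * q * / s) = INR N * q * (1 - q) - s ^ 2 * (y j * q * / s) by [rewrite s2; ring]; field; lra.
have E2 : INR j.+1 * (1 - q) = s ^ 2 * (1 + u2).
  rewrite S_INR Ej /u2 Rmult_plus_distr_l Rmult_1_r {1}s2; field; lra.
have ss0 : 0 < s ^ 2 by apply: pow_lt.
have jN : (j < N)%N.
  rewrite ltnNge; apply/negP => /INR_leq h.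
  have : 0 < (INR N - INR j) * q by rewrite E1; apply: Rmult_lt_0_compat; lra.
  nra.
split=> //.
have b0 : 0 < binp N j by apply: binp_gt0; apply: ltnW.
have b1 : 0 < binp N j.+1 by apply: binp_gt0.
have HR : binp N j.+1 * (1 + u2) = binp N j * (1 + u1).
  have := binp_ratio jN; rewrite E1 E2 => h.
  by apply: (Rmult_eq_reg_l (s ^ 2)); lra.
rewrite yS; set t := y j.
rewrite (gs_step t); set g := gs (t + / s); have g0 : 0 < g by exact: gs_pos.
set E := exp (t / s + / (2 * s ^ 2)); have E0 : 0 < E by exact: exp_pos.
set F := exp (C0 / s ^ 2); have F0 : 0 < F by exact: exp_pos.
(* The terms of order [1 / s] of the binomial ratio and of the Gaussian step cancel; only order
   [1 / s^2] survives. *)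
have lin : u1 - u2 + (t / s + / (2 * s ^ 2)) = (q - / 2) * / s ^ 2.
  by rewrite /u1 /u2 -/t; field; lra.
have iss : 0 < / s ^ 2 by apply: Rinv_0_lt_compat.
have C0e : C0 / s ^ 2 = / s ^ 2 + 2 * ((X + 2) ^ 2 * / s ^ 2) by rewrite /C0; field; lra.
have hq : - / s ^ 2 <= (q - / 2) * / s ^ 2 <= / s ^ 2 by nra.
split.
  have -> : binp N j.+1 / g = binp N j / (g * E) * ((1 + u1) * E / (1 + u2)).
    have -> : binp N j = binp N j.+1 * (1 + u2) / (1 + u1) by rewrite HR; field; lra.
    by field; lra.
  apply: Rmult_le_compat_l; first by apply: Rlt_le; apply: Rdiv_lt_0_compat => //; apply: Rmult_lt_0_compat.
  apply/Rle_div_l; first lra.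
  apply: (Rle_trans _ (exp u1 * E)).
    by apply: Rmult_le_compat_r; [lra|have := exp_ineq1_le u1; lra].
  apply: (Rle_trans _ (F * exp (u2 - 2 * u2 ^ 2))); last first.
    by apply: Rmult_le_compat_l; [lra|exact: exp_sub_sq_le].
  rewrite /F /E -!exp_plus; apply: exp_le; lra.
have -> : binp N j / (g * E) = binp N j.+1 / g * ((1 + u2) / ((1 + u1) * E)).
  have -> : binp N j.+1 = binp N j * (1 + u1) / (1 + u2) by rewrite -HR; field; lra.
  by field; lra.
apply: Rmult_le_compat_l; first by apply: Rlt_le; apply: Rdiv_lt_0_compat.
apply/Rle_div_l; first by apply: Rmult_lt_0_compat; lra.
apply: (Rle_trans _ (exp u2)); first by have := exp_ineq1_le u2; lra.
apply: (Rle_trans _ (F * (exp (u1 - 2 * u1 ^ 2) * E))); last first.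
  by apply: Rmult_le_compat_l; [lra|apply: Rmult_le_compat_r; [lra|exact: exp_sub_sq_le]].
rewrite /F /E -!exp_plus; apply: exp_le; lra.
Qed.

End Local.
End Binomial.

(** [gs] is 1-Lipschitz because [|c| <= exp (c^2 / 2)]. *)
Lemma gs_lip u h : 0 <= h -> Rabs (Phi0 (u + h) - Phi0 u - h * gs u) <= h ^ 2.
Proof.
move=> h0.
have L a b : Rabs (gs b - gs a) <= Rabs (b - a).
  have [||c [_ ->]] := MVT_gen gs a b (fun t => - t * gs t).
  - move=> t _; rewrite /gs; auto_derive => //.
    by rewrite (_ : - (t * (t * 1)) * / 2 = - t ^ 2 / 2); [field|field].
  - by move=> t _; apply/continuity_pt_filterlim; exact: continuous_gs.
  rewrite Rabs_mult -[X in _ <= X]Rmult_1_l; apply: Rmult_le_compat_r; first exact: Rabs_pos.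
  rewrite Rabs_mult Rabs_Ropp (Rabs_pos_eq (gs c)); last by apply: Rlt_le; exact: gs_pos.
  have -> : gs c = / exp (c ^ 2 / 2).
    by rewrite -exp_Ropp /gs; congr exp; field.
  apply/Rle_div_l; first exact: exp_pos.
  have := exp_ineq1_le (c ^ 2 / 2); rewrite -(pow2_abs c); have := Rabs_pos c; nra.
have [||c [[c1 c2] ->]] := MVT_gen Phi0 u (u + h) gs.
- by move=> x _; exact: is_derive_Phi0.
- move=> x _; apply: derivable_continuous_pt; exists (gs x).
  by apply/is_derive_Reals; exact: is_derive_Phi0.
rewrite Rmin_left in c1; last lra.
rewrite Rmax_right in c2; last lra.
have -> : gs c * (u + h - u) - h * gs u = h * (gs c - gs u) by ring.
rewrite Rabs_mult (Rabs_pos_eq h) //= Rmult_1_r; apply: Rmult_le_compat_l => //.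
by apply: Rle_trans (L _ _) _; apply: Rabs_le; lra.
Qed.

Lemma sq_le_between a b : 0 <= b -> a ^ 2 <= b ^ 2 -> - b <= a <= b.
Proof. by move=> b0 h; split; nra. Qed.

Section DeMoivreLaplace.
Variable q : R.
Hypothesis q01 : 0 < q < 1.

Section Explicit.
Variables (N : nat) (X : R).
Let s := sqrt (INR N * q * (1 - q)).
Hypotheses (X1 : 1 <= X) (hs : 4 * (X + 1) <= s).
Let y (j : nat) := (INR j - INR N * q) / s.
Let C0 := 1 + 2 * (X + 2) ^ 2.
Let s0 : 0 < s. Proof. by lra. Qed.
Let is0 : 0 < / s. Proof. exact: Rinv_0_lt_compat. Qed.
Let s2 : s ^ 2 = INR N * q * (1 - q).
Proof.
rewrite /s pow2_sqrt //; apply: Rmult_le_pos; last lra.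
by apply: Rmult_le_pos; [exact: pos_INR|lra].
Qed.

(** [c] is the first index with [y c > t]; it stays within the range because [X * s < s^2]. *)
Lemma crossing t : - X <= t <= X -> exists c : nat, (c <= N)%N /\
  (forall j, (j < c)%N = Rleb (y j) t) /\ t < y c <= t + / s /\
  INR c - 1 <= INR N * q + t * s < INR c.
Proof.
move=> ht; have N0 := pos_INR N.
have h1 : X * s < s ^ 2 by rewrite /=; nra.
have h2 : INR N * q * (1 - q) <= INR N * q by nra.
have h3 : INR N * q * (1 - q) <= INR N * (1 - q) by nra.
have ts : - (X * s) <= t * s <= X * s by nra.
have p0 : 0 <= INR N * q + t * s by lra.
have [c [hc1 hc2]] : exists c : nat, INR c - 1 <= INR N * q + t * s < INR c.
  have [a1 a2] := archimed (INR N * q + t * s); exists (Z.to_nat (up (INR N * q + t * s))).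
  by rewrite INR_IZR_INZ Z2Nat.id; [lra|apply: le_IZR; lra].
exists c; split.
  rewrite -ltnS ltnNge; apply/negP => /INR_leq; rewrite S_INR; lra.
have Hy j : y j <= t <-> INR j <= INR N * q + t * s.
  rewrite /y; split=> h; first by move/(Rle_div_l _ _ _ s0): h; lra.
  by apply/(Rle_div_l _ _ _ s0); lra.
split.
  move=> j; apply/idP/RlebP => [jc|/Hy h].
    apply/Hy; have := INR_leq jc; rewrite S_INR; lra.
  by rewrite ltnNge; apply/negP => /INR_leq; lra.
split=> //; split.
  by apply: Rnot_le_lt => /Hy; lra.
rewrite /y; apply/(Rle_div_l _ _ _ s0).
have -> : (t + / s) * s = t * s + 1 by field; lra.
lra.
Qed.

(** [u] and [v] are Riemann sums for the Gaussian integral over [[- X, x]] and [[- X, X]]. Over the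
    [O(X s)] indices of the window all weights agree with a common multiple of the density up to a
    factor close to 1. That multiple, [r 0] in the proof, is eliminated by playing the part up to
    [x] against the whole window, whose binomial mass is known up to [1 / X^2]. *)
Lemma dml_explicit x : - X <= x <= X -> exists u v,
  Rabs (u - (Phi0 x + Phi0 X)) <= (2 * X + 3) / s /\
  Rabs (v - (Phi0 X + Phi0 X)) <= (2 * X + 3) / s /\ 0 <= u /\
  let P := \rsum_(j < N.+1) (b2R (Rleb (y j) x) * binp q N j) in
  let E2 := exp (2 * (C0 * (2 * X + 1) / s)) in
  P * v <= v / X ^ 2 + E2 * u /\ (1 - / X ^ 2) * u <= E2 * (P * v).
Proof.
move=> hx; have X2 : 0 < X ^ 2 by apply: pow_lt; lra.
have [a [aN [Ha [ya Ia]]]] := @crossing (- X) ltac:(lra).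
have [c [cN [Hc [yc Ic]]]] := @crossing x hx.
have [m [mN [Hm [ym Im]]]] := @crossing X ltac:(lra).
have xs : - (X * s) <= x * s <= X * s by nra.
have ac : (a <= c)%N.
  by rewrite leqNgt; apply/negP => /INR_leq; rewrite S_INR; lra.
have cm : (c <= m)%N.
  by rewrite leqNgt; apply/negP => /INR_leq; rewrite S_INR; lra.
have am : (a <= m)%N := leq_trans ac cm.
have ym1 j : (a <= j)%N -> - X < y j.
  move=> aj; apply: Rnot_le_lt => h; have : Rleb (y j) (- X) by apply/RlebP.
  by rewrite -Ha ltnNge aj.
have ym2 j : (j < m)%N -> y j <= X by rewrite Hm => /RlebP.
set F := exp (C0 / s ^ 2).
have F1 : 1 <= F.
  rewrite /F -exp_0; apply: exp_le; apply: Rdiv_le_0_compat; last by apply: pow_lt.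
  by rewrite /C0; have := pow2_ge_0 (X + 2); lra.
pose r i := binp q N (a + i)%N / gs (y (a + i)%N).
have step i : (a + i < m)%N -> r i.+1 <= r i * F /\ r i <= r i.+1 * F.
  move=> im; have h1 := ym1 (a + i)%N (leq_addr _ _); have h2 := ym2 _ im.
  have := local_ratio q01 X1 hs (j := (a + i)%N) ltac:(apply: Rabs_le; rewrite -/s -/(y _); lra).
  by move=> [_]; rewrite /r addnS.
have iter i : (a + i <= m)%N -> r i <= r 0%N * F ^ i /\ r 0%N <= r i * F ^ i.
  elim: i => [|i IH] im; first by rewrite /= !Rmult_1_r; split; apply: Rle_refl.
  have im' : (a + i < m)%N by rewrite addnS in im.
  have [h1 h2] := IH (ltnW im'); have [h3 h4] := step i im'.
  have Fi : 0 <= F ^ i by apply: pow_le; lra.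
  rewrite -[F ^ i.+1]/(F * F ^ i); split.
    by apply: Rle_trans h3 _; rewrite (Rmult_comm F) -Rmult_assoc; apply: Rmult_le_compat_r; lra.
  by apply: Rle_trans h2 _; rewrite -Rmult_assoc; apply: Rmult_le_compat_r.
have cnt_am : INR (m - a)%N <= 2 * X * s + 1.
  by rewrite minus_INR; [lra|apply/leP].
set E := exp (C0 * (2 * X + 1) / s).
have C00 : 0 < C0 by rewrite /C0; have := pow2_ge_0 (X + 2); lra.
have FE i : (a + i <= m)%N -> F ^ i <= E.
  move=> im; rewrite pow_exp_ln; last by lra.
  rewrite ln_exp; apply: exp_le.
  have hi : INR i <= (2 * X + 1) * s.
    have : (i <= m - a)%N by rewrite leq_subRL.
    by move=> /INR_leq; nra.
  have -> : C0 * (2 * X + 1) / s = ((2 * X + 1) * s) * (C0 / s ^ 2) by field; lra.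
  by apply: Rmult_le_compat_r => //; apply: Rlt_le; apply: Rdiv_lt_0_compat => //; apply: pow_lt.
have EE : exp (2 * (C0 * (2 * X + 1) / s)) = E * E.
  by rewrite /E -exp_plus; congr exp; ring.
have E0 : 0 < E by exact: exp_pos.
have r0 : 0 < r 0%N by apply: Rdiv_lt_0_compat; [apply: binp_gt0 => //; rewrite addn0|exact: gs_pos].
have bnd i : (a + i < m)%N ->
  binp q N (a + i)%N <= r 0%N * E * gs (y (a + i)%N) /\ r 0%N * gs (y (a + i)%N) <= E * binp q N (a + i)%N.
  move=> im; have [h1 h2] := iter i (ltnW im); have h3 := FE i (ltnW im).
  set g := gs (y (a + i)%N); have g0 : 0 < g by exact: gs_pos.
  have Eb : binp q N (a + i)%N = r i * g by rewrite /r -/g; field; lra.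
  have ri : 0 <= r i by apply: Rdiv_le_0_compat => //; exact: binp_ge0.
  rewrite Eb; split.
    apply: Rmult_le_compat_r; first lra.
    by apply: Rle_trans h1 _; apply: Rmult_le_compat_l; lra.
  rewrite -Rmult_assoc; apply: Rmult_le_compat_r; first lra.
  by apply: Rle_trans h2 _; rewrite Rmult_comm; apply: Rmult_le_compat_r.
pose S t := \rsum_(i < t - a) gs (y (a + i)%N).
pose B t := \rsum_(i < t - a) binp q N (a + i)%N.
have hB t : (a <= t <= m)%N -> B t <= r 0%N * E * S t /\ r 0%N * S t <= E * B t.
  move=> /andP [at_ tm].
  have H i : (i < t - a)%N -> (a + i < m)%N.
    by move=> it; apply: leq_trans tm; rewrite -ltn_subRL.
  rewrite -!rsum_scal; split; apply: rsum_le => i _; have := bnd i (H i (ltn_ord i)); tauto.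
have S0 t : 0 <= S t by apply: rsum_ge0 => i _; apply: Rlt_le; exact: gs_pos.
have riem t tt : (a <= t <= m)%N -> tt < y t <= tt + / s ->
    Rabs (S t / s - (Phi0 tt + Phi0 X)) <= (2 * X + 3) / s.
  move=> /andP [at_ tm] ht.
  pose g i := - Phi0 (y (a + i)%N).
  have E1 : \rsum_(i < t - a) (Phi0 (y (a + i)%N + / s) - Phi0 (y (a + i)%N)) = Phi0 (y t) - Phi0 (y a).
    have -> : Phi0 (y t) - Phi0 (y a) = g 0%N - g (t - a)%N by rewrite /g addn0 subnKC //; ring.
    rewrite -rsum_telescope; apply: eq_bigr => i _; rewrite /g addnS.
    have -> : y (a + i).+1 = y (a + i)%N + / s by rewrite /y S_INR; field; lra.
    by ring.
  have E2 : Rabs (Phi0 (y t) - Phi0 (y a) - S t / s) <= (2 * X + 1) / s.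
    have -> : Phi0 (y t) - Phi0 (y a) - S t / s =
      \rsum_(i < t - a) (Phi0 (y (a + i)%N + / s) - Phi0 (y (a + i)%N) - / s * gs (y (a + i)%N)).
      by rewrite rsum_sub E1 rsum_scal [/ s * _]Rmult_comm.
    apply: Rle_trans (rsum_abs _ _ _) _.
    apply: (Rle_trans _ (\rsum_(i < t - a) (/ s) ^ 2)).
      by apply: rsum_le => i _; apply: gs_lip; lra.
    rewrite rsum_ord_const.
    have h : INR (t - a)%N <= (2 * X + 1) * s.
      have : (t - a <= m - a)%N by apply: leq_sub2r.
      by move=> /INR_leq; nra.
    have -> : (2 * X + 1) / s = (/ s) ^ 2 * ((2 * X + 1) * s) by field; lra.
    by apply: Rmult_le_compat_l => //; exact: pow2_ge_0.
  have d1 := @Phi0_diff tt (y t) ltac:(lra).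
  have d2 := @Phi0_diff (- X) (y a) ltac:(lra).
  rewrite Phi0_opp in d2.
  have -> : (2 * X + 3) / s = (2 * X + 1) / s + (/ s + / s) by field; lra.
  have -> : S t / s - (Phi0 tt + Phi0 X) = - (Phi0 (y t) - Phi0 (y a) - S t / s) +
     (Phi0 (y t) - Phi0 tt - (Phi0 (y a) - - Phi0 X)) by ring.
  apply: Rle_trans (Rabs_triang _ _) _; rewrite Rabs_Ropp; apply: Rplus_le_compat => //.
  by apply: Rabs_le; lra.
pose Bc t := \rsum_(j < t) binp q N j.
have Bsplit t : (a <= t)%N -> Bc t = Bc a + B t.
  move=> at_; rewrite /Bc /B -!(big_mkord xpredT (binp q N)) (@big_cat_nat _ _ _ a 0%N t _ _ (leq0n a) at_) /=.
  by congr (_ + _); rewrite -[X in index_iota X _]add0n big_addn big_mkord; apply: eq_bigr => i _; rewrite addnC.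
have Bwid t : (t <= N.+1)%N -> Bc t = \rsum_(j < N.+1) (b2R (j < t)%N * binp q N j).
  move=> tN; rewrite /Bc (big_ord_widen _ (binp q N) tN) big_mkcond.
  by apply: eq_bigr => j _; case: (j < t)%N => /=; ring.
have EP : \rsum_(j < N.+1) (b2R (Rleb (y j) x) * binp q N j) = Bc c.
  by rewrite Bwid ?leqW //; apply: eq_bigr => j _; rewrite Hc.
have Btot : \rsum_(j < N.+1) binp q N j = 1.
  by rewrite -(sum_binp q N); apply: eq_bigr => j _; ring.
(* Chebyshev's inequality, from the exact binomial variance. *)
have tail : Bc a + (1 - Bc m) <= / X ^ 2.
  rewrite -Btot !Bwid ?leqW // -rsum_sub -rsum_add.
  have -> : / X ^ 2 = / (s ^ 2 * X ^ 2) * (INR N * q * (1 - q)).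
    by rewrite -s2; field; lra.
  rewrite -sum_binp_var -rsum_scal; apply: rsum_le => j _.
  have b0 := binp_ge0 q01 N j.
  have -> : / (s ^ 2 * X ^ 2) * (binp q N j * (INR j - INR N * q) ^ 2) = binp q N j * (y j ^ 2 / X ^ 2).
    by rewrite /y; field; lra.
  have y20 : 0 <= y j ^ 2 / X ^ 2 by apply: Rdiv_le_0_compat => //; exact: pow2_ge_0.
  have big : X ^ 2 <= y j ^ 2 -> 1 <= y j ^ 2 / X ^ 2 by move=> h; apply/Rle_div_r; lra.
  case: (ltnP j a) => ja; case: (ltnP j m) => jm /=.
  - have /RlebP h : Rleb (y j) (- X) by rewrite -Ha.
    have : 1 <= y j ^ 2 / X ^ 2 by apply: big; rewrite /=; nra.
    rewrite /=; nra.
  - by have := leq_trans ja am; rewrite ltnNge jm.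
  - rewrite /= in y20 *; nra.
  have h : X < y j.
    apply: Rnot_le_lt => h; have : Rleb (y j) X by apply/RlebP.
    by rewrite -Hm ltnNge jm.
  have : 1 <= y j ^ 2 / X ^ 2 by apply: big; rewrite /=; nra.
  rewrite /=; nra.
have Bc0 t : 0 <= Bc t by apply: rsum_ge0 => j _; exact: binp_ge0.
have Bcm : Bc m <= 1.
  rewrite -Btot; apply: rsum_ord_widen; first by apply: leqW.
  by move=> j; exact: binp_ge0.
have Ba0 := Bc0 a.
have Bm1 : B m <= 1 by have := Bsplit m am; lra.
have Bm2 : 1 - / X ^ 2 <= B m by have := Bsplit m am; lra.
have [c1 c2] := hB c ltac:(by rewrite ac cm).
have [m1 m2] := hB m ltac:(by rewrite am leqnn).
have Bc_c := Bsplit c ac.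
have Bca : Bc a <= / X ^ 2 by lra.
have Sc := S0 c; have Sm := S0 m.
have Bcc : 0 <= B c by apply: rsum_ge0 => j _; exact: binp_ge0.
exists (S c / s), (S m / s).
split; first by apply: riem; [rewrite ac cm|].
split; first by apply: riem; [rewrite am leqnn|].
split; first by apply: Rdiv_le_0_compat.
cbv zeta; rewrite EP EE Bc_c; split.
  have -> : (Bc a + B c) * (S m / s) = (Bc a * S m + B c * S m) * / s by rewrite /Rdiv; ring.
  have -> : S m / s / X ^ 2 + E * E * (S c / s) = (/ X ^ 2 * S m + E * E * S c) * / s by rewrite /Rdiv; ring.
  apply: Rmult_le_compat_r; first lra.
  apply: Rplus_le_compat; first by apply: Rmult_le_compat_r.
  apply: (Rle_trans _ (r 0%N * E * S c * S m)); first by apply: Rmult_le_compat_r.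
  have -> : r 0%N * E * S c * S m = E * S c * (r 0%N * S m) by ring.
  have -> : E * E * S c = E * S c * (E * 1) by ring.
  apply: Rmult_le_compat_l; first by apply: Rmult_le_pos; lra.
  by apply: Rle_trans m2 _; apply: Rmult_le_compat_l; lra.
have -> : (1 - / X ^ 2) * (S c / s) = (1 - / X ^ 2) * S c * / s by rewrite /Rdiv; ring.
have -> : E * E * ((Bc a + B c) * (S m / s)) = (E * E * (Bc a + B c) * S m) * / s by rewrite /Rdiv; ring.
apply: Rmult_le_compat_r; first lra.
apply: (Rle_trans _ (r 0%N * E * S m * S c)).
  by apply: Rmult_le_compat_r; lra.
have -> : r 0%N * E * S m * S c = E * S m * (r 0%N * S c) by ring.
have -> : E * E * (Bc a + B c) * S m = E * S m * (E * (Bc a + B c)) by ring.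
apply: Rmult_le_compat_l; first by apply: Rmult_le_pos; lra.
by apply: Rle_trans c2 _; apply: Rmult_le_compat_l; lra.
Qed.

End Explicit.

Definition binCDF (N : nat) (x : R) : R :=
  \rsum_(j < N.+1) (b2R (Rleb ((INR j - INR N * q) / sqrt (INR N * q * (1 - q))) x) * binp q N j).

Lemma de_moivre_laplace x eps : 0 < eps -> exists N0, forall N, (N0 <= N)%N ->
  Rabs (binCDF N x - (/ 2 + Phi0 x / sqrt (2 * PI))) <= eps.
Proof.
move=> eps0; set ep := Rmin eps 1.
have ep0 : 0 < ep by apply: Rmin_glb_lt; lra.
have ep1 : ep <= 1 by apply: Rmin_r.
suff [N0 H] : exists N0, forall N, (N0 <= N)%N ->
    Rabs (binCDF N x - (/ 2 + Phi0 x / sqrt (2 * PI))) <= ep.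
  by exists N0 => N hN; apply: Rle_trans (H N hN) _; apply: Rmin_l.
have P0 := PI_RGT_0; have P2 := PI2_1.
set G := sqrt (PI / 2).
have G1 : 1 <= G by rewrite -sqrt_1; apply: sqrt_le_1_alt; lra.
have EG : sqrt (2 * PI) = 2 * G.
  have -> : 2 * PI = 4 * (PI / 2) by field.
  rewrite sqrt_mult; try lra.
  have -> : sqrt 4 = 2 by have -> : 4 = 2 * 2 by [ring]; rewrite sqrt_square; lra.
  by [].
have [A0 [A01 HA]] := @Phi0_cvg (ep / 64) ltac:(lra).
(* Makes the missing Gaussian tail at most [ep / 64] and the binomial one at most
   [1 / X^2 <= ep / 8]. *)
set X := Rmax (Rmax A0 (Rabs x)) (8 / ep).
have X1 : A0 <= X by apply: Rle_trans (Rmax_l _ _); apply: Rmax_l.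
have X2 : Rabs x <= X by apply: Rle_trans (Rmax_l _ _); apply: Rmax_r.
have X3 : 8 / ep <= X by apply: Rmax_r.
have X4 : 1 <= X by lra.
have hPX := HA X X1; rewrite -/G in hPX.
have hx : - X <= x <= X by apply/Rabs_le_between.
have iX : / X ^ 2 <= ep / 8.
  have h : 8 <= X * ep by apply/(Rle_div_l 8 X ep ep0).
  have X20 : 0 < X ^ 2 by apply: pow_lt; lra.
  apply: (Rmult_le_reg_r (X ^ 2)) => //; rewrite Rinv_l; last lra.
  rewrite /=; nra.
set C0 := 1 + 2 * (X + 2) ^ 2.
have C00 : 0 < C0 by rewrite /C0; have := pow2_ge_0 (X + 2); lra.
have ln1 : 0 < ln (1 + ep / 8) by apply: ln_gt0; lra.
(* Three demands on the standard deviation: the local estimate applies, the Riemann sums are within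
   [ep / 32], and the distortion [E2] is at most [1 + ep / 8]. *)
set s1 := Rmax (4 * (X + 1)) (Rmax ((2 * X + 3) / (ep / 32)) (2 * (C0 * (2 * X + 1)) / ln (1 + ep / 8))).
have s11 : 4 * (X + 1) <= s1 by apply: Rmax_l.
have s12 : (2 * X + 3) / (ep / 32) <= s1 by apply: Rle_trans (Rmax_r _ _); apply: Rmax_l.
have s13 : 2 * (C0 * (2 * X + 1)) / ln (1 + ep / 8) <= s1 by apply: Rle_trans (Rmax_r _ _); apply: Rmax_r.
have q1 : 0 < q * (1 - q) by nra.
have [N0 [hN0 _]] := nat_ceil (x := s1 ^ 2 / (q * (1 - q)))
  ltac:(apply: Rdiv_le_0_compat => //; exact: pow2_ge_0).
exists N0 => N /INR_leq hN.
set s := sqrt (INR N * q * (1 - q)).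
have hs : s1 <= s.
  rewrite -(sqrt_pow2 s1); last lra.
  apply: sqrt_le_1_alt; rewrite Rmult_assoc; apply/(Rle_div_l _ _ _ q1); lra.
have s0 : 0 < s by lra.
have [u [v [hu [hv [u0 [up lo]]]]]] := dml_explicit X4 (Rle_trans _ _ _ s11 hs) hx.
rewrite -/s -/C0 in hu hv up lo; rewrite -/(binCDF N x) in up lo.
set P := binCDF N x in up lo *.
have he : (2 * X + 3) / s <= ep / 32.
  apply/(Rle_div_l _ _ _ s0); move/(Rle_div_l _ _ _ (_ : ep / 32 > 0)): s12 => h.
  have := h ltac:(lra); nra.
set E2 := exp _ in up lo.
have hE2 : E2 <= 1 + ep / 8.
  rewrite -(exp_ln (1 + ep / 8)); last lra.
  apply: exp_le.
  have -> : 2 * (C0 * (2 * X + 1) / s) = 2 * (C0 * (2 * X + 1)) / s by field; lra.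
  apply/(Rle_div_l _ _ _ s0); move/(Rle_div_l _ _ _ ln1): s13; nra.
have E20 : 0 < E2 by exact: exp_pos.
move/Rabs_le_between: hu => hu; move/Rabs_le_between: hv => hv; move/Rabs_le_between: hPX => hPX.
set T := 2 * G; set w := Phi0 x + G.
have T2 : 2 <= T by rewrite /T; lra.
have hw : 0 <= w <= T.
  have g := gauss_integral_identity x; have [g0 _] := Gaux_bounds x.
  have hG2 : G ^ 2 = PI / 2 by rewrite /G pow2_sqrt //; lra.
  have : Phi0 x ^ 2 <= G ^ 2 by lra.
  by move/(sq_le_between (ltac:(lra) : 0 <= G)); rewrite /w /T; lra.
have El : / 2 + Phi0 x / sqrt (2 * PI) = w / T by rewrite EG /w /T; field; lra.
rewrite El; set l0 := w / T.
have Ew : w = l0 * T by rewrite /l0; field; lra.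
have l01 : 0 <= l0 <= 1.
  by split; [apply: Rdiv_le_0_compat; lra|apply/Rle_div_l; lra].
set eta := ep / 16.
have hu' : l0 * T - eta <= u <= l0 * T + eta by rewrite -Ew /w /eta; lra.
have hv' : T - eta <= v <= T + eta by rewrite /T /eta; lra.
have eT : eta <= eta * T by rewrite /eta; nra.
have v1 : T * (1 - eta) <= v by lra.
have v2 : v <= T * (1 + eta) by lra.
have v0 : 0 < v.
  by apply: Rlt_le_trans v1; apply: Rmult_lt_0_compat; rewrite /eta; lra.
have u1 : u <= T * (l0 + eta) by lra.
have u2 : T * (l0 - eta) <= u by lra.
apply: Rabs_le; split.
  suff : l0 - ep <= P by lra.
  apply: Rnot_lt_le => hP.
  have b1 : (1 - ep / 8) * (T * (l0 - eta)) <= (1 - / X ^ 2) * u.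
    apply: (Rle_trans _ ((1 - ep / 8) * u)); first by apply: Rmult_le_compat_l; lra.
    by apply: Rmult_le_compat_r; lra.
  have l0e : 0 <= l0 - ep \/ l0 - ep < 0 by lra.
  have Pv0 : 0 <= P by apply: rsum_ge0 => j _; apply: Rmult_le_pos; [exact: b2R_ge0|exact: binp_ge0].
  have b2 : E2 * (P * v) <= (1 + ep / 8) * ((l0 - ep) * (T * (1 + eta))).
    apply: Rmult_le_compat; try lra; first by apply: Rmult_le_pos; lra.
    by apply: Rmult_le_compat; lra.
  have b3 : (1 - ep / 8) * (l0 - eta) <= (1 + ep / 8) * ((l0 - ep) * (1 + eta)).
    apply: (Rmult_le_reg_l T); first lra.
    by lra.
  rewrite /eta in b3; have a1 : 0 <= ep * (1 - l0) by apply: Rmult_le_pos; lra.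
  have a2 : 0 <= ep * (ep * (1 - l0)) by apply: Rmult_le_pos; lra.
  have a3 : 0 <= ep ^ 3 by apply: pow_le; lra.
  have a4 : 0 <= ep ^ 2 by apply: pow2_ge_0.
  lra.
suff : P <= l0 + ep by lra.
apply: Rnot_lt_le => hP.
have b1 : (l0 + ep) * (T * (1 - eta)) <= P * v.
  by apply: Rmult_le_compat; try lra; apply: Rmult_le_pos; rewrite /eta; lra.
have b2 : v / X ^ 2 + E2 * u <= T * (1 + eta) * (ep / 8) + (1 + ep / 8) * (T * (l0 + eta)).
  apply: Rplus_le_compat.
    apply: Rmult_le_compat => //; first lra.
    by apply: Rlt_le; apply: Rinv_0_lt_compat; apply: pow_lt; lra.
  by apply: Rmult_le_compat; lra.
have b3 : (l0 + ep) * (1 - eta) <= (1 + eta) * (ep / 8) + (1 + ep / 8) * (l0 + eta).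
  apply: (Rmult_le_reg_l T); first lra.
  by lra.
rewrite /eta in b3; have a1 : 0 <= ep * (1 - l0) by apply: Rmult_le_pos; lra.
have a2 : 0 <= ep * (1 - ep) by apply: Rmult_le_pos; lra.
lra.
Qed.

End DeMoivreLaplace.

(** * The limit law *)

Section Patterns.
Variables (e : nat) (I : finType).
Let d := e.+2.
Implicit Types (a : {ffun I -> 'I_d}) (G A : {set I}).

Definition nzset a : {set I} := [set i | nat_of_ord (a i) != 0%N].

Lemma rprod_b2R (P : pred I) : \rprod_i b2R (P i) = b2R [forall i, P i].
Proof.
case: (boolP [forall i, P i]) => [/forallP h|].
  by rewrite big1 // => i _; rewrite h.
by rewrite negb_forall => /existsP [i /negbTE hi]; rewrite (bigD1 i) //= hi /=; ring.
Qed.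

Lemma sum_nzset_eq A : \rsum_(a | nzset a == A) 1 = (INR d - 1) ^ #|A|.
Proof.
transitivity (\rsum_(a : {ffun I -> 'I_d}) \rprod_i b2R ((nat_of_ord (a i) != 0%N) == (i \in A))).
  rewrite big_mkcond; apply: eq_bigr => a _; rewrite rprod_b2R.
  have -> : (nzset a == A) = [forall i, (nat_of_ord (a i) != 0%N) == (i \in A)].
    apply/eqP/forallP => [<- i|h]; first by rewrite inE.
    apply/setP => i; rewrite inE. exact: (eqP (h i)).
  by case: [forall i, _].
rewrite -(big_distr_ffunR (fun i j => b2R ((nat_of_ord j != 0%N) == (i \in A)))).
transitivity (\rprod_(i | i \in A) (INR d - 1)); last first.
  by rewrite big_const; elim: #|A| => //= n ->.
rewrite [RHS]big_mkcond; apply: eq_bigr => i _; rewrite big_ord_recl.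
have := rsum_ord_const e.+1 1; have -> : INR d - 1 = INR e.+1 by rewrite (S_INR e.+1); ring.
set X := INR e.+1 => hX; case: (i \in A) => /=; first by rewrite hX; ring.
by rewrite big1 //; ring.
Qed.

Lemma sum_nzset_sub G (F : nat -> R) : \rsum_(a | nzset a \subset G) F #|nzset a| =
  \rsum_(j < #|G|.+1) (INR 'C(#|G|, j) * (INR d - 1) ^ j * F j).
Proof.
rewrite (partition_big nzset (fun A => A \subset G)) //.
transitivity (\big[Rplus/0]_(A : {set I} | A \subset G) ((INR d - 1) ^ #|A| * F #|A|)).
  apply: eq_bigr => A AG; rewrite -sum_nzset_eq -rsum_scalr.
  apply: eq_big => [a|a /andP [_ /eqP ->]]; last by ring.
  by case: eqP => [->|_]; rewrite ?andbT ?andbF ?AG.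
rewrite (partition_big (fun A : {set I} => inord #|A|) (fun j : 'I_#|G|.+1 => true)) //.
apply: eq_bigr => j _.
rewrite (eq_bigl (mem [set A : {set I} | A \subset G & #|A| == j])); last first.
  move=> A; rewrite !inE; case AG: (A \subset G) => //=.
  by rewrite -val_eqE /= inordK // ltnS subset_leq_card.
rewrite (eq_bigr (fun=> (INR d - 1) ^ j * F j * 1)); last first.
  by move=> A; rewrite !inE => /andP [_ /eqP ->]; rewrite Rmult_1_r.
rewrite rsum_scal rsum_count cards_draws; ring.
Qed.

(** A pattern on [G] is encoded as a function on all of [I] that vanishes off [G]. Uniform digits
    make the number of nonzero ones binomial with parameter [1 - 1 / d]. *)
Lemma sum_nzset_binp G (Phi : pred nat) :
  \rsum_(a | nzset a \subset G) (b2R (Phi #|nzset a|) * / INR d ^ #|G|) =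
  \rsum_(j < #|G|.+1) (b2R (Phi j) * binp (1 - / INR d) #|G| j).
Proof.
rewrite (sum_nzset_sub G (fun j => b2R (Phi j) * / INR d ^ #|G|)).
have d2 := INR_d_ge2 e; rewrite -/d in d2.
apply: eq_bigr => j _; rewrite /binp.
have -> : 1 - (1 - / INR d) = / INR d by ring.
have jN : (j <= #|G|)%N by rewrite -ltnS.
have -> : INR d ^ #|G| = INR d ^ j * INR d ^ (#|G| - j)%N by rewrite -pow_add; congr (_ ^ _); rewrite -[in LHS](subnKC jN).
have -> : 1 - / INR d = (INR d - 1) * / INR d by field; lra.
rewrite Rpow_mult_distr !pow_inv; field.
by split; apply: pow_nonzero; lra.
Qed.

Lemma sum_patterns_card G : \rsum_(a | nzset a \subset G) / INR d ^ #|G| = 1.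
Proof.
have d2 := INR_d_ge2 e; rewrite -/d in d2.
have := sum_nzset_binp G xpredT; rewrite /= => E.
transitivity (\rsum_(a | nzset a \subset G) (b2R true * / INR d ^ #|G|)).
  by apply: eq_bigr => a _ /=; ring.
rewrite E -[RHS](sum_binp (1 - / INR d) #|G|); apply: eq_bigr => j _ /=; ring.
Qed.

(** Exactly one pattern agrees with [a] on [G]: the restriction of [a], extended by 0. *)
Lemma pattern_decomp G (Phi : pred nat) a :
  b2R (Phi #|nzset a :&: G|) =
  \rsum_(al | nzset al \subset G)
     (b2R (Phi #|nzset al|) * b2R [forall i, (i \in G) ==> (a i == al i)]).
Proof.
pose al0 : {ffun I -> 'I_d} := [ffun i => if i \in G then a i else ord0].
have E0 : nzset al0 = nzset a :&: G.
  by apply/setP => i; rewrite !inE ffunE; case: (i \in G); rewrite ?andbT ?andbF.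
rewrite (bigD1 al0) /=; last by rewrite E0 subsetIr.
rewrite E0 big1 => [|al /andP [/subsetP sG ne]]; last first.
  case: forallP => [h|_] /=; last by ring.
  case/eqP: ne; apply/ffunP => i; rewrite ffunE; case iG: (i \in G).
    by move/implyP: (h i) => /(_ iG) /eqP ->.
  apply: val_inj => /=; apply/eqP; apply: contraFT iG => nz0; apply: sG; by rewrite inE.
have -> : [forall i, (i \in G) ==> (a i == al0 i)] = true.
  by apply/forallP => i; apply/implyP => iG; rewrite ffunE iG.
by rewrite [b2R true]/=; ring.
Qed.

End Patterns.

Section BlockLaw.
Variables (e k : nat) (p : nat -> nat) (D : nat) (c4 Cu cden : R).
Hypotheses (k0 : (0 < k)%N) (Hp : coprime_bases k.+1 p) (D0 : (0 < D)%N) (c40 : 0 < c4)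
  (cden0 : 0 < cden).
Variables (n : nat) (r lam eps : R).
Hypothesis Hrg : regime e k p D c4 Cu cden n r lam eps.
Let d := e.+2.
Let m := k.+1.
Let L := lam * / r.
Variables (G : {set 'I_n.+1}) (tau eta : R).
Hypotheses (GS : forall h, h \in G -> inS m p h) (fG : few k p D r (fun h => h \in G)).
Hypotheses (htau : \rsum_(h | h \in G) (r * INR h * INR d) <= tau) (tau2 : tau <= / 2)
  (heta : (\rsum_(h | h \in G) (2 * INR d * INR h)) * Cmaj e k p c4 / L / cden
          + 2 * Ce e cden * (eps * L) <= eta) (eta01 : 0 <= eta <= 1).

Let r0 : 0 < r := rg_r Hrg.
Let P0 : (0 < Pcount d m p n)%N := Pcount_gt0 cden0 Hrg.
Let rh0 (h : 'I_n.+1) : 0 <= r * INR h * INR d.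
Proof. by do 2 (apply: Rmult_le_pos; last exact: pos_INR); lra. Qed.

Lemma exp_le_1_2x x : 0 <= x <= / 2 -> exp x <= 1 + 2 * x.
Proof.
move=> hx; have h1 := exp_ineq1_le (- x); have h2 := exp_pos x.
have h3 : exp x * exp (- x) = 1 by rewrite -exp_plus Rplus_opp_r exp_0.
have : exp x * (1 - x) <= 1 by rewrite -h3; apply: Rmult_le_compat_l; lra.
nra.
Qed.

Lemma tilted_block_near (al : {ffun 'I_n.+1 -> 'I_d}) :
  Rabs (\rprod_(h | h \in G) law d m p r h (al h) - / INR d ^ #|G|) <= 2 * tau * / INR d ^ #|G|.
Proof.
have d2 := INR_d_ge2 e; rewrite -/d in d2.
have dG : / INR d ^ #|G| = \rprod_(h | h \in G) / INR d.
  by rewrite big_const; elim: #|G| => [|i IH] /=; [field|rewrite -IH Rinv_mult].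
have id0 : 0 < / INR d by apply: Rinv_0_lt_compat; lra.
have wb h : h \in G -> exp (- (r * INR h * INR d)) * / INR d <= law d m p r h (al h)
    <= exp (r * INR h * INR d) * / INR d.
  move=> hG; rewrite /law GS //; apply: tilt_near => //.
  by apply: Rmult_le_pos; [lra|exact: pos_INR].
set T := \rsum_(h | h \in G) (r * INR h * INR d).
have hT : T <= tau := htau.
have T0 : 0 <= T by apply: rsum_ge0 => h _.
have iG : 0 < / INR d ^ #|G| by apply: Rinv_0_lt_compat; apply: pow_lt; lra.
have up := @rprod_le _ (index_enum _) (fun h => h \in G) (fun h => law d m p r h (al h)) (fun h => exp (r * INR h * INR d) * / INR d)
  ltac:(move=> h hG; split; [have := wb h hG; have : 0 < exp (- (r * INR h * INR d)) * / INR d by [apply: Rmult_lt_0_compat => //; exact: exp_pos]; lra|by have [] := wb h hG]).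
have lo := @rprod_le _ (index_enum _) (fun h => h \in G) (fun h => exp (- (r * INR h * INR d)) * / INR d) (fun h => law d m p r h (al h))
  ltac:(move=> h hG; split; [by apply: Rmult_le_pos; [apply: Rlt_le; exact: exp_pos|lra]|by have [] := wb h hG]).
rewrite !big_split !rprod_exp -dG in up lo.
have ET : \rsum_(h | h \in G) (- (r * INR h * INR d)) = - T.
  by rewrite -[RHS]Rmult_1_l Ropp_mult_distr_r_reverse Ropp_mult_distr_l -rsum_scal; apply: eq_bigr => h _; ring.
rewrite ET in lo; rewrite -/T in up.
have e1 := exp_le_1_2x (conj T0 (Rle_trans _ _ _ hT tau2)).
have e2 := exp_ineq1_le (- T).
set W := \rprod_(h | h \in G) _ in up lo *; set x := / _ in iG up lo *.
have up1 : W <= exp T * x := up.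
have lo1 : exp (- T) * x <= W := lo.
by apply: Rabs_le; split; nra.
Qed.

(** Both errors, the conditioning ([eta]) and the tilt ([tau]), are relative to the uniform weight
    [1 / d^|G|] of a pattern, so the sum over all patterns does not enlarge them. *)
Lemma block_law (Phi : pred nat) :
  Rabs (RE m p (fun a : {ffun 'I_n.+1 -> 'I_d} => b2R (Phi #|nzset a :&: G|)) -
    \rsum_(j < #|G|.+1) (b2R (Phi j) * binp (1 - / INR d) #|G| j)) <= 2 * eta + 2 * tau.
Proof.
have d2 := INR_d_ge2 e; rewrite -/d in d2.
have tau0 : 0 <= tau by apply: Rle_trans htau; apply: rsum_ge0 => h _.
set iG := / INR d ^ #|G|.
have iG0 : 0 < iG by apply: Rinv_0_lt_compat; apply: pow_lt; lra.
rewrite -(sum_nzset_binp e) -/d -/iG.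
have -> : RE m p (fun a : {ffun 'I_n.+1 -> 'I_d} => b2R (Phi #|nzset a :&: G|)) =
  \big[Rplus/0]_(al : {ffun 'I_n.+1 -> 'I_d} | nzset al \subset G)
    (b2R (Phi #|nzset al|) * RE m p (fun a => b2R [forall h, (h \in G) ==> (a h == al h)])).
  transitivity (RE m p (fun a => \big[Rplus/0]_(al : {ffun 'I_n.+1 -> 'I_d} | nzset al \subset G)
    (b2R (Phi #|nzset al|) * b2R [forall h, (h \in G) ==> (a h == al h)]))).
    by apply: (eq_RE (n := n)) => a _; exact: pattern_decomp.
  by rewrite RE_sum; apply: eq_bigr => al _; rewrite (RE_scal P0).
rewrite -rsum_sub; apply: Rle_trans (rsum_abs _ _ _) _.
have -> : 2 * eta + 2 * tau = \big[Rplus/0]_(al : {ffun 'I_n.+1 -> 'I_d} | nzset al \subset G) ((2 * eta + 2 * tau) * iG).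
  by rewrite rsum_scal (sum_patterns_card e G); ring.
apply: rsum_le => al _.
have -> : b2R (Phi #|nzset al|) * RE m p (fun a => b2R [forall h, (h \in G) ==> (a h == al h)]) -
    b2R (Phi #|nzset al|) * iG =
  b2R (Phi #|nzset al|) * (RE m p (fun a => b2R [forall h, (h \in G) ==> (a h == al h)]) - iG) by ring.
rewrite Rabs_mult Rabs_pos_eq; last exact: b2R_ge0.
have b1 := b2R_le1 (Phi #|nzset al|); have b0 := b2R_ge0 (Phi #|nzset al|).
have h1 := block_le k0 Hp D0 c40 cden0 Hrg fG al.
have h2 := tilted_block_near al; rewrite -/iG in h2.
set W := \rprod_(h | h \in G) law d m p r h (al h) in h1 h2.
set X := RE _ _ _ in h1 *; rewrite -/d -/m -/L in h1.
have W0 : 0 <= W by apply: rprod_ge0 => h _; have [] := law_ldist e k p r0 h.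
set E := _ + 2 * Ce _ _ * _ in h1.
have heta' : E <= eta := heta.
have h1' : Rabs (X - W) <= W * eta by apply: Rle_trans h1 _; apply: Rmult_le_compat_l.
have WiG : W <= iG * (1 + 2 * tau) by move/Rabs_le_between: h2 => h2; lra.
have XG : Rabs (X - iG) <= (2 * eta + 2 * tau) * iG.
  have -> : X - iG = (X - W) + (W - iG) by ring.
  apply: Rle_trans (Rabs_triang _ _) _.
  have : W * eta <= 2 * eta * iG.
    have W2 : W <= 2 * iG by nra.
    by rewrite (_ : 2 * eta * iG = 2 * iG * eta); [apply: Rmult_le_compat_r; lra|ring].
  lra.
apply: Rle_trans XG; have := Rabs_pos (X - iG); nra.
Qed.

End BlockLaw.

(** * Splitting the weight into a block and a small remainder *)

Section Decomposition.
Variables (e k : nat) (p : nat -> nat).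
Hypotheses (k0 : (0 < k)%N) (Hp : coprime_bases k.+1 p).
Let d := e.+2.
Let m := k.+1.
Let q0 := 1 - / INR d.
Let S (n : nat) := cnt m p n.+1 (INR n).
Let Hpos i : (i < m)%N -> (1 < p i)%N. Proof. by case: Hp => H _; apply: H. Qed.
Let den := INR (Factorial.fact m) * lnprod p m.
Let den0 : 0 < den. Proof. exact: cnt_den_gt0 Hp. Qed.

(** Both logarithms in the volume of the triangle are multiplied by [D], which divides the count by
    about [D^2]. *)
Lemma cnt_pexp_small delta : 0 < delta -> exists D, (0 < D)%N /\ exists n0, forall n, (n0 <= n)%N ->
  cnt 2 (pexp p D) n.+1 (INR n) <= delta * ln (INR n) ^ m.
Proof.
move=> delta0.
have p0 : 0 < ln (INR (p 0%N)) by apply: ln_gt0; have := INR_ge2 (Hpos (ltn0Sn k)); lra.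
have p1 : 0 < ln (INR (p 1%N)) by apply: ln_gt0; have := INR_ge2 (Hpos (k0 : (1 < m)%N)); lra.
set a := ln (INR (p 0%N)) * ln (INR (p 1%N)).
have a0 : 0 < a by apply: Rmult_lt_0_compat.
have ad : 0 < a * delta by apply: Rmult_lt_0_compat.
have [D [hD _]] := nat_ceil (x := 2 / (a * delta) + 1)
  ltac:(have : 0 < 2 / (a * delta) by [apply: Rdiv_lt_0_compat; lra]; lra).
have D1 : 1 <= INR D by have : 0 < 2 / (a * delta) by [apply: Rdiv_lt_0_compat; lra]; lra.
have D0 : (0 < D)%N by apply: leq_INR; rewrite /=; lra.
exists D; split=> //.
have Hp2 := pexp_bases D0 (k0 : (2 <= m)%N) Hp.
have [n0 H0] := evR_nat (evR_and (evR_ge 1) (evR_ge (lnsum (pexp p D) 2))).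
exists (maxn n0 1) => n; rewrite geq_max => /andP [/H0 [l1 ls] n1].
set l := ln (INR n) in l1 ls *.
have n1' : 1 <= INR n < INR n.+1.
  by split; [have := INR_leq n1; rewrite /=|apply: INR_ltn].
have [_ h] := cnt_bounds Hp2 n1'; apply: Rle_trans h _; rewrite -/l.
have -> : lnprod (pexp p D) 2 = INR D ^ 2 * a.
  rewrite /lnprod !big_ord_recl big_ord0 /pexp -[nat_of_ord (lift _ _)]/1%N -[nat_of_ord ord0]/0%N !INR_expn !ln_pow; first by rewrite /a; ring.
    by have := INR_ge2 (Hpos (k0 : (1 < m)%N)); lra.
  by have := INR_ge2 (Hpos (ltn0Sn k)); lra.
have s0 : 0 <= lnsum (pexp p D) 2 by apply: lnsum_ge0; case: Hp2.
have hl : l ^ 2 <= l ^ m by apply: Rle_pow => //; apply/leP.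
have h2 : (l + lnsum (pexp p D) 2) ^ 2 <= 4 * l ^ 2.
  have -> : 4 * l ^ 2 = (2 * l) ^ 2 by ring.
  by apply: pow_incr; lra.
have Da : 2 <= INR D ^ 2 * a * delta.
  have : 2 / (a * delta) <= INR D by lra.
  move/(Rle_div_l _ _ _ ad) => h3; have : INR D * (a * delta) <= INR D ^ 2 * (a * delta).
    by apply: Rmult_le_compat_r; [lra|rewrite /=; nra].
  lra.
have Da0 : 0 < INR D ^ 2 * a by apply: Rmult_lt_0_compat => //; apply: pow_lt; lra.
apply/Rle_div_l; first by rewrite [INR (Factorial.fact 2)]/=; lra.
have -> : INR (Factorial.fact 2) = 2 by rewrite /=; ring.
apply: Rle_trans h2 _.
have l20 : 0 <= l ^ 2 by apply: pow_le; lra.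
have : 2 * l ^ m <= (INR D ^ 2 * a * delta) * l ^ m by apply: Rmult_le_compat_r => //; lra.
lra.
Qed.

Lemma evR_negligible C delta : 0 < delta -> evR (fun l => C * (l ^ k * ln l) <= delta * l ^ m).
Proof.
move=> delta0; have [L0 H] := evR_and (evR_ge 0) (evR_ln (C / delta)).
exists L0 => l /H [l0 h].
have h1 : C * ln l <= delta * l.
  have -> : C * ln l = delta * (C / delta * ln l) by field; lra.
  by apply: Rmult_le_compat_l; lra.
have lk : 0 <= l ^ k by apply: pow_le.
have := Rmult_le_compat_l _ _ _ lk h1; rewrite /m -[l ^ k.+1]/(l * l ^ k); lra.
Qed.

Lemma rsum_in_const n (G : {set 'I_n}) c : \rsum_(h | h \in G) c = c * INR #|G|.
Proof.
rewrite -[c in LHS]Rmult_1_r rsum_scal rsum_count; congr (_ * INR _); exact: eq_card.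
Qed.

Lemma card_nzset n (a : {ffun 'I_n.+1 -> 'I_d}) (G : {set 'I_n.+1}) :
  INR #|nzset a :&: G| = \rsum_(h | h \in G) nz (a h).
Proof.
transitivity (\rsum_(h | h \in nzset a :&: G) 1); first by rewrite rsum_in_const Rmult_1_l.
rewrite big_mkcond [RHS]big_mkcond; apply: eq_bigr => h _.
by rewrite !inE /nz; case: (h \in G); case: (nat_of_ord (a h) != 0%N).
Qed.

Lemma sq3_le x y z : (x - y - z) ^ 2 <= 3 * (x ^ 2 + y ^ 2 + z ^ 2).
Proof. by have := pow2_ge_0 (x + y); have := pow2_ge_0 (x + z); have := pow2_ge_0 (y - z); lra. Qed.

(** The remainder has three parts: the digits outside [G], whose variance is at most their number up
    to [O(lam^2)]; the bias of the mean; and the deviation of the tilted means on [G] from [q0]. *)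
Lemma remainder_second_moment D c4 Cu cden n r lam eps (G : {set 'I_n.+1}) :
  (0 < D)%N -> 0 < c4 -> 0 < cden -> regime e k p D c4 Cu cden n r lam eps ->
  (forall h, h \in G -> inS m p h) ->
  RE m p (fun a : {ffun 'I_n.+1 -> 'I_d} =>
     (INR (@weight d n a) - EW d m p n - (INR #|nzset a :&: G| - INR #|G| * q0)) ^ 2)
  <= 3 * (S n - INR #|G| + (Ca e k p c4 cden * Cu + Cb e k p c4 cden * Cu ^ 2 + Ce e cden) * lam ^ 2
     + (Ca e k p c4 cden * Cu + Ce e cden) ^ 2 * lam ^ 2
     + (\rsum_(h | h \in G) Rabs (qn e k p r h - q0)) ^ 2).
Proof.
move=> D0 c40 cden0 Hrg GS.
have P0 := Pcount_gt0 cden0 Hrg; rewrite -/d -/m in P0.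
set cv := _ + Ce e cden; set ca := Ca e k p c4 cden * Cu + Ce e cden.
pose Tp (h : 'I_n.+1) := inS m p h.
pose Tr (h : 'I_n.+1) := inS m p h && (h \notin G).
have TS h : Tp h -> inS m p h by [].
have TR h : Tr h -> inS m p h by move=> /andP [].
have M1 := mean_T k0 Hp D0 c40 cden0 Hrg TS.
have M2 := second_moment_T k0 Hp D0 c40 cden0 Hrg TR.
rewrite -/ca -/cv in M1 M2.
set q := qn e k p r in M1 M2 *.
pose Z (a : {ffun 'I_n.+1 -> 'I_d}) := \big[Rplus/0]_(h : 'I_n.+1 | Tp h) (nz (a h) - q h).
pose Rr (a : {ffun 'I_n.+1 -> 'I_d}) := \big[Rplus/0]_(h : 'I_n.+1 | Tr h) (nz (a h) - q h).
have {}M1 : Rabs (RE m p Z) <= ca * lam by exact: M1.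
have {}M2 : Rabs (RE m p (fun a => Rr a ^ 2) - \big[Rplus/0]_(h : 'I_n.+1 | Tr h) (q h * (1 - q h))) <= cv * lam ^ 2 by exact: M2.
set Q := \big[Rplus/0]_(h : 'I_n.+1 | Tp h) q h.
have EZ a : @is_rep d m p n a -> INR (@weight d n a) = Z a + Q.
  move=> Ha; have -> : INR (@weight d n a) = \big[Rplus/0]_(h : 'I_n.+1 | Tp h) nz (a h) := weight_sum Ha.
  by rewrite /Z rsum_sub -/Q /Rminus Rplus_assoc Rplus_opp_l Rplus_0_r.
have EE : EW d m p n = RE m p Z + Q.
  by rewrite EW_RE -[Q](RE_const P0) -(RE_add P0); apply: eq_RE => a Ha; exact: EZ.
have split_G (F : 'I_n.+1 -> R) : \big[Rplus/0]_(h : 'I_n.+1 | Tp h) F h =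
   \rsum_(h | h \in G) F h + \big[Rplus/0]_(h : 'I_n.+1 | Tr h) F h.
  rewrite (bigID (fun h => h \in G)) /=; congr (_ + _).
  by apply: eq_bigl => h; rewrite /Tp; case hG: (h \in G); rewrite ?andbF ?andbT ?GS.
set K := \rsum_(h | h \in G) (q h - q0).
have EY a : @is_rep d m p n a ->
  INR (@weight d n a) - EW d m p n - (INR #|nzset a :&: G| - INR #|G| * q0) = Rr a - RE m p Z - K.
  move=> Ha; rewrite EZ // EE.
  have -> : K = \rsum_(h | h \in G) q h - INR #|G| * q0.
    by rewrite /K rsum_sub rsum_in_const (Rmult_comm q0).
  have -> : Z a = INR #|nzset a :&: G| - \rsum_(h | h \in G) q h + Rr a.
    by rewrite card_nzset -rsum_sub /Z split_G.
  by ring.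
apply: (Rle_trans _ (RE m p (fun a => 3 * (Rr a ^ 2 + ((RE m p Z) ^ 2 + K ^ 2))))).
  apply: (RE_le P0) => a Ha; rewrite EY //.
  by apply: Rle_trans (sq3_le _ _ _) _; lra.
rewrite (RE_scal P0) (RE_add P0) (RE_const P0).
have h1 : \big[Rplus/0]_(h : 'I_n.+1 | Tr h) (q h * (1 - q h)) <= S n - INR #|G|.
  have -> : S n = \big[Rplus/0]_(h : 'I_n.+1 | Tp h) 1 by rewrite (sum_inS_count k p n).
  rewrite split_G rsum_in_const.
  have : \big[Rplus/0]_(h : 'I_n.+1 | Tr h) (q h * (1 - q h)) <= \big[Rplus/0]_(h : 'I_n.+1 | Tr h) 1.
    by apply: rsum_le => h _; have := qn_bounds Hrg h; rewrite -/q; nra.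
  lra.
have h2 : (RE m p Z) ^ 2 <= ca ^ 2 * lam ^ 2.
  rewrite -Rpow_mult_distr -(pow2_abs (RE m p Z)); apply: pow_incr; split=> //; exact: Rabs_pos.
have h3 : K ^ 2 <= (\rsum_(h | h \in G) Rabs (q h - q0)) ^ 2.
  rewrite -(pow2_abs K); apply: pow_incr; split; [exact: Rabs_pos|exact: rsum_abs].
move/Rabs_le_between: M2 => M2.
lra.
Qed.

Definition block (D n : nat) (H : R) : {set 'I_n.+1} :=
  [set h : 'I_n.+1 | [&& inS m p h, Rleb (INR h) H & ~~ inS 2 (pexp p D) h]].

Lemma card_block D n H : H <= INR n ->
  S n - (S n - cnt m p n.+1 H) - cnt 2 (pexp p D) n.+1 (INR n) <= INR #|block D n H| <= S n.
Proof.
move=> Hn; have hn (h : 'I_n.+1) : Rleb (INR h) (INR n).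
  by apply/RlebP; apply: INR_leq; rewrite -ltnS.
have EG : INR #|block D n H| = \rsum_(h < n.+1)
   b2R [&& inS m p h, Rleb (INR h) H & ~~ inS 2 (pexp p D) h].
  rewrite -[INR _]Rmult_1_l -rsum_in_const big_mkcond; apply: eq_bigr => h _.
  by rewrite inE; case: [&& _, _ & _].
rewrite EG; split; last first.
  rewrite /S /cnt [X in _ <= X]big_mkcond; apply: rsum_le => h _; rewrite hn.
  by case: (inS m p h); case: Rleb; case: (inS 2 _ h) => /=; lra.
have -> : S n - (S n - cnt m p n.+1 H) - cnt 2 (pexp p D) n.+1 (INR n) =
  cnt m p n.+1 H - cnt 2 (pexp p D) n.+1 (INR n) by ring.
rewrite /cnt [X in X - _]big_mkcond [X in _ - X]big_mkcond -rsum_sub; apply: rsum_le => h _.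
by rewrite hn; case: (inS m p h); case: Rleb; case: (inS 2 _ h) => /=; lra.
Qed.

(** All that the limit law takes from the arithmetic: the block holds almost all of [S], the rest of
    the weight has a small second moment, and the number of nonzero digits on the block is nearly
    binomial. *)
Lemma block_decomposition delta : 0 < delta -> exists n0, forall n, (n0 <= n)%N ->
  (0 < Pcount d m p n)%N /\ exists G : {set 'I_n.+1},
  [/\ S n * (1 - delta) <= INR #|G| <= S n,
      1 <= delta * S n,
      Rabs (VarW d m p n - S n * (q0 * (1 - q0))) <= delta * S n,
      RE m p (fun a : {ffun 'I_n.+1 -> 'I_d} =>
        (INR (@weight d n a) - EW d m p n - (INR #|nzset a :&: G| - INR #|G| * q0)) ^ 2) <= delta * S n &
      forall Phi : pred nat, Rabs (RE m p (fun a : {ffun 'I_n.+1 -> 'I_d} => b2R (Phi #|nzset a :&: G|)) -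
         \rsum_(j < #|G|.+1) (b2R (Phi j) * binp q0 #|G| j)) <= delta].
Proof.
move=> delta0.
have d2 := INR_d_ge2 e; rewrite -/d in d2.
have s0 : 0 <= lnsum p m by exact: lnsum_ge0.
set Cm := (1 + lnsum p m) ^ m / den.
have Cm0 : 0 < Cm by apply: Rdiv_lt_0_compat => //; apply: pow_lt; lra.
(* [delta] on the scale of [l^m]: as [S n >= l^m / den], whatever is below [delta1 * l^m] is below
   [delta * S n]. *)
set delta1 := delta / den.
have delta10 : 0 < delta1 by apply: Rdiv_lt_0_compat.
have [D [D0 [n1 H1]]] := @cnt_pexp_small (delta1 / 16) ltac:(lra).
have [c4 [Cu [cden [c40 cden0 [n2 H2]]]]] := regime_eventually e k0 Hp D0.
have [C3 [n3 H3]] := cnt_top_window e Hp m.+1.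
have [C4 [n4 H4]] := mean_var_count e k0 Hp.
set cv := Ca e k p c4 cden * Cu + Cb e k p c4 cden * Cu ^ 2 + Ce e cden.
set ca := Ca e k p c4 cden * Cu + Ce e cden.
set Eb := 2 * Rabs (Cmaj e k p c4) / cden * (INR d * Cm) + 2 * Rabs (Ce e cden) * den.
have Eb0 : 0 <= Eb.
  apply: Rplus_le_le_0_compat; last by apply: Rmult_le_pos; [have := Rabs_pos (Ce e cden); lra|lra].
  apply: Rmult_le_pos; last by apply: Rmult_le_pos; lra.
  by apply: Rdiv_le_0_compat => //; have := Rabs_pos (Cmaj e k p c4); lra.
have [n5 H5] := evR_nat (evR_and (evR_ge 1) (evR_and (evR_ge (INR (p k)))
  (evR_and (evR_negligible C3 (delta := delta1 / 16) ltac:(lra)) (evR_and (evR_negligible C4 delta10)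
  (evR_and (evR_ge (den / delta)) (evR_and (evR_ge ((Rabs cv + ca ^ 2 + 1) / (delta1 / 16)))
  (evR_and (evR_ge (2 * INR d ^ 2 * Cm)) (evR_and (evR_ge Eb) (evR_ge ((2 * Eb + 2 * (INR d * Cm)) / delta)))))))))).
exists (maxn n1 (maxn n2 (maxn n3 (maxn n4 (maxn n5 1))))) => n.
rewrite !geq_max => /and5P [/H1 h1 /H2 [r [eps [Hrg hr1 hr2]]] nn3 /H4 [P0 _ hV] /andP [/H5 h5 n0]].
have r0 := rg_r Hrg; have [[hH1 hH2] hH3] := H3 n r nn3 r0 hr1 hr2.
set l := ln (INR n) in h1 Hrg hH1 hH2 hH3 hV h5.
case: h5 => [l1 [lq [l3 [l4 [l5 [l6 [l7 [l8 l9]]]]]]]].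
have n1' : 1 <= INR n < INR n.+1.
  by split; [have := INR_leq n0; rewrite /=|apply: INR_ltn].
have lk1 : 1 <= l ^ k by apply: pow_R1_Rle.
have lm1 : 1 <= l ^ m by apply: pow_R1_Rle.
have llm : l <= l ^ m by rewrite -{1}(pow_1 l); apply: Rle_pow => //; apply/leP.
have S2 : S n <= Cm * l ^ m by apply: (cnt_le_pow Hp) => //; exact: Rle_refl.
have S1 : l ^ m <= den * S n.
  have := cnt_ge_pow Hp n1' (l := l) ltac:(split; [lra|exact: Rle_refl]).
  by rewrite -/den -/m -/(S n) => h; move/(Rle_div_l _ _ _ den0): h; rewrite Rmult_comm.
have dS : delta1 * l ^ m <= delta * S n.
  have -> : delta * S n = delta1 * (den * S n) by rewrite /delta1; field; lra.
  by apply: Rmult_le_compat_l; lra.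
have ld0 : 0 < delta1 * l ^ m by apply: Rmult_lt_0_compat; lra.
have S0 : 0 < S n by apply: (Rmult_lt_reg_l delta); lra.
split=> //.
(* The block has at most [Cm * l^m] elements, each with [r h <= 1 / l^(m+1)]; tilt and phase
   together perturb it by [O(1 / l)]. *)
set H := / r / l ^ m.+1 in hH1 hH2 hH3.
exists (block D n H); have GS h : h \in block D n H -> inS m p h by rewrite inE => /and3P [].
have [cG1 cG2] := card_block D hH2.
have hH4 : S n - cnt m p n.+1 H <= delta1 / 16 * l ^ m := Rle_trans _ _ _ hH3 l3.
have hcut : S n - INR #|block D n H| <= delta1 / 8 * l ^ m by lra.
have lam0 := rg_lam Hrg.
have Elam : sqrt (l ^ k) ^ 2 = l ^ k by rewrite pow2_sqrt //; lra.
set lam := sqrt (l ^ k) in Hrg lam0 Elam.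
have lm1' : 0 < l ^ m.+1 by apply: pow_lt; lra.
have hT : \rsum_(h | h \in block D n H) (r * INR h * INR d) <= INR d * Cm / l.
  apply: (Rle_trans _ (\rsum_(h | h \in block D n H) (INR d / l ^ m.+1))).
    apply: rsum_le => h; rewrite inE => /and3P [_ /RlebP hh _].
    have : r * INR h <= / l ^ m.+1.
      have -> : / l ^ m.+1 = r * H by rewrite /H; field; lra.
      by apply: Rmult_le_compat_l; lra.
    by move=> h'; rewrite /Rdiv (Rmult_comm (INR d)); apply: Rmult_le_compat_r; lra.
  rewrite rsum_in_const; apply: (Rle_trans _ (INR d / l ^ m.+1 * (Cm * l ^ m))).
    by apply: Rmult_le_compat_l; [apply: Rdiv_le_0_compat; lra|lra].
  rewrite -[l ^ m.+1]/(l * l ^ m); apply: Req_le; field; lra.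
have T0 : 0 <= \rsum_(h | h \in block D n H) (r * INR h * INR d).
  by apply: rsum_ge0 => h _; do 2 (apply: Rmult_le_pos; last exact: pos_INR); lra.
set T := \rsum_(h | h \in block D n H) (r * INR h * INR d) in hT T0.
have tau2 : INR d * Cm / l <= / (2 * INR d).
  apply/Rle_div_l; first lra.
  apply: (Rmult_le_reg_l (2 * INR d)); first lra.
  have -> : 2 * INR d * (/ (2 * INR d) * l) = l by [field; lra]; lra.
have tau2' : INR d * Cm / l <= / 2 by apply: Rle_trans tau2 _; apply: Rinv_le_contravar; lra.
split.
- have : delta1 / 8 * l ^ m <= delta * S n by lra.
  by lra.
- apply: Rle_trans dS; have : den / delta * delta1 = 1 by rewrite /delta1; field; lra.
  have : den / delta * delta1 <= l ^ m * delta1 by apply: Rmult_le_compat_r; lra.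
  lra.
- exact: Rle_trans (Rle_trans _ _ _ hV l4) dS.
- have Hr := remainder_second_moment D0 c40 cden0 Hrg GS.
  rewrite -/cv -/ca Elam in Hr; apply: Rle_trans Hr _.
  set K := \rsum_(h | h \in block D n H) Rabs _.
  have K1 : K <= 1.
    apply: (Rle_trans _ (INR d * T)).
      rewrite /T -rsum_scal; apply: rsum_le => h hG.
      rewrite /qn /law GS //.
      have := @Ew_nz_near e (r * INR h) ltac:(apply: Rmult_le_pos; [lra|exact: pos_INR]).
      rewrite -/d -/q0 => h'; apply: Rle_trans h' _; apply: Req_le; ring.
    have : INR d * T <= INR d * / (2 * INR d) by apply: Rmult_le_compat_l; lra.
    have -> : INR d * / (2 * INR d) = / 2 by field; lra.
    lra.
  have K0 : 0 <= K by apply: rsum_ge0 => h _; exact: Rabs_pos.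
  have K2 : K ^ 2 <= l ^ k by rewrite /=; nra.
  have h6 : (Rabs cv + ca ^ 2 + 1) * l ^ k <= delta1 / 16 * l ^ m.
    move/(Rle_div_l _ _ _ (_ : delta1 / 16 > 0)): l6 => /(_ ltac:(lra)) l6.
    rewrite -[l ^ m]/(l * l ^ k) -Rmult_assoc (Rmult_comm (delta1 / 16)).
    by apply: Rmult_le_compat_r; lra.
  have : cv * l ^ k <= Rabs cv * l ^ k by apply: Rmult_le_compat_r; [lra|exact: Rle_abs].
  lra.
move=> Phi.
(* Every term vanishes: the block avoids the elements carrying the energy and stays below [N / q]
   because [l^(m+1) >= q]. *)
have fG : few k p D r (fun h => h \in block D n H).
  rewrite /few big1; first lra.
  move=> h; rewrite inE => /and3P [_ /RlebP hh /negbTE ->].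
  have -> : Rleb (INR h) (/ r / INR (p k)).
    apply/RlebP; apply: Rle_trans hh _; apply: Rmult_le_compat_l.
      by apply: Rlt_le; apply: Rinv_0_lt_compat.
    apply: Rinv_le_contravar; first by have := INR_ge2 (Hpos (ltnSn k)); lra.
    apply: Rle_trans lq _; apply: Rle_trans llm _; apply: Rle_pow => //; apply/leP; exact: leqnSn.
  by rewrite !andbF.
have tiny := rg_tiny Hrg; rewrite -/m -/(S n) in tiny.
set EL := eps * (lam * / r) in tiny.
have EL0 : 0 <= EL.
  apply: Rmult_le_pos; first exact: rg_eps Hrg.
  by apply: Rmult_le_pos; [lra|apply: Rlt_le; exact: Rinv_0_lt_compat].
have ELl : EL <= den / l.
  apply: (proj1 (Rle_div_r _ _ _ _)); first lra.
  have h : EL * (S n + 1) <= 1.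
    apply: Rle_trans tiny; apply: Rmult_le_compat_l => //; rewrite /=; nra.
  have h' : EL * l <= EL * (den * S n) by apply: Rmult_le_compat_l; lra.
  have h'' : den * (EL * (S n + 1)) <= den * 1 by apply: Rmult_le_compat_l; lra.
  have : 0 <= den * EL by apply: Rmult_le_pos; lra.
  lra.
have il0 : 0 < / l by apply: Rinv_0_lt_compat; lra.
have heta : (\rsum_(h | h \in block D n H) (2 * INR d * INR h)) * Cmaj e k p c4 / (lam * / r) / cden
     + 2 * Ce e cden * EL <= Eb / l.
  have -> : Eb / l = 2 * Rabs (Cmaj e k p c4) / cden * (INR d * Cm / l) + 2 * Rabs (Ce e cden) * (den / l).
    by rewrite /Eb; field; lra.
  apply: Rplus_le_compat; last first.
    apply: (Rle_trans _ (2 * Rabs (Ce e cden) * EL)).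
      by apply: Rmult_le_compat_r => //; have := Rle_abs (Ce e cden); lra.
    by apply: Rmult_le_compat_l => //; have := Rabs_pos (Ce e cden); lra.
  have -> : \rsum_(h | h \in block D n H) (2 * INR d * INR h) = 2 * / r * T.
    by rewrite -rsum_scal; apply: eq_bigr => h _; field; lra.
  have -> : 2 * / r * T * Cmaj e k p c4 / (lam * / r) / cden = 2 * Cmaj e k p c4 / cden * (T / lam) by field; lra.
  have TL : 0 <= T / lam <= T.
    split; first by apply: Rdiv_le_0_compat; lra.
    by apply/Rle_div_l; nra.
  apply: (Rle_trans _ (2 * Rabs (Cmaj e k p c4) / cden * (T / lam))).
    apply: Rmult_le_compat_r; first lra.
    apply: Rmult_le_compat_r; first by apply: Rlt_le; exact: Rinv_0_lt_compat.
    by have := Rle_abs (Cmaj e k p c4); lra.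
  apply: Rmult_le_compat_l; last lra.
  by apply: Rdiv_le_0_compat => //; have := Rabs_pos (Cmaj e k p c4); lra.
have eta1 : 0 <= Eb / l <= 1 by split; [apply: Rdiv_le_0_compat; lra|apply/Rle_div_l; lra].
have := block_law k0 Hp D0 c40 cden0 Hrg GS fG hT tau2' heta eta1 Phi.
move=> h; apply: Rle_trans h _.
move/(Rle_div_l _ _ _ delta0): l9 => l9.
have -> : 2 * (Eb / l) + 2 * (INR d * Cm / l) = (2 * Eb + 2 * (INR d * Cm)) / l by field; lra.
by apply/Rle_div_l; lra.
Qed.

End Decomposition.

(** * Convergence in distribution *)

Lemma sqrt_near a b c : 0 < b -> 0 <= a -> 0 <= c -> Rabs (a - b ^ 2) <= c * b ^ 2 ->
  Rabs (sqrt a - b) <= c * b.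
Proof.
move=> b0 a0 c0 h; have s0 := sqrt_pos a.
have E : (sqrt a - b) * (sqrt a + b) = a - b ^ 2 by rewrite -[a in RHS](pow2_sqrt a a0); ring.
rewrite -E Rabs_mult (Rabs_pos_eq (sqrt a + b)) in h; last lra.
have := Rabs_pos (sqrt a - b); nra.
Qed.

Section CLT.
Variables (e k : nat) (p : nat -> nat).
Hypotheses (k0 : (0 < k)%N) (Hp : coprime_bases k.+1 p).
Let d := e.+2.
Let m := k.+1.
Let q0 := 1 - / INR d.
Let S (n : nat) := cnt m p n.+1 (INR n).

(** A Slutsky argument: the distribution function is sandwiched between those of the block at
    [x - 2 tau] and [x + 2 tau], up to the probability that the remainder exceeds [tau * s]. *)
Lemma clt x : Un_cv (fun n => ProbLe d m p n x) (/ 2 + Phi0 x / sqrt (2 * PI)).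
Proof.
move=> eps eps0.
have d2 := INR_d_ge2 e; rewrite -/d in d2.
have id0 : 0 < / INR d by apply: Rinv_0_lt_compat; lra.
have id1 : / INR d <= / 2 by apply: Rinv_le_contravar; lra.
have q01 : 0 < q0 < 1 by rewrite /q0; lra.
set v := q0 * (1 - q0); have v0 : 0 < v by apply: Rmult_lt_0_compat; lra.
have v1 : v <= 1 by rewrite /v; nra.
(* One [tau] pays for the remainder [Y], one for replacing [sqrt V] by [s]. The limit is
   1-Lipschitz, so the shift costs at most [2 tau = eps / 8]. *)
set tau := eps / 16; have tau0 : 0 < tau by rewrite /tau; lra.
have e8 : 0 < eps / 8 by lra.
have [N1 HN1] := de_moivre_laplace q01 (x + 2 * tau) e8.
have [N2 HN2] := de_moivre_laplace q01 (x - 2 * tau) e8.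
set M := INR N1 + INR N2 + 1.
have M1 : 1 <= M by have := pos_INR N1; have := pos_INR N2; rewrite /M; lra.
have ax := Rabs_pos x.
(* The bounds on [delta] serve, in this order, to make [|G|] exceed [N1] and [N2], to control the
   law of the block, to apply Chebyshev's inequality to [Y], and to bring [sqrt V] close to [s]. *)
have [delta [dl0 dl1 dl2 dl3 dl4]] : exists delta, [/\ 0 < delta, delta <= / (2 * M),
    delta <= eps / 8, delta <= v * (eps * tau ^ 2 / 16) & delta * (4 * (Rabs x + 2)) <= v * tau /\ 8 * delta <= v].
  have a1 : 0 < / (2 * M) by apply: Rinv_0_lt_compat; lra.
  have a2 : 0 < v * (eps * tau ^ 2 / 16).
    apply: Rmult_lt_0_compat => //; apply: Rdiv_lt_0_compat; last lra.
    by apply: Rmult_lt_0_compat => //; apply: pow_lt.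
  have a3 : 0 < v * tau / (4 * (Rabs x + 2)).
    by apply: Rdiv_lt_0_compat; [apply: Rmult_lt_0_compat|lra].
  exists (Rmin (Rmin (/ (2 * M)) (eps / 8)) (Rmin (v * (eps * tau ^ 2 / 16)) (Rmin (v * tau / (4 * (Rabs x + 2))) (v / 8)))).
  split.
  - by repeat apply: Rmin_glb_lt; lra.
  - by apply: Rle_trans (Rmin_l _ _) _; apply: Rmin_l.
  - by apply: Rle_trans (Rmin_l _ _) _; apply: Rmin_r.
  - by apply: Rle_trans (Rmin_r _ _) _; apply: Rmin_l.
  set A := v * tau / _ in a3 *; set B := Rmin (v * _) _.
  have hA : Rmin (Rmin (/ (2 * M)) (eps / 8)) B <= A.
    by apply: Rle_trans (Rmin_r _ _) _; apply: Rle_trans (Rmin_r _ _) _; apply: Rmin_l.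
  have hB : Rmin (Rmin (/ (2 * M)) (eps / 8)) B <= v / 8.
    by apply: Rle_trans (Rmin_r _ _) _; apply: Rle_trans (Rmin_r _ _) _; apply: Rmin_r.
  split; last lra.
  have -> : v * tau = A * (4 * (Rabs x + 2)) by rewrite /A; field; lra.
  by apply: Rmult_le_compat_r; lra.
have [dl5 dl6] := dl4 => {dl4}.
have [n0 H] := block_decomposition e k0 Hp dl0.
exists n0 => n /leP /H [P0 [G [[g1 g2] hS hV hY hPhi]]].
rewrite -/d -/m in P0 g1 g2 hS hV hY hPhi; rewrite -/q0 -/(S n) in g1 g2 hS hV hY hPhi.
have dl7 : delta <= / 8 by lra.
have S0 : 0 < S n by apply: (Rmult_lt_reg_l delta); lra.
have G2 : S n <= 2 * INR #|G| by nra.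
have G0 : 0 < INR #|G| by lra.
have SM : M <= INR #|G|.
  have : 2 * M * delta <= 1.
    by move: dl1 => h; have := Rmult_le_compat_l (2 * M) _ _ ltac:(lra) h; rewrite Rinv_r; lra.
  move=> h; have : M * (delta * S n) <= S n / 2 by nra.
  have : M * 1 <= M * (delta * S n) by apply: Rmult_le_compat_l; lra.
  lra.
have GN1 : (N1 <= #|G|)%N by apply: leq_INR; have := pos_INR N2; rewrite /M in SM; lra.
have GN2 : (N2 <= #|G|)%N by apply: leq_INR; have := pos_INR N1; rewrite /M in SM; lra.
set s := sqrt (INR #|G| * q0 * (1 - q0)).
have Gv : INR #|G| * q0 * (1 - q0) = INR #|G| * v by rewrite /v; ring.
have s2 : s ^ 2 = INR #|G| * v by rewrite /s Gv pow2_sqrt //; apply: Rmult_le_pos; lra.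
have s0 : 0 < s by apply: sqrt_lt_R0; rewrite Gv; apply: Rmult_lt_0_compat.
set V := VarW d m p n in hV *; set mu := EW d m p n in hY *.
have dSs : 2 * delta * S n <= 4 * delta / v * s ^ 2.
  have -> : 4 * delta / v * s ^ 2 = 2 * delta * (2 * INR #|G|) by rewrite s2; field; lra.
  by apply: Rmult_le_compat_l; lra.
have Vs : Rabs (V - s ^ 2) <= 4 * delta / v * s ^ 2.
  apply: Rle_trans dSs; rewrite s2 -/v in hV *.
  have -> : V - INR #|G| * v = (V - S n * v) + (S n - INR #|G|) * v by ring.
  apply: Rle_trans (Rabs_triang _ _) _; rewrite Rabs_mult (Rabs_pos_eq v); last lra.
  rewrite (Rabs_pos_eq (S n - INR #|G|)); last lra.
  have : (S n - INR #|G|) * v <= delta * S n * 1 by apply: Rmult_le_compat; lra.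
  lra.
have c40 : 0 <= 4 * delta / v <= / 2.
  by split; [apply: Rdiv_le_0_compat; lra|apply/Rle_div_l; lra].
have ss0 : 0 < s ^ 2 by apply: pow_lt.
have V0 : 0 < V by move/Rabs_le_between: Vs => Vs; nra.
have hsig := sqrt_near s0 (Rlt_le _ _ V0) (proj1 c40) Vs.
set sg := sqrt V in hsig *; have sg0 : 0 < sg by exact: sqrt_lt_R0.
have xs : Rabs (x * sg - x * s) <= tau * s.
  rewrite -Rmult_minus_distr_l Rabs_mult.
  apply: (Rle_trans _ (Rabs x * (4 * delta / v * s))); first by apply: Rmult_le_compat_l.
  rewrite -Rmult_assoc; apply: Rmult_le_compat_r; first lra.
  have -> : Rabs x * (4 * delta / v) = (Rabs x * (4 * delta)) / v by rewrite /Rdiv; ring.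
  by apply/Rle_div_l; lra.
pose Wg (a : {ffun 'I_n.+1 -> 'I_d}) := INR #|nzset a :&: G| - INR #|G| * q0.
pose Y (a : {ffun 'I_n.+1 -> 'I_d}) := INR (@weight d n a) - mu - Wg a.
have hCh : RE m p (fun a => b2R (~~ Rleb (Rabs (Y a)) (tau * s))) <= eps / 8.
  have ts : 0 < tau * s by apply: Rmult_lt_0_compat.
  apply: Rle_trans (RE_chebyshev P0 Y ts) _.
  have ts2 : 0 < (tau * s) ^ 2 by apply: pow_lt.
  apply/Rle_div_l => //; apply: Rle_trans hY _.
  rewrite Rpow_mult_distr s2.
  have -> : eps / 8 * (tau ^ 2 * (INR #|G| * v)) = v * (eps * tau ^ 2 / 16) * (2 * INR #|G|) by field.
  by apply: Rmult_le_compat; lra.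
have hblk y : Rabs (RE m p (fun a => b2R (Rleb (Wg a / s) y)) - binCDF q0 #|G| y) <= eps / 8.
  apply: Rle_trans dl2.
  exact: (hPhi (fun j => Rleb ((INR j - INR #|G| * q0) / s) y)).
move/Rabs_le_between: xs => xs.
rewrite ProbLe_RE -/mu -/V -/sg.
set A := RE m p _.
have up : A <= RE m p (fun a => b2R (Rleb (Wg a / s) (x + 2 * tau))) +
    RE m p (fun a => b2R (~~ Rleb (Rabs (Y a)) (tau * s))).
  rewrite -(RE_add P0); apply: (RE_le P0) => a _.
  case: RlebP => h1; case: RlebP => h2; case: RlebP => h3 /=; try lra.
  exfalso; apply: h2; apply/Rle_div_l => //.
  move/(Rle_div_l _ _ _ sg0): h1 => h1; move/Rabs_le_between: h3; rewrite /Y /d; lra.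
have lo : RE m p (fun a => b2R (Rleb (Wg a / s) (x - 2 * tau))) <= A +
    RE m p (fun a => b2R (~~ Rleb (Rabs (Y a)) (tau * s))).
  rewrite -(RE_add P0); apply: (RE_le P0) => a _.
  case: RlebP => h1; case: RlebP => h2; case: RlebP => h3 /=; try lra.
  exfalso; apply: h2; apply/Rle_div_l => //.
  move/(Rle_div_l _ _ _ s0): h1 => h1; move/Rabs_le_between: h3; rewrite /Y /d; lra.
set t := sqrt (2 * PI).
have := hblk (x + 2 * tau); have := hblk (x - 2 * tau).
have := HN1 _ GN1; have := HN2 _ GN2; rewrite -/t.
do 4 (move/Rabs_le_between => ?).
have [p1 p2] := @Phi0_diff x (x + 2 * tau) ltac:(lra).
have [p3 p4] := @Phi0_diff (x - 2 * tau) x ltac:(lra).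
have t1 : 1 <= t.
  by rewrite -sqrt_1; apply: sqrt_le_1_alt; have := PI2_1; lra.
have dv a b : 0 <= a - b <= 2 * tau -> 0 <= a / t - b / t <= 2 * tau.
  move=> [h1 h2]; have -> : a / t - b / t = (a - b) / t by field; lra.
  split; first by apply: Rdiv_le_0_compat; lra.
  apply/Rle_div_l; first lra.
  have : 2 * tau * 1 <= 2 * tau * t by apply: Rmult_le_compat_l; lra.
  lra.
have := dv _ _ (conj p1 (_ : Phi0 (x + 2 * tau) - Phi0 x <= 2 * tau)); move=> /(_ ltac:(lra)) dv1.
have := dv _ _ (conj p3 (_ : Phi0 x - Phi0 (x - 2 * tau) <= 2 * tau)); move=> /(_ ltac:(lra)) dv2.
rewrite /R_dist; apply: Rle_lt_trans (_ : eps / 2 < eps); last lra.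
have Et : 2 * tau = eps / 8 by rewrite /tau; field.
by apply: Rabs_le; lra.
Qed.

End CLT.

Theorem mainTheorem4 (d m : nat) (p : nat -> nat)
  (hd : (2 <= d)%N) (hm : (2 <= m)%N)
  (hp1 : (1 < p 0%N)%N)
  (hpinc : forall i j : nat, (i < j)%N -> (j < m)%N -> (p i < p j)%N)
  (hcop : forall i j : nat, (i < m)%N -> (j < m)%N -> i <> j -> gcdn (p i) (p j) = 1%N) :
  (exists C : R, exists N0 : nat, forall n : nat, (N0 <= n)%N ->
     Rabs (EW d m p n
           - kappa d m p * (INR d - 1) / (INR d * ln (INR d)) * ln (INR n) ^ m)
     <= C * ln (INR n) ^ (m - 1) * ln (ln (INR n)))
  /\
  (exists C : R, exists N0 : nat, forall n : nat, (N0 <= n)%N ->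
     Rabs (VarW d m p n
           - kappa d m p * (INR d - 1) / (INR d ^ 2 * ln (INR d)) * ln (INR n) ^ m)
     <= C * ln (INR n) ^ (m - 1) * ln (ln (INR n)))
  /\
  (forall x l : R, std_normal_cdf_is x l ->
     Un_cv (fun n => ProbLe d m p n x) l).
Proof.
case: d hd => [|[|e]] // _; case: m hm hpinc hcop => [|k] // k0 hpinc hcop.
have Hp : coprime_bases k.+1 p.
  split=> [i ik|i j ik jk ij]; last by rewrite /coprime hcop.
  case: i ik => [//|i] ik; apply: leq_trans hp1 _; apply: ltnW; exact: hpinc.
rewrite subn1 [k.+1.-1]/=.
have [hE hV] := mean_var_asymptotics e k0 Hp; split=> //; split=> // x l /std_normal_cdf_Phi0 ->.
exact: clt.
Qed.
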